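(* Let $T$ and $U$ be $\Delta^{\boldsymbol{\alpha}}_1$-definable $\Sigma^{\boldsymbol{\alpha}}_1$-sound extensions of $\mathsf{KP}_1+\mathsf{Exists}(\boldsymbol{\alpha})$. Then $$|T|_{\Sigma^{\boldsymbol{\alpha}}_1}\le|U|_{\Sigma^{\boldsymbol{\alpha}}_1}\iff T\le^{\Pi^{\boldsymbol{\alpha}}_1}_{\mathsf{RFN}_{\Sigma^{\boldsymbol{\alpha}}_1}}U.$$
   Context: All theories are in the language $\{\in\}$ of set theory. $\Delta_0$-formulas are the formulas with only bounded quantifiers; $\Sigma_1$-formulas are those of the form $\exists x\,\psi$ with $\psi\in\Delta_0$, and $\Pi_1$-formulas those of the form $\forall x\,\psi$ with $\psi\in\Delta_0$ (free variables allowed). $\mathsf{KP}_1$ is the theory with axioms Extensionality, Union, Pairing, Infinity, $\Delta_0$-Separation, $\Sigma_1$-Collection ($\forall x\in a\,\exists y\,\phi(x,y)\to\exists b\,\forall x\in a\,\exists y\in b\,\phi(x,y)$ for $\phi\in\Sigma_1$, parameters allowed), and $\in$-induction ($\forall x[\forall y\in x\,\phi(y)\to\phi(x)]\to\forall x\,\phi(x)$) for $\phi\in\Sigma_1\cup\Pi_1$. $\mathsf{KP}$ is the same with $\in$-induction for all formulas. An ordinal $\xi$ is admissible if $L_\xi\models\mathsf{KP}$. A representation is a $\Sigma_1$-formula $R(x)$ such that $\mathsf{KP}_1\vdash\forall x\forall y(R(x)\wedge R(y)\to x=y)$. A boldface letter $\boldsymbol{\alpha}$ denotes a representation, with formula $R^{\boldsymbol{\alpha}}$;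 it represents the ordinal $\alpha$ if $R^{\boldsymbol{\alpha}}$ defines $\alpha$ over $L$. $\varphi(\boldsymbol{\alpha})$ abbreviates $\forall x(R^{\boldsymbol{\alpha}}(x)\to\varphi(x))$, and $\mathsf{Exists}(\boldsymbol{\alpha})$ abbreviates $\exists x R^{\boldsymbol{\alpha}}(x)$. A representation $\boldsymbol{\alpha}$ is $\mathsf{KP}_1$-provably admissible if $\mathsf{KP}_1\vdash\forall\xi[R^{\boldsymbol{\alpha}}(\xi)\to\xi\text{ is admissible}]$. Standing assumptions: $\boldsymbol{\alpha}$ is a fixed $\mathsf{KP}_1$-provably admissible representation, the metatheory satisfies $V=L$ and $\mathsf{Exists}(\boldsymbol{\alpha})$, and $\alpha$ is the represented ordinal. $F^z$ is obtained from $F$ by restricting all unrestricted quantifiers to $z$. A formula is $\Sigma^{\boldsymbol{\alpha}}_1$ ($\Pi^{\boldsymbol{\alpha}}_1$) if it is of the form $F^{L_{\boldsymbol{\alpha}}}$ with $F$ a $\Sigma_1$ ($\Pi_1$) formula. $T$ is $\Sigma^{\boldsymbol{\alpha}}_1$-sound if for every $\Sigma_1$ sentence $\varphi$, $T\vdash\varphi^{L_{\boldsymbol{\alpha}}}$ implies $L_\alpha\models\varphi$. $T$ is $\Delta^{\boldsymbol{\alpha}}_1$-definable if the set of codes of its axioms is defined by a formula that is ($\mathsf{KP}_1+\mathsf{Exists}(\boldsymbol{\alpha})$-provably) equivalent both to a $\Sigma^{\boldsymbol{\alpha}}_1$ and to a $\Pi^{\boldsymbol{\alpha}}_1$ formula;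 the formalized provability predicate $\mathsf{Pr}_T$ is built from such a defining formula. For $T$ containing $\mathsf{KP}_1$, $|T|_{\Sigma^{\boldsymbol{\alpha}}_1}:=\min\{\beta\mid\text{for every }\Sigma_1\text{ sentence }\varphi,\text{ if }T\vdash\varphi^{L_{\boldsymbol{\alpha}}}\text{ then }L_\beta\models\varphi\}$. $\mathsf{RFN}_{\Sigma^{\boldsymbol{\alpha}}_1}(T)$ is the sentence $$\forall\varphi\in\Delta_0\Big(\mathsf{Pr}_T\big(\exists x\in L_{\boldsymbol{\alpha}}\;\varphi(x)\big)\to L_{\boldsymbol{\alpha}}\models_{\Sigma_1}\exists x\,\varphi(x)\Big),$$ where the quantifier ranges over codes of $\Delta_0$-formulas $\varphi(x)$ and $\models_{\Sigma_1}$ is the formalized truth predicate for $\Sigma_1$ sentences. Provability in the presence of an oracle for $\Pi^{\boldsymbol{\alpha}}_1$-truths: $S\vdash^{\Pi^{\boldsymbol{\alpha}}_1}\varphi$ if there is a true $\Pi^{\boldsymbol{\alpha}}_1$ sentence $\psi$ such that $S+\psi\vdash\varphi$. Finally, $T\le^{\Pi^{\boldsymbol{\alpha}}_1}_{\mathsf{RFN}_{\Sigma^{\boldsymbol{\alpha}}_1}}U$ means $$\mathsf{KP}_1+\mathsf{Exists}(\boldsymbol{\alpha})\vdash^{\Pi^{\boldsymbol{\alpha}}_1}\mathsf{RFN}_{\Sigma^{\boldsymbol{\alpha}}_1}(U)\to\mathsf{RFN}_{\Sigma^{\boldsymbol{\alpha}}_1}(T).$$ *)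

(* Defs.v *)
From Stdlib Require Import List Arith ClassicalEpsilon.
Import ListNotations.

Set Implicit Arguments.
Unset Strict Implicit.
Unset Printing Implicit Defensive.

(** * The language of set theory *)

(** Variables are de Bruijn indices. *)
Inductive form : Set :=
| Mem (i j : nat)
| Eq (i j : nat)
| Neg (p : form)
| Imp (p q : form)
| All (p : form).

(** Axiom schemes are written once, over an abstract signature, and used both
    for formulas and for (set-theoretic descriptions of) codes of formulas. *)
Class syntax (F : Type) := {
  mem : nat -> nat -> F;
  eql : nat -> nat -> F;
  neg : F -> F;
  imp : F -> F -> F;
  all : F -> F }.

#[export] Instance form_syntax : syntax form :=
  { mem := Mem; eql := Eq; neg := Neg; imp := Imp; all := All }.

Fixpoint interp (F : Type) (S : syntax F) (p : form) : F :=
  match p with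
  | Mem i j => mem i j
  | Eq i j => eql i j
  | Neg p => neg (interp S p)
  | Imp p q => imp (interp S p) (interp S q)
  | All p => all (interp S p)
  end.

Section Derived.
Context {F : Type} {S : syntax F}.
Definition Or (p q : F) : F := imp (neg p) q.
Definition And (p q : F) : F := neg (imp p (neg q)).
Definition Iff (p q : F) : F := And (imp p q) (imp q p).
Definition Ex (p : F) : F := neg (all (neg p)).
(** [forall x in y, p] and [exists x in y, p]; inside [p] the bound variable is
    [0], so that the variable [y] of the context is [y + 1] there. *)
Definition BAll (y : nat) (p : F) : F := all (imp (mem 0 (1 + y)) p).
Definition BEx (y : nat) (p : F) : F := neg (BAll y (neg p)).
End Derived.

Definition up (r : nat -> nat) (n : nat) : nat :=
  match n with 0 => 0 | S n => S (r n) end.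

Fixpoint ren (r : nat -> nat) (p : form) : form :=
  match p with
  | Mem i j => Mem (r i) (r j)
  | Eq i j => Eq (r i) (r j)
  | Neg p => Neg (ren r p)
  | Imp p q => Imp (ren r p) (ren r q)
  | All p => All (ren (up r) p)
  end.

Definition inst (t : nat) (n : nat) : nat := match n with 0 => t | S n => n end.

Fixpoint bounded (n : nat) (p : form) : Prop :=
  match p with
  | Mem i j | Eq i j => i < n /\ j < n
  | Neg p => bounded n p
  | Imp p q => bounded n p /\ bounded n q
  | All p => bounded (S n) p
  end.

Definition sentence (p : form) : Prop := bounded 0 p.

Inductive Delta0 : form -> Prop :=
| D0_mem i j : Delta0 (Mem i j)
| D0_eq i j : Delta0 (Eq i j)
| D0_neg p : Delta0 p -> Delta0 (Neg p)
| D0_imp p q : Delta0 p -> Delta0 q -> Delta0 (Imp p q)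
| D0_ball y p : Delta0 p -> Delta0 (BAll y p).

Definition Sigma1 (p : form) : Prop := exists q, Delta0 q /\ p = Ex q.
Definition Pi1 (p : form) : Prop := exists q, Delta0 q /\ p = all q.

(** [rel z p] is p^z: the quantifiers which are not already bounded are restricted
    to [z]. *)
Fixpoint rel (z : nat) (p : form) : form :=
  match p with
  | Mem _ _ | Eq _ _ => p
  | Neg p => Neg (rel z p)
  | Imp p q => Imp (rel z p) (rel z q)
  | All (Imp (Mem 0 (S y)) p) => BAll y (rel (S z) p)
  | All p => BAll z (rel (S z) p)
  end.

(** * Theories and provability *)

(** A theory is given by its axioms; because of the generalization rule below,
    an axiom with free variables stands for its universal closure. *)
Definition theory := form -> Prop.
Definition add (T : theory) (p : form) : theory := fun q => T q \/ q = p.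

Section Schemes.
Context {F : Type} {S : syntax F}.

Definition ax_K (p q : F) : F := imp p (imp q p).
Definition ax_S (p q r : F) : F :=
  imp (imp p (imp q r)) (imp (imp p q) (imp p r)).
Definition ax_N (p q : F) : F := imp (imp (neg p) (neg q)) (imp q p).
Definition ax_dist (p q : F) : F := imp (all (imp p q)) (imp (all p) (all q)).
(** [p'] is [p] shifted by one. *)
Definition ax_vac (p p' : F) : F := imp p (all p').
(** [p'] is [p] with a variable substituted for [0]. *)
Definition ax_inst (p p' : F) : F := imp (all p) p'.
Definition eq_refl_ax : F := all (eql 0 0).
Definition eq_eucl_ax : F :=
  all (all (all (imp (eql 2 1) (imp (eql 2 0) (eql 1 0))))).
Definition eq_mem_l_ax : F :=
  all (all (all (imp (eql 2 1) (imp (mem 2 0) (mem 1 0))))).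
Definition eq_mem_r_ax : F :=
  all (all (all (imp (eql 2 1) (imp (mem 0 2) (mem 0 1))))).

Definition extensionality : F :=
  all (all (imp (all (Iff (mem 0 2) (mem 0 1))) (eql 1 0))).
Definition union : F :=
  all (Ex (all (Iff (mem 0 1) (Ex (And (mem 0 3) (mem 1 0)))))).
Definition pairing : F :=
  all (all (Ex (all (Iff (mem 0 1) (Or (eql 0 3) (eql 0 2)))))).
Definition infinity : F :=
  Ex (And (Ex (And (mem 0 1) (all (neg (mem 0 1)))))
     (all (imp (mem 0 1) (Ex (And (mem 0 2)
        (all (Iff (mem 0 1) (Or (mem 0 2) (eql 0 2))))))))).
(** [p'] is [p(x)] in the context [a, b, x] (with [b] not free). *)
Definition separation (p' : F) : F :=
  all (Ex (all (Iff (mem 0 1) (And (mem 0 2) p')))).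
(** [p] is [p(x,y)] in the context [a, x, y], and [p'] is the same formula in
    the context [a, b, x, y]. *)
Definition collection (p p' : F) : F :=
  all (imp (all (imp (mem 0 1) (Ex p)))
      (Ex (all (imp (mem 0 2) (Ex (And (mem 0 2) p')))))).
(** [p] is [p(x)] in the context [x], and [p'] is [p(y)] in the context [x, y]. *)
Definition induction (p p' : F) : F :=
  imp (all (imp (all (imp (mem 0 1) p')) p)) (all p).
End Schemes.

Inductive logical_axiom : form -> Prop :=
| la_K p q : logical_axiom (ax_K p q)
| la_S p q r : logical_axiom (ax_S p q r)
| la_N p q : logical_axiom (ax_N p q)
| la_dist p q : logical_axiom (ax_dist p q)
| la_vac p : logical_axiom (ax_vac p (ren S p))
| la_inst p t : logical_axiom (ax_inst p (ren (inst t) p))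
| la_refl : logical_axiom eq_refl_ax
| la_eucl : logical_axiom eq_eucl_ax
| la_mem_l : logical_axiom eq_mem_l_ax
| la_mem_r : logical_axiom eq_mem_r_ax.

Inductive prov (T : theory) : form -> Prop :=
| prov_log p : logical_axiom p -> prov T p
| prov_ax p : T p -> prov T p
| prov_mp p q : prov T p -> prov T (Imp p q) -> prov T q
| prov_gen p : prov T p -> prov T (All p).

Definition extends (T S : theory) : Prop := forall p, prov S p -> prov T p.

(** [KP_like C] has induction for the formulas in [C]. *)
Inductive KP_like (C : form -> Prop) : theory :=
| KP_ext : KP_like C extensionality
| KP_union : KP_like C union
| KP_pair : KP_like C pairing
| KP_inf : KP_like C infinity
| KP_sep p : Delta0 p -> KP_like C (separation (ren (up S) p))
| KP_coll p : Sigma1 p -> KP_like C (collection p (ren (up (up S)) p))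
| KP_ind p : C p -> KP_like C (induction p (ren (up S) p)).

Definition KP1 : theory := KP_like (fun p => Sigma1 p \/ Pi1 p).

(** * The universe of sets and the constructible hierarchy *)

Inductive Ens : Type := sup (A : Type) (f : A -> Ens).

Definition idx (x : Ens) : Type := let (A, _) := x in A.
Definition elt (x : Ens) : idx x -> Ens :=
  match x with sup f => f end.

Fixpoint eqv (x y : Ens) : Prop :=
  match x, y with
  | sup f, sup g =>
      (forall a, exists b, eqv (f a) (g b)) /\ (forall b, exists a, eqv (f a) (g b))
  end.
Definition isin (x y : Ens) : Prop := exists b : idx y, eqv x (elt b).
Definition incl (x y : Ens) : Prop := forall z, isin z x -> isin z y.

Definition transitive (x : Ens) : Prop := forall y, isin y x -> incl y x.
Definition ordinal (x : Ens) : Prop :=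
  transitive x /\ forall y, isin y x -> transitive y.

Definition scons (x : Ens) (e : nat -> Ens) (n : nat) : Ens :=
  match n with 0 => x | S n => e n end.

(** Truth in the structure whose domain is the class [D]. *)
Fixpoint sat (D : Ens -> Prop) (e : nat -> Ens) (p : form) : Prop :=
  match p with
  | Mem i j => isin (e i) (e j)
  | Eq i j => eqv (e i) (e j)
  | Neg p => ~ sat D e p
  | Imp p q => sat D e p -> sat D e q
  | All p => forall x, D x -> sat D (scons x e) p
  end.

Definition empty : Ens := sup (fun a : Empty_set => match a with end).

Definition env (l : list Ens) : nat -> Ens := fun n => nth n l empty.

(** [models A p] : the structure (A, in) satisfies the sentence [p]. *)
Definition models (A : Ens) (p : form) : Prop := sat (fun x => isin x A) (env []) p.

(** The set of subsets of [A] definable over (A, in) with parameters. *)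
Definition Def (A : Ens) : Ens :=
  sup (fun c : { c : form * list (idx A) | bounded (S (length (snd c))) (fst c) } =>
    sup (fun a : { a : idx A |
        sat (fun x => isin x A)
            (env (elt a :: map (@elt A) (snd (proj1_sig c)))) (fst (proj1_sig c)) } =>
      elt (proj1_sig a))).

(** L_x is the union of Def(L_y) over y in x; for ordinals this is the usual
    hierarchy. *)
Fixpoint L (x : Ens) : Ens :=
  match x with
  | sup f => sup (fun c : { a & idx (Def (L (f a))) } => elt (projT2 c))
  end.

Definition in_L (x : Ens) : Prop := exists a, ordinal a /\ isin x (L a).
Definition V_equals_L : Prop := forall x, in_L x.

Definition true_V (p : form) : Prop := sat (fun _ => True) (env []) p.

Definition upair (x y : Ens) : Ens := sup (fun b : bool => if b then x else y).
Definition opair (x y : Ens) : Ens := upair (upair x x) (upair x y).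
Definition succ (x : Ens) : Ens :=
  sup (fun o : option (idx x) => match o with Some a => elt a | None => x end).
Fixpoint num (n : nat) : Ens :=
  match n with 0 => empty | S n => succ (num n) end.

Fixpoint code (p : form) : Ens :=
  match p with
  | Mem i j => opair (num 0) (opair (num i) (num j))
  | Eq i j => opair (num 1) (opair (num i) (num j))
  | Neg p => opair (num 2) (code p)
  | Imp p q => opair (num 3) (opair (code p) (code q))
  | All p => opair (num 4) (code p)
  end.

(** * Writing concrete formulas *)

(** A [pform] is a formula under [d] binders, as a function of [d].  In it,
    variables are de Bruijn levels, so that binders can be Rocq functions:
    the [n]-th outermost binder is named [n]. *)
Definition pform := nat -> form.

Definition pmem (x y : nat) : pform := fun d => Mem (d - S x) (d - S y).
Definition peq (x y : nat) : pform := fun d => Eq (d - S x) (d - S y).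
Definition pneg (P : pform) : pform := fun d => neg (P d).
Definition pimp (P Q : pform) : pform := fun d => imp (P d) (Q d).
Definition pand (P Q : pform) : pform := fun d => And (P d) (Q d).
Definition por (P Q : pform) : pform := fun d => Or (P d) (Q d).
Definition piff (P Q : pform) : pform := fun d => Iff (P d) (Q d).
Definition pall (P : nat -> pform) : pform := fun d => all (P d (S d)).
Definition pex (P : nat -> pform) : pform := fun d => Ex (P d (S d)).

(** [papp p [x0; x1; ...]] is [p] with [xi] for the index [i]. *)
Definition papp (p : form) (l : list nat) : pform :=
  fun d => ren (fun i => d - S (nth i l 0)) p.

Declare Scope pf_scope.
Delimit Scope pf_scope with pf.
Bind Scope pf_scope with pform.
Notation "x ∈ y" := (pmem x y) (at level 70) : pf_scope.
Notation "x = y" := (peq x y) : pf_scope.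
Notation "~ P" := (pneg P) : pf_scope.
Notation "P /\ Q" := (pand P Q) : pf_scope.
Notation "P \/ Q" := (por P Q) : pf_scope.
Notation "P ⇒ Q" := (pimp P Q) (at level 90, right associativity) : pf_scope.
Notation "P ⇔ Q" := (piff P Q) (at level 95, no associativity) : pf_scope.
Notation "∀ x .. y , P" := (pall (fun x => .. (pall (fun y => P%pf)) ..))
  (at level 200, x binder, y binder, right associativity) : pf_scope.
Notation "∃ x .. y , P" := (pex (fun x => .. (pex (fun y => P%pf)) ..))
  (at level 200, x binder, y binder, right associativity) : pf_scope.
Local Open Scope pf_scope.

(** A defined set [t]; the formula [t x] says that [x] is [t]. *)
Definition dterm := nat -> pform.

Definition var (v : nat) : dterm := fun x => x = v.
Notation "$ v" := (var v) (at level 1, v at level 0, format "$ v") : pf_scope.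

Definition is_in (t : dterm) (y : nat) : pform := ∃ x, t x /\ x ∈ y.
Notation "t ':∈' y" := (is_in t y) (at level 70) : pf_scope.

Definition d0 : dterm := fun x => ∀ z, ~ z ∈ x.
Definition dS (t : dterm) : dterm :=
  fun x => ∃ y, t y /\ ∀ z, z ∈ x ⇔ z ∈ y \/ z = y.
Fixpoint dnum (n : nat) : dterm :=
  match n with 0 => d0 | S n => dS (dnum n) end.
Definition dupair (s t : dterm) : dterm :=
  fun x => ∃ a b, s a /\ t b /\ ∀ z, z ∈ x ⇔ z = a \/ z = b.
Definition dpair (s t : dterm) : dterm :=
  fun x => ∃ a b, s a /\ t b /\ dupair (dupair $a $a) (dupair $a $b) x.

(** Codes of formulas, matching [code]. *)
Definition cMem (s t : dterm) : dterm := dpair (dnum 0) (dpair s t).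
Definition cEq (s t : dterm) : dterm := dpair (dnum 1) (dpair s t).
Definition cNeg (s : dterm) : dterm := dpair (dnum 2) s.
Definition cImp (s t : dterm) : dterm := dpair (dnum 3) (dpair s t).
Definition cAll (s : dterm) : dterm := dpair (dnum 4) s.

#[export] Instance code_syntax : syntax dterm :=
  { mem := fun i j => cMem (dnum i) (dnum j);
    eql := fun i j => cEq (dnum i) (dnum j);
    neg := cNeg; imp := cImp; all := cAll }.

Definition quote (p : form) : dterm := interp code_syntax p.

Definition is_trans (x : nat) : pform := ∀ y z, y ∈ x /\ z ∈ y ⇒ z ∈ x.
Definition is_ord (x : nat) : pform := is_trans x /\ ∀ y, y ∈ x ⇒ is_trans y.
Definition is_nat (n : nat) : pform :=
  is_ord n /\ (d0 n \/ ∃ k, dS $k n) /\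
  ∀ m, m ∈ n ⇒ d0 m \/ ∃ k, dS $k m.
Definition is_fun (f : nat) : pform :=
  ∀ i x y, dpair $i $x :∈ f /\ dpair $i $y :∈ f ⇒ x = y.

(** Recursive predicates on codes are expressed by the existence of a set [W]
    each of whose elements is justified by other elements of [W]. *)

(** [c] codes a formula all of whose free variables are below [n]. *)
Definition is_bounded (n c : nat) : pform :=
  ∃ W, dpair $n $c :∈ W /\
  ∀ m c, dpair $m $c :∈ W ⇒
      (∃ i j, i ∈ m /\ j ∈ m /\ (cMem $i $j c \/ cEq $i $j c))
   \/ (∃ a, cNeg $a c /\ dpair $m $a :∈ W)
   \/ (∃ a b, cImp $a $b c /\ dpair $m $a :∈ W /\ dpair $m $b :∈ W)
   \/ (∃ a, cAll $a c /\ dpair (dS $m) $a :∈ W).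

Definition is_form (c : nat) : pform := ∃ n, is_nat n /\ is_bounded n c.

Definition is_Delta0 (c : nat) : pform :=
  ∃ W, c ∈ W /\
  ∀ c, c ∈ W ⇒
      (∃ i j, is_nat i /\ is_nat j /\ (cMem $i $j c \/ cEq $i $j c))
   \/ (∃ a, cNeg $a c /\ a ∈ W)
   \/ (∃ a b, cImp $a $b c /\ a ∈ W /\ b ∈ W)
   \/ (∃ y a, is_nat y /\ cAll (cImp (cMem (dnum 0) (dS $y)) $a) c /\ a ∈ W).

Definition is_Sigma1 (c : nat) : pform := ∃ p, is_Delta0 p /\ (Ex $p : dterm) c.

(** The renamings [S], [inst t] and [up r] as sets of pairs. *)
Definition is_shift (r : nat) : pform :=
  ∀ n m, dpair $n $m :∈ r ⇔ is_nat n /\ dS $n m.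
Definition is_inst (t r : nat) : pform :=
  ∀ n m, dpair $n $m :∈ r ⇔ is_nat n /\ (d0 n /\ m = t \/ dS $m n).
Definition is_up (r r' : nat) : pform :=
  ∀ n m, dpair $n $m :∈ r' ⇔
    d0 n /\ d0 m \/ ∃ n' m', dS $n' n /\ dS $m' m /\ dpair $n' $m' :∈ r.

(** [c'] codes the renaming by [r] of the formula coded by [c]. *)
Definition is_ren (r c c' : nat) : pform :=
  ∃ W, dpair $r (dpair $c $c') :∈ W /\
  ∀ r c c', dpair $r (dpair $c $c') :∈ W ⇒
      (∃ i j i' j', dpair $i $i' :∈ r /\ dpair $j $j' :∈ r /\
         (cMem $i $j c /\ cMem $i' $j' c' \/ cEq $i $j c /\ cEq $i' $j' c'))
   \/ (∃ a a', cNeg $a c /\ cNeg $a' c' /\ dpair $r (dpair $a $a') :∈ W)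
   \/ (∃ a b a' b', cImp $a $b c /\ cImp $a' $b' c' /\
         dpair $r (dpair $a $a') :∈ W /\ dpair $r (dpair $b $b') :∈ W)
   \/ (∃ a a' r', cAll $a c /\ cAll $a' c' /\ is_up r r' /\
         dpair $r' (dpair $a $a') :∈ W).

(** ** Provability *)

Definition is_logical_axiom (c : nat) : pform :=
      (∃ p q, is_form p /\ is_form q /\ (ax_K $p $q : dterm) c)
   \/ (∃ p q r, is_form p /\ is_form q /\ is_form r /\ (ax_S $p $q $r : dterm) c)
   \/ (∃ p q, is_form p /\ is_form q /\ (ax_N $p $q : dterm) c)
   \/ (∃ p q, is_form p /\ is_form q /\ (ax_dist $p $q : dterm) c)
   \/ (∃ p r p', is_form p /\ is_shift r /\ is_ren r p p' /\
         (ax_vac $p $p' : dterm) c)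
   \/ (∃ p t r p', is_form p /\ is_nat t /\ is_inst t r /\ is_ren r p p' /\
         (ax_inst $p $p' : dterm) c)
   \/ (eq_refl_ax : dterm) c
   \/ (eq_eucl_ax : dterm) c
   \/ (eq_mem_l_ax : dterm) c
   \/ (eq_mem_r_ax : dterm) c.

(** Pr_T(c), where [tau] defines the axioms of T: there is a sequence [P] of
    length [n] whose last entry is [c] and each of whose entries is an axiom or
    follows from earlier entries. *)
Definition is_provable (tau : form) (c : nat) : pform :=
  ∃ n P, is_nat n /\ is_fun P /\
  (∃ m, dS $m n /\ dpair $m $c :∈ P) /\
  ∀ i, i ∈ n ⇒ ∃ x, dpair $i $x :∈ P /\
    (    is_logical_axiom x
      \/ (is_form x /\ papp tau [x])
      \/ (∃ j k y z, j ∈ i /\ k ∈ i /\ dpair $j $y :∈ P /\ dpair $k $z :∈ P /\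
            cImp $y $x z)
      \/ (∃ j y, j ∈ i /\ dpair $j $y :∈ P /\ cAll $y x)).

(** ** Satisfaction in set structures and the constructible hierarchy *)

(** [s] is a sequence of length [n] of elements of [M]. *)
Definition is_seq (M n s : nat) : pform :=
  is_fun s /\
  (∀ q, q ∈ s ⇒ ∃ i x, i ∈ n /\ x ∈ M /\ dpair $i $x q) /\
  (∀ i, i ∈ n ⇒ ∃ x, dpair $i $x :∈ s).

Definition is_scons (a s s' : nat) : pform :=
  ∀ q, q ∈ s' ⇔ dpair (dnum 0) $a q \/
                 ∃ i x, dpair $i $x :∈ s /\ dpair (dS $i) $x q.

(** The formula coded by [c] holds in ([M], in) under the assignment [s]: there
    are a set [D] of pairs (formula, assignment), closed under the recursive
    clauses of satisfaction, and the set [W] of those which are true. *)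
Definition is_sat (M c s : nat) : pform :=
  ∃ D W, dpair $c $s :∈ D /\ dpair $c $s :∈ W /\
  ∀ c s, dpair $c $s :∈ D ⇒
      (∃ i j x y, dpair $i $x :∈ s /\ dpair $j $y :∈ s /\
         (cMem $i $j c /\ (dpair $c $s :∈ W ⇔ x ∈ y) \/
          cEq $i $j c /\ (dpair $c $s :∈ W ⇔ x = y)))
   \/ (∃ a, cNeg $a c /\ dpair $a $s :∈ D /\
         (dpair $c $s :∈ W ⇔ ~ dpair $a $s :∈ W))
   \/ (∃ a b, cImp $a $b c /\ dpair $a $s :∈ D /\ dpair $b $s :∈ D /\
         (dpair $c $s :∈ W ⇔ (dpair $a $s :∈ W ⇒ dpair $b $s :∈ W)))
   \/ (∃ a, cAll $a c /\
         (∀ x, x ∈ M ⇒ ∃ s', is_scons x s s' /\ dpair $a $s' :∈ D) /\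
         (dpair $c $s :∈ W ⇔
            ∀ x s', x ∈ M /\ is_scons x s s' ⇒ dpair $a $s' :∈ W)).

(** The formula coded by [c] holds in [M] under all assignments. *)
Definition is_model (M c : nat) : pform :=
  ∀ n s, is_nat n /\ is_bounded n c /\ is_seq M n s ⇒ is_sat M c s.

(** The truth predicate for Sigma_1 sentences, in the structure [M]. *)
Definition is_true_Sigma1 (M c : nat) : pform :=
  ∃ p s, is_Delta0 p /\ (∃ n, dnum 1 n /\ is_bounded n p) /\
         (Ex $p : dterm) c /\ d0 s /\ is_sat M c s.

(** [x] is an element of Def([M]). *)
Definition in_Def (M x : nat) : pform :=
  ∃ n c s, is_nat n /\ (∃ k, dS $n k /\ is_bounded k c) /\ is_seq M n s /\
  ∀ a, a ∈ x ⇔ a ∈ M /\ ∃ s', is_scons a s s' /\ is_sat M c s'.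

(** [l] is L_[a]; [f] is the sequence of the L_[g], for [g] up to [a]. *)
Definition is_L (a l : nat) : pform :=
  ∃ f, is_fun f /\ dpair $a $l :∈ f /\
  ∀ g m, dpair $g $m :∈ f ⇒
    (∀ h, h ∈ g ⇒ ∃ k, dpair $h $k :∈ f) /\
    (∀ x, x ∈ m ⇔ ∃ h k, h ∈ g /\ dpair $h $k :∈ f /\ in_Def k x).

(** [c] codes an axiom of KP. *)
Definition is_KP (c : nat) : pform :=
      (extensionality : dterm) c
   \/ (union : dterm) c
   \/ (pairing : dterm) c
   \/ (infinity : dterm) c
   \/ (∃ p r r' p', is_form p /\ is_Delta0 p /\
         is_shift r /\ is_up r r' /\ is_ren r' p p' /\
         (separation $p' : dterm) c)
   \/ (∃ p r r' r'' p', is_form p /\ is_Sigma1 p /\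
         is_shift r /\ is_up r r' /\ is_up r' r'' /\ is_ren r'' p p' /\
         (collection $p $p' : dterm) c)
   \/ (∃ p r r' p', is_form p /\
         is_shift r /\ is_up r r' /\ is_ren r' p p' /\
         (induction $p $p' : dterm) c).

Definition is_admissible (a : nat) : pform :=
  is_ord a /\ ∃ l, is_L a l /\ ∀ c, is_KP c ⇒ is_model l c.

(** * Representations *)

(** [R] has the free variable [0] only. *)
Definition representation (R : form) : Prop :=
  Sigma1 R /\ bounded 1 R /\
  prov KP1 ((∀ x y, papp R [x] /\ papp R [y] ⇒ x = y) 0).

Definition provably_admissible (R : form) : Prop :=
  prov KP1 ((∀ x, papp R [x] ⇒ is_admissible x) 0).

Definition Exists (R : form) : form := Ex R.

Definition represents (R : form) (a : Ens) : Prop :=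
  (ordinal a /\ forall x, in_L x -> (sat in_L (env [x]) R <-> eqv x a))%type.

Definition KP1_Exists (R : form) : theory := add KP1 (Exists R).

(** The formula "[0] is L_[1]". *)
Definition L_form : form := is_L 0 1 2.

(** p^(L_alpha), for alpha represented by [R]: for all a and l, if R(a) and l is
    L_a, then p^l. *)
Definition rel_L (R p : form) : form :=
  All (Imp R (All (Imp L_form (rel 0 (ren (fun i => 2 + i) p))))).

(** (exists x, p(x))^(L_alpha), for [p] in Delta_0 with the free variable [0]
    only. *)
Definition rel_L_ex {F : Type} {S : syntax F} (R p : F) : F :=
  all (imp R (all (imp (interp S L_form) (BEx 0 p)))).

Definition Delta1_definition (R : form) (T : theory) (tau : form) : Prop :=
  (bounded 1 tau /\
  (forall x, sat (fun _ => True) (env [x]) tau <-> exists p, T p /\ eqv x (code p)) /\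
  (exists s, Sigma1 s /\ bounded 1 s /\
     prov (KP1_Exists R) (All (Iff tau (rel_L R s)))) /\
  (exists s, Pi1 s /\ bounded 1 s /\
     prov (KP1_Exists R) (All (Iff tau (rel_L R s)))))%type.

Definition Sigma1_sound (R : form) (a : Ens) (T : theory) : Prop :=
  forall p, Sigma1 p -> sentence p -> prov T (rel_L R p) -> models (L a) p.

Definition least_ordinal (P : Ens -> Prop) : Ens :=
  epsilon (inhabits empty)
    (fun b => ordinal b /\ P b /\ forall c, ordinal c -> P c -> incl b c)%type.

(** |T|; the soundness of T for [L b] is what the definition asks of b. *)
Definition Sigma1_norm (R : form) (T : theory) : Ens :=
  least_ordinal (fun b => Sigma1_sound R b T).

Definition RFN (R tau : form) : form :=
  (∀ p, is_Delta0 p /\ (∃ n, dnum 1 n /\ is_bounded n p) ⇒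
   ∀ c, rel_L_ex (quote R) $p c /\ is_provable tau c ⇒
   ∀ a l e, papp R [a] /\ is_L a l /\ (Ex $p : dterm) e ⇒ is_true_Sigma1 l e) 0.

Definition oracle_prov (R : form) (S : theory) (p : form) : Prop :=
  (exists q, Pi1 q /\ sentence q /\ true_V (rel_L R q) /\
     prov (add S (rel_L R q)) p)%type.

(** The theories compared are given by definitions of their axioms. *)
Definition RFN_le (R tau upsilon : form) : Prop :=
  oracle_prov R (KP1_Exists R) (Imp (RFN R upsilon) (RFN R tau)).

(* Main.v *)
From Stdlib Require Import List Arith Lia ClassicalEpsilon FunctionalExtensionality PropExtensionality Cantor Eqdep_dec.
Require Import Defs.
Import ListNotations.
Set Implicit Arguments.
Unset Strict Implicit.

(** By completeness it suffices to argue in models of [KP1 + Exists(alpha)].  There L_alpha is admissible, so Sigma_1-collection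
    turns RFN(T), "every Sigma_1 sentence whose relativization T proves holds in L_alpha", into "some level L_delta in L_alpha
    satisfies all these sentences" (call L_delta T-saturated).  This is Sigma_1 over L_alpha, since being a level, satisfaction in
    a level and the axioms of T are all certified by elements of L_alpha.

    If |T| <= |U|, then "every U-saturated level is T-saturated" is a true Pi_1 sentence over L_alpha, and with it RFN(U) implies
    RFN(T).

    If |U| < |T|, take a Sigma_1 sentence phi proved by T for L_alpha but false in L_|U|.  Then chi, "every level satisfying phi
    is U-saturated", is true.  If an oracle psi gives RFN(U) -> RFN(T), then T proves that chi or psi fails in L_alpha, or that
    rho, "there is a T-saturated level".  This is Sigma_1, hence true in L_|T|; as chi and psi are true, L_|T| contains a
    T-saturated level L_delta, and delta < |T| contradicts the definition of |T|. *)

(** Models of [KP1] may be ill-founded, with nonstandard natural numbers, codes and proofs, and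
    their induction reaches only one unbounded quantifier. Facts about arbitrary codes can therefore
    not be proved by induction on [form]; they need inductions inside the model whose formula is
    Delta_0 or Sigma_1. The device for this is a closed set [z], which contains all codes of
    formulas and all assignments over its elements: evaluated inside [z] any fixed formula is
    Delta_0, and compactness lemmas show that [z] gives the same answers as the whole model.

    For the same reason levels are recognized by chains and not by ordinals. Only in the universe of
    sets are they matched with ordinals, and there well-foundedness also makes every internal proof
    an actual one.

    The constructions are needed both in the model and in L_alpha, where Sigma_1 statements must
    find their witnesses; they are carried out once, for any class satisfying [isU]. As T and U are
    only Delta_1 over L_alpha, a certificate carries their restrictions to one closed set together
    with the witnesses that decide them. *)

(** * Tarski semantics over an arbitrary relation, and renaming of variables *)

Definition sc {X : Type} (x : X) (e : nat -> X) (n : nat) : X :=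
  match n with 0 => x | S n => e n end.

(** Equality is read as identity, which spares congruence arguments later; in return both the term
    model and the universe of sets have to be formed as quotients. *)
Fixpoint tsat {X : Type} (E : X -> X -> Prop) (D : X -> Prop) (e : nat -> X) (p : form) : Prop :=
  match p with
  | Mem i j => E (e i) (e j)
  | Eq i j => e i = e j
  | Neg p => ~ tsat E D e p
  | Imp p q => tsat E D e p -> tsat E D e q
  | All p => forall x, D x -> tsat E D (sc x e) p
  end.

Lemma sc_up {X : Type} (x : X) e r : (fun n => sc x e (up r n)) = sc x (fun n => e (r n)).
Proof. apply functional_extensionality; intros [|n]; reflexivity. Qed.

Lemma sc_eta {X : Type} (e : nat -> X) : sc (e 0) (fun n => e (S n)) = e.
Proof. apply functional_extensionality; intros [|n]; reflexivity. Qed.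

Lemma tsat_ren {X : Type} (E : X -> X -> Prop) D p : forall r e,
  tsat E D e (ren r p) <-> tsat E D (fun n => e (r n)) p.
Proof.
  induction p; simpl; intros; try tauto.
  - rewrite IHp; tauto.
  - rewrite IHp1, IHp2; tauto.
  - split; intros H x Hx; specialize (H x Hx); rewrite IHp, sc_up in *; auto.
Qed.

Lemma tsat_ext {X : Type} (E : X -> X -> Prop) D p : forall n e e', bounded n p ->
  (forall i, i < n -> e i = e' i) -> (tsat E D e p <-> tsat E D e' p).
Proof.
  induction p; simpl; intros n e e' B H.
  - rewrite !H by tauto; tauto.
  - rewrite !H by tauto; tauto.
  - rewrite (IHp n e e'); tauto.
  - rewrite (IHp1 n e e'), (IHp2 n e e'); tauto.
  - assert (R : forall x, tsat E D (sc x e) p <-> tsat E D (sc x e') p).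
    { intros x; apply (IHp (S n)); auto. intros [|i] Hi; simpl; auto. apply H; lia. }
    split; intros H1 x Hx; apply R; auto.
Qed.

Lemma ren_ren p : forall r s, ren r (ren s p) = ren (fun n => r (s n)) p.
Proof.
  induction p; simpl; intros; f_equal; auto.
  rewrite IHp; f_equal. apply functional_extensionality; intros [|n]; reflexivity.
Qed.

Lemma ren_ext p : forall n r s, bounded n p -> (forall i, i < n -> r i = s i) -> ren r p = ren s p.
Proof.
  induction p; simpl; intros n r s B H; f_equal; try (apply H; tauto).
  - eauto.
  - apply (IHp1 n); tauto.
  - apply (IHp2 n); tauto.
  - apply (IHp (S n)); auto. intros [|i] Hi; simpl; auto. f_equal; apply H; lia.
Qed.

Lemma ren_id p : forall n r, bounded n p -> (forall i, i < n -> r i = i) -> ren r p = p.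
Proof.
  induction p; simpl; intros n r B H; f_equal; try (apply H; tauto).
  - eauto.
  - apply (IHp1 n); tauto.
  - apply (IHp2 n); tauto.
  - apply (IHp (S n)); auto. intros [|i] Hi; simpl; auto. f_equal; apply H; lia.
Qed.

Lemma bounded_ren p : forall n m r, bounded n p -> (forall i, i < n -> r i < m) -> bounded m (ren r p).
Proof.
  induction p; simpl; intros n m r B H; try (split; apply H; tauto).
  - eauto.
  - split; [apply (IHp1 n)|apply (IHp2 n)]; tauto.
  - apply (IHp (S n)); auto. intros [|i] Hi; simpl; [lia|]. apply -> Nat.succ_lt_mono; apply H; lia.
Qed.

Lemma bounded_mono p : forall n m, n <= m -> bounded n p -> bounded m p.
Proof.
  induction p; simpl; intros n m H B; try (split; lia).
  - eauto.
  - split; [apply (IHp1 n)|apply (IHp2 n)]; tauto.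
  - apply (IHp (S n)); auto; lia.
Qed.

Fixpoint bnd (p : form) : nat :=
  match p with
  | Mem i j | Eq i j => S (i + j)
  | Neg p => bnd p
  | Imp p q => bnd p + bnd q
  | All p => bnd p
  end.
Lemma bnd_ok p : bounded (bnd p) p.
Proof.
  induction p; simpl; auto; try lia.
  - split; [eapply bounded_mono; [|apply IHp1]|eapply bounded_mono; [|apply IHp2]]; lia.
  - eapply bounded_mono; [|apply IHp]; lia.
Qed.

(** * Completeness *)

Section Der.
Variable T : theory.
Notation "⊢ p" := (prov T p) (at level 80).

Lemma prov_id p : prov T (Imp p p).
Proof.
  eapply prov_mp; [|eapply prov_mp; [|apply prov_log, (la_S p (Imp p p) p)]];
  apply prov_log; [apply (la_K p p)|apply (la_K p (Imp p p))].
Qed.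

(** [la_inst] substitutes for variable 0 only, so a renaming is carried out one variable at a time.
    After [n] rounds the first [n] variables have their new values and variable [n] stands at 0,
    ready to be generalized and instantiated by [r n]. The inductive call raises the new values by
    one because this instantiation lowers them again. *)
Lemma prov_ren_aux n : forall r p, prov T p -> prov T (ren (fun i => if i <? n then r i else i - n) p).
Proof.
  induction n; intros r p H.
  - rewrite (ren_id (bnd_ok p)); auto. intros; simpl; lia.
  - assert (H1 := IHn (fun i => S (r i)) p H).
    apply prov_gen in H1.
    assert (H2 := prov_mp H1 (prov_log T (la_inst _ (r n)))).
    rewrite ren_ren in H2.
    erewrite ren_ext; [exact H2|apply bnd_ok|].
    intros i _; simpl.
    destruct (Nat.ltb_spec i (S n)), (Nat.ltb_spec i n); try lia; simpl; auto.
    + replace i with n by lia. rewrite Nat.sub_diag; reflexivity.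
    + replace (i - n) with (S (i - S n)) by lia; reflexivity.
Qed.

Lemma prov_ren r p : prov T p -> prov T (ren r p).
Proof.
  intros H. erewrite ren_ext; [apply (prov_ren_aux (bnd p) r H)|apply bnd_ok|].
  intros i Hi; simpl. destruct (Nat.ltb_spec i (bnd p)); [auto|lia].
Qed.

Inductive der (G : list form) : form -> Prop :=
| der_in p : In p G -> der G p
| der_prov p : prov T p -> der G p
| der_mp p q : der G p -> der G (Imp p q) -> der G q.

Lemma der_K G p q : der G p -> der G (Imp q p).
Proof. intros H; eapply der_mp; [exact H|]. apply der_prov, prov_log, (la_K p q). Qed.

Lemma der_ded G h p : der (h :: G) p -> der G (Imp h p).
Proof.
  induction 1 as [p [->|H]|p H|p q _ IH1 _ IH2].
  - apply der_prov, prov_id.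
  - apply der_K, der_in, H.
  - apply der_K, der_prov, H.
  - eapply der_mp; [exact IH1|eapply der_mp; [exact IH2|]].
    apply der_prov, prov_log, (la_S h p q).
Qed.

Lemma der_mono G G' p : (forall q, In q G -> In q G') -> der G p -> der G' p.
Proof. induction 2; eauto using der. Qed.

Lemma der_cut G h p : der G h -> der (h :: G) p -> der G p.
Proof. intros H1 H2; eapply der_mp; [exact H1|apply der_ded, H2]. Qed.

Lemma der_nil p : der [] p -> prov T p.
Proof. induction 1; simpl in *; try tauto; eauto using prov. Qed.

Lemma der_ax G p : logical_axiom p -> der G p.
Proof. intros; apply der_prov, prov_log; auto. Qed.

Lemma der_expl G p q : der G p -> der G (Neg p) -> der G q.
Proof.
  intros H1 H2. eapply der_mp; [exact H1|]. eapply der_mp; [|apply der_ax, (la_N q p)].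
  apply der_K, H2.
Qed.

Lemma der_contra G p q : der (Neg p :: G) q -> der (Neg p :: G) (Neg q) -> der G p.
Proof.
  intros H1 H2. pose (t := Imp p p).
  assert (H : der G (Imp t p)).
  { eapply der_mp; [|apply der_ax, (la_N p t)]. apply der_ded. eapply der_expl with (p := q); eauto. }
  eapply der_mp; [|exact H]. apply der_prov, prov_id.
Qed.

Lemma der_neg G p q : der (p :: G) q -> der (p :: G) (Neg q) -> der G (Neg p).
Proof.
  intros H1 H2.
  assert (D : der (Neg (Neg p) :: G) p).
  { apply der_contra with (q := Neg p); apply der_in; simpl; auto. }
  assert (M : forall r, der (p :: G) r -> der (Neg (Neg p) :: G) r).
  { intros r Hr. eapply der_cut; [exact D|]. eapply der_mono; [|exact Hr]. simpl; tauto. }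
  apply der_contra with (q := q); auto.
Qed.

Fixpoint imps (G : list form) (p : form) : form :=
  match G with [] => p | h :: G => imps G (Imp h p) end.

Lemma der_imps G : forall p, der G p -> prov T (imps G p).
Proof. induction G; simpl; intros; [apply der_nil; auto|]. apply IHG, der_ded, H. Qed.


Lemma der_all_mp G p q : der G (All (Imp p q)) -> der G (All p) -> der G (All q).
Proof. intros H1 H2. eapply der_mp; [exact H2|]. eapply der_mp; [exact H1|]. apply der_ax, (la_dist p q). Qed.

Lemma der_all_imps G : forall H p, der H (All (imps G p)) -> (forall q, In q G -> der H (All q)) -> der H (All p).
Proof.
  induction G; simpl; intros H p D I; auto.
    apply der_all_mp with (p := a).
  - apply IHG; [exact D|]. intros; apply I; simpl; auto.
  - apply I; simpl; auto.
Qed.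

(** The hypotheses are moved into the formula, where generalization is allowed; [la_dist] then
    distributes the quantifier, and each hypothesis, being shifted, is recovered by vacuous
    quantification. *)
Lemma der_gen G p : der (map (ren S) G) p -> der G (All p).
Proof.
  intros H. apply der_imps, prov_gen in H.
  eapply der_all_imps; [apply der_prov, H|].
  intros q Hq. apply in_map_iff in Hq as (q' & <- & Hq).
  eapply der_mp; [apply der_in, Hq|]. apply der_ax, (la_vac q').
Qed.

Lemma der_ren r G p : der G p -> der (map (ren r) G) (ren r p).
Proof.
  induction 1 as [p H|p H|p q _ IH1 _ IH2].
  - apply der_in, in_map, H.
  - apply der_prov, prov_ren, H.
  - exact (der_mp IH1 IH2).
Qed.

(** The whole derivation is renamed by [s], which moves [y] to 0 and shifts every other variable. On
    the hypotheses, whose variables lie below [y], this is the plain shift, so [der_gen] applies. *)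
Lemma der_fresh G p y : (forall q, In q G -> bounded y q) -> bounded (S y) p ->
  der G (ren (inst y) p) -> der G (All p).
Proof.
  intros HG Hp H. apply der_gen.
  pose (s := fun i => if i =? y then 0 else S i).
  apply (der_ren s) in H.
  replace (map (ren S) G) with (map (ren s) G).
  2:{ apply map_ext_in. intros q Hq. eapply ren_ext; [apply HG, Hq|].
      intros i Hi; unfold s. destruct (Nat.eqb_spec i y); lia. }
  replace p with (ren s (ren (inst y) p)); auto.
  rewrite ren_ren. eapply ren_id; [exact Hp|].
  intros [|i] Hi; unfold s; simpl; [now rewrite Nat.eqb_refl|].
  destruct (Nat.eqb_spec i y); lia.
Qed.

Definition cons G := exists p, ~ der G p.

Lemma cons_neg G p : ~ der G p -> cons (Neg p :: G).
Proof.
  intros H. exists p. intros D. apply H. apply der_contra with (q := p); auto.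
  apply der_in; simpl; auto.
Qed.

Lemma cons_iff G p : cons G -> der G p -> der G (Neg p) -> False.
Proof. intros [q Hq] H1 H2; apply Hq; apply der_expl with (p := p); auto. Qed.

Fixpoint enc (p : form) : nat :=
  match p with
  | Mem i j => Cantor.to_nat (0, Cantor.to_nat (i, j))
  | Eq i j => Cantor.to_nat (1, Cantor.to_nat (i, j))
  | Neg p => Cantor.to_nat (2, enc p)
  | Imp p q => Cantor.to_nat (3, Cantor.to_nat (enc p, enc q))
  | All p => Cantor.to_nat (4, enc p)
  end.

Lemma enc_inj p : forall q, enc p = enc q -> p = q.
Proof.
  induction p; intros []; unfold enc; fold enc; intros H; apply to_nat_inj in H;
  try discriminate; apply (f_equal snd) in H; unfold snd in H.
  1, 2: apply to_nat_inj in H; injection H; intros; subst; reflexivity.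
  1, 3: f_equal; auto.
  apply to_nat_inj in H; injection H; intros; f_equal; auto.
Qed.

Definition dec (n : nat) : form := epsilon (inhabits (Eq 0 0)) (fun p => enc p = n).
Lemma dec_enc p : dec (enc p) = p.
Proof. apply enc_inj. unfold dec. apply (epsilon_spec (inhabits (Eq 0 0)) (fun q => enc q = enc p)). exists p; auto. Qed.

Definition fresh (G : list form) : nat := list_max (map bnd G).
Lemma fresh_ok G q : In q G -> bounded (fresh G) q.
Proof.
  intros H. eapply bounded_mono; [|apply bnd_ok].
  apply (in_map bnd) in H. unfold fresh.
  pose proof (list_max_le (map bnd G) (list_max (map bnd G))) as [H1 _].
  specialize (H1 (le_n _)). rewrite Forall_forall in H1. auto.
Qed.

(** Variables serve as Henkin constants: only finitely many occur in [G], so a refuted universal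
    formula can be given a fresh one as counterexample without enlarging the language. *)
Definition wit (G : list form) (q : form) : list form :=
  match q with Neg (All r) => [Neg (ren (inst (fresh (q :: G))) r)] | _ => [] end.

Definition step (G : list form) (q : form) : list form :=
  if excluded_middle_informative (cons (q :: G)) then wit G q ++ q :: G else Neg q :: G.

Lemma step_cons G q : cons G -> cons (step G q).
Proof.
  unfold step; intros HG. destruct (excluded_middle_informative _) as [H|H].
  - destruct q; simpl; auto. destruct q; simpl; auto.
    apply cons_neg. intros D. 
    assert (In (Neg (All q)) (Neg (All q) :: G)) as I by (left; auto).
    apply (cons_iff H (p := All q)); [|apply der_in, I].
    eapply der_fresh; [| |exact D].
    + intros; apply fresh_ok; auto.
    + apply fresh_ok in I. exact I.
  - destruct HG as [p Hp]. exists p. intros D. apply H. exists p. intros D'. apply Hp.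
    assert (A : forall r, der (q :: G) r) by (intros r; apply NNPP; intros N; apply H; exists r; exact N).
    assert (D1 : der G (Neg q)) by (apply der_neg with (q := p); auto).
    eapply der_cut; eauto.
Qed.

Section Henkin.
Variable G0 : list form.
Hypothesis HG0 : cons G0.

Fixpoint stage (n : nat) : list form :=
  match n with 0 => G0 | S n => step (stage n) (dec n) end.

Lemma stage_enc q : stage (S (enc q)) = step (stage (enc q)) q.
Proof. simpl. rewrite dec_enc; reflexivity. Qed.

Lemma stage_cons n : cons (stage n).
Proof. induction n; simpl; auto using step_cons. Qed.

Lemma step_incl G q p : In p G -> In p (step G q).
Proof.
  unfold step; intros. destruct (excluded_middle_informative _); simpl; auto.
  apply in_or_app; simpl; auto.
Qed.

Lemma stage_mono n m p : n <= m -> In p (stage n) -> In p (stage m).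
Proof. induction 1; auto; simpl; intros; apply step_incl; auto. Qed.

Definition Dl (p : form) : Prop := exists n, In p (stage n).

Lemma Dl_dec p : Dl p \/ Dl (Neg p).
Proof.
  assert (In p (stage (S (enc p))) \/ In (Neg p) (stage (S (enc p)))) as [H|H].
  { simpl. rewrite dec_enc. unfold step. destruct (excluded_middle_informative _); simpl; auto.
    left. apply in_or_app; simpl; auto. }
  - left; eexists; eauto.
  - right; eexists; eauto.
Qed.

Lemma Dl_con p : Dl p -> Dl (Neg p) -> False.
Proof.
  intros [n Hn] [m Hm]. apply (cons_iff (stage_cons (n + m)) (p := p)); apply der_in.
  - eapply stage_mono; [|exact Hn]; lia.
  - eapply stage_mono; [|exact Hm]; lia.
Qed.

Lemma Dl_der G p : (forall q, In q G -> Dl q) -> der G p -> Dl p.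
Proof.
  intros HG D.
  assert (exists n, forall q, In q G -> In q (stage n)) as [n Hn].
  { clear D. induction G as [|q G IH]; [exists 0; simpl; tauto|].
    destruct IH as [n Hn]; [intros; apply HG; right; auto|].
    destruct (HG q) as [m Hm]; [left; auto|]. exists (n + m). intros r [->|Hr].
    - eapply stage_mono; [|exact Hm]; lia.
    - eapply stage_mono; [|apply Hn, Hr]; lia. }
  destruct (Dl_dec p) as [H|[m Hm]]; auto. exfalso.
  apply (cons_iff (stage_cons (n + m)) (p := p)).
  - eapply der_mono; [|exact D]. intros; eapply stage_mono; [|apply Hn; auto]; lia.
  - apply der_in. eapply stage_mono; [|exact Hm]; lia.
Qed.

Lemma Dl_wit r : Dl (Neg (All r)) -> exists y, Dl (Neg (ren (inst y) r)).
Proof.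
  intros H. set (q := Neg (All r)) in *.
  assert (c : cons (q :: stage (enc q))).
  { apply NNPP; intros c. apply (Dl_con H). exists (S (enc q)). rewrite stage_enc; unfold step.
    destruct (excluded_middle_informative _); [tauto|left; auto]. }
  exists (fresh (q :: stage (enc q))). exists (S (enc q)). rewrite stage_enc; unfold step.
  destruct (excluded_middle_informative _); [|tauto]. left; auto.
Qed.

Lemma Dl_prov p : prov T p -> Dl p.
Proof. intros; apply (@Dl_der []); simpl; [tauto|]. apply der_prov; auto. Qed.
Lemma Dl_mp p q : Dl (Imp p q) -> Dl p -> Dl q.
Proof. intros; apply (@Dl_der [Imp p q; p]); simpl; [intuition (subst; auto)|].
  eapply der_mp; apply der_in; simpl; eauto. Qed.

Lemma Dl_all p t : Dl (All p) -> Dl (ren (inst t) p).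
Proof. intros. eapply Dl_mp; [|eassumption]. apply Dl_prov, prov_log, (la_inst p t). Qed.

Lemma Dl_refl i : Dl (Eq i i).
Proof. pose proof (Dl_prov (prov_log T la_refl)) as H. apply (@Dl_all _ i) in H; exact H. Qed.
Lemma Dl_eucl i j k : Dl (Eq i j) -> Dl (Eq i k) -> Dl (Eq j k).
Proof. pose proof (Dl_prov (prov_log T la_eucl)) as H. 
  apply (@Dl_all _ i) in H; simpl in H; apply (@Dl_all _ j) in H; simpl in H; apply (@Dl_all _ k) in H; simpl in H.
  intros H1 H2; exact (Dl_mp (Dl_mp H H1) H2). Qed.
Lemma Dl_sym i j : Dl (Eq i j) -> Dl (Eq j i).
Proof. eauto using Dl_eucl, Dl_refl. Qed.
Lemma Dl_meml i j k : Dl (Eq i j) -> Dl (Mem i k) -> Dl (Mem j k).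
Proof. pose proof (Dl_prov (prov_log T la_mem_l)) as H. 
  apply (@Dl_all _ i) in H; simpl in H; apply (@Dl_all _ j) in H; simpl in H; apply (@Dl_all _ k) in H; simpl in H.
  intros H1 H2; exact (Dl_mp (Dl_mp H H1) H2). Qed.
Lemma Dl_memr i j k : Dl (Eq i j) -> Dl (Mem k i) -> Dl (Mem k j).
Proof. pose proof (Dl_prov (prov_log T la_mem_r)) as H. 
  apply (@Dl_all _ i) in H; simpl in H; apply (@Dl_all _ j) in H; simpl in H; apply (@Dl_all _ k) in H; simpl in H.
  intros H1 H2; exact (Dl_mp (Dl_mp H H1) H2). Qed.

(** Epsilon depends only on the predicate, and variables equal according to [Dl] have the same one;
    so it chooses one representative per class. The fixed points of [rep] form the quotient, on
    which equality is identity. *)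
Definition rep (i : nat) : nat := epsilon (inhabits 0) (fun j => Dl (Eq i j)).
Lemma rep_ok i : Dl (Eq i (rep i)).
Proof. apply (epsilon_spec (inhabits 0) (fun j => Dl (Eq i j))). exists i; apply Dl_refl. Qed.
Lemma rep_eq i j : rep i = rep j <-> Dl (Eq i j).
Proof.
  split; intros H.
  - apply Dl_eucl with (rep i); [apply Dl_sym, rep_ok|rewrite H; apply Dl_sym, rep_ok].
  - unfold rep. f_equal. apply functional_extensionality; intros k. apply propositional_extensionality.
    split; intros; eauto using Dl_eucl, Dl_sym.
Qed.

Definition tm := { i : nat | rep i = i }.
Definition cls (i : nat) : tm := exist _ (rep i) (proj2 (rep_eq (rep i) i) (Dl_sym (rep_ok i))).
Definition tmE (x y : tm) : Prop := Dl (Mem (proj1_sig x) (proj1_sig y)).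

Lemma tm_eq (x y : tm) : proj1_sig x = proj1_sig y -> x = y.
Proof. destruct x as [x Hx], y as [y Hy]; simpl; intros ->. f_equal. apply UIP_dec, Nat.eq_dec. Qed.

Lemma cls_surj (x : tm) : exists i, x = cls i.
Proof. exists (proj1_sig x). apply tm_eq; simpl. symmetry; apply (proj2_sig x). Qed.

Lemma truth p : forall s, tsat tmE (fun _ => True) (fun n => cls (s n)) p <-> Dl (ren s p).
Proof.
  induction p; intros s; simpl.
  - unfold tmE; simpl. pose proof (rep_ok (s i)); pose proof (rep_ok (s j)).
    split; intros H1.
    + eapply Dl_meml; [apply Dl_sym; eassumption|]. eapply Dl_memr; [apply Dl_sym; eassumption|auto].
    + eapply Dl_meml; [eassumption|]. eapply Dl_memr; [eassumption|auto].
  - split; intros H.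
    + apply rep_eq. injection H; auto.
    + apply tm_eq; simpl; apply rep_eq; auto.
  - rewrite IHp. split; intros H.
    + destruct (Dl_dec (ren s p)); tauto.
    + intros H1; eapply Dl_con; eauto.
  - rewrite IHp1, IHp2. split; intros H.
    + destruct (Dl_dec (ren s p1)) as [H1|H1].
      * apply (@Dl_der [ren s p2]); simpl; [intuition (subst; auto)|]. apply der_K, der_in; simpl; auto.
      * apply (@Dl_der [Neg (ren s p1)]); simpl; [intuition (subst; auto)|].
        apply der_ded. apply der_expl with (p := ren s p1); apply der_in; simpl; auto.
    + intros H1; exact (Dl_mp H H1).
  - assert (R : forall t, tsat tmE (fun _ => True) (sc (cls t) (fun n => cls (s n))) p <-> Dl (ren (inst t) (ren (up s) p))).
    { intros t. rewrite ren_ren, <- IHp. 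
      replace (sc (cls t) (fun n => cls (s n))) with (fun n => cls (inst t (up s n))); [tauto|].
      apply functional_extensionality; intros [|n]; reflexivity. }
    split; intros H.
    + destruct (Dl_dec (All (ren (up s) p))) as [H1|H1]; auto. exfalso.
      apply Dl_wit in H1 as [y Hy]. apply (Dl_con (proj1 (R y) (H _ I)) Hy).
    + intros x _. destruct (cls_surj x) as [t ->]. apply R, Dl_all, H.
Qed.
End Henkin.

Theorem completeness (p : form) :
  (forall (X : Type) (E : X -> X -> Prop), X ->
     (forall q e, T q -> tsat E (fun _ => True) e q) -> forall e, tsat E (fun _ => True) e p) ->
  prov T p.
Proof.
  intros H. apply NNPP; intros N.
  assert (C : cons [Neg p]).
  { apply cons_neg. intros D; apply N, der_nil, D. }
  set (cl := @cls [Neg p] C).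
  assert (Rid : forall q, ren (fun n => n) q = q) by (intros q; eapply ren_id; [apply bnd_ok|auto]).
  assert (N1 : ~ tsat (@tmE [Neg p]) (fun _ => True) (fun n => cl n) p).
  { intros H1. apply (truth C p (fun n => n)) in H1. rewrite Rid in H1.
    apply (Dl_con C H1). exists 0; simpl; auto. }
  apply N1. apply H; [exact (cl 0)|]. intros q e Hq.
  assert (exists s, e = fun n => cl (s n)) as [s ->].
  { exists (fun n => proj1_sig (e n)). apply functional_extensionality; intros n.
    apply tm_eq; simpl. symmetry; apply (proj2_sig (e n)). }
  (* An axiom with free variables must hold under every assignment of classes of variables to them;
     this is closure of provability under renaming. *)
  apply (truth C), (Dl_prov C), prov_ren, prov_ax, Hq.
Qed.
End Der.

Theorem soundness T p (X : Type) (E : X -> X -> Prop) :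
  (forall q e, T q -> tsat E (fun _ => True) e q) -> prov T p -> forall e, tsat E (fun _ => True) e p.
Proof.
  intros HT. induction 1 as [p H| | |]; intros e; auto.
  - destruct H; simpl; try tauto.
    + intros. apply H; auto.
    + intros H1 x _. rewrite tsat_ren. exact H1.
    + intros H1. rewrite tsat_ren. specialize (H1 (e t) I).
      replace (fun n => e (inst t n)) with (sc (e t) e); auto.
      apply functional_extensionality; intros [|n]; reflexivity.
    + intros; congruence.
    + intros ? ? ? ? ? ? ->; auto.
    + intros ? ? ? ? ? ? ->; auto.
  - apply (IHprov2 e), IHprov1.
  - intros x _. apply IHprov.
Qed.

(** * Models of [KP1] and the clauses of Tarski's definition *)

Record kpm := {
  car :> Type;
  E : car -> car -> Prop;
  dft : car;
  kp_ax : forall p, KP1 p -> forall e, tsat E (fun _ => True) e p }.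
Arguments E {k}. Arguments dft {k}.

Declare Scope set_scope.
Open Scope set_scope.
Notation "x ∈ y" := (E x y) (at level 70) : set_scope.
Notation "x ∉ y" := (~ E x y) (at level 70) : set_scope.
Notation dsat D e p := (tsat E D e p).
Notation sat e p := (tsat E (fun _ => True) e p).

Definition el {S : kpm} (l : list S) (n : nat) : S := nth n l dft.

Arguments el {S} l n /.

Lemma sc_el {S : kpm} (x : S) l : sc x (el l) = el (x :: l).
Proof. apply functional_extensionality; intros [|n]; reflexivity. Qed.

Section TarskiClauses.
Context {X : Type} (E : X -> X -> Prop) (D : X -> Prop) (e : nat -> X).
Implicit Types p q : form.
Lemma s_all p : tsat E D e (all p) <-> forall x, D x -> tsat E D (sc x e) p. Proof. reflexivity. Qed.
Lemma s_imp p q : tsat E D e (imp p q) <-> (tsat E D e p -> tsat E D e q). Proof. reflexivity. Qed.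
Lemma s_neg p : tsat E D e (neg p) <-> ~ tsat E D e p. Proof. reflexivity. Qed.
Lemma s_And p q : tsat E D e (And p q) <-> tsat E D e p /\ tsat E D e q.
Proof. unfold And. simpl. tauto. Qed.
Lemma s_Or p q : tsat E D e (Or p q) <-> tsat E D e p \/ tsat E D e q.
Proof. unfold Or. simpl. tauto. Qed.
Lemma s_Iff p q : tsat E D e (Iff p q) <-> (tsat E D e p <-> tsat E D e q).
Proof. unfold Iff. rewrite s_And, !s_imp. tauto. Qed.
Lemma s_Ex p : tsat E D e (Ex p) <-> exists x, D x /\ tsat E D (sc x e) p.
Proof.
  unfold Ex. simpl. split.
  - intros H. apply NNPP; intros N. apply H. intros x Hx Hp. apply N; eauto.
  - intros (x & Hx & Hp) H. apply (H x); auto.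
Qed.
Lemma s_BAll y p : tsat E D e (BAll y p) <-> forall x, D x -> E x (e y) -> tsat E D (sc x e) p.
Proof. reflexivity. Qed.
Lemma s_BEx y p : tsat E D e (BEx y p) <-> exists x, D x /\ E x (e y) /\ tsat E D (sc x e) p.
Proof.
  unfold BEx. simpl. split.
  - intros H. apply NNPP; intros N. apply H. intros x Hx Hp Hq. apply N; eauto.
  - intros (x & Hx & Hp & Hq) H. apply (H x); auto.
Qed.
End TarskiClauses.

Lemma Delta0_ren p : Delta0 p -> forall r, Delta0 (ren r p).
Proof.
  induction 1; simpl; intros r; constructor; auto.
Qed.

(** * Uniformly Delta_0-definable predicates *)

Definition pred := forall S : kpm, (nat -> S) -> Prop.
Definition term := forall S : kpm, (nat -> S) -> S.
(** One formula has to work in all models at once: the oracle, and the sentence that T proves, are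
    fixed before completeness supplies a model. In each model the formula then gives separation,
    collection and induction for the semantic predicate [P]. *)
Definition dfn (n : nat) (P : pred) : Prop :=
  exists p, Delta0 p /\ bounded n p /\ forall S e, sat e p <-> P S e.
Definition isv (n : nat) (v : term) : Prop := exists i, i < n /\ forall S e, v S e = e i.
(** There are no function symbols, so a term is used through its graph; in [t ∈ v] a bounded
    quantifier over [v] names the value. *)
Definition dt (n : nat) (t : term) : Prop :=
  dfn (S n) (fun S e => e 0 = t S (fun i => e (Datatypes.S i))).

Section D0.
Variable n : nat.
Implicit Types P Q : pred.
Implicit Types u v w : term.

Lemma d0_ext P Q : dfn n P -> (forall S e, P S e <-> Q S e) -> dfn n Q.
Proof. intros (p & D & B & H) HQ. exists p; split; [|split]; auto. intros; rewrite H; auto. Qed.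
Lemma d0_mem u v : isv n u -> isv n v -> dfn n (fun S e => u S e ∈ v S e).
Proof.
  intros (i & Hi & Hu) (j & Hj & Hv). exists (Mem i j). repeat split; try constructor; auto; simpl;
  rewrite Hu, Hv; auto.
Qed.
Lemma d0_eq u v : isv n u -> isv n v -> dfn n (fun S e => u S e = v S e).
Proof.
  intros (i & Hi & Hu) (j & Hj & Hv). exists (Eq i j). repeat split; try constructor; auto; simpl;
  rewrite Hu, Hv; auto.
Qed.
Lemma d0_not P : dfn n P -> dfn n (fun S e => ~ P S e).
Proof. intros (p & D & B & H). exists (Neg p). split; [constructor; auto|split; auto]. intros; simpl. rewrite H; tauto. Qed.
Lemma d0_imp P Q : dfn n P -> dfn n Q -> dfn n (fun S e => P S e -> Q S e).
Proof. intros (p & D & B & H) (q & D' & B' & H'). exists (Imp p q).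
  split; [constructor; auto|split; [split; auto|]]. intros; simpl. rewrite H, H'; tauto. Qed.
Lemma d0_and P Q : dfn n P -> dfn n Q -> dfn n (fun S e => P S e /\ Q S e).
Proof. intros HP HQ. apply (d0_ext (d0_not (d0_imp HP (d0_not HQ)))). intros; tauto. Qed.
Lemma d0_or P Q : dfn n P -> dfn n Q -> dfn n (fun S e => P S e \/ Q S e).
Proof. intros HP HQ. apply (d0_ext (d0_imp (d0_not HP) HQ)). intros; tauto. Qed.
Lemma d0_iff P Q : dfn n P -> dfn n Q -> dfn n (fun S e => P S e <-> Q S e).
Proof. intros HP HQ. apply (d0_ext (d0_and (d0_imp HP HQ) (d0_imp HQ HP))). intros; tauto. Qed.
End D0.
Section D0b.
Variable n : nat.
Implicit Types P Q : pred.
Implicit Types u v w : term.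
Lemma d0_ball v (Q : forall S : kpm, S -> (nat -> S) -> Prop) : isv n v ->
  dfn (S n) (fun S e => Q S (e 0) (fun i => e (Datatypes.S i))) ->
  dfn n (fun S e => forall x, x ∈ v S e -> Q S x e).
Proof.
  intros (i & Hi & Hv) (p & D & B & H). exists (BAll i p).
  split; [constructor; auto|split; [simpl; repeat split; auto; lia|]].
  intros S e. rewrite s_BAll. rewrite Hv.
  split; intros H1 x Hx; specialize (H1 x); [specialize (H1 I Hx)|intros Hx'; specialize (H1 Hx')];
  apply (H S (sc x e)); auto.
Qed.
Lemma d0_bex v (Q : forall S : kpm, S -> (nat -> S) -> Prop) : isv n v ->
  dfn (S n) (fun S e => Q S (e 0) (fun i => e (Datatypes.S i))) ->
  dfn n (fun S e => exists x, x ∈ v S e /\ Q S x e).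
Proof.
  intros Hv HQ. apply d0_not in HQ.
  apply (@d0_ball v (fun S x e => ~ Q S x e) Hv), d0_not in HQ.
  apply (d0_ext HQ). intros S e; split.
  - intros H. apply NNPP; intros N. apply H. intros x Hx Hq. apply N; eauto.
  - intros (x & Hx & Hq) H. apply (H x); auto.
Qed.
Lemma d0_ren m P r : dfn m P -> (forall i, i < m -> r i < n) -> dfn n (fun S e => P S (fun i => e (r i))).
Proof.
  intros (p & D & B & H) Hr. exists (ren r p). split; [|split].
  - apply Delta0_ren; auto.
  - eapply bounded_ren; eauto.
  - intros S e. rewrite tsat_ren. apply H.
Qed.
Lemma d0_env m P (l : list term) : dfn m P -> Forall (isv n) l -> m <= length l ->
  dfn n (fun S e => P S (el (map (fun u => u S e) l))).
Proof.
  intros (p & D & B & H) Hl Hm.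
  assert (exists r, forall i, i < length l -> r i < n /\ forall S e, nth i l (fun S e => dft) S e = e (r i)) as [r Hr].
  { clear B Hm. induction Hl as [|u l (i & Hi & Hu) Hl [r Hr]].
    - exists (fun i => i); simpl; lia.
    - exists (fun j => match j with 0 => i | Datatypes.S j => r j end).
      intros [|j] Hj; simpl in *; [split; auto|apply Hr; lia]. }
  apply (d0_ext (P := fun S e => sat (fun i => e (r i)) p)).
  - apply (@d0_ren m (fun S e => sat e p)); [exists p; repeat split; auto|].
    intros i Hi. apply Hr; lia.
  - intros S e. rewrite <- H. apply (@tsat_ext _ _ _ p m); auto.
    intros i Hi. destruct (Hr i) as [_ H1]; [lia|]. rewrite <- H1. unfold el.
    exact (eq_sym (map_nth (fun u : term => u S e) l (fun S e => dft) i)).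
Qed.
Lemma d0_True : 0 < n -> dfn n (fun S e => True).
Proof. intros. apply (d0_ext (P := fun S e => e 0 = e 0)); [|tauto]. apply d0_eq; exists 0; auto. Qed.
Lemma d0_False : 0 < n -> dfn n (fun S e => False).
Proof. intros. apply (d0_ext (d0_not (d0_True H))); tauto. Qed.
End D0b.


(** Unlike [rel], this restricts the bounded quantifiers too. Every formula thus becomes Delta_0,
    and its truth is literally truth in the substructure with domain [z]. *)
Fixpoint relz (z : nat) (p : form) : form :=
  match p with
  | Mem _ _ | Eq _ _ => p
  | Neg p => Neg (relz z p)
  | Imp p q => Imp (relz z p) (relz z q)
  | All p => BAll z (relz (S z) p)
  end.

Lemma relz_sat {X : Type} (E : X -> X -> Prop) p : forall z e,
  tsat E (fun _ => True) e (relz z p) <-> tsat E (fun x => E x (e z)) e p.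
Proof.
  induction p; simpl; intros z e; try tauto.
  - rewrite IHp; tauto.
  - rewrite IHp1, IHp2; tauto.
  - split; intros H x; [intros Hx; specialize (H x I Hx)|intros _ Hx; specialize (H x Hx)];
    apply (IHp (S z) (sc x e)); auto.
Qed.

Lemma relz_D0 p : forall z, Delta0 (relz z p).
Proof. induction p; simpl; intros; constructor; auto. Qed.

Lemma relz_bounded p : forall n z, z < n -> bounded n p -> bounded n (relz z p).
Proof.
  induction p; simpl; intros n z Hz B; auto.
  - split; [apply IHp1|apply IHp2]; tauto.
  - split; [lia|]. apply IHp; auto; lia.
Qed.

(** The source of many Delta_0 definitions below: boundedness of codes, provability and satisfaction
    are not given by Delta_0 formulas, but their defining formulas become Delta_0 when evaluated
    inside a set. *)
Lemma d0_dsat n p (v : term) (l : list term) : isv n v -> Forall (isv n) l -> bounded (length l) p ->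
  dfn n (fun S e => dsat (fun x => x ∈ v S e) (el (map (fun u => u S e) l)) p).
Proof.
  intros Hv Hl B.
  apply (d0_ext (P := fun S e => sat (el (map (fun u => u S e) (l ++ [v]))) (relz (length l) p))).
  - apply (@d0_env n (S (length l)) (fun S e => sat e (relz (length l) p))).
    + eexists; split; [apply relz_D0|split; [|intros; reflexivity]].
      apply relz_bounded; auto. eapply bounded_mono; [|exact B]; lia.
    + apply Forall_app; auto.
    + rewrite length_app; simpl; lia.
  - intros S e. rewrite relz_sat.
    assert (Ev : el (map (fun u => u S e) (l ++ [v])) (length l) = v S e).
    { unfold el. rewrite map_app, app_nth2; rewrite length_map; auto. rewrite Nat.sub_diag; reflexivity. }
    rewrite Ev. apply (@tsat_ext _ _ _ p (length l)); auto.
    intros i Hi. unfold el. rewrite map_app, app_nth1; auto. rewrite length_map; auto.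
Qed.

Lemma d0_sat n p (l : list term) : Delta0 p -> Forall (isv n) l -> bounded (length l) p ->
  dfn n (fun S e => sat (el (map (fun u => u S e) l)) p).
Proof.
  intros D Hl B. apply (@d0_env n (length l) (fun S e => sat e p)); auto.
  exists p; repeat split; auto.
Qed.

Fixpoint bdb (n : nat) (p : form) : bool :=
  match p with
  | Mem i j | Eq i j => (i <? n) && (j <? n)
  | Neg p => bdb n p
  | Imp p q => bdb n p && bdb n q
  | All p => bdb (S n) p
  end.
Lemma bdb_ok p : forall n, bdb n p = true -> bounded n p.
Proof.
  induction p; simpl; intros n H; auto; try apply andb_prop in H as [H1 H2];
  try (split; apply Nat.ltb_lt; auto); auto.
Qed.

Lemma d0_dsat1 n p (v a : term) : isv n v -> isv n a -> bounded 1 p ->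
  dfn n (fun S e => dsat (fun x => x ∈ v S e) (el [a S e]) p).
Proof. intros; apply (@d0_dsat n p v [a]); auto. Qed.
Lemma d0_dsat2 n p (v a b : term) : isv n v -> isv n a -> isv n b -> bounded 2 p ->
  dfn n (fun S e => dsat (fun x => x ∈ v S e) (el [a S e; b S e]) p).
Proof. intros; apply (@d0_dsat n p v [a; b]); auto. Qed.
Lemma d0_dsat3 n p (v a b c : term) : isv n v -> isv n a -> isv n b -> isv n c -> bounded 3 p ->
  dfn n (fun S e => dsat (fun x => x ∈ v S e) (el [a S e; b S e; c S e]) p).
Proof. intros; apply (@d0_dsat n p v [a; b; c]); auto. Qed.
Lemma d0_sat1 n p (a : term) : Delta0 p -> isv n a -> bounded 1 p -> dfn n (fun S e => sat (el [a S e]) p).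
Proof. intros; apply (@d0_sat n p [a]); auto. Qed.
Lemma d0_sat2 n p (a b : term) : Delta0 p -> isv n a -> isv n b -> bounded 2 p -> dfn n (fun S e => sat (el [a S e; b S e]) p).
Proof. intros; apply (@d0_sat n p [a; b]); auto. Qed.

Lemma dt_var n v : isv n v -> dt n v.
Proof. intros (i & Hi & Hv). unfold dt. apply d0_eq; [exists 0; split; auto; lia|].
  exists (S i); split; [lia|]. intros; rewrite Hv; auto. Qed.
Lemma d0_eqt n v t : isv n v -> dt n t -> dfn n (fun S e => v S e = t S e).
Proof.
  intros (i & Hi & Hv) H.
  apply (@d0_ren n _ _ (fun j => match j with 0 => i | S j => j end)) in H.
  - apply (d0_ext H). intros S e; rewrite Hv; tauto.
  - intros [|j] Hj; lia.
Qed.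
Lemma d0_memt n t v : dt n t -> isv n v -> dfn n (fun S e => t S e ∈ v S e).
Proof.
  intros Ht Hv. apply (d0_ext (P := fun S e => exists x, x ∈ v S e /\ x = t S e)).
  - apply d0_bex; auto.
  - intros S e; split; [intros (x & Hx & ->); auto|eauto].
Qed.
Lemma isv_S n v : isv n v -> isv (S n) (fun S e => v S (fun i => e (Datatypes.S i))).
Proof. intros (i & Hi & H). exists (S i); split; [lia|]. intros; apply H. Qed.
Lemma dt_S n t : dt n t -> dt (S n) (fun S e => t S (fun i => e (Datatypes.S i))).
Proof.
  unfold dt; intros H.
  apply (@d0_ren (S (S n)) _ _ (fun j => match j with 0 => 0 | S j => S (S j) end)) in H; [exact H|].
  intros [|j]; lia.
Qed.

Ltac isvt := eexists; split; [|intros; reflexivity]; cbn [length]; lia.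
Ltac d0step :=
  cbv beta;
  lazymatch goal with
  | |- isv _ _ => isvt
  | |- _ < _ => lia
  | |- bounded _ _ => first [assumption | apply bdb_ok; vm_compute; reflexivity]
  | |- Delta0 _ => assumption
  | |- dfn _ _ =>
    first [ assumption
          | simple apply d0_mem; [isvt|isvt]
          | simple apply d0_eq; [isvt|isvt]
          | simple apply d0_iff | simple apply d0_and | simple apply d0_or
          | simple apply d0_not
          | simple apply d0_ball; [isvt|] | simple apply d0_bex; [isvt|]
          | simple apply d0_imp
          | simple apply d0_True | simple apply d0_False ]
  end.

(** * Elementary sets in a model *)

Section Model.
Variable S : kpm.
Implicit Types x y z a b c f : S.

Lemma ext x y : (forall z, z ∈ x <-> z ∈ y) -> x = y.
Proof.
  intros H. pose proof (@kp_ax S _ (KP_ext _) (el [])) as A. unfold extensionality in A.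
  rewrite s_all in A. specialize (A x I). rewrite s_all in A. specialize (A y I).
  rewrite s_imp in A. apply A. rewrite s_all. intros z _. rewrite s_Iff. apply H.
Qed.

Lemma sep_ex n (P : pred) : dfn (Datatypes.S n) P -> forall (e : nat -> S) X,
  exists Y, forall x, x ∈ Y <-> x ∈ X /\ P S (sc x e).
Proof.
  intros (p & D & B & H) e X.
  (* Variable 1 is the set separated from, which [p] does not mention; the parameters move up past
     it. *)
  pose (r := fun i => match i with 0 => 0 | Datatypes.S i => Datatypes.S (Datatypes.S i) end).
  assert (D' : Delta0 (ren r p)) by (apply Delta0_ren; auto).
  pose proof (@kp_ax S _ (KP_sep _ D') e) as A. unfold separation in A.
  rewrite s_all in A. specialize (A X I). rewrite s_Ex in A. destruct A as (Y & _ & A).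
  exists Y. intros x. rewrite s_all in A. specialize (A x I). rewrite s_Iff, s_And in A.
  simpl in A. rewrite A. rewrite !tsat_ren. rewrite <- H.
  rewrite (@tsat_ext _ _ _ p (Datatypes.S n) _ (sc x e)); auto; [tauto|].
  intros [|i] Hi; reflexivity.
Qed.

Lemma coll_ex n (P : pred) : dfn (2 + n) P -> forall (e : nat -> S) X,
  (forall x, x ∈ X -> exists y, P S (sc y (sc x e))) ->
  exists b, forall x, x ∈ X -> exists y, y ∈ b /\ P S (sc y (sc x e)).
Proof.
  intros (p & D & B & H) e X HX.
  (* Collection is stated for Sigma_1 formulas, so the Delta_0 matrix gets a dummy existential
     quantifier at index 0; index 3 is the set [X], skipped by the parameters. *)
  pose (r := fun i => match i with 0 => 1 | 1 => 2 | Datatypes.S (Datatypes.S i) => 4 + i end).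
  assert (Sg : Sigma1 (Ex (ren r p))).
  { exists (ren r p); split; auto using Delta0_ren. }
  pose proof (@kp_ax S _ (KP_coll _ Sg) e) as A. unfold collection in A.
  rewrite s_all in A. specialize (A X I). rewrite s_imp in A.
  rewrite s_Ex in A. destruct A as (b & _ & A).
  - rewrite s_all. intros x _. rewrite s_imp. intros Hx. simpl in Hx.
    destruct (HX x Hx) as [y Hy]. rewrite s_Ex. exists y; split; auto. rewrite s_Ex. exists y; split; auto.
    rewrite tsat_ren. apply H in Hy. revert Hy. apply (@tsat_ext _ _ _ p (2 + n)); auto.
    intros [|[|i]] Hi; reflexivity.
  - exists b. intros x Hx. rewrite s_all in A. specialize (A x I). rewrite s_imp in A. specialize (A Hx).
    rewrite s_Ex in A. destruct A as (y & _ & A). rewrite s_And in A. destruct A as (A1 & A2).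
    exists y; split; [exact A1|]. rewrite tsat_ren, s_Ex in A2. destruct A2 as (w & _ & A2).
    rewrite tsat_ren in A2. apply H. revert A2. apply (@tsat_ext _ _ _ p (2 + n)); auto.
    intros [|[|i]] Hi; reflexivity.
Qed.

Lemma ind_ex n (P : pred) : dfn (2 + n) P -> forall (e : nat -> S),
  (forall x, (forall y, y ∈ x -> exists w, P S (sc w (sc y e))) -> exists w, P S (sc w (sc x e))) ->
  forall x, exists w, P S (sc w (sc x e)).
Proof.
  intros (p & D & B & H) e Hx x.
  assert (Sg : Sigma1 (Ex p) \/ Pi1 (Ex p)) by (left; exists p; split; auto).
  pose proof (@kp_ax S _ (@KP_ind (fun p => Sigma1 p \/ Pi1 p) _ Sg) e) as A. unfold induction in A.
  rewrite s_imp, !s_all in A.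
  assert (R : forall x, sat (sc x e) (Ex p) <-> exists w, P S (sc w (sc x e))).
  { intros y. rewrite s_Ex. split; intros (w & Hw); exists w; [apply H; tauto|rewrite H; tauto]. }
  apply R. apply A; [|auto]. intros y _. rewrite s_imp, s_all. intros H1. apply R, Hx.
  intros z Hz. specialize (H1 z I). rewrite s_imp in H1. specialize (H1 Hz).
  rewrite tsat_ren in H1. apply R. revert H1.
  replace (fun n0 => sc z (sc y e) (up Datatypes.S n0)) with (sc z e); auto.
  apply functional_extensionality; intros [|i]; reflexivity.
Qed.

Definition ep (P : S -> Prop) : S := epsilon (inhabits dft) P.
Lemma ep_spec (P : S -> Prop) : (exists x, P x) -> P (ep P).
Proof. apply epsilon_spec. Qed.

Definition emp : S := ep (fun x => forall z, z ∉ x).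
Definition up2 a b : S := ep (fun x => forall z, z ∈ x <-> z = a \/ z = b).
Definition Un a : S := ep (fun x => forall z, z ∈ x <-> exists y, y ∈ a /\ z ∈ y).
Definition sing a : S := up2 a a.
Definition un a b : S := Un (up2 a b).
Definition pr a b : S := up2 (up2 a a) (up2 a b).
Definition suc a : S := un a (sing a).
Fixpoint nm (n : nat) : S := match n with 0 => emp | Datatypes.S n => suc (nm n) end.

Lemma emp_spec z : z ∉ emp.
Proof.
  revert z. apply (ep_spec (P := fun x : S => forall z, z ∉ x)). destruct (@sep_ex 0 (fun S e => e 0 <> e 0)) with (e := @el S []) (X := @dft S) as [Y HY].
  - apply d0_not, d0_eq; exists 0; split; auto.
  - exists Y. intros z Hz. apply HY in Hz. tauto.
Qed.
Lemma up2_spec a b z : z ∈ up2 a b <-> z = a \/ z = b.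
Proof.
  revert z. apply (ep_spec (P := fun x => forall z, z ∈ x <-> z = a \/ z = b)).
  pose proof (@kp_ax S _ (KP_pair _) (el [])) as A. unfold pairing in A.
  rewrite s_all in A. specialize (A a I). rewrite s_all in A. specialize (A b I).
  rewrite s_Ex in A. destruct A as (x & _ & A). exists x. intros z. rewrite s_all in A. specialize (A z I).
  rewrite s_Iff, s_Or in A. exact A.
Qed.
Lemma Un_spec a z : z ∈ Un a <-> exists y, y ∈ a /\ z ∈ y.
Proof.
  revert z. apply (ep_spec (P := fun x => forall z, z ∈ x <-> exists y, y ∈ a /\ z ∈ y)).
  pose proof (@kp_ax S _ (KP_union _) (el [])) as A. unfold union in A.
  rewrite s_all in A. specialize (A a I).
  rewrite s_Ex in A. destruct A as (x & _ & A). exists x. intros z. rewrite s_all in A. specialize (A z I).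
  rewrite s_Iff, s_Ex in A.
  split.
  - intros Hz. apply A in Hz as (y & _ & Hy). rewrite s_And in Hy. exists y; exact Hy.
  - intros (y & Hy). apply A. exists y; split; [exact I|]. rewrite s_And; exact Hy.
Qed.
Lemma sing_spec a z : z ∈ sing a <-> z = a.
Proof. unfold sing; rewrite up2_spec; tauto. Qed.
Lemma un_spec a b z : z ∈ un a b <-> z ∈ a \/ z ∈ b.
Proof.
  unfold un; rewrite Un_spec. split.
  - intros (y & Hy & Hz). apply up2_spec in Hy as [->| ->]; auto.
  - intros [H|H]; eexists; split; [|exact H| |exact H]; apply up2_spec; auto.
Qed.
Lemma suc_spec a z : z ∈ suc a <-> z ∈ a \/ z = a.
Proof. unfold suc; rewrite un_spec, sing_spec; tauto. Qed.

Lemma up2_eq a b c d : up2 a b = up2 c d -> (a = c /\ b = d) \/ (a = d /\ b = c).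
Proof.
  intros H. assert (A : forall z, z = a \/ z = b <-> z = c \/ z = d).
  { intros z. rewrite <- !up2_spec, H; tauto. }
  pose proof (proj1 (A a) (or_introl eq_refl)). pose proof (proj1 (A b) (or_intror eq_refl)).
  pose proof (proj2 (A c) (or_introl eq_refl)). pose proof (proj2 (A d) (or_intror eq_refl)).
  intuition congruence.
Qed.
Lemma pr_inj a b c d : pr a b = pr c d -> a = c /\ b = d.
Proof.
  intros H. apply up2_eq in H as [[H1 H2]|[H1 H2]]; apply up2_eq in H1, H2; intuition congruence.
Qed.
Lemma pr_eq a b c d : pr a b = pr c d <-> a = c /\ b = d.
Proof. split; [apply pr_inj|intros [-> ->]; auto]. Qed.


Definition trans x := forall y, y ∈ x -> forall z, z ∈ y -> z ∈ x.
End Model.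

Arguments emp {S}. Arguments nm {S}.

Lemma d0_isup : dfn 3 (fun S e => e 0 = up2 (e 1) (e 2)).
Proof.
  apply (d0_ext (P := fun S e => e 1 ∈ e 0 /\ e 2 ∈ e 0 /\ forall x, x ∈ e 0 -> x = e 1 \/ x = e 2)).
  - repeat d0step.
  - intros S e. split.
    + intros (H1 & H2 & H3). apply ext. intros z. rewrite up2_spec. split; auto. intros [->| ->]; auto.
    + intros ->. rewrite !up2_spec. repeat split; auto. intros z; rewrite up2_spec; auto.
Qed.

Lemma dt_up2 n s t : dt n s -> dt n t -> dt n (fun S e => up2 (s S e) (t S e)).
Proof.
  intros Hs Ht. unfold dt.
  apply (d0_ext (P := fun S e => exists a, a ∈ e 0 /\ a = s S (fun i => e (Datatypes.S i)) /\
     exists b, b ∈ e 0 /\ b = t S (fun i => e (Datatypes.S i)) /\ e 0 = up2 a b)).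
  - apply d0_bex; [isvt|]. apply d0_and.
    + apply (d0_eqt (v := fun S e => e 0) (t := fun S e => s S (fun i => e (2 + i)))); [isvt|exact (dt_S (dt_S Hs))].
    + apply d0_bex; [isvt|]. apply d0_and.
      * apply (d0_eqt (v := fun S e => e 0) (t := fun S e => t S (fun i => e (3 + i)))); [isvt|exact (dt_S (dt_S (dt_S Ht)))].
      * assert (H := @d0_ren (3 + n) 3 _ (fun i => match i with 0 => 2 | 1 => 1 | _ => 0 end) d0_isup).
        apply H. intros [|[|i]] Hi; lia.
  - intros S e; split.
    + intros (a & Ha & -> & b & Hb & -> & H); auto.
    + intros ->. exists (s S (fun i => e (Datatypes.S i))). rewrite up2_spec. repeat split; auto.
      exists (t S (fun i => e (Datatypes.S i))). rewrite up2_spec. repeat split; auto.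
Qed.
Lemma dt_pr n s t : dt n s -> dt n t -> dt n (fun S e => pr (s S e) (t S e)).
Proof. intros; apply dt_up2; apply dt_up2; auto. Qed.
Lemma dt_sing n s : dt n s -> dt n (fun S e => sing (s S e)).
Proof. intros; apply dt_up2; auto. Qed.

Lemma dt_emp n : dt n (fun S e => emp).
Proof.
  unfold dt. apply (d0_ext (P := fun S e => forall x, x ∈ e 0 -> False)).
  - apply d0_ball; [isvt|]. apply d0_False; lia.
  - intros S e; split.
    + intros H; apply ext; intros z; split; [intros Hz; destruct (H z Hz)|intros Hz; destruct (emp_spec Hz)].
    + intros -> x Hx; exact (emp_spec Hx).
Qed.

(** A bounded description of the composition must reach the inner value from the outer one; the
    second hypothesis says that the inner value is a member of [g S a] or a member of a member. *)
Lemma dt_comp1 (n : nat) (g : forall S : kpm, S -> S) (t : term) :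
  dfn 2 (fun S e => e 0 = g S (e 1)) ->
  (forall (S : kpm) (a : S), exists z, z ∈ g S a /\ (a ∈ z \/ a = z)) ->
  dt n t -> dt n (fun S e => g S (t S e)).
Proof.
  intros Hg Hb Ht. unfold dt.
  apply (d0_ext (P := fun S e => exists z, z ∈ e 0 /\ 
     ((exists a, a ∈ z /\ a = t S (fun i => e (Datatypes.S i)) /\ e 0 = g S a) \/
     (z = t S (fun i => e (Datatypes.S i)) /\ e 0 = g S z)))).
  - apply d0_bex; [isvt|]. apply d0_or; [apply d0_bex; [isvt|]|]; apply d0_and.
    + apply (d0_eqt (v := fun S e => e 0) (t := fun S e => t S (fun i => e (3 + i)))); [isvt|exact (dt_S (dt_S (dt_S Ht)))].
    + apply (@d0_ren _ 2 _ (fun i => match i with 0 => 2 | _ => 0 end) Hg). intros [|i]; lia.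
    + apply (d0_eqt (v := fun S e => e 0) (t := fun S e => t S (fun i => e (2 + i)))); [isvt|exact (dt_S (dt_S Ht))].
    + apply (@d0_ren _ 2 _ (fun i => match i with 0 => 1 | _ => 0 end) Hg). intros [|i]; lia.
  - intros S e; split.
    + intros (z & Hz & [(a & _ & -> & H)|[-> H]]); auto.
    + intros H. destruct (Hb S (t S (fun i => e (Datatypes.S i)))) as (z & Hz & [H1|<-]).
      * exists z. rewrite H. split; auto. left; eauto.
      * exists (t S (fun i => e (Datatypes.S i))). split; [rewrite H; auto|]. auto.
Qed.

Lemma dt_suc n s : dt n s -> dt n (fun S e => suc (s S e)).
Proof.
  apply (dt_comp1 (g := fun S => @suc S)).
  - apply (d0_ext (P := fun S e => e 1 ∈ e 0 /\ (forall x, x ∈ e 1 -> x ∈ e 0) /\ forall x, x ∈ e 0 -> x ∈ e 1 \/ x = e 1)).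
    + repeat d0step.
    + intros S e; split.
      * intros (H1 & H2 & H3). apply ext; intros z; rewrite suc_spec. split; auto. intros [H| ->]; auto.
      * intros ->. repeat split; intros; rewrite suc_spec in *; auto.
  - intros S a. exists a. rewrite suc_spec; auto.
Qed.
Lemma dt_nm n k : dt n (fun S e => nm k).
Proof. induction k; simpl; [apply dt_emp|apply (dt_suc IHk)]. Qed.

Fixpoint cd {S : kpm} (p : form) : S :=
  match p with
  | Mem i j => pr (nm 0) (pr (nm i) (nm j))
  | Eq i j => pr (nm 1) (pr (nm i) (nm j))
  | Neg p => pr (nm 2) (cd p)
  | Imp p q => pr (nm 3) (pr (cd p) (cd q))
  | All p => pr (nm 4) (cd p)
  end.
Lemma dt_cd n p : dt n (fun S e => cd p).
Proof. induction p; cbn [cd]; repeat (apply dt_pr || apply dt_nm || assumption). Qed.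

(** [dth] and [d0h] are hooks, redefined each time further terms and predicates have been shown
    definable. *)
Ltac dth := fail.
Ltac dtt := cbv beta;
  first [ simple apply dt_pr; dtt | simple apply dt_up2; dtt | simple apply dt_sing; dtt | simple apply dt_suc; dtt
        | simple apply dt_nm | simple apply dt_emp | simple apply dt_cd
        | dth | simple apply dt_var; isvt ].
Ltac d0h := fail.
Ltac d0t :=
  cbv beta;
  lazymatch goal with
  | |- isv _ _ => isvt
  | |- _ < _ => cbn [length]; lia
  | |- bounded _ _ => first [assumption | apply bdb_ok; vm_compute; reflexivity]
  | |- Delta0 _ => assumption
  | |- dfn _ _ =>
    first [ assumption
          | simple apply d0_mem; [isvt|isvt]
          | simple apply d0_eq; [isvt|isvt]
          | simple apply d0_eqt; [isvt|dtt]
          | simple apply d0_memt; [dtt|isvt]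
          | d0h
          | simple apply d0_iff; d0t | simple apply d0_and; d0t | simple apply d0_or; d0t
          | simple apply d0_not; d0t
          | simple apply d0_ball; [isvt|d0t] | simple apply d0_bex; [isvt|d0t]
          | simple apply d0_imp; d0t
          | simple apply d0_dsat1; d0t | simple apply d0_dsat2; d0t | simple apply d0_dsat3; d0t
          | simple apply d0_sat1; d0t | simple apply d0_sat2; d0t
          | simple apply d0_True; cbn [length]; lia | simple apply d0_False; cbn [length]; lia
          | idtac ]
  end.

Section Pairs.
Variable n : nat.

(** Both components of a pair are members of its members, so quantifying over them is bounded. *)
Lemma d0_expr (v : term) (Q : forall S : kpm, S -> S -> (nat -> S) -> Prop) : isv n v ->
  dfn (2 + n) (fun S e => Q S (e 1) (e 0) (fun i => e (Datatypes.S (Datatypes.S i)))) ->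
  dfn n (fun S e => exists a b, v S e = pr a b /\ Q S a b e).
Proof.
  intros Hv HQ. apply (d0_ext (P := fun S e => exists u, u ∈ v S e /\ exists a, a ∈ u /\ exists w, w ∈ v S e /\
    exists b, b ∈ w /\ v S e = pr a b /\ Q S a b e)).
  - apply d0_bex; [exact Hv|]. apply d0_bex; [isvt|].
    assert (H2 : isv (2 + n) (fun S e => v S (fun i => e (2 + i)))) by exact (isv_S (isv_S Hv)).
    assert (H4 : isv (4 + n) (fun S e => v S (fun i => e (4 + i)))) by exact (isv_S (isv_S (isv_S (isv_S Hv)))).
    apply d0_bex; [exact H2|]. apply d0_bex; [isvt|]. apply d0_and.
    + apply d0_eqt; [exact H4|]. dtt.
    + cbv beta. apply (@d0_ren _ (2 + n) _ (fun i => match i with 0 => 0 | 1 => 2 | S (S i) => 4 + i end) HQ).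
      intros [|[|i]]; lia.
  - intros S e; split.
    + intros (u & _ & a & _ & w & _ & b & _ & H); eauto.
    + intros (a & b & H & H1). exists (up2 a a). rewrite H. split; [apply up2_spec; auto|].
      exists a. split; [apply up2_spec; auto|]. exists (up2 a b). split; [apply up2_spec; auto|].
      exists b. split; [apply up2_spec; auto|auto].
Qed.

Lemma d0_exval (v t : term) (Q : forall S : kpm, S -> (nat -> S) -> Prop) : isv n v -> dt n t ->
  dfn (1 + n) (fun S e => Q S (e 0) (fun i => e (Datatypes.S i))) ->
  dfn n (fun S e => exists b, pr (t S e) b ∈ v S e /\ Q S b e).
Proof.
  intros Hv Ht HQ. apply (d0_ext (P := fun S e => exists q, q ∈ v S e /\ exists w, w ∈ q /\ exists b, b ∈ w /\
     q = pr (t S e) b /\ Q S b e)).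
  - apply d0_bex; [exact Hv|]. apply d0_bex; [isvt|]. apply d0_bex; [isvt|].
    assert (H3 : dt (3 + n) (fun S e => t S (fun i => e (3 + i)))) by exact (dt_S (dt_S (dt_S Ht))).
    apply d0_and.
    + apply d0_eqt; [isvt|]. apply dt_pr; [exact H3|dtt].
    + cbv beta. apply (@d0_ren _ (1 + n) _ (fun i => match i with 0 => 0 | S i => 3 + i end) HQ).
      intros [|i]; lia.
  - intros S e; split.
    + intros (q & H & w & _ & b & _ & -> & H1); eauto.
    + intros (b & H & H1). exists (pr (t S e) b). split; auto. exists (up2 (t S e) b).
      split; [apply up2_spec; auto|]. exists b. split; [apply up2_spec; auto|auto].
Qed.

Lemma d0_exmem (v : term) (Q : forall S : kpm, S -> S -> (nat -> S) -> Prop) : isv n v ->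
  dfn (2 + n) (fun S e => Q S (e 1) (e 0) (fun i => e (Datatypes.S (Datatypes.S i)))) ->
  dfn n (fun S e => exists a b, pr a b ∈ v S e /\ Q S a b e).
Proof.
  intros Hv HQ. apply (d0_ext (P := fun S e => exists q, q ∈ v S e /\ exists u, u ∈ q /\ exists a, a ∈ u /\
     exists b, pr a b ∈ v S e /\ Q S a b e)).
  - apply d0_bex; [exact Hv|]. apply d0_bex; [isvt|]. apply d0_bex; [isvt|].
    assert (H3 : isv (3 + n) (fun S e => v S (fun i => e (3 + i)))) by exact (isv_S (isv_S (isv_S Hv))).
    cbv beta.
    assert (HQ' : dfn (4 + n) (fun S e => Q S (e 1) (e 0) (fun i => e (4 + i)))).
    { apply (@d0_ren _ (2 + n) _ (fun i => match i with 0 => 0 | 1 => 1 | S (S i) => 4 + i end) HQ).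
      intros [|[|i]]; lia. }
    revert H3 HQ'. clear. intros H3 HQ'.
    unfold dt in *. 
    apply (d0_ext (P := fun S e => exists q, q ∈ v S (fun i => e (3 + i)) /\ exists w, w ∈ q /\ exists b, b ∈ w /\
     q = pr (e 0) b /\ Q S (e 0) b (fun i => e (3 + i)))).
    + apply d0_bex; [exact H3|]. apply d0_bex; [isvt|]. apply d0_bex; [isvt|]. apply d0_and; [d0t|]. cbv beta.
      apply (@d0_ren _ (4 + n) _ (fun i => match i with 0 => 0 | 1 => 3 | S (S i) => 4 + i end) HQ').
      intros [|[|i]]; lia.
    + intros S e; split.
      * intros (q & H & w & _ & b & _ & -> & H1); eauto.
      * intros (b & H & H1). exists (pr (e 0) b). split; auto. exists (up2 (e 0) b).
        split; [apply up2_spec; auto|]. exists b. split; [apply up2_spec; auto|auto].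
  - intros S e; split.
    + intros (q & H & w & _ & a & _ & b & H1); eauto.
    + intros (a & b & H & H1). exists (pr a b). split; auto. exists (up2 a b).
      split; [apply up2_spec; auto|]. exists a. split; [apply up2_spec; auto|eauto].
Qed.

Lemma d0_allval (v t : term) (Q : forall S : kpm, S -> (nat -> S) -> Prop) : isv n v -> dt n t ->
  dfn (1 + n) (fun S e => Q S (e 0) (fun i => e (Datatypes.S i))) ->
  dfn n (fun S e => forall b, pr (t S e) b ∈ v S e -> Q S b e).
Proof.
  intros Hv Ht HQ. apply d0_not in HQ.
  pose proof (d0_not (@d0_exval v t (fun S b e => ~ Q S b e) Hv Ht HQ)) as H. apply (d0_ext H).
  intros S e; split.
  - intros N b Hb. apply NNPP; intros N1; apply N; eauto.
  - intros H1 (b & Hb & N). auto.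
Qed.

Lemma d0_allmem (v : term) (Q : forall S : kpm, S -> S -> (nat -> S) -> Prop) : isv n v ->
  dfn (2 + n) (fun S e => Q S (e 1) (e 0) (fun i => e (Datatypes.S (Datatypes.S i)))) ->
  dfn n (fun S e => forall a b, pr a b ∈ v S e -> Q S a b e).
Proof.
  intros Hv HQ. apply d0_not in HQ.
  pose proof (d0_not (@d0_exmem v (fun S a b e => ~ Q S a b e) Hv HQ)) as H. apply (d0_ext H).
  intros S e; split.
  - intros N a b Hb. apply NNPP; intros N1; apply N; eauto.
  - intros H1 (a & b & Hb & N). exact (N (H1 a b Hb)).
Qed.

Lemma d0_allpr (v : term) (Q : forall S : kpm, S -> S -> (nat -> S) -> Prop) : isv n v ->
  dfn (2 + n) (fun S e => Q S (e 1) (e 0) (fun i => e (Datatypes.S (Datatypes.S i)))) ->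
  dfn n (fun S e => forall a b, v S e = pr a b -> Q S a b e).
Proof.
  intros Hv HQ. apply d0_not in HQ.
  pose proof (d0_not (@d0_expr v (fun S a b e => ~ Q S a b e) Hv HQ)) as H. apply (d0_ext H).
  intros S e; split.
  - intros N a b Hb. apply NNPP; intros N1; apply N; eauto.
  - intros H1 (a & b & Hb & N). exact (N (H1 a b Hb)).
Qed.
End Pairs.

(** A Delta_0 description, which nonstandard elements of an ill-founded model may satisfy too. The
    same then happens with codes, so facts about arbitrary codes are proved by induction inside the
    model. *)
Definition Nat {S : kpm} (n : S) : Prop :=
  trans n /\ (forall y, y ∈ n -> trans y) /\ (n = emp \/ exists k, n = suc k) /\
  forall m, m ∈ n -> m = emp \/ exists k, m = suc k.

Lemma d0_Nat n v : isv n v -> dfn n (fun S e => Nat (v S e)).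
Proof.
  intros (i & Hi & Hv).
  apply (d0_ext (P := fun S e => (forall y, y ∈ e i -> forall z, z ∈ y -> z ∈ e i) /\
   (forall y, y ∈ e i -> forall z, z ∈ y -> forall w, w ∈ z -> w ∈ y) /\
   (e i = emp \/ exists k, k ∈ e i /\ e i = suc k) /\ forall m, m ∈ e i -> m = emp \/ exists k, k ∈ m /\ m = suc k)).
  - d0t.
  - intros S e. rewrite Hv. unfold Nat, trans.
    assert (A : forall m : S, (m = emp \/ (exists k, k ∈ m /\ m = suc k)) <-> (m = emp \/ exists k, m = suc k)).
    { intros m; split; intros [H|(k & H)]; auto; right; exists k; [apply H|split; auto].
      rewrite H, suc_spec; auto. }
    rewrite A. split; intros (H1 & H2 & H3 & H4); repeat split; auto; intros m Hm; apply A, H4, Hm.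
Qed.
Ltac d0h ::= first [ simple apply d0_expr; [isvt|d0t] | simple apply d0_exval; [isvt|dtt|d0t]
  | simple apply d0_exmem; [isvt|d0t] | simple apply d0_allval; [isvt|dtt|d0t] | simple apply d0_allmem; [isvt|d0t]
  | simple apply d0_allpr; [isvt|d0t] | simple apply d0_Nat; isvt ].

Lemma un_graph : dfn 3 (fun S e => e 0 = un (e 1) (e 2)).
Proof.
  apply (d0_ext (P := fun S e => (forall x, x ∈ e 1 -> x ∈ e 0) /\ (forall x, x ∈ e 2 -> x ∈ e 0) /\
     forall x, x ∈ e 0 -> x ∈ e 1 \/ x ∈ e 2)); [d0t|].
  intros S e; split.
  - intros (H1 & H2 & H3). apply ext; intros z; rewrite un_spec; intuition auto.
  - intros ->. repeat split; intros x; rewrite un_spec; auto.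
Qed.
Lemma dt_un n u v : isv n u -> isv n v -> dt n (fun S e => un (u S e) (v S e)).
Proof.
  intros (i & Hi & Hu) (j & Hj & Hv). unfold dt.
  pose proof (@d0_ren (S n) 3 _ (fun k => match k with 0 => 0 | 1 => S i | _ => S j end) un_graph) as H.
  refine (d0_ext (H _) _); [intros [|[|k]]; lia|]. intros S e; rewrite Hu, Hv; simpl; tauto.
Qed.

Section Model.
Variable S : kpm.

Lemma ind0 (P : pred) (l : list S) : dfn (1 + length l) P ->
  (forall x, (forall y, y ∈ x -> P S (el (y :: l))) -> P S (el (x :: l))) -> forall x, P S (el (x :: l)).
Proof.
  intros HP H x.
  destruct (@ind_ex S (length l) (fun S e => P S (fun i => e (Datatypes.S i)))) with (e := el l) (x := x) as [w Hw].
  - apply (@d0_ren _ (1 + length l) P); auto. lia.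
  (* The existential quantifier of Sigma_1 induction is vacuous here. *)
  - intros y Hy. exists y. change (P S (sc y (el l))). rewrite sc_el. apply H. intros z Hz.
    destruct (Hy z Hz) as [w Hw]. change (P S (sc z (el l))) in Hw. rewrite sc_el in Hw. exact Hw.
  - change (P S (sc x (el l))) in Hw. rewrite sc_el in Hw. exact Hw.
Qed.

(** Four steps of membership lead from the code of an implication, [pr (nm 3) (pr a b)], down to its
    two parts; the immediate subformulas of a negation or a quantification are nearer. *)
Definition deep (y x : S) := y ∈ x \/ (exists a, a ∈ x /\ (y ∈ a \/ exists b, b ∈ a /\ (y ∈ b \/ exists c, c ∈ b /\ y ∈ c))).

(** Ordinary induction, applied to the statement for [x] together with three generations of its
    members; assumed for the members of [x], it covers everything up to four steps below [x]. *)
Lemma ind4 (P : pred) (l : list S) : dfn (1 + length l) P ->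
  (forall x, (forall y, deep y x -> P S (el (y :: l))) -> P S (el (x :: l))) -> forall x, P S (el (x :: l)).
Proof.
  intros HP H x.
  assert (A : P S (el (x :: l)) /\ forall a, a ∈ x -> P S (el (a :: l)) /\ forall b, b ∈ a -> P S (el (b :: l)) /\
     forall c, c ∈ b -> P S (el (c :: l))); [|exact (proj1 A)].
  revert x. apply (@ind0 (fun S e => let R (x : S) := P S (sc x (fun i => e (Datatypes.S i))) in 
    R (e 0) /\ forall a, a ∈ e 0 -> R a /\ forall b, b ∈ a -> R b /\ forall c, c ∈ b -> R c) l).
  - cbv beta zeta.
    apply d0_and.
    + apply (@d0_ren (1 + length l) (1 + length l) P (fun i => i)) in HP; [|lia].
      apply (d0_ext HP). intros S' e. rewrite sc_eta. tauto.
    + apply d0_ball; [isvt|]. apply d0_and.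
      * apply (@d0_ren (2 + length l) (1 + length l) P (fun i => match i with 0 => 0 | Datatypes.S i => 2 + i end)) in HP; [|intros [|i]; lia].
        apply (d0_ext HP). intros S' e. 
        replace (sc (e 0) (fun i => e (Datatypes.S (Datatypes.S i)))) with (fun i => e match i with 0 => 0 | Datatypes.S i => 2 + i end); [tauto|].
        apply functional_extensionality; intros [|i]; reflexivity.
      * apply d0_ball; [isvt|]. apply d0_and.
        -- apply (@d0_ren (3 + length l) (1 + length l) P (fun i => match i with 0 => 0 | Datatypes.S i => 3 + i end)) in HP; [|intros [|i]; lia].
           apply (d0_ext HP). intros S' e. 
           replace (sc (e 0) _) with (fun i => e match i with 0 => 0 | Datatypes.S i => 3 + i end); [tauto|].
           apply functional_extensionality; intros [|i]; reflexivity.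
        -- apply d0_ball; [isvt|].
           apply (@d0_ren (4 + length l) (1 + length l) P (fun i => match i with 0 => 0 | Datatypes.S i => 4 + i end)) in HP; [|intros [|i]; lia].
           apply (d0_ext HP). intros S' e. 
           replace (sc (e 0) _) with (fun i => e match i with 0 => 0 | Datatypes.S i => 4 + i end); [tauto|].
           apply functional_extensionality; intros [|i]; reflexivity.
  - cbv beta zeta. intros x IH.
    assert (Q : forall a, P S (sc a (fun i => el (x :: l) (Datatypes.S i))) <-> P S (el (a :: l))).
    { intros a. change (fun i => el (x :: l) (Datatypes.S i)) with (el l). rewrite sc_el; tauto. }
    assert (IH' : forall y, y ∈ x -> P S (el (y :: l)) /\ forall a, a ∈ y -> P S (el (a :: l)) /\
     forall b, b ∈ a -> P S (el (b :: l)) /\ forall c, c ∈ b -> P S (el (c :: l))).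
    { intros y Hy. specialize (IH y Hy).
      change (fun i => el (y :: l) (Datatypes.S i)) with (el l) in IH. rewrite sc_el in IH.
      destruct IH as [H1 H2]. split; [exact H1|]. intros a Ha. destruct (H2 a Ha) as [H3 H4].
      rewrite sc_el in H3. split; [exact H3|]. intros b Hb. destruct (H4 b Hb) as [H5 H6]. rewrite sc_el in H5.
      split; [exact H5|]. intros c Hc. specialize (H6 c Hc). rewrite sc_el in H6; exact H6. }
    clear IH. split.
    + rewrite Q. apply H. intros y [Hy|(a & Ha & [Hy|(b & Hb & [Hy|(c & Hc & Hy)])])].
      * apply IH', Hy.
      * destruct (IH' a Ha) as [_ H2]. apply H2, Hy.
      * destruct (IH' a Ha) as [_ H2]. destruct (H2 b Hb) as [_ H3]. apply H3, Hy.
      * destruct (IH' a Ha) as [_ H2]. destruct (H2 b Hb) as [_ H3]. destruct (H3 c Hc) as [_ H4]. apply H4, Hy.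
    + intros a Ha. rewrite Q. destruct (IH' a Ha) as [H1 H2]. split; auto. intros b Hb.
      rewrite Q. destruct (H2 b Hb) as [H3 H4]. split; auto. intros c Hc. rewrite Q. apply H4, Hc.
Qed.

Lemma irrefl (x : S) : x ∉ x.
Proof.
  revert x. apply (@ind0 (fun S e => ~ e 0 ∈ e 0) []); [d0t|].
  intros x H Hx. exact (H x Hx Hx).
Qed.
Lemma asym (x y : S) : x ∈ y -> y ∈ x -> False.
Proof.
  assert (A : forall x y : S, y ∈ x -> x ∉ y); [|intros H1 H2; exact (A x y H2 H1)].
  apply (@ind0 (fun S e => forall y, y ∈ e 0 -> ~ e 0 ∈ y) []); [d0t|].
  simpl. intros x' H y' Hy Hx. exact (H y' Hy x' Hx Hy).
Qed.
Lemma suc_inj (x y : S) : suc x = suc y -> x = y.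
Proof.
  intros H. assert (H1 : x ∈ suc y) by (rewrite <- H, suc_spec; auto).
  assert (H2 : y ∈ suc x) by (rewrite H, suc_spec; auto).
  apply suc_spec in H1 as [H1|H1], H2 as [H2|H2]; auto. exfalso; exact (asym H1 H2).
Qed.
Lemma suc_emp (x : S) : suc x <> emp.
Proof. intros H. apply (@emp_spec S x). rewrite <- H, suc_spec; auto. Qed.
Lemma in_suc (x : S) : x ∈ suc x. Proof. apply suc_spec; auto. Qed.

Lemma N_emp : Nat (@emp S).
Proof. repeat split; auto; intros y Hy; destruct (emp_spec Hy). Qed.
Lemma N_mem (n m : S) : Nat n -> m ∈ n -> Nat m.
Proof.
  intros (H1 & H2 & H3 & H4) Hm. repeat split; auto.
  - intros y Hy. apply H2, (H1 m); auto.
  - intros k Hk. apply H4, (H1 m); auto.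
Qed.
Lemma N_suc (n : S) : Nat n -> Nat (suc n).
Proof.
  intros (H1 & H2 & H3 & H4). repeat split.
  - intros y Hy z Hz. apply suc_spec in Hy as [Hy| ->]; apply suc_spec; left; auto. apply (H1 y); auto.
  - intros y Hy. apply suc_spec in Hy as [Hy| ->]; auto.
  - right; eauto.
  - intros m Hm. apply suc_spec in Hm as [Hm| ->]; auto.
Qed.
Lemma N_pred (n : S) : Nat (suc n) -> Nat n.
Proof. intros H; apply (N_mem H), in_suc. Qed.
Lemma N_case (n : S) : Nat n -> n = emp \/ exists k, Nat k /\ n = suc k.
Proof.
  intros H. destruct (H) as (_ & _ & [H1|[k H1]] & _); auto. right. exists k; split; auto.
  apply N_pred; rewrite <- H1; auto.
Qed.
Lemma N_ind (P : pred) (l : list S) : dfn (1 + length l) P ->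
  P S (el (emp :: l)) -> (forall k, Nat k -> P S (el (k :: l)) -> P S (el (suc k :: l))) ->
  forall n, Nat n -> P S (el (n :: l)).
Proof.
  intros HP H0 HS. apply (@ind0 (fun S e => Nat (e 0) -> P S e) l).
  - apply d0_imp; [d0t|auto].
  - simpl. intros x IH Hx. destruct (N_case Hx) as [->|(k & Hk & ->)]; auto.
    apply HS; auto. apply IH; auto. apply in_suc.
Qed.
Lemma nm_Nat i : Nat (@nm S i).
Proof. induction i; [apply N_emp|apply N_suc; auto]. Qed.

Lemma emp_in_N (n : S) : Nat n -> n = emp \/ emp ∈ n.
Proof.
  apply (@N_ind (fun S e => e 0 = emp \/ emp ∈ e 0) []); [d0t|left; auto|].
  simpl. intros k _ [->|H]; right; apply suc_spec; auto.
Qed.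
Lemma suc_in_N (n m : S) : Nat n -> m ∈ n -> suc m = n \/ suc m ∈ n.
Proof.
  revert m. intros m Hn. revert m.
  assert (forall m, m ∈ n -> suc m = n \/ suc m ∈ n); auto. revert n Hn.
  apply (@N_ind (fun S e => forall m, m ∈ e 0 -> suc m = e 0 \/ suc m ∈ e 0) []).
  - apply (d0_ext (P := fun S e => forall m, m ∈ e 0 -> e 0 = suc m \/ suc m ∈ e 0)); [d0t|].
    intros S' e. split; intros H m Hm; destruct (H m Hm); auto.
  - intros m Hm; destruct (emp_spec Hm).
  - simpl. intros k _ H m Hm. apply suc_spec in Hm as [Hm| ->]; auto.
    destruct (H m Hm) as [<-|H1]; right; apply suc_spec; auto.
Qed.
Lemma N_tri (n m : S) : Nat n -> Nat m -> n ∈ m \/ n = m \/ m ∈ n.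
Proof.
  (* The set [a] only bounds the quantifier over [m], which makes the induction formula Delta_0. *)
  intros Hn. revert m. assert (forall a, forall m, m ∈ a -> Nat m -> n ∈ m \/ n = m \/ m ∈ n).
  - intros a. revert n Hn.
    apply (@N_ind (fun S e => forall m, m ∈ e 1 -> Nat m -> e 0 ∈ m \/ e 0 = m \/ m ∈ e 0) [a]); [d0t| |]; simpl.
    + intros m _ Hm. destruct (emp_in_N Hm); auto.
    + intros k Hk IH m Ha Hm. destruct (IH m Ha Hm) as [H|[->|H]].
      * destruct (suc_in_N Hm H); auto.
      * right; right; apply in_suc.
      * right; right; apply suc_spec; auto.
  - intros m Hm. apply (H (suc m)); auto. apply in_suc.
Qed.
Lemma in_N_suc (n m : S) : Nat n -> m ∈ n -> suc m ∈ suc n.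
Proof. intros Hn Hm. apply suc_spec. destruct (suc_in_N Hn Hm); auto. Qed.
Lemma suc_in_suc (n m : S) : Nat n -> suc m ∈ suc n -> m ∈ n.
Proof.
  intros Hn H. apply suc_spec in H as [H|<-]; [|apply in_suc].
  destruct Hn as (H1 & _). apply (H1 _ H), in_suc.
Qed.

Lemma om_ex : exists w : S, forall n, n ∈ w <-> Nat n.
Proof.
  pose proof (@kp_ax S _ (KP_inf _) (el [])) as A. unfold infinity in A.
  rewrite s_Ex in A. destruct A as (i & _ & A). rewrite s_And in A. destruct A as [A1 A2].
  rewrite s_Ex in A1. destruct A1 as (o & _ & A1). rewrite s_And in A1. destruct A1 as [A0 A1].
  assert (Ho : o = emp).
  { apply ext. intros z; split; intros Hz; [|destruct (emp_spec Hz)]. rewrite s_all in A1.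
    specialize (A1 z I). destruct (A1 Hz). }
  subst o. rewrite s_all in A2.
  assert (H : forall n, Nat n -> n ∈ i).
  { apply (@N_ind (fun S e => e 0 ∈ e 1) [i]); [d0t|exact A0|].
    simpl. intros k _ Hk. specialize (A2 k I). rewrite s_imp in A2. specialize (A2 Hk).
    rewrite s_Ex in A2. destruct A2 as (y & _ & A2). rewrite s_And in A2. destruct A2 as [A2 A3].
    replace (suc k) with y; auto. apply ext. intros z. rewrite suc_spec. rewrite s_all in A3.
    specialize (A3 z I). rewrite s_Iff, s_Or in A3. exact A3. }
  destruct (@sep_ex S 0 (fun S e => Nat (e 0))) with (e := @el S []) (X := i) as [w Hw]; [d0t|].
  exists w. intros n. rewrite Hw. simpl. split; [tauto|auto].
Qed.
Definition om : S := ep (fun w => forall n, n ∈ w <-> Nat n).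
Lemma om_spec (n : S) : n ∈ om <-> Nat n.
Proof. revert n. apply (ep_spec (P := fun w : S => forall n, n ∈ w <-> Nat n)), om_ex. Qed.

(** Holds of the whole model and of its admissible levels, so that witnesses can be constructed in either. *)
Record isU (U : S -> Prop) : Prop := {
  U_tr : forall x y, U x -> y ∈ x -> U y;
  U_up2 : forall x y, U x -> U y -> U (up2 x y);
  U_Un : forall x, U x -> U (Un x);
  U_om : U om;
  U_sep : forall (P : pred) (l : list S) X, dfn (1 + length l) P -> Forall U l -> U X ->
    exists Y, U Y /\ forall x, x ∈ Y <-> x ∈ X /\ P S (el (x :: l));
  U_coll : forall (P : pred) (l : list S) X, dfn (2 + length l) P -> Forall U l -> U X ->
    (forall x, x ∈ X -> exists y, U y /\ P S (el (y :: x :: l))) ->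
    exists b, U b /\ forall x, x ∈ X -> exists y, y ∈ b /\ P S (el (y :: x :: l));
  U_ind : forall (P : pred) (l : list S), dfn (2 + length l) P ->
    (forall x, (forall y, y ∈ x -> exists w, U w /\ P S (el (w :: y :: l))) ->
       exists w, U w /\ P S (el (w :: x :: l))) ->
    forall x, exists w, U w /\ P S (el (w :: x :: l)) }.

Lemma isU_True : isU (fun _ : S => True).
Proof.
  constructor; auto.
  - intros P l X HP _ _. destruct (sep_ex HP (el l) X) as [Y HY]. exists Y; split; [exact I|exact HY].
  - intros P l X HP _ _ H. destruct (@coll_ex S _ _ HP (el l) X) as [b Hb].
    + intros x Hx. destruct (H x Hx) as (y & _ & Hy). exists y. exact Hy.
    + exists b; split; [exact I|exact Hb].
  - intros P l HP H x. destruct (@ind_ex S _ _ HP (el l)) with (x := x) as [w Hw].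
    + intros y Hy. destruct (H y) as (w & _ & Hw).
      * intros z Hz. destruct (Hy z Hz) as [w Hw]. exists w; split; [exact I|exact Hw].
      * exists w; exact Hw.
    + exists w; split; [exact I|exact Hw].
Qed.
End Model.
Arguments om {S}.

Lemma d0_perm n m P Q (r : nat -> nat) : dfn m P -> (forall i, i < m -> r i < n) ->
  (forall (S : kpm) (e : nat -> S), P S (fun i => e (r i)) <-> Q S e) -> dfn n Q.
Proof. intros HP Hr H. apply (d0_ext (d0_ren HP Hr)). exact H. Qed.


(** * Iteration of a definable operation along the natural numbers *)

Section Iter.
Variable S : kpm.
Variable U : S -> Prop.
Hypothesis HU : isU U.

Lemma U_img (P : pred) (l : list S) X : dfn (2 + length l) P -> Forall U l -> U X ->
  (forall x, x ∈ X -> exists y, U y /\ P S (el (y :: x :: l))) ->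
  (forall x y y', P S (el (y :: x :: l)) -> P S (el (y' :: x :: l)) -> y = y') ->
  exists Y, U Y /\ forall y, y ∈ Y <-> exists x, x ∈ X /\ P S (el (y :: x :: l)).
Proof.
  intros HP Hl HX H Hf. destruct (U_coll HU HP Hl HX H) as (b & Hb & H1).
  destruct (@U_sep _ _ HU (fun S e => exists x, x ∈ e 1 /\ P S (fun i => match i with 0 => e 0 | 1 => x | Datatypes.S (Datatypes.S i) => e (2 + i) end)) (X :: l) b)
    as (Y & HY & H2); auto.
  - apply d0_bex; [isvt|]. cbv beta.
    apply (d0_perm (m := 2 + length l) (P := P) (r := fun i => match i with 0 => 1 | 1 => 0 | Datatypes.S (Datatypes.S i) => 3 + i end)); auto.
    + intros [|[|i]]; simpl; lia.
    + intros S' e. match goal with |- P S' ?a <-> P S' ?b => replace a with b; [tauto|] end.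
      apply functional_extensionality; intros [|[|i]]; reflexivity.
  - exists Y; split; auto. intros y. rewrite H2. split; [intros (_ & x & Hx & Hy); exists x; split; auto|].
    intros (x & Hx & Hy). split; [|exists x; split; auto].
    destruct (H1 x Hx) as (y' & Hy' & H3). rewrite (Hf _ _ _ Hy H3); auto.
Qed.

Lemma U_emp : U emp.
Proof. apply (U_tr HU (U_om HU)), om_spec, N_emp. Qed.
Lemma U_sing x : U x -> U (sing x).
Proof. intros; apply (U_up2 HU); auto. Qed.
Lemma U_pr x y : U x -> U y -> U (pr x y).
Proof. intros; apply (U_up2 HU); apply (U_up2 HU); auto. Qed.
Lemma U_un x y : U x -> U y -> U (un x y).
Proof. intros; apply (U_Un HU), (U_up2 HU); auto. Qed.
Lemma U_suc x : U x -> U (suc x).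
Proof. intros; apply U_un, U_sing; auto. Qed.
Lemma U_Nat n : Nat n -> U n.
Proof. intros; apply (U_tr HU (U_om HU)), om_spec; auto. Qed.

Section It.
Variables (P : pred) (l : list S) (X : S).
#[local] Arguments P : clear implicits.
Hypothesis HP : dfn (2 + length l) P.
Hypothesis Hl : Forall U l.
Hypothesis HX : U X.
Notation St Y Y' := (P S (el (Y' :: Y :: l))).
Hypothesis Htot : forall Y, U Y -> exists Y', U Y' /\ St Y Y'.
Hypothesis Hfun : forall Y Y1 Y2, St Y Y1 -> St Y Y2 -> Y1 = Y2.

(** A finite approximation to the iteration: [F] lists the stages 0 to [n], starting from [X]. For a
    Delta_0 step this is Delta_0 and can be the matrix of a Sigma_1 induction. *)
Definition apx (S : kpm) (P : S -> S -> Prop) (X n F : S) : Prop :=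
  (forall q, q ∈ F -> exists i Y, q = pr i Y /\ (i ∈ n \/ i = n)) /\
  (forall i Y, pr i Y ∈ F -> forall Y', pr i Y' ∈ F -> Y = Y') /\
  pr emp X ∈ F /\
  forall i, i ∈ n -> exists Y, pr i Y ∈ F /\ exists Y', pr (suc i) Y' ∈ F /\ P Y Y'.

Lemma apx_d0 (f x n : term) : forall k (r : nat -> nat), isv k f -> isv k x -> isv k n ->
  (forall i, i < length l -> r i < k) ->
  dfn k (fun S e => @apx S (fun Y Y' => P S (fun i => match i with 0 => Y' | 1 => Y | Datatypes.S (Datatypes.S i) => e (r i) end)) (x S e) (n S e) (f S e)).
Proof.
  intros k r (i1 & L1 & Hf) (i2 & L2 & Hx) (i3 & L3 & Hn) Hr.
  apply (d0_ext (P := fun S e => @apx S (fun Y Y' => P S (fun i => match i with 0 => Y' | 1 => Y | Datatypes.S (Datatypes.S i) => e (r i) end)) (e i2) (e i3) (e i1))).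
  2:{ intros S' e. rewrite Hf, Hx, Hn. tauto. }
  clear Hf Hx Hn. unfold apx.
  apply d0_and; [d0t|]. apply d0_and; [d0t|]. apply d0_and; [d0t|].
  apply d0_ball; [isvt|]. apply d0_exval; [isvt|dtt|]. apply d0_exval; [isvt|dtt|]. cbv beta.
  apply (d0_perm (P := P) (m := 2 + length l) (r := fun i => match i with 0 => 0 | 1 => 1 | Datatypes.S (Datatypes.S i) => 3 + r i end)); auto.
  - intros [|[|i]]; simpl; try lia. intros Hi. pose proof (Hr i). lia.
  - intros S' e. match goal with |- P S' ?a <-> P S' ?b => replace a with b; [tauto|] end.
    apply functional_extensionality; intros [|[|i]]; reflexivity.
Qed.

Notation Ap n F := (apx (fun Y Y' => St Y Y') X n F).

Lemma apx_agree n m F F' : Nat n -> Nat m -> Ap n F -> Ap m F' ->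
  forall i, Nat i -> forall Y, pr i Y ∈ F -> forall Y', pr i Y' ∈ F' -> Y = Y'.
Proof.
  intros Hn Hm (A1 & A2 & A3 & A4) (B1 & B2 & B3 & B4).
  apply (@N_ind S (fun S e => forall Y, pr (e 0) Y ∈ e 1 -> forall Y', pr (e 0) Y' ∈ e 2 -> Y = Y') [F; F']).
  - d0t.
  - simpl. intros Y H Y' H'. rewrite (A2 _ _ H _ A3), (B2 _ _ H' _ B3); auto.
  - simpl. intros k Hk IH Y H Y' H'.
    assert (K : k ∈ n /\ k ∈ m).
    { split.
      - destruct (A1 _ H) as (i & Z & Hq & Hi). apply pr_inj in Hq as [<- _].
        apply (@suc_in_suc S); auto. apply suc_spec; auto.
      - destruct (B1 _ H') as (i & Z & Hq & Hi). apply pr_inj in Hq as [<- _].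
        apply (@suc_in_suc S); auto. apply suc_spec; auto. }
    destruct (A4 k (proj1 K)) as (Z & HZ & Z' & HZ' & HS).
    destruct (B4 k (proj2 K)) as (V & HV & V' & HV' & HS').
    rewrite (A2 _ _ H _ HZ'), (B2 _ _ H' _ HV').
    rewrite (IH _ HZ _ HV) in HS. exact (Hfun HS HS').
Qed.

(** Sigma_1 induction within [U]. The guard [Nat n] stands inside the existential because the
    induction runs over all sets; those that are not natural numbers get a dummy witness. *)
Lemma apx_ex : forall n, exists F, U F /\ (Nat n -> Ap n F).
Proof.
  apply (@U_ind S U HU (fun S e => Nat (e 1) -> @apx S (fun Y Y' => P S (fun i => match i with 0 => Y' | 1 => Y | Datatypes.S (Datatypes.S i) => e (3 + i) end)) (e 2) (e 1) (e 0)) (X :: l)).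
  - apply d0_imp; [d0t|]. apply (@apx_d0 (fun S e => e 0) (fun S e => e 2) (fun S e => e 1) _ (fun i => 3 + i)); try isvt.
    simpl; lia.
  - intros x IH. destruct (classic (Nat x)) as [Hx|Hx].
    2:{ exists emp. split; [apply U_emp|]. intros H; destruct (Hx H). }
    destruct (N_case Hx) as [->|(k & Hk & ->)].
    + exists (sing (pr emp X)). split; [apply U_sing, U_pr; auto using U_emp|]. intros _. simpl.
      split; [|split; [|split]].
      * intros q Hq. apply sing_spec in Hq as ->. exists emp, X; auto.
      * intros i Y H Y' H'. rewrite sing_spec, pr_eq in *. intuition congruence.
      * apply sing_spec; auto.
      * intros i Hi; destruct (emp_spec Hi).
    + destruct (IH k (in_suc k)) as (F & HF & A). specialize (A Hk). simpl in A.
      destruct A as (A1 & A2 & A3 & A4).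
      assert (exists Y, pr k Y ∈ F) as [Y HY].
      { destruct (N_case Hk) as [->|(j & Hj & ->)]; [eauto|].
        destruct (A4 j (in_suc j)) as (_ & _ & Y' & H & _); eauto. }
      assert (UY : U Y).
      { apply (U_tr HU) with (up2 k Y); [apply (U_tr HU) with (pr k Y); [exact (U_tr HU HF HY)|]|]; apply up2_spec; auto. }
      destruct (Htot UY) as (Y' & UY' & HS).
      exists (un F (sing (pr (suc k) Y'))). split; [apply U_un, U_sing, U_pr; auto; apply U_Nat, N_suc; auto|].
      intros _. simpl.
      assert (Nk : forall Z, pr (suc k) Z ∉ F).
      { intros Z H. destruct (A1 _ H) as (i & Z' & Hq & Hi). apply pr_inj in Hq as [<- _].
        destruct Hi as [Hi|Hi]; [exact (asym Hi (in_suc k))|]. apply (@irrefl S k). rewrite <- Hi at 2. apply in_suc. }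
      split; [|split; [|split]].
      * intros q Hq. apply un_spec in Hq as [Hq|Hq].
        -- destruct (A1 q Hq) as (i & Z & -> & Hi). exists i, Z; split; auto. left. apply suc_spec; auto.
        -- apply sing_spec in Hq as ->. exists (suc k), Y'; auto.
      * intros i Z H Z' H'. rewrite un_spec, sing_spec, pr_eq in *.
        destruct H as [H|[-> ->]], H' as [H'|[H1 ->]]; eauto; subst; exfalso; eapply Nk; eauto.
      * apply un_spec; auto.
      * intros i Hi. apply suc_spec in Hi as [Hi| ->].
        -- destruct (A4 i Hi) as (Z & HZ & Z' & HZ' & H). exists Z. split; [apply un_spec; auto|].
           exists Z'. split; [apply un_spec; auto|]. exact H.
        -- exists Y. split; [apply un_spec; auto|]. exists Y'.
           split; [apply un_spec; right; apply sing_spec; auto|]. exact HS.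
Qed.

(** Approximations of different lengths agree where both are defined, so once collected they unite
    to one function on the natural numbers. *)
Lemma iter : exists G, U G /\ (forall i Y, pr i Y ∈ G -> forall Y', pr i Y' ∈ G -> Y = Y') /\
  (forall q, q ∈ G -> exists i Y, q = pr i Y /\ Nat i) /\
  pr emp X ∈ G /\
  forall i, Nat i -> exists Y, pr i Y ∈ G /\ exists Y', pr (suc i) Y' ∈ G /\ St Y Y'.
Proof.
  assert (D : forall k (f x n : term) r, isv k f -> isv k x -> isv k n -> (forall i, i < length l -> r i < k) ->
    dfn k (fun S e => @apx S (fun Y Y' => P S (fun i => match i with 0 => Y' | 1 => Y | Datatypes.S (Datatypes.S i) => e (r i) end)) (x S e) (n S e) (f S e)))
  by (intros; apply apx_d0; auto).
  destruct (@U_coll S U HU (fun S e => @apx S (fun Y Y' => P S (fun i => match i with 0 => Y' | 1 => Y | Datatypes.S (Datatypes.S i) => e (3 + i) end)) (e 2) (e 1) (e 0)) (X :: l) om) as (b & Hb & H).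
  - apply (D _ (fun S e => e 0) (fun S e => e 2) (fun S e => e 1) (fun i => 3 + i)); try isvt. simpl; lia.
  - auto.
  - apply (U_om HU).
  - intros n Hn. apply om_spec in Hn. destruct (apx_ex n) as (F & HF & A). exists F; split; [auto|exact (A Hn)].
  (* Collection may put other sets into [b], so only those members that are approximations
     contribute to [G]. *)
  - destruct (@U_sep S U HU (fun S e => exists n, n ∈ e 2 /\ exists F, F ∈ e 1 /\ F ∈ e 1 /\ (e 0 ∈ F /\ 
      @apx S (fun Y Y' => P S (fun i => match i with 0 => Y' | 1 => Y | Datatypes.S (Datatypes.S i) => e (4 + i) end)) (e 3) n F)) (b :: om :: X :: l) (Un b)) as (G & HG & HGs).
    + apply d0_bex; [isvt|]. apply d0_bex; [isvt|]. apply d0_and; [d0t|]. apply d0_and; [d0t|].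
      apply (D _ (fun S e => e 0) (fun S e => e 5) (fun S e => e 1) (fun i => 6 + i)); try isvt. simpl; lia.
    + repeat constructor; auto. apply (U_om HU).
    + apply (U_Un HU); auto.
    + assert (HG' : forall q, q ∈ G <-> exists n F, Nat n /\ F ∈ b /\ Ap n F /\ q ∈ F).
      { intros q. rewrite HGs. simpl. split.
        - intros (_ & n & Hn & F & HF & _ & Hq & A). exists n, F. apply om_spec in Hn. split; [auto|split; [auto|split; [exact A|auto]]].
        - intros (n & F & Hn & HF & A & Hq). split; [apply Un_spec; eauto|]. exists n; split; [apply om_spec; auto|].
          exists F; repeat split; auto; apply A. }
      assert (HA : forall n, Nat n -> exists F, F ∈ b /\ Ap n F).
      { intros n Hn. apply om_spec in Hn. exact (H n Hn). }
      exists G. split; [auto|]. split; [|split; [|split]].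
      * intros i Y H1 Y' H2. apply HG' in H1 as (n & F & Hn & HF & A & H1), H2 as (m & F' & Hm & HF' & A' & H2).
        apply (apx_agree Hn Hm A A' (i := i)); auto.
        destruct A as (A1 & _). destruct (A1 _ H1) as (j & Z & Hq & Hj). apply pr_inj in Hq as [<- _].
        destruct Hj as [Hj| ->]; auto. apply (N_mem Hn Hj).
      * intros q Hq. apply HG' in Hq as (n & F & Hn & HF & A & H1). destruct A as (A1 & _).
        destruct (A1 _ H1) as (j & Z & -> & Hj). exists j, Z; split; auto. destruct Hj as [Hj| ->]; auto. apply (N_mem Hn Hj).
      * apply HG'. destruct (HA emp (@N_emp S)) as (F & HF & A). exists emp, F. split; [apply N_emp|].
        split; auto. split; auto. apply A.
      * intros i Hi. destruct (HA (suc i) (N_suc Hi)) as (F & HF & A). pose proof A as (_ & _ & _ & A4).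
        destruct (A4 i (in_suc i)) as (Y & HY & Y' & HY' & HS). exists Y. split.
        -- apply HG'. exists (suc i), F. split; [apply N_suc; auto|auto].
        -- exists Y'. split; auto. apply HG'. exists (suc i), F. split; [apply N_suc; auto|auto].
Qed.
End It.
End Iter.

(** ** Renamings as sets, and sets closed under simple operations *)

Definition upr {S : kpm} (r : S) : S :=
  ep (fun y => forall q, q ∈ y <-> q = pr emp emp \/ exists n m, pr n m ∈ r /\ q = pr (suc n) (suc m)).
Definition ins {S : kpm} (t : S) : S :=
  ep (fun y => forall q, q ∈ y <-> q = pr emp t \/ exists m, Nat m /\ q = pr (suc m) m).
Definition shf {S : kpm} : S :=
  ep (fun y => forall q, q ∈ y <-> exists n, Nat n /\ q = pr n (suc n)).

Section Ops.
Variable S : kpm.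
Lemma upr_ex (U : S -> Prop) (HU : isU U) r : U r -> exists y, U y /\
  forall q, q ∈ y <-> q = pr emp emp \/ exists n m, pr n m ∈ r /\ q = pr (suc n) (suc m).
Proof.
  intros Hr.
  destruct (@U_coll S U HU (fun S e => forall n m, e 1 = pr n m -> e 0 = pr (suc n) (suc m)) [] r) as (b & Hb & H); auto.
  - d0t.
  - intros x Hx. destruct (classic (exists n m, x = pr n m)) as [(n & m & ->)|N].
    + exists (pr (suc n) (suc m)). split.
      * assert (U (up2 n m)) by (apply (U_tr HU (U_tr HU Hr Hx)); apply up2_spec; auto).
        apply (U_pr HU); apply (U_suc HU); apply (U_tr HU H); apply up2_spec; auto.
      * simpl. intros a c Hac. apply pr_inj in Hac as [-> ->]; auto.
    + exists emp; split; [apply (U_emp HU)|]. simpl. intros n m ->. exfalso; eauto.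
  - destruct (@U_sep S U HU (fun S e => exists n m, pr n m ∈ e 1 /\ e 0 = pr (suc n) (suc m)) [r] b) as (Y & HY & H1); auto.
    + d0t.
    + exists (un (sing (pr emp emp)) Y). split; [apply (U_un HU); auto; apply (U_sing HU), (U_pr HU); apply (U_emp HU)|].
      intros q. rewrite un_spec, sing_spec, H1. simpl. split; [intuition auto|].
      intros [Hq|(n & m & Hn & ->)]; auto. right. split; [|eauto].
      destruct (H _ Hn) as (y & Hy & H2). simpl in H2. rewrite <- (H2 n m eq_refl); auto.
Qed.
Lemma upr_spec (r q : S) : q ∈ upr r <-> q = pr emp emp \/ exists n m, pr n m ∈ r /\ q = pr (suc n) (suc m).
Proof.
  revert q. apply (ep_spec (P := fun y : S => forall q, q ∈ y <-> q = pr emp emp \/ exists n m, pr n m ∈ r /\ q = pr (suc n) (suc m))).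
  destruct (upr_ex (isU_True S) (r := r) I) as (y & _ & H); eauto.
Qed.
Lemma U_upr (U : S -> Prop) (HU : isU U) r : U r -> U (upr r).
Proof.
  intros Hr. destruct (upr_ex HU Hr) as (y & Hy & H).
  replace (upr r) with y; auto. apply ext; intros q. rewrite H, upr_spec; tauto.
Qed.

Lemma ins_ex (U : S -> Prop) (HU : isU U) t : U t -> exists y, U y /\
  forall q, q ∈ y <-> q = pr emp t \/ exists m, Nat m /\ q = pr (suc m) m.
Proof.
  intros Ht.
  destruct (@U_img S U HU (fun S e => e 0 = pr (suc (e 1)) (e 1)) [] om) as (Y & HY & H1); auto.
  - d0t.
  - apply (U_om HU).
  - intros x Hx. exists (pr (suc x) x); split; [|reflexivity]. pose proof (U_tr HU (U_om HU) Hx).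
    apply (U_pr HU); auto. apply (U_suc HU); auto.
  - simpl; intros; congruence.
  - exists (un (sing (pr emp t)) Y). split; [apply (U_un HU); auto; apply (U_sing HU), (U_pr HU); auto; apply (U_emp HU)|].
    intros q. rewrite un_spec, sing_spec, H1. simpl. 
    split; (intros [Hq|(m & Hm & Hq)]; [auto|right; exists m; split; auto; apply om_spec; auto]).
Qed.
Lemma ins_spec (t q : S) : q ∈ ins t <-> q = pr emp t \/ exists m, Nat m /\ q = pr (suc m) m.
Proof.
  revert q. apply (ep_spec (P := fun y : S => forall q, q ∈ y <-> q = pr emp t \/ exists m, Nat m /\ q = pr (suc m) m)).
  destruct (ins_ex (isU_True S) (t := t) I) as (y & _ & H); eauto.
Qed.
Lemma U_ins (U : S -> Prop) (HU : isU U) t : U t -> U (ins t).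
Proof.
  intros Hr. destruct (ins_ex HU Hr) as (y & Hy & H).
  replace (ins t) with y; auto. apply ext; intros q. rewrite H, ins_spec; tauto.
Qed.
Lemma shf_ex (U : S -> Prop) (HU : isU U) : exists y, U y /\
  forall q, q ∈ y <-> exists n, Nat n /\ q = pr n (suc n).
Proof.
  destruct (@U_img S U HU (fun S e => e 0 = pr (e 1) (suc (e 1))) [] om) as (Y & HY & H1); auto.
  - d0t.
  - apply (U_om HU).
  - intros x Hx. exists (pr x (suc x)); split; [|reflexivity]. pose proof (U_tr HU (U_om HU) Hx).
    apply (U_pr HU); auto. apply (U_suc HU); auto.
  - simpl; intros; congruence.
  - exists Y. split; auto.
    intros q. rewrite H1. simpl. split; intros (m & Hm & Hq); exists m; split; auto; apply om_spec; auto.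
Qed.
Lemma shf_spec (q : S) : q ∈ shf <-> exists n, Nat n /\ q = pr n (suc n).
Proof.
  revert q. apply (ep_spec (P := fun y : S => forall q, q ∈ y <-> exists n, Nat n /\ q = pr n (suc n))).
  destruct (shf_ex (isU_True S)) as (y & _ & H); eauto.
Qed.
Lemma U_shf (U : S -> Prop) (HU : isU U) : U shf.
Proof.
  destruct (shf_ex HU) as (y & Hy & H).
  replace (@shf S) with y; auto. apply ext; intros q. rewrite H, shf_spec; tauto.
Qed.
End Ops.

Lemma upr_graph : dfn 2 (fun S e => e 0 = upr (e 1)).
Proof.
  apply (d0_ext (P := fun S e => (forall q, q ∈ e 0 -> q = pr emp emp \/ exists n m, pr n m ∈ e 1 /\ q = pr (suc n) (suc m)) /\
    pr emp emp ∈ e 0 /\ forall n m, pr n m ∈ e 1 -> pr (suc n) (suc m) ∈ e 0)); [d0t|].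
  intros S e; split.
  - intros (H1 & H2 & H3). apply ext; intros q. rewrite upr_spec. split; auto.
    intros [-> |(n & m & H & ->)]; auto.
  - intros ->. repeat split.
    + intros q; apply upr_spec.
    + apply upr_spec; auto.
    + intros n m H; apply upr_spec; eauto.
Qed.
Lemma ins_graph : dfn 2 (fun S e => e 0 = ins (e 1)).
Proof.
  apply (d0_ext (P := fun S e => (forall q, q ∈ e 0 -> q = pr emp (e 1) \/ exists n m, q = pr n m /\ Nat m /\ n = suc m) /\
    pr emp (e 1) ∈ e 0 /\ pr (suc emp) emp ∈ e 0 /\ forall n m, pr n m ∈ e 0 -> n = suc m -> pr (suc n) n ∈ e 0)); [d0t|].
  intros S e; split.
  - intros (H1 & H2 & H3 & H4).
    assert (A : forall m, Nat m -> pr (suc m) m ∈ e 0).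
    { apply (@N_ind S (fun S e => pr (suc (e 0)) (e 0) ∈ e 1) [e 0]); [d0t|exact H3|].
      simpl. intros k _ Hk. exact (H4 _ _ Hk eq_refl). }
    apply ext; intros q. rewrite ins_spec. split.
    + intros Hq. destruct (H1 q Hq) as [H|(n & m & -> & Hm & ->)]; eauto.
    + intros [->|(m & Hm & ->)]; auto.
  - intros ->. repeat split.
    + intros q Hq; apply ins_spec in Hq as [->|(m & Hm & ->)]; auto. right; exists (suc m), m; auto.
    + apply ins_spec; auto.
    + apply ins_spec; right; exists emp; split; auto using N_emp.
    + intros n m H ->. apply ins_spec in H as [H|(k & Hk & H)]; apply pr_inj in H as [H H0].
      * destruct (suc_emp H).
      * subst. apply ins_spec; right; exists (suc k); auto using N_suc.
Qed.
Lemma shf_graph : dfn 1 (fun S e => e 0 = shf).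
Proof.
  apply (d0_ext (P := fun S e => (forall q, q ∈ e 0 -> exists n m, q = pr n m /\ Nat n /\ m = suc n) /\
    pr emp (suc emp) ∈ e 0 /\ forall n m, pr n m ∈ e 0 -> pr m (suc m) ∈ e 0)); [d0t|].
  intros S e; split.
  - intros (H1 & H2 & H3).
    assert (A : forall m, Nat m -> pr m (suc m) ∈ e 0).
    { apply (@N_ind S (fun S e => pr (e 0) (suc (e 0)) ∈ e 1) [e 0]); [d0t|exact H2|].
      simpl. intros k _ Hk. exact (H3 _ _ Hk). }
    apply ext; intros q. rewrite shf_spec. split.
    + intros Hq. destruct (H1 q Hq) as (n & m & -> & Hm & ->); eauto.
    + intros (m & Hm & ->); auto.
  - intros ->. repeat split.
    + intros q Hq; apply shf_spec in Hq as (m & Hm & ->). exists m, (suc m); auto.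
    + apply shf_spec; exists emp; split; auto using N_emp.
    + intros n m H. apply shf_spec in H as (k & Hk & H); apply pr_inj in H as [-> ->].
      apply shf_spec; exists (suc k); auto using N_suc.
Qed.
Lemma dt_upr n v : isv n v -> dt n (fun S e => upr (v S e)).
Proof.
  intros (i & Hi & Hv). unfold dt.
  pose proof (@d0_ren (S n) 2 _ (fun k => match k with 0 => 0 | _ => S i end) upr_graph) as H.
  refine (d0_ext (H _) _); [intros [|k]; lia|]. intros S e; rewrite Hv; simpl; tauto.
Qed.
Lemma dt_ins n v : isv n v -> dt n (fun S e => ins (v S e)).
Proof.
  intros (i & Hi & Hv). unfold dt.
  pose proof (@d0_ren (S n) 2 _ (fun k => match k with 0 => 0 | _ => S i end) ins_graph) as H.
  refine (d0_ext (H _) _); [intros [|k]; lia|]. intros S e; rewrite Hv; simpl; tauto.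
Qed.
Lemma dt_shf n : dt n (fun S e => shf).
Proof.
  unfold dt. apply (@d0_ren (S n) 1 _ (fun k => 0) shf_graph). lia.
Qed.
Ltac dth ::= first [simple apply dt_un; isvt | simple apply dt_upr; isvt | simple apply dt_ins; isvt | simple apply dt_shf].

(** In such a class [D], which may be a set, the syntactic notions have the same meaning as in the whole model. *)
Record closed {S : kpm} (D : S -> Prop) : Prop := {
  cl_tr : forall x y, D x -> y ∈ x -> D y;
  cl_emp : D emp;
  cl_sing : forall x, D x -> D (sing x);
  cl_un : forall x y, D x -> D y -> D (un x y);
  cl_upr : forall x, D x -> D (upr x);
  cl_ins : forall x, D x -> D (ins x);
  cl_shf : D shf }.

Definition clset {S : kpm} (z : S) : Prop := closed (fun x => x ∈ z).

Lemma d0_clset n v : isv n v -> dfn n (fun S e => clset (v S e)).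
Proof.
  intros (i & Hi & Hv).
  apply (d0_ext (P := fun S e => (forall x, x ∈ e i -> forall y, y ∈ x -> y ∈ e i) /\ emp ∈ e i /\ 
    (forall x, x ∈ e i -> sing x ∈ e i) /\ (forall x, x ∈ e i -> forall y, y ∈ e i -> un x y ∈ e i) /\ 
    (forall x, x ∈ e i -> upr x ∈ e i) /\ (forall x, x ∈ e i -> ins x ∈ e i) /\ shf ∈ e i)); [d0t|].
  intros S e. rewrite Hv. split.
  - intros (H1 & H2 & H3 & H4 & H5 & H6 & H7). constructor; eauto.
  - intros []; repeat split; eauto.
Qed.

Section Closure.
Variable S : kpm.
Variable U : S -> Prop.
Hypothesis HU : isU U.

Lemma U_closed : closed U.
Proof.
  constructor.
  - apply (U_tr HU).
  - apply (U_emp HU).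
  - apply (U_sing HU).
  - apply (U_un HU).
  - apply (U_upr HU).
  - apply (U_ins HU).
  - apply (U_shf HU).
Qed.

Definition gen1 {S : kpm} (y X : S) : Prop := y ∈ X \/ (exists x, x ∈ X /\ y ∈ x) \/
  (exists x, x ∈ X /\ exists x', x' ∈ X /\ y = un x x') \/
  exists x, x ∈ X /\ (y = sing x \/ y = upr x \/ y = ins x).
(** Equivalent to [forall y, y ∈ Y <-> gen1 y X], but with bounded quantifiers only, as [iter]
    requires of the operation it iterates. *)
Definition Step {S : kpm} (X Y : S) : Prop := (forall y, y ∈ Y -> gen1 y X) /\
  (forall x, x ∈ X -> x ∈ Y /\ (forall y, y ∈ x -> y ∈ Y) /\ (forall x', x' ∈ X -> un x x' ∈ Y) /\
     sing x ∈ Y /\ upr x ∈ Y /\ ins x ∈ Y).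

Lemma Step_iff (X Y : S) : Step X Y <-> forall y, y ∈ Y <-> gen1 y X.
Proof.
  unfold Step, gen1. split.
  - intros [H1 H2] y. split; [apply H1|]. intros [H|[(x & Hx & H)|[(x & Hx & x' & Hx' & ->)|(x & Hx & [->|[->| ->]])]]];
    [destruct (H2 y H) as (A1 & A2 & A3 & A4 & A5 & A6)|destruct (H2 x Hx) as (A1 & A2 & A3 & A4 & A5 & A6)..]; auto.
  - intros H. split; [intros y; apply H|]. intros x Hx. repeat split; intros; apply H; eauto 10.
Qed.

Lemma Step_ex (X : S) : U X -> exists Y, U Y /\ Step X Y.
Proof.
  intros HX.
  assert (I1 : forall x, U x -> exists Y, U Y /\ forall y, y ∈ Y <-> exists x', x' ∈ X /\ y = un x x').
  { intros x Ux. apply (@U_img S U HU (fun S e => e 0 = un (e 2) (e 1)) [x] X); auto.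
    - d0t.
    - intros x' Hx'. exists (un x x'). split; [|reflexivity]. apply (U_un HU); auto. apply (U_tr HU HX Hx').
    - simpl; congruence. }
  destruct (@U_coll S U HU (fun S e => forall x', x' ∈ e 2 -> un (e 1) x' ∈ e 0) [X] X) as (b & Hb & H1); auto.
  { d0t. }
  { intros x Hx. destruct (I1 x (U_tr HU HX Hx)) as (Y & HY & H). exists Y; split; auto. simpl. intros x' Hx'.
    apply H; eauto. }
  destruct (@U_sep S U HU (fun S e => exists x, x ∈ e 1 /\ exists x', x' ∈ e 1 /\ e 0 = un x x') [X] (Un b)) as (Y1 & UY1 & HY1); auto.
  { d0t. } { apply (U_Un HU); auto. }
  assert (I2 : forall g : forall S : kpm, S -> S, dfn 2 (fun S e => e 0 = g S (e 1)) -> (forall x, U x -> U (g S x)) ->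
    exists Y, U Y /\ forall y, y ∈ Y <-> exists x, x ∈ X /\ y = g S x).
  { intros g Hg Ug. apply (@U_img S U HU (fun S e => e 0 = g S (e 1)) [] X); auto.
    - intros x' Hx'. exists (g S x'). split; [|reflexivity]. apply Ug, (U_tr HU HX Hx').
    - simpl; congruence. }
  destruct (I2 (fun S => @sing S)) as (Y2 & UY2 & HY2); [d0t|apply (U_sing HU)|].
  destruct (I2 (fun S => @upr S)) as (Y3 & UY3 & HY3); [apply upr_graph|apply (U_upr HU)|].
  destruct (I2 (fun S => @ins S)) as (Y4 & UY4 & HY4); [apply ins_graph|apply (U_ins HU)|].
  exists (un X (un (Un X) (un Y1 (un Y2 (un Y3 Y4))))). split.
  - apply (U_un HU); auto. apply (U_un HU); [apply (U_Un HU); auto|]. repeat apply (U_un HU); auto.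
  - apply Step_iff. intros y. rewrite !un_spec, Un_spec, HY1, HY2, HY3, HY4. unfold gen1.
    split.
    + intros [H|[H|[[_ H]|[(x & Hx & H)|[(x & Hx & H)|(x & Hx & H)]]]]]; auto; right; right; right; eauto 6.
    + intros [H|[H|[H|(x & Hx & H)]]]; auto.
      * right; right; left. split; auto. simpl in H. destruct H as (x & Hx & x' & Hx' & ->).
        destruct (H1 x Hx) as (Y & HY & H). apply Un_spec. exists Y; split; [exact HY|]. apply H; auto.
      * destruct H as [H|[H|H]]; eauto 8.
Qed.

(** The union of the finite stages of the one-step closure. Stages increase, so two members of the
    union lie in a common stage, and the next stage contains what they generate. *)
Theorem closure (X : S) : U X -> exists z, U z /\ clset z /\ X ∈ z.
Proof.
  intros HX. pose (X0 := un (sing X) (un (sing emp) (sing shf))).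
  assert (UX0 : U X0).
  { unfold X0. repeat apply (U_un HU); apply (U_sing HU); auto. apply (U_emp HU). apply (U_shf HU). }
  destruct (@iter S U HU (fun S e => Step (e 1) (e 0)) [] X0) as (G & UG & G1 & G2 & G3 & G4); auto.
  - unfold Step, gen1. d0t.
  - apply Step_ex.
  - intros Y Y1 Y2. simpl. rewrite !Step_iff. intros H1 H2. apply ext; intros y. rewrite H1, H2; tauto.
  - simpl in G4.
    assert (G5 : forall i Y, pr i Y ∈ G -> Nat i).
    { intros i Y H. destruct (G2 _ H) as (j & Z & Hq & Hj). apply pr_inj in Hq as [-> _]; auto. }
    assert (G4' : forall i Y Y', pr i Y ∈ G -> pr (suc i) Y' ∈ G -> Step Y Y').
    { intros i Y Y' H H'. destruct (G4 i (G5 _ _ H)) as (Z & HZ & Z' & HZ' & HS).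
      rewrite (G1 _ _ H _ HZ), (G1 _ _ H' _ HZ'); auto. }
    assert (Mono : forall j, Nat j -> forall i, i ∈ j -> forall Y, pr i Y ∈ G -> forall Y', pr j Y' ∈ G -> forall x, x ∈ Y -> x ∈ Y').
    { apply (@N_ind S (fun S e => forall i, i ∈ e 0 -> forall Y, pr i Y ∈ e 1 -> forall Y', pr (e 0) Y' ∈ e 1 -> forall x, x ∈ Y -> x ∈ Y') [G]); [d0t| |]; simpl.
      - intros i Hi; destruct (emp_spec Hi).
      - intros k Hk IH i Hi Y HY Y' HY' x Hx. destruct (G4 k Hk) as (Z & HZ & _).
        assert (x ∈ Z).
        { apply suc_spec in Hi as [Hi| ->]; [exact (IH i Hi Y HY Z HZ x Hx)|]. rewrite (G1 _ _ HZ _ HY); auto. }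
        destruct (G4' _ _ _ HZ HY') as [_ HS]. apply HS; auto. }
    destruct (@U_sep S U HU (fun S e => exists i Y, pr i Y ∈ e 1 /\ e 0 ∈ Y) [G] (Un (Un (Un G)))) as (z & Uz & Hz); auto.
    { d0t. } { repeat apply (U_Un HU); auto. }
    assert (Hz' : forall x, x ∈ z <-> exists i Y, pr i Y ∈ G /\ x ∈ Y).
    { intros x. rewrite Hz. simpl. split; [tauto|]. intros (i & Y & H1 & H2). split; [|eauto].
      apply Un_spec. exists Y; split; auto. apply Un_spec. exists (up2 i Y).
      split; [|apply up2_spec; auto]. apply Un_spec. exists (pr i Y). split; auto. apply up2_spec; auto. }
    assert (Hz2 : forall x y, x ∈ z -> y ∈ z -> exists i Y, pr i Y ∈ G /\ x ∈ Y /\ y ∈ Y).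
    { intros x y Hx Hy. apply Hz' in Hx as (i & Y & HY & Hx), Hy as (j & Y' & HY' & Hy).
      destruct (N_tri (G5 _ _ HY) (G5 _ _ HY')) as [H|[H|H]].
      - exists j, Y'; repeat split; auto. exact (Mono j (G5 _ _ HY') i H _ HY _ HY' x Hx).
      - subst j. exists i, Y; repeat split; auto. rewrite (G1 _ _ HY _ HY'); auto.
      - exists i, Y; repeat split; auto. exact (Mono i (G5 _ _ HY) j H _ HY' _ HY y Hy). }
    assert (Hz3 : forall x y, x ∈ z -> y ∈ z -> forall w, (forall Y, x ∈ Y -> y ∈ Y -> gen1 w Y) -> w ∈ z).
    { intros x y Hx Hy w Hw. destruct (Hz2 x y Hx Hy) as (i & Y & HY & H1 & H2).
      destruct (G4 i (G5 _ _ HY)) as (Y1 & HY1 & Y' & HY' & HS). apply Hz'. exists (suc i), Y'. split; auto.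
      rewrite Step_iff in HS. apply HS. rewrite (G1 _ _ HY1 _ HY). auto. }
    assert (Z0 : forall x, x ∈ X0 -> x ∈ z) by (intros x Hx; apply Hz'; eauto).
    assert (X0s : forall x, x ∈ X0 <-> x = X \/ x = emp \/ x = shf) by (intros; unfold X0; rewrite !un_spec, !sing_spec; tauto).
    exists z. split; auto. split; [|apply Z0, X0s; auto].
    constructor.
    + intros x y Hx Hy. apply (Hz3 x x Hx Hx). unfold gen1; eauto.
    + apply Z0, X0s; auto.
    + intros x Hx. apply (Hz3 x x Hx Hx). unfold gen1; eauto 8.
    + intros x y Hx Hy. apply (Hz3 x y Hx Hy). unfold gen1; eauto 10.
    + intros x Hx. apply (Hz3 x x Hx Hx). unfold gen1; eauto 8.
    + intros x Hx. apply (Hz3 x x Hx Hx). unfold gen1; eauto 8.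
    + apply Z0, X0s; auto.
Qed.
End Closure.

Definition kMem {S : kpm} (i j : S) := pr (nm 0) (pr i j).
Definition kEq {S : kpm} (i j : S) := pr (nm 1) (pr i j).
Definition kNeg {S : kpm} (a : S) := pr (nm 2) a.
Definition kImp {S : kpm} (a b : S) := pr (nm 3) (pr a b).
Definition kAll {S : kpm} (a : S) := pr (nm 4) a.

#[export] Instance k_syntax (S : kpm) : syntax S :=
  { mem := fun i j => kMem (nm i) (nm j);
    eql := fun i j => kEq (nm i) (nm j);
    neg := kNeg; imp := kImp; all := kAll }.

(** The meaning, in the class [D], of formulas of [Defs]: [Bd] is [is_bounded], [Fm] is [is_form], [D0c] is [is_Delta0], [Rn] is [is_ren],
    [LA] is [is_logical_axiom], [PV] is [is_provable], [Scn] is [is_scons], [St] is [is_sat], [MD] is [is_model], [TS] is [is_true_Sigma1];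
    [BW], [DW], [RW], [PW], [SC] are the conditions on the justifying sets. *)
Section Preds.
Context {S : kpm}.
Variable D : S -> Prop.

Definition isfun (f : S) := forall i x y, pr i x ∈ f /\ pr i y ∈ f -> x = y.
Definition isord (x : S) := trans x /\ forall y, y ∈ x -> trans y.
Definition BW (W : S) := forall m c, pr m c ∈ W ->
      (exists i j, i ∈ m /\ j ∈ m /\ (c = kMem i j \/ c = kEq i j))
   \/ (exists a, c = kNeg a /\ pr m a ∈ W)
   \/ (exists a b, c = kImp a b /\ pr m a ∈ W /\ pr m b ∈ W)
   \/ (exists a, c = kAll a /\ pr (suc m) a ∈ W).
Definition Bd (n c : S) := exists W, D W /\ pr n c ∈ W /\ BW W.
Definition Fm (c : S) := exists n, Nat n /\ Bd n c.
Definition DW (W : S) := forall c, c ∈ W ->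
      (exists i j, Nat i /\ Nat j /\ (c = kMem i j \/ c = kEq i j))
   \/ (exists a, c = kNeg a /\ a ∈ W)
   \/ (exists a b, c = kImp a b /\ a ∈ W /\ b ∈ W)
   \/ (exists y a, Nat y /\ c = kAll (kImp (kMem (nm 0) (suc y)) a) /\ a ∈ W).
Definition D0c (c : S) := exists W, D W /\ c ∈ W /\ DW W.
Definition ShfR (r : S) := forall n m, pr n m ∈ r <-> Nat n /\ m = suc n.
Definition InsR (t r : S) := forall n m, pr n m ∈ r <-> Nat n /\ (n = emp /\ m = t \/ n = suc m).
Definition UpR (r r' : S) := forall n m, pr n m ∈ r' <->
   n = emp /\ m = emp \/ exists n' m', n = suc n' /\ m = suc m' /\ pr n' m' ∈ r.
Definition RW (W : S) := forall r c c', pr r (pr c c') ∈ W ->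
      (exists i j i' j', pr i i' ∈ r /\ pr j j' ∈ r /\
         (c = kMem i j /\ c' = kMem i' j' \/ c = kEq i j /\ c' = kEq i' j'))
   \/ (exists a a', c = kNeg a /\ c' = kNeg a' /\ pr r (pr a a') ∈ W)
   \/ (exists a b a' b', c = kImp a b /\ c' = kImp a' b' /\ pr r (pr a a') ∈ W /\ pr r (pr b b') ∈ W)
   \/ (exists a a' r', c = kAll a /\ c' = kAll a' /\ UpR r r' /\ pr r' (pr a a') ∈ W).
Definition Rn (r c c' : S) := exists W, D W /\ pr r (pr c c') ∈ W /\ RW W.

Definition LA (c : S) :=
      (exists p q, Fm p /\ Fm q /\ c = ax_K p q)
   \/ (exists p q r, Fm p /\ Fm q /\ Fm r /\ c = ax_S p q r)
   \/ (exists p q, Fm p /\ Fm q /\ c = ax_N p q)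
   \/ (exists p q, Fm p /\ Fm q /\ c = ax_dist p q)
   \/ (exists p r, D r /\ exists p', Fm p /\ ShfR r /\ Rn r p p' /\ c = ax_vac p p')
   \/ (exists p t r, D r /\ exists p', Fm p /\ Nat t /\ InsR t r /\ Rn r p p' /\ c = ax_inst p p')
   \/ c = eq_refl_ax \/ c = eq_eucl_ax \/ c = eq_mem_l_ax \/ c = eq_mem_r_ax.

Definition PW (T : S -> Prop) (n P : S) := 
  forall i, i ∈ n -> exists x, pr i x ∈ P /\
    (    LA x
      \/ (Fm x /\ T x)
      \/ (exists j k y z, j ∈ i /\ k ∈ i /\ pr j y ∈ P /\ pr k z ∈ P /\ z = kImp y x)
      \/ (exists j y, j ∈ i /\ pr j y ∈ P /\ x = kAll y)).
Definition PV (T : S -> Prop) (c : S) := exists n P, D P /\ Nat n /\ isfun P /\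
   (exists m, n = suc m /\ pr m c ∈ P) /\ PW T n P.

Definition Seq (M n s : S) := isfun s /\ (forall q, q ∈ s -> exists i x, i ∈ n /\ x ∈ M /\ q = pr i x) /\
  forall i, i ∈ n -> exists x, pr i x ∈ s.
Definition Scn (a s s' : S) := forall q, q ∈ s' <-> q = pr emp a \/ exists i x, pr i x ∈ s /\ q = pr (suc i) x.
Definition SC (M A W : S) := forall c s, pr c s ∈ A ->
      (exists i j x y, pr i x ∈ s /\ pr j y ∈ s /\
         (c = kMem i j /\ (pr c s ∈ W <-> x ∈ y) \/ c = kEq i j /\ (pr c s ∈ W <-> x = y)))
   \/ (exists a, c = kNeg a /\ pr a s ∈ A /\ (pr c s ∈ W <-> ~ pr a s ∈ W))
   \/ (exists a b, c = kImp a b /\ pr a s ∈ A /\ pr b s ∈ A /\ (pr c s ∈ W <-> (pr a s ∈ W -> pr b s ∈ W)))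
   \/ (exists a, c = kAll a /\ (forall x, x ∈ M -> exists s', Scn x s s' /\ pr a s' ∈ A) /\
         (pr c s ∈ W <-> forall x s', x ∈ M /\ Scn x s s' -> pr a s' ∈ W)).
Definition St (M c s : S) := exists A W, D A /\ D W /\ pr c s ∈ A /\ pr c s ∈ W /\ SC M A W.
Definition MD (M c : S) := forall n s, D s -> Nat n /\ Bd n c /\ Seq M n s -> St M c s.
Definition TS (M c : S) := exists p s, D0c p /\ (exists n, n = nm 1 /\ Bd n p) /\ c = Ex p /\ s = emp /\ St M c s.
Definition InD (M x : S) := exists n c s, D s /\ Nat n /\ (exists k, k = suc n /\ Bd k c) /\ Seq M n s /\
  forall a, a ∈ x <-> a ∈ M /\ exists s', D s' /\ Scn a s s' /\ St M c s'.
Definition IsL (a l : S) := exists f, D f /\ isfun f /\ pr a l ∈ f /\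
  forall g m, pr g m ∈ f -> (forall h, h ∈ g -> exists k, pr h k ∈ f) /\
   forall x, D x -> (x ∈ m <-> exists h k, h ∈ g /\ pr h k ∈ f /\ InD k x).
Definition KPc (c : S) :=
      c = extensionality \/ c = union \/ c = pairing \/ c = infinity
   \/ (exists p r, D r /\ exists r', D r' /\ exists p', Fm p /\ D0c p /\ ShfR r /\ UpR r r' /\ Rn r' p p' /\ c = separation p')
   \/ (exists p r, D r /\ exists r', D r' /\ exists r'', D r'' /\ exists p', Fm p /\ (exists q, D0c q /\ p = Ex q) /\ 
        ShfR r /\ UpR r r' /\ UpR r' r'' /\ Rn r'' p p' /\ c = collection p p')
   \/ (exists p r, D r /\ exists r', D r' /\ exists p', Fm p /\ ShfR r /\ UpR r r' /\ Rn r' p p' /\ c = induction p p').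
Definition Adm (a : S) := isord a /\ exists l, D l /\ IsL a l /\ forall c, D c -> KPc c -> MD l c.
End Preds.

(** * Semantics of [pform]s *)

Definition lv {X : Type} (d : nat) (e : nat -> X) (x : nat) : X := e (d - S x).

Section Sem.
Variable S : kpm.
Variable D : S -> Prop.
Hypothesis HD : closed D.
Notation Sn := Datatypes.S.

Definition vv (d : nat) (e : nat -> S) (x : nat) (u : S) := x < d /\ lv d e x = u /\ D u.
Definition extd d e d' (e' : nat -> S) := d <= d' /\ forall x, x < d -> lv d' e' x = lv d e x.
(** Quantifying over extended assignments lets a denotation survive further binders, below which the
    same [dterm] is unfolded at a greater depth. *)
Definition den d e (t : dterm) (v : S) := D v /\ forall d' e', extd d e d' e' ->
  forall x u, vv d' e' x u -> (dsat D e' (t x d') <-> u = v).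

Lemma lv_new d (e : nat -> S) a : lv (Sn d) (sc a e) d = a.
Proof. unfold lv. rewrite Nat.sub_diag; reflexivity. Qed.
Lemma lv_old d (e : nat -> S) a x : x < d -> lv (Sn d) (sc a e) x = lv d e x.
Proof. intros H. unfold lv. replace (Sn d - Sn x) with (Sn (d - Sn x)) by lia. reflexivity. Qed.
Lemma vv_new d e a : D a -> vv (Sn d) (sc a e) d a.
Proof. split; [lia|split; auto using lv_new]. Qed.
Lemma vv_old d e a x u : vv d e x u -> vv (Sn d) (sc a e) x u.
Proof. intros (H1 & H2 & H3). split; [lia|split; auto]. rewrite lv_old; auto. Qed.
Lemma extd_S d e a : extd d e (Sn d) (sc a e).
Proof. split; [lia|]. intros; apply lv_old; auto. Qed.
Lemma extd_refl d e : extd d e d e.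
Proof. split; auto. Qed.
Lemma extd_trans d e d' e' d'' e'' : extd d e d' e' -> extd d' e' d'' e'' -> extd d e d'' e''.
Proof. intros [H1 H2] [H3 H4]. split; [lia|]. intros x Hx. rewrite H4, H2; auto; lia. Qed.
Lemma vv_ext d e d' e' x u : extd d e d' e' -> vv d e x u -> vv d' e' x u.
Proof. intros [H1 H2] (H3 & H4 & H5). split; [lia|split; auto]. rewrite H2; auto. Qed.
Lemma den_ext d e d' e' t v : extd d e d' e' -> den d e t v -> den d' e' t v.
Proof. intros H [H1 H2]. split; auto. intros; eapply H2; eauto using extd_trans. Qed.
Lemma den_old d e a t v : den d e t v -> den (Sn d) (sc a e) t v.
Proof. apply den_ext, extd_S. Qed.

Lemma r_mem d e x y u v : vv d e x u -> vv d e y v -> (dsat D e (pmem x y d) <-> u ∈ v).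
Proof. intros (_ & <- & _) (_ & <- & _). reflexivity. Qed.
Lemma r_eq d e x y u v : vv d e x u -> vv d e y v -> (dsat D e (peq x y d) <-> u = v).
Proof. intros (_ & <- & _) (_ & <- & _). reflexivity. Qed.
Lemma r_neg d e P Q : (dsat D e (P d) <-> Q) -> (dsat D e (pneg P d) <-> ~ Q).
Proof. unfold pneg. rewrite s_neg. tauto. Qed.
Lemma r_imp d e P P' Q Q' : (dsat D e (P d) <-> Q) -> (dsat D e (P' d) <-> Q') -> (dsat D e (pimp P P' d) <-> (Q -> Q')).
Proof. unfold pimp. rewrite s_imp. tauto. Qed.
Lemma r_and d e P P' Q Q' : (dsat D e (P d) <-> Q) -> (dsat D e (P' d) <-> Q') -> (dsat D e (pand P P' d) <-> (Q /\ Q')).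
Proof. unfold pand. rewrite s_And. tauto. Qed.
Lemma r_or d e P P' Q Q' : (dsat D e (P d) <-> Q) -> (dsat D e (P' d) <-> Q') -> (dsat D e (por P P' d) <-> (Q \/ Q')).
Proof. unfold por. rewrite s_Or. tauto. Qed.
Lemma r_iff d e P P' Q Q' : (dsat D e (P d) <-> Q) -> (dsat D e (P' d) <-> Q') -> (dsat D e (piff P P' d) <-> (Q <-> Q')).
Proof. unfold piff. rewrite s_Iff. tauto. Qed.
Lemma r_all d e P (Q : S -> Prop) : (forall a, D a -> (dsat D (sc a e) (P d (Sn d)) <-> Q a)) ->
  (dsat D e (pall P d) <-> forall a, D a -> Q a).
Proof. unfold pall. rewrite s_all. intros H. split; intros H1 a Ha; apply (H a Ha), H1; auto. Qed.
Lemma r_ex d e P (Q : S -> Prop) : (forall a, D a -> (dsat D (sc a e) (P d (Sn d)) <-> Q a)) ->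
  (dsat D e (pex P d) <-> exists a, D a /\ Q a).
Proof. unfold pex. rewrite s_Ex. intros H. split; intros (a & Ha & H1); exists a; split; auto; apply (H a Ha), H1. Qed.
(** Quantifiers of a formula evaluated in [D] range over [D]. They become unrestricted when every
    counterexample lies in [D] anyway, usually as a component of a set already in [D]; [r_exB] is
    the dual for witnesses. *)
Lemma r_allB d e P (Q : S -> Prop) : (forall a, ~ Q a -> D a) -> (forall a, D a -> (dsat D (sc a e) (P d (Sn d)) <-> Q a)) ->
  (dsat D e (pall P d) <-> forall a, Q a).
Proof.
  intros HQ H. rewrite (r_all H). split; auto. intros H1 a.
  destruct (classic (Q a)); auto.
Qed.
Lemma r_exB d e P (Q : S -> Prop) : (forall a, Q a -> D a) -> (forall a, D a -> (dsat D (sc a e) (P d (Sn d)) <-> Q a)) ->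
  (dsat D e (pex P d) <-> exists a, Q a).
Proof.
  intros HQ H. rewrite (r_ex H). split; intros (a & Ha); exists a; [tauto|split; auto].
Qed.
Lemma r_term d e t v x u : den d e t v -> vv d e x u -> (dsat D e (t x d) <-> u = v).
Proof. intros [_ H] Hx. apply (H _ _ (extd_refl d e)); auto. Qed.
Lemma r_in d e t v y w : den d e t v -> vv d e y w -> (dsat D e (is_in t y d) <-> v ∈ w).
Proof.
  intros Ht Hy. unfold is_in. rewrite (r_ex (Q := fun a => a = v /\ a ∈ w)).
  - split; [intros (a & _ & -> & H); auto|]. intros H; exists v; split; [apply Ht|auto].
  - intros a Ha. apply r_and.
    + apply r_term; [apply den_old, Ht|apply vv_new, Ha].
    + apply r_mem; [apply vv_new, Ha|apply vv_old, Hy].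
Qed.

Lemma D_in x y : D y -> x ∈ y -> D x. Proof. apply (cl_tr HD). Qed.
Lemma D_up2 a b : D a -> D b -> D (up2 a b).
Proof.
  intros. replace (up2 a b) with (un (sing a) (sing b)).
  - apply (cl_un HD); apply (cl_sing HD); auto.
  - apply ext; intros z. rewrite un_spec, !sing_spec, up2_spec; tauto.
Qed.
Lemma D_pr a b : D a -> D b -> D (pr a b). Proof. intros; apply D_up2; apply D_up2; auto. Qed.
Lemma D_suc a : D a -> D (suc a). Proof. intros; apply (cl_un HD); auto; apply (cl_sing HD); auto. Qed.
Lemma D_nm k : D (nm k). Proof. induction k; [apply (cl_emp HD)|apply D_suc; auto]. Qed.
Lemma D_pr1 a b : D (pr a b) -> D a.
Proof. intros H. apply D_in with (up2 a a); [apply (D_in H)|]; apply up2_spec; auto. Qed.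
Lemma D_pr2 a b : D (pr a b) -> D b.
Proof. intros H. apply D_in with (up2 a b); [apply (D_in H)|]; apply up2_spec; auto. Qed.
Lemma D_sucI a : D (suc a) -> D a. Proof. intros H; apply (D_in H), in_suc. Qed.
(** A natural number is the first component of a pair in [shf]; in this way a closed class contains
    all of them. *)
Lemma D_Nat n : Nat n -> D n.
Proof.
  intros H. apply (@D_pr1 n (suc n)). apply D_in with shf; [apply (cl_shf HD)|]. apply shf_spec; eauto.
Qed.
Lemma D_kMem a b : D a -> D b -> D (kMem a b). Proof. intros; repeat apply D_pr; auto; apply (D_nm 0). Qed.
Lemma D_kEq a b : D a -> D b -> D (kEq a b). Proof. intros; repeat apply D_pr; auto; apply (D_nm 1). Qed.
Lemma D_kNeg a : D a -> D (kNeg a). Proof. intros; repeat apply D_pr; auto; apply (D_nm 2). Qed.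
Lemma D_kImp a b : D a -> D b -> D (kImp a b). Proof. intros; repeat apply D_pr; auto; apply (D_nm 3). Qed.
Lemma D_kAll a : D a -> D (kAll a). Proof. intros; repeat apply D_pr; auto; apply (D_nm 4). Qed.

Lemma den_var d e x u : vv d e x u -> den d e (var x) u.
Proof. intros H. split; [apply H|]. intros d' e' He y v Hy. apply (r_eq Hy), (vv_ext He H). Qed.
Lemma den_d0 d e : den d e d0 emp.
Proof.
  split; [apply (cl_emp HD)|]. intros d' e' He y v Hy. unfold Defs.d0.
  rewrite (r_all (Q := fun a => ~ a ∈ v)).
  - split; [|intros -> a _; apply emp_spec]. intros H. apply ext; intros z. split; intros Hz.
    + destruct (H z); auto. apply (D_in (proj2 (proj2 Hy)) Hz).
    + destruct (emp_spec Hz).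
  - intros a Ha. apply r_neg, r_mem; auto using vv_new, vv_old.
Qed.
Lemma den_S d e t a : den d e t a -> den d e (dS t) (suc a).
Proof.
  intros Ht. split; [apply D_suc, Ht|]. intros d' e' He y v Hy. unfold dS.
  rewrite (r_ex (Q := fun b => b = a /\ forall z, D z -> (z ∈ v <-> z ∈ b \/ z = b))).
  - split.
    + intros (b & Hb & -> & H). apply ext; intros z. rewrite suc_spec. split.
      * intros Hz. apply H; auto. apply (D_in (proj2 (proj2 Hy)) Hz).
      * intros Hz. apply H; auto. destruct Hz as [Hz| ->]; auto. apply (D_in Hb Hz).
    + intros ->. exists a. split; [apply Ht|]. split; auto. intros z _. apply suc_spec.
  - intros b Hb. apply r_and; [apply r_term; [|apply vv_new, Hb]|].
    + apply den_old. apply (den_ext He Ht).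
    + apply r_all. intros z Hz. apply r_iff; [|apply r_or].
      * apply r_mem; auto using vv_new, vv_old.
      * apply r_mem; auto using vv_new, vv_old.
      * apply r_eq; auto using vv_new, vv_old.
Qed.
Lemma den_num d e k : den d e (dnum k) (nm k).
Proof. induction k; simpl; [apply den_d0|apply den_S; auto]. Qed.
Lemma den_upair d e s t a b : den d e s a -> den d e t b -> den d e (dupair s t) (up2 a b).
Proof.
  intros Hs Ht. split; [apply D_up2; [apply Hs|apply Ht]|]. intros d' e' He y v Hy. unfold dupair.
  rewrite (r_ex (Q := fun a' => exists b', D b' /\ (a' = a /\ b' = b /\ forall z, D z -> (z ∈ v <-> z = a' \/ z = b')))).
  - split.
    + intros (a' & Ha & b' & Hb & -> & -> & H). apply ext; intros z. rewrite up2_spec. split.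
      * intros Hz. apply H; auto. apply (D_in (proj2 (proj2 Hy)) Hz).
      * intros Hz. apply H; auto. destruct Hz as [->| ->]; auto.
    + intros ->. exists a. split; [apply Hs|]. exists b; split; [apply Ht|]. repeat split; auto; apply up2_spec.
  - intros a' Ha'. apply r_ex. intros b' Hb'. apply r_and; [|apply r_and].
    + apply r_term; [|auto using vv_new, vv_old]. apply den_old, den_old, (den_ext He Hs).
    + apply r_term; [|auto using vv_new, vv_old]. apply den_old, den_old, (den_ext He Ht).
    + apply r_all. intros z Hz. apply r_iff; [|apply r_or].
      * apply r_mem; auto using vv_new, vv_old.
      * apply r_eq; auto using vv_new, vv_old.
      * apply r_eq; auto using vv_new, vv_old.
Qed.
Lemma den_pair d e s t a b : den d e s a -> den d e t b -> den d e (dpair s t) (pr a b).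
Proof.
  intros Hs Ht. split; [apply D_pr; [apply Hs|apply Ht]|]. intros d' e' He y v Hy. unfold dpair.
  rewrite (r_ex (Q := fun a' => exists b', D b' /\ (a' = a /\ b' = b /\ v = pr a' b'))).
  - split.
    + intros (a' & Ha & b' & Hb & -> & -> & H). auto.
    + intros ->. exists a. split; [apply Hs|]. exists b; split; [apply Ht|]. repeat split; auto.
  - intros a' Ha'. apply r_ex. intros b' Hb'. apply r_and; [|apply r_and].
    + apply r_term; [|auto using vv_new, vv_old]. apply den_old, den_old, (den_ext He Hs).
    + apply r_term; [|auto using vv_new, vv_old]. apply den_old, den_old, (den_ext He Ht).
    + apply r_term; [|auto using vv_new, vv_old]. apply den_upair; apply den_upair; apply den_var; auto using vv_new, vv_old.
Qed.
Lemma den_cMem d e s t a b : den d e s a -> den d e t b -> den d e (cMem s t) (kMem a b).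
Proof. intros; apply den_pair; [apply (den_num d e 0)|apply den_pair; auto]. Qed.
Lemma den_cEq d e s t a b : den d e s a -> den d e t b -> den d e (cEq s t) (kEq a b).
Proof. intros; apply den_pair; [apply (den_num d e 1)|apply den_pair; auto]. Qed.
Lemma den_cNeg d e s a : den d e s a -> den d e (cNeg s) (kNeg a).
Proof. intros; apply den_pair; [apply (den_num d e 2)|auto]. Qed.
Lemma den_cImp d e s t a b : den d e s a -> den d e t b -> den d e (cImp s t) (kImp a b).
Proof. intros; apply den_pair; [apply (den_num d e 3)|apply den_pair; auto]. Qed.
Lemma den_cAll d e s a : den d e s a -> den d e (cAll s) (kAll a).
Proof. intros; apply den_pair; [apply (den_num d e 4)|auto]. Qed.
Lemma den_interp d e p : den d e (interp code_syntax p) (interp (k_syntax S) p).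
Proof. induction p; simpl; auto using den_cMem, den_cEq, den_cNeg, den_cImp, den_cAll, den_num. Qed.
End Sem.

Lemma interp_cd (S : kpm) p : interp (k_syntax S) p = cd p.
Proof. induction p; cbn [cd]; rewrite <- ?IHp, <- ?IHp1, <- ?IHp2; reflexivity. Qed.

Section Sem2.
Variable S : kpm.
Variable D : S -> Prop.
Hypothesis HD : closed D.
Notation Sn := Datatypes.S.
Notation vv := (vv D).
Notation den := (den D).

Lemma Dp1 c a b : D c -> c = pr a b -> D a. Proof. intros H ->; exact (D_pr1 HD H). Qed.
Lemma Dp2 c a b : D c -> c = pr a b -> D b. Proof. intros H ->; exact (D_pr2 HD H). Qed.
Lemma Dq1 f a b : D f -> pr a b ∈ f -> D a. Proof. intros H H1. exact (D_pr1 HD (D_in HD H H1)). Qed.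
Lemma Dq2 f a b : D f -> pr a b ∈ f -> D b. Proof. intros H H1. exact (D_pr2 HD (D_in HD H H1)). Qed.
Lemma Dq3 f a b c : D f -> pr a (pr b c) ∈ f -> D b. Proof. intros H H1. exact (D_pr1 HD (Dq2 H H1)). Qed.
Lemma Dq4 f a b c : D f -> pr a (pr b c) ∈ f -> D c. Proof. intros H H1. exact (D_pr2 HD (Dq2 H H1)). Qed.
Lemma Dk1 c a b : D c -> c = kMem a b -> D a. Proof. intros H ->; exact (D_pr1 HD (D_pr2 HD H)). Qed.
Lemma Dk2 c a b : D c -> c = kMem a b -> D b. Proof. intros H ->; exact (D_pr2 HD (D_pr2 HD H)). Qed.
Lemma Dk3 c a b : D c -> c = kEq a b -> D a. Proof. intros H ->; exact (D_pr1 HD (D_pr2 HD H)). Qed.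
Lemma Dk4 c a b : D c -> c = kEq a b -> D b. Proof. intros H ->; exact (D_pr2 HD (D_pr2 HD H)). Qed.
Lemma Dk5 c a : D c -> c = kNeg a -> D a. Proof. intros H ->; exact (D_pr2 HD H). Qed.
Lemma Dk6 c a b : D c -> c = kImp a b -> D a. Proof. intros H ->; exact (D_pr1 HD (D_pr2 HD H)). Qed.
Lemma Dk7 c a b : D c -> c = kImp a b -> D b. Proof. intros H ->; exact (D_pr2 HD (D_pr2 HD H)). Qed.
Lemma Dk8 c a : D c -> c = kAll a -> D a. Proof. intros H ->; exact (D_pr2 HD H). Qed.
Lemma Dk9 c a b y : D c -> c = kAll (kImp (kMem (nm 0) (suc y)) a) -> b = a -> D b.
Proof. intros H -> ->; exact (D_pr2 HD (D_pr2 HD (D_pr2 HD H))). Qed.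
Lemma Ds1 c a : D c -> c = suc a -> D a. Proof. intros H ->; exact (D_sucI HD H). Qed.
Lemma Ds2 c a : D a -> c = suc a -> D c. Proof. intros H ->; exact (D_suc HD H). Qed.
Lemma De c : c = emp -> D c. Proof. intros ->; apply (cl_emp HD). Qed.
Lemma Dn1 c : c = nm 1 -> D c. Proof. intros ->; apply (D_nm HD 1). Qed.
Lemma Deq a b : a = b -> D b -> D a. Proof. intros ->; auto. Qed.
Lemma Dpk a b : D a -> D b -> D (pr a b). Proof. apply (D_pr HD). Qed.

End Sem2.

Ltac dnt := first
  [ eassumption
  | simple apply den_pair; [eassumption|dnt|dnt]
  | simple apply den_cMem; [eassumption|dnt|dnt]
  | simple apply den_cEq; [eassumption|dnt|dnt]
  | simple apply den_cNeg; [eassumption|dnt]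
  | simple apply den_cImp; [eassumption|dnt|dnt]
  | simple apply den_cAll; [eassumption|dnt]
  | simple apply den_S; [eassumption|dnt]
  | simple apply (fun S D HD d e => @den_num S D HD d e 1); eassumption
  | simple apply den_num; eassumption
  | simple apply den_d0; eassumption
  | simple apply den_var; eassumption ].

Ltac updv a :=
  repeat match goal with
  | H : vv ?D ?d ?e ?x ?u |- tsat _ _ (sc a ?e) _ <-> _ => apply (@vv_old _ _ d e a x u) in H
  | H : den ?D ?d ?e ?t ?u |- tsat _ _ (sc a ?e) _ <-> _ => apply (@den_old _ _ d e a t u) in H
  end.

Ltac vclean :=
  repeat match goal with
  | H : vv _ _ _ _ _ |- _ => destruct H as (_ & _ & H)
  end.

Ltac dbrk := repeat match goal with
  | H : exists _, _ |- _ => destruct H as [? H]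
  | H : _ /\ _ |- _ => destruct H
  | H : _ \/ _ |- _ => destruct H
  end.


(** The goals ask whether a component of a set in [D] is in [D]; the search climbs along the
    hypotheses from a set to one that contains it, and the fuel stops cycles. *)
Ltac solveD0 HD fuel :=
  lazymatch fuel with O => fail | S ?n =>
  first [ assumption
        | match goal with
          | H : Nat ?a |- _ ?a => apply (D_Nat HD H)
          | H : pr ?a ?b ∈ ?f |- _ ?a => apply (Dq1 HD (f := f) (a := a) (b := b)); [solveD0 HD n|exact H]
          | H : pr ?a ?b ∈ ?f |- _ ?b => apply (Dq2 HD (f := f) (a := a) (b := b)); [solveD0 HD n|exact H]
          | H : pr ?a (pr ?b ?c) ∈ ?f |- _ ?b => apply (Dq3 HD (f := f) (a := a) (b := b) (c := c)); [solveD0 HD n|exact H]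
          | H : pr ?a (pr ?b ?c) ∈ ?f |- _ ?c => apply (Dq4 HD (f := f) (a := a) (b := b) (c := c)); [solveD0 HD n|exact H]
          | H : ?c = kMem ?a ?b |- _ ?a => apply (Dk1 HD (c := c) (a := a) (b := b)); [solveD0 HD n|exact H]
          | H : ?c = kMem ?a ?b |- _ ?b => apply (Dk2 HD (c := c) (a := a) (b := b)); [solveD0 HD n|exact H]
          | H : ?c = kEq ?a ?b |- _ ?a => apply (Dk3 HD (c := c) (a := a) (b := b)); [solveD0 HD n|exact H]
          | H : ?c = kEq ?a ?b |- _ ?b => apply (Dk4 HD (c := c) (a := a) (b := b)); [solveD0 HD n|exact H]
          | H : ?c = kNeg ?a |- _ ?a => apply (Dk5 HD (c := c) (a := a)); [solveD0 HD n|exact H]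
          | H : ?c = kImp ?a ?b |- _ ?a => apply (Dk6 HD (c := c) (a := a) (b := b)); [solveD0 HD n|exact H]
          | H : ?c = kImp ?a ?b |- _ ?b => apply (Dk7 HD (c := c) (a := a) (b := b)); [solveD0 HD n|exact H]
          | H : ?c = kAll (kImp (kMem (nm 0) (suc ?y)) ?a) |- _ ?a => apply (Dk9 HD (c := c) (a := a) (y := y) (b := a)); [solveD0 HD n|exact H|reflexivity]
          | H : ?c = kAll ?a |- _ ?a => apply (Dk8 HD (c := c) (a := a)); [solveD0 HD n|exact H]
          | H : ?c = pr ?a ?b |- _ ?a => apply (Dp1 HD (c := c) (a := a) (b := b)); [solveD0 HD n|exact H]
          | H : ?c = pr ?a ?b |- _ ?b => apply (Dp2 HD (c := c) (a := a) (b := b)); [solveD0 HD n|exact H]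
          | H : ?c = suc ?a |- _ ?a => apply (Ds1 HD (c := c) (a := a)); [solveD0 HD n|exact H]
          | H : ?c = suc ?a |- _ ?c => apply (Ds2 HD (c := c) (a := a)); [solveD0 HD n|exact H]
          | H : ?c = emp |- _ ?c => apply (De HD H)
          | H : ?c = nm 1 |- _ ?c => apply (Dn1 HD H)
          | H : ?x ∈ ?y |- _ ?x => apply (D_in HD (y := y)); [solveD0 HD n|exact H]
          | H : ?x = ?y |- _ ?x => apply (Deq H); solveD0 HD n
          | |- _ emp => apply (cl_emp HD)
          | |- _ (suc _) => apply (D_suc HD); solveD0 HD n
          | |- _ (pr _ _) => apply (Dpk HD); solveD0 HD n
          end ] end.
Ltac solveD := vclean; match goal with HD : closed _ |- _ => solveD0 HD 6 end.
Ltac solveEx := let a := fresh "a" in let H := fresh "H" in intros a H; cbv beta in H; dbrk; solveD.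
Ltac solveAl := let a := fresh "a" in let N := fresh "N" in let ND := fresh "ND" in
  intros a N; apply NNPP; intros ND; apply N; clear N; cbv beta; intros; try (split; intros); exfalso; apply ND; dbrk; solveD.

Ltac rth := fail.
(** Reads the meaning of a formula off its structure. The hook [rth] supplies the notions already
    treated, so that later characterizations do not unfold earlier ones. *)
Ltac rt :=
  cbv beta;
  lazymatch goal with
  | |- tsat _ _ _ (pand _ _ _) <-> _ => simple apply r_and; rt
  | |- tsat _ _ _ (por _ _ _) <-> _ => simple apply r_or; rt
  | |- tsat _ _ _ (pimp _ _ _) <-> _ => simple apply r_imp; rt
  | |- tsat _ _ _ (piff _ _ _) <-> _ => simple apply r_iff; rt
  | |- tsat _ _ _ (pneg _ _) <-> _ => simple apply r_neg; rt
  | |- tsat _ _ _ (pmem _ _ _) <-> _ => simple eapply r_mem; eassumption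
  | |- tsat _ _ _ (peq _ _ _) <-> _ => simple eapply r_eq; eassumption
  | |- tsat _ _ _ (is_in _ _ _) <-> _ => simple eapply r_in; [dnt|eassumption]
  | |- tsat _ _ _ (pex _ _) <-> _ =>
      first [ simple apply r_ex; rtb | simple apply r_exB; [solveEx|rtb] ]
  | |- tsat _ _ _ (pall _ _) <-> _ =>
      first [ simple apply r_all; rtb | simple apply r_allB; [solveAl|rtb] ]
  | |- _ => first [ rth | simple eapply r_term; [dnt|eassumption] | idtac ]
  end
with rtb :=
  let a := fresh "a" in let Ha := fresh "Ha" in intros a Ha; cbv beta;
  match goal with |- tsat _ ?D (sc a ?e) (_ (Datatypes.S ?d)) <-> _ => updv a; pose proof (@vv_new _ D d e a Ha) | |- _ => idtac end;
  rt.

(** * The meaning of the individual formulas in a closed class *)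

Section Char.
Variable S : kpm.
Variable D : S -> Prop.
Hypothesis HD : closed D.
Notation Sn := Datatypes.S.
Notation vv := (vv D).

Variables (d : nat) (e : nat -> S).

Lemma r_trans x u : vv d e x u -> (dsat D e (is_trans x d) <-> trans u).
Proof.
  intros H. unfold is_trans. transitivity (forall y z, y ∈ u /\ z ∈ y -> z ∈ u).
  - rt.
  - unfold trans; split; intros H1; [intros; eapply H1; eauto|intros y z [H2 H3]; eauto].
Qed.
End Char.
Ltac rth1 := simple eapply r_trans; eassumption.
Ltac rth ::= rth1.

Section Char2.
Variable S : kpm.
Variable D : S -> Prop.
Hypothesis HD : closed D.
Notation Sn := Datatypes.S.
Notation vv := (vv D).

Lemma r_ord d e x u : vv d e x u -> (dsat D e (is_ord x d) <-> isord u).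
Proof. intros H. unfold is_ord, isord. rt. Qed.
Lemma r_fun d e x u : vv d e x u -> (dsat D e (is_fun x d) <-> isfun u).
Proof. intros H. unfold is_fun, isfun. rt. Qed.
Lemma r_nat d e x u : vv d e x u -> (dsat D e (is_nat x d) <-> Nat u).
Proof.
  intros H. unfold is_nat. transitivity (isord u /\ (u = emp \/ exists k, u = suc k) /\ forall m, m ∈ u -> m = emp \/ exists k, m = suc k).
  - pose proof (@r_ord d e x u H). apply r_and; [auto|]. rt.
  - unfold isord, Nat. tauto.
Qed.
End Char2.
Lemma DFm (S : kpm) (D : S -> Prop) (HD : closed D) c : Fm D c -> D c.
Proof. intros (n & _ & W & HW & H & _). exact (Dq2 HD HW H). Qed.
Lemma DBd (S : kpm) (D : S -> Prop) (HD : closed D) n c : Bd D n c -> D c.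
Proof. intros (W & HW & H & _). exact (Dq2 HD HW H). Qed.
Lemma DBd1 (S : kpm) (D : S -> Prop) (HD : closed D) n c : Bd D n c -> D n.
Proof. intros (W & HW & H & _). exact (Dq1 HD HW H). Qed.
Lemma DD0 (S : kpm) (D : S -> Prop) (HD : closed D) c : D0c D c -> D c.
Proof. intros (W & HW & H & _). exact (D_in HD HW H). Qed.
Lemma DRn1 (S : kpm) (D : S -> Prop) (HD : closed D) r c c' : Rn D r c c' -> D c.
Proof. intros (W & HW & H & _). exact (Dq3 HD HW H). Qed.
Lemma DRn2 (S : kpm) (D : S -> Prop) (HD : closed D) r c c' : Rn D r c c' -> D c'.
Proof. intros (W & HW & H & _). exact (Dq4 HD HW H). Qed.

Ltac solveD1 HD := first
  [ solveD0 HD 6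
  | match goal with
    | H : Fm _ ?a |- _ ?a => exact (DFm HD H)
    | H : Bd _ _ ?a |- _ ?a => exact (DBd HD H)
    | H : Bd _ ?a _ |- _ ?a => exact (DBd1 HD H)
    | H : D0c _ ?a |- _ ?a => exact (DD0 HD H)
    | H : Rn _ _ ?a _ |- _ ?a => exact (DRn1 HD H)
    | H : Rn _ _ _ ?a |- _ ?a => exact (DRn2 HD H)
    end ].
Ltac solveD ::= vclean; match goal with HD : closed _ |- _ => solveD1 HD end.

Section Char3.
Variable S : kpm.
Variable D : S -> Prop.
Hypothesis HD : closed D.
Notation Sn := Datatypes.S.
Notation vv := (vv D).
Notation den := (den D).

Section Den.
Variables (d : nat) (e : nat -> S).
Notation dn s a := (den d e s a).
Lemma den_imp s t a b : dn s a -> dn t b -> dn (@imp dterm code_syntax s t) (@imp S (k_syntax S) a b).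
Proof. apply (den_cImp HD). Qed.
Lemma den_neg s a : dn s a -> dn (@neg dterm code_syntax s) (@neg S (k_syntax S) a).
Proof. apply (den_cNeg HD). Qed.
Lemma den_all s a : dn s a -> dn (@all dterm code_syntax s) (@all S (k_syntax S) a).
Proof. apply (den_cAll HD). Qed.
Lemma den_mem i j : dn (@mem dterm code_syntax i j) (@mem S (k_syntax S) i j).
Proof. apply (den_interp HD d e (Mem i j)). Qed.
Lemma den_eql i j : dn (@eql dterm code_syntax i j) (@eql S (k_syntax S) i j).
Proof. apply (den_interp HD d e (Eq i j)). Qed.
Ltac dk := repeat first [assumption | simple apply den_imp | simple apply den_neg | simple apply den_all | simple apply den_mem | simple apply den_eql].
Lemma den_Ex s a : dn s a -> dn (@Ex dterm code_syntax s) (@Ex S (k_syntax S) a).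
Proof. intros; unfold Ex; dk. Qed.
Lemma den_K s t a b : dn s a -> dn t b -> dn (ax_K s t) (ax_K a b).
Proof. intros; unfold ax_K; dk. Qed.
Lemma den_Sx s t r a b c : dn s a -> dn t b -> dn r c -> dn (ax_S s t r) (ax_S a b c).
Proof. intros; unfold ax_S; dk. Qed.
Lemma den_N s t a b : dn s a -> dn t b -> dn (ax_N s t) (ax_N a b).
Proof. intros; unfold ax_N; dk. Qed.
Lemma den_dist s t a b : dn s a -> dn t b -> dn (ax_dist s t) (ax_dist a b).
Proof. intros; unfold ax_dist; dk. Qed.
Lemma den_vac s t a b : dn s a -> dn t b -> dn (ax_vac s t) (ax_vac a b).
Proof. intros; unfold ax_vac; dk. Qed.
Lemma den_inst s t a b : dn s a -> dn t b -> dn (ax_inst s t) (ax_inst a b).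
Proof. intros; unfold ax_inst; dk. Qed.
Lemma den_sep s a : dn s a -> dn (separation s) (separation a).
Proof. intros; unfold separation, Ex, Iff, And; dk. Qed.
Lemma den_coll s t a b : dn s a -> dn t b -> dn (collection s t) (collection a b).
Proof. intros; unfold collection, Ex, Iff, And; dk. Qed.
Lemma den_ind s t a b : dn s a -> dn t b -> dn (induction s t) (induction a b).
Proof. intros; unfold induction; dk. Qed.
Lemma den_refl : dn eq_refl_ax eq_refl_ax. Proof. unfold eq_refl_ax; dk. Qed.
Lemma den_eucl : dn eq_eucl_ax eq_eucl_ax. Proof. unfold eq_eucl_ax; dk. Qed.
Lemma den_meml : dn eq_mem_l_ax eq_mem_l_ax. Proof. unfold eq_mem_l_ax; dk. Qed.
Lemma den_memr : dn eq_mem_r_ax eq_mem_r_ax. Proof. unfold eq_mem_r_ax; dk. Qed.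
Lemma den_ext' : dn extensionality extensionality. Proof. unfold extensionality, Ex, Iff, And, Or; dk. Qed.
Lemma den_union : dn union union. Proof. unfold union, Ex, Iff, And, Or; dk. Qed.
Lemma den_pairing : dn pairing pairing. Proof. unfold pairing, Ex, Iff, And, Or; dk. Qed.
Lemma den_infinity : dn infinity infinity. Proof. unfold infinity, Ex, Iff, And, Or; dk. Qed.
Lemma den_rel_L_ex s t a b : dn s a -> dn t b -> dn (rel_L_ex s t) (rel_L_ex a b).
Proof. intros; unfold rel_L_ex, BEx, BAll; dk; apply (den_interp HD). Qed.
End Den.
End Char3.

Ltac dnk := first
  [ simple apply den_Ex; [eassumption|dnt] | simple apply den_K; [eassumption|dnt|dnt] | simple apply den_Sx; [eassumption|dnt|dnt|dnt]
  | simple apply den_N; [eassumption|dnt|dnt] | simple apply den_dist; [eassumption|dnt|dnt] | simple apply den_vac; [eassumption|dnt|dnt]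
  | simple apply den_inst; [eassumption|dnt|dnt] | simple apply den_sep; [eassumption|dnt] | simple apply den_coll; [eassumption|dnt|dnt]
  | simple apply den_ind; [eassumption|dnt|dnt] | simple apply den_refl; eassumption | simple apply den_eucl; eassumption
  | simple apply den_meml; eassumption | simple apply den_memr; eassumption | simple apply den_ext'; eassumption
  | simple apply den_union; eassumption | simple apply den_pairing; eassumption | simple apply den_infinity; eassumption
  | simple apply den_rel_L_ex; [eassumption|dnt|dnt] ].
Ltac rth2 := first [ simple eapply r_trans; eassumption | simple eapply r_ord; eassumption | simple eapply r_fun; eassumption
  | simple eapply r_nat; eassumption | simple eapply r_term; [dnk|eassumption] ].
Ltac rth ::= rth2.

Opaque ax_K ax_S ax_N ax_dist ax_vac ax_inst eq_refl_ax eq_eucl_ax eq_mem_l_ax eq_mem_r_ax extensionality union pairing infinity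
  separation collection induction rel_L_ex Ex dpair dupair cMem cEq cNeg cImp cAll dS Defs.d0 pr up2 emp suc kMem kEq kNeg kImp kAll.

Section Char4.
Variable S : kpm.
Variable D : S -> Prop.
Hypothesis HD : closed D.
Notation Sn := Datatypes.S.
Notation vv := (vv D).

Lemma r_bounded d e n c u v : vv d e n u -> vv d e c v -> (dsat D e (is_bounded n c d) <-> Bd D u v).
Proof. intros H1 H2. unfold is_bounded, Bd, BW. rt. Qed.
Lemma r_form d e c v : vv d e c v -> (dsat D e (is_form c d) <-> Fm D v).
Proof.
  intros H2. unfold is_form, Fm. simple apply r_exB; [solveEx|].
  intros a Ha. apply r_and; [|apply r_bounded; auto using vv_new, vv_old]. eapply r_nat; auto using vv_new.
Qed.
Lemma r_Delta0 d e c v : vv d e c v -> (dsat D e (is_Delta0 c d) <-> D0c D v).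
Proof. intros H1. unfold is_Delta0, D0c, DW. rt. Qed.
Lemma r_shift d e c v : vv d e c v -> (dsat D e (is_shift c d) <-> ShfR v).
Proof. intros H1. unfold is_shift, ShfR. rt. Qed.
Lemma r_insR d e t c u v : vv d e t u -> vv d e c v -> (dsat D e (is_inst t c d) <-> InsR u v).
Proof. intros H1 H2. unfold is_inst, InsR. rt. Qed.
Lemma r_up d e t c u v : vv d e t u -> vv d e c v -> (dsat D e (is_up t c d) <-> UpR u v).
Proof. intros H1 H2. unfold is_up, UpR. rt. Qed.
End Char4.
Ltac rth3 := first [ simple eapply r_bounded; eassumption | simple eapply r_form; eassumption | simple eapply r_Delta0; eassumption
  | simple eapply r_shift; eassumption | simple eapply r_insR; eassumption | simple eapply r_up; eassumption | rth2 ].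
Ltac rth ::= rth3.

Section Char5.
Variable S : kpm.
Variable D : S -> Prop.
Hypothesis HD : closed D.
Notation Sn := Datatypes.S.
Notation vv := (vv D).

Lemma r_ren d e r c c' u v v' : vv d e r u -> vv d e c v -> vv d e c' v' -> (dsat D e (is_ren r c c' d) <-> Rn D u v v').
Proof. intros H1 H2 H3. unfold is_ren, Rn, RW. rt. Qed.
Lemma r_seq d e M n s u v w : vv d e M u -> vv d e n v -> vv d e s w -> (dsat D e (is_seq M n s d) <-> Seq u v w).
Proof. intros H1 H2 H3. unfold is_seq, Seq. rt. Qed.
Lemma r_scons d e a s s' u v w : vv d e a u -> vv d e s v -> vv d e s' w -> (dsat D e (is_scons a s s' d) <-> Scn u v w).
Proof. intros H1 H2 H3. unfold is_scons, Scn. rt. Qed.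
End Char5.
Ltac rth4 := first [ simple eapply r_ren; eassumption | simple eapply r_seq; eassumption | simple eapply r_scons; eassumption | rth3 ].
Ltac rth ::= rth4.

Section Char6.
Variable S : kpm.
Variable D : S -> Prop.
Hypothesis HD : closed D.
Notation Sn := Datatypes.S.
Notation vv := (vv D).

Lemma r_logical d e c v : vv d e c v -> (dsat D e (is_logical_axiom c d) <-> LA D v).
Proof. intros H1. unfold is_logical_axiom, LA. rt. Qed.

(** The literal reading of the formula, whose last clause quantifies over [x] and [s'] in [D]. An
    extended assignment is unique and the one demanded by [A] lies in [D], so this agrees with
    [SC]. *)
Definition SCD (M A W : S) := forall c s, pr c s ∈ A ->
      (exists i j x y, pr i x ∈ s /\ pr j y ∈ s /\
         (c = kMem i j /\ (pr c s ∈ W <-> x ∈ y) \/ c = kEq i j /\ (pr c s ∈ W <-> x = y)))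
   \/ (exists a, c = kNeg a /\ pr a s ∈ A /\ (pr c s ∈ W <-> ~ pr a s ∈ W))
   \/ (exists a b, c = kImp a b /\ pr a s ∈ A /\ pr b s ∈ A /\ (pr c s ∈ W <-> (pr a s ∈ W -> pr b s ∈ W)))
   \/ (exists a, c = kAll a /\ (forall x, x ∈ M -> exists s', Scn x s s' /\ pr a s' ∈ A) /\
         (pr c s ∈ W <-> forall x, D x -> forall s', D s' -> x ∈ M /\ Scn x s s' -> pr a s' ∈ W)).

Lemma Scn_fun (a s s1 s2 : S) : Scn a s s1 -> Scn a s s2 -> s1 = s2.
Proof. intros H1 H2. apply ext; intros q. rewrite (H1 q), (H2 q); tauto. Qed.

Lemma SCD_SC M A W : D M -> D A -> (SCD M A W <-> SC M A W).
Proof.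
  intros HM HA.
  assert (K : forall c s a, pr c s ∈ A -> (forall x, x ∈ M -> exists s', Scn x s s' /\ pr a s' ∈ A) ->
    ((forall x, D x -> forall s', D s' -> x ∈ M /\ Scn x s s' -> pr a s' ∈ W) <-> (forall x s', x ∈ M /\ Scn x s s' -> pr a s' ∈ W))).
  { intros c s a _ Hx. split; intros H x; [|intros _ s' _; apply H]. intros s' [H1 H2]. apply (H x).
    - exact (D_in HD HM H1).
    - destruct (Hx x H1) as (s'' & H3 & H4). rewrite (Scn_fun H2 H3). exact (Dq2 HD HA H4).
    - auto. }
  split; intros H c s Hc; destruct (H c s Hc) as [H1|[H1|[H1|(a & -> & H1 & H2)]]]; auto;
  right; right; right; exists a; (split; [auto|split; [auto|]]); rewrite H2; [|symmetry]; apply (K _ _ _ Hc H1).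
Qed.
Lemma r_sat d e M c s u v w : vv d e M u -> vv d e c v -> vv d e s w -> (dsat D e (is_sat M c s d) <-> St D u v w).
Proof.
  intros H1 H2 H3. unfold is_sat. transitivity (exists A W, D A /\ D W /\ pr v w ∈ A /\ pr v w ∈ W /\ SCD u A W).
  - transitivity (exists A, D A /\ exists W, D W /\ (pr v w ∈ A /\ pr v w ∈ W /\ SCD u A W)).
    + unfold SCD. rt.
    + split; intros (A & H); [destruct H as (HA & W & HW & H)|destruct H as (W & HA & HW & H)].
      * exists A, W; auto.
      * exists A; split; auto; exists W; auto.
  - destruct H1 as (_ & _ & H1).
    split; intros (A & W & HA & HW & H4 & H5 & H6); exists A, W; repeat split; auto; apply (SCD_SC W H1 HA); auto.
Qed.
End Char6.
Ltac rth5 := first [ simple eapply r_logical; eassumption | simple eapply r_sat; eassumption | rth4 ].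
Ltac rth ::= rth5.

Section Char7.
Variable S : kpm.
Variable D : S -> Prop.
Hypothesis HD : closed D.
Notation Sn := Datatypes.S.
Notation vv := (vv D).

Lemma r_model d e M c u v : vv d e M u -> vv d e c v -> (dsat D e (is_model M c d) <-> MD D u v).
Proof. intros H1 H2. unfold is_model, MD. rt. Qed.
Lemma r_true d e M c u v : vv d e M u -> vv d e c v -> (dsat D e (is_true_Sigma1 M c d) <-> TS D u v).
Proof. intros H1 H2. unfold is_true_Sigma1, TS. rt. Qed.
Lemma r_inDef d e M c u v : vv d e M u -> vv d e c v -> (dsat D e (in_Def M c d) <-> InD D u v).
Proof. intros H1 H2. unfold in_Def, InD. rt. Qed.
Lemma r_Sigma1 d e c v : vv d e c v -> (dsat D e (is_Sigma1 c d) <-> exists p, D0c D p /\ v = Ex p).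
Proof. intros H1. unfold is_Sigma1. rt. Qed.
Lemma r_provable d e tau (T : S -> Prop) c v :
  (forall d' e' y u, extd d e d' e' -> vv d' e' y u -> (dsat D e' (papp tau [y] d') <-> T u)) ->
  vv d e c v -> (dsat D e (is_provable tau c d) <-> PV D T v).
Proof. intros HT H1. unfold is_provable, PV, PW. rt. apply HT; auto. repeat (eapply extd_trans; [|apply extd_S]). apply extd_refl. Qed.
End Char7.
Ltac rth6 := first [ simple eapply r_model; eassumption | simple eapply r_inDef; eassumption | simple eapply r_Sigma1; eassumption | rth5 ].
Ltac rth ::= rth6.

Section Char8.
Variable S : kpm.
Variable D : S -> Prop.
Hypothesis HD : closed D.
Notation Sn := Datatypes.S.
Notation vv := (vv D).

Lemma r_L d e M c u v : vv d e M u -> vv d e c v -> (dsat D e (is_L M c d) <-> IsL D u v).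
Proof. intros H1 H2. unfold is_L, IsL. rt. Qed.
Lemma r_KP d e c v : vv d e c v -> (dsat D e (is_KP c d) <-> KPc D v).
Proof. intros H1. unfold is_KP, KPc. rt. Qed.
Lemma r_adm d e c v : vv d e c v -> (dsat D e (is_admissible c d) <-> Adm D v).
Proof.
  intros H1. unfold is_admissible, Adm. apply r_and; [eapply r_ord; eassumption|]. apply r_ex. intros a Ha.
  apply r_and; [apply r_L; auto using vv_new, vv_old|]. apply r_all. intros b Hb.
  apply r_imp; [apply r_KP; auto using vv_new|apply r_model; auto using vv_new, vv_old].
Qed.
End Char8.
Transparent ax_K ax_S ax_N ax_dist ax_vac ax_inst eq_refl_ax eq_eucl_ax eq_mem_l_ax eq_mem_r_ax extensionality union pairing infinity
  separation collection induction rel_L_ex Ex dpair dupair cMem cEq cNeg cImp cAll dS Defs.d0 pr up2 emp suc kMem kEq kNeg kImp kAll.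

Opaque Nat.

Lemma N_tr (S : kpm) (n : S) : Nat n -> trans n. Proof. intros H; exact (proj1 H). Qed.

(** * Codes: closure properties and finiteness *)

Section Codes.
Variable S : kpm.

Lemma deep2 (a b c : S) : a ∈ b -> b ∈ c -> deep a c. Proof. right; exists b; auto. Qed.
Lemma deep_pr2 (a b : S) : deep b (pr a b).
Proof. apply deep2 with (up2 a b); apply up2_spec; auto. Qed.
Lemma deep_Neg (a : S) : deep a (kNeg a). Proof. apply deep_pr2. Qed.
Lemma deep_All (a : S) : deep a (kAll a). Proof. apply deep_pr2. Qed.
Lemma deep_Imp1 (a b : S) : deep a (kImp a b).
Proof.
  right. exists (up2 (nm 3) (pr a b)). split; [apply up2_spec; auto|]. right. exists (pr a b). split; [apply up2_spec; auto|].
  right. exists (up2 a b). split; apply up2_spec; auto.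
Qed.
Lemma deep_Imp2 (a b : S) : deep b (kImp a b).
Proof.
  right. exists (up2 (nm 3) (pr a b)). split; [apply up2_spec; auto|]. right. exists (pr a b). split; [apply up2_spec; auto|].
  right. exists (up2 a b). split; apply up2_spec; auto.
Qed.

Lemma nm_inj i j : @nm S i = nm j -> i = j.
Proof.
  revert j; induction i; intros [|j] H; simpl in H; auto.
  - destruct (suc_emp (eq_sym H)).
  - destruct (suc_emp H).
  - f_equal. apply IHi, suc_inj, H.
Qed.

Ltac kinv H := unfold kMem, kEq, kNeg, kImp, kAll in H; repeat match type of H with
  | pr _ _ = pr _ _ => apply pr_inj in H
  | _ /\ _ => destruct H as [? H]
  end.
Lemma kNeg_inj (a b : S) : kNeg a = kNeg b -> a = b. Proof. intros H; kinv H; auto. Qed.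
Lemma kAll_inj (a b : S) : kAll a = kAll b -> a = b. Proof. intros H; kinv H; auto. Qed.
Lemma kImp_inj (a b c d : S) : kImp a b = kImp c d -> a = c /\ b = d. Proof. intros H; kinv H; auto. Qed.
Lemma kMem_inj (a b c d : S) : kMem a b = kMem c d -> a = c /\ b = d. Proof. intros H; kinv H; auto. Qed.
Lemma kEq_inj (a b c d : S) : kEq a b = kEq c d -> a = c /\ b = d. Proof. intros H; kinv H; auto. Qed.
Lemma tag_neq i j (a b : S) : i <> j -> pr (nm i) a <> pr (nm j) b.
Proof. intros N H. apply pr_inj in H as [H _]. apply N, (nm_inj H). Qed.

Lemma closed_True : closed (fun _ : S => True).
Proof. apply U_closed, isU_True. Qed.

(** ** Boundedness *)
Definition JB (W m c : S) :=
      (exists i j, i ∈ m /\ j ∈ m /\ (c = kMem i j \/ c = kEq i j))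
   \/ (exists a, c = kNeg a /\ pr m a ∈ W)
   \/ (exists a b, c = kImp a b /\ pr m a ∈ W /\ pr m b ∈ W)
   \/ (exists a, c = kAll a /\ pr (suc m) a ∈ W).
Lemma JB_mono (W W' m c : S) : (forall x, x ∈ W -> x ∈ W') -> JB W m c -> JB W' m c.
Proof. intros H [H1|[(a & H1)|[(a & b & H1)|(a & H1)]]]; [left|right; left; exists a|right; right; left; exists a, b|right; right; right; exists a]; intuition auto. Qed.
Lemma BW_add (W m c : S) : BW W -> JB W m c -> BW (un W (sing (pr m c))).
Proof.
  intros H H1 m' c' H2. apply (@JB_mono W); [intros; apply un_spec; auto|].
  apply un_spec in H2 as [H2|H2]; [apply H, H2|]. apply sing_spec, pr_inj in H2 as [-> ->]; auto.
Qed.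
Lemma BW_un (W W' : S) : BW W -> BW W' -> BW (un W W').
Proof.
  intros H H' m c H2. apply un_spec in H2 as [H2|H2]; [apply (@JB_mono W); [intros; apply un_spec; auto|apply H, H2]|].
  apply (@JB_mono W'); [intros; apply un_spec; auto|apply H', H2].
Qed.
Lemma BW_emp : BW (@emp S). Proof. intros m c H; destruct (emp_spec H). Qed.

Section WithD.
Variable D : S -> Prop.
Hypothesis HD : closed D.

Lemma Bd_intro W n c : D W -> BW W -> JB W n c -> D n -> D c -> Bd D n c.
Proof.
  intros HW H1 H2 Hn Hc. exists (un W (sing (pr n c))). repeat split.
  - apply (cl_un HD); auto. apply (cl_sing HD), (D_pr HD); auto.
  - apply un_spec; right; apply sing_spec; auto.
  - apply BW_add; auto.
Qed.
Lemma Bd_mem n i j : Nat n -> i ∈ n -> j ∈ n -> Bd D n (kMem i j).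
Proof.
  intros Hn Hi Hj. apply (@Bd_intro emp); auto using BW_emp, (cl_emp HD), (D_Nat HD).
  - left; eauto 6.
  - apply (D_kMem HD); apply (D_Nat HD), (N_mem Hn); auto.
Qed.
Lemma Bd_eq n i j : Nat n -> i ∈ n -> j ∈ n -> Bd D n (kEq i j).
Proof.
  intros Hn Hi Hj. apply (@Bd_intro emp); auto using BW_emp, (cl_emp HD), (D_Nat HD).
  - left; eauto 6.
  - apply (D_kEq HD); apply (D_Nat HD), (N_mem Hn); auto.
Qed.
Lemma Bd_neg n a : Bd D n a -> Bd D n (kNeg a).
Proof.
  intros (W & H1 & H2 & H3). apply (@Bd_intro W); auto.
  - right; left; eauto.
  - exact (Dq1 HD H1 H2).
  - apply (D_kNeg HD). exact (Dq2 HD H1 H2).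
Qed.
Lemma Bd_all n a : Bd D (suc n) a -> Bd D n (kAll a).
Proof.
  intros (W & H1 & H2 & H3). apply (@Bd_intro W); auto.
  - right; right; right; eauto.
  - exact (D_sucI HD (Dq1 HD H1 H2)).
  - apply (D_kAll HD). exact (Dq2 HD H1 H2).
Qed.
Lemma Bd_imp n a b : Bd D n a -> Bd D n b -> Bd D n (kImp a b).
Proof.
  intros (W & H1 & H2 & H3) (W' & H1' & H2' & H3'). apply (@Bd_intro (un W W')); auto using BW_un, (cl_un HD).
  - right; right; left. exists a, b; rewrite !un_spec; auto.
  - exact (Dq1 HD H1 H2).
  - apply (D_kImp HD); [exact (Dq2 HD H1 H2)|exact (Dq2 HD H1' H2')].
Qed.
Lemma Bd_inv n c : Bd D n c -> (exists i j, i ∈ n /\ j ∈ n /\ (c = kMem i j \/ c = kEq i j)) \/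
  (exists a, c = kNeg a /\ Bd D n a) \/ (exists a b, c = kImp a b /\ Bd D n a /\ Bd D n b) \/
  (exists a, c = kAll a /\ Bd D (suc n) a).
Proof.
  intros (W & H1 & H2 & H3). destruct (H3 n c H2) as [H|[(a & H & H4)|[(a & b & H & H4 & H5)|(a & H & H4)]]]; auto.
  - right; left. exists a; split; auto. exists W; auto.
  - right; right; left. exists a, b; repeat split; auto; exists W; auto.
  - right; right; right. exists a; split; auto. exists W; auto.
Qed.
End WithD.
Lemma Bd_sub (D D' : S -> Prop) n c : (forall x, D x -> D' x) -> Bd D n c -> Bd D' n c.
Proof. intros H (W & HW & H1); exists W; auto. Qed.

Definition fb : form := is_bounded 0 1 2.
Lemma vv_el1 (D : S -> Prop) a : D a -> vv D 1 (el [a]) 0 a. Proof. repeat split; auto. Qed.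
Lemma vv_el2 (D : S -> Prop) a b : D a -> D b -> vv D 2 (el [b; a]) 0 a /\ vv D 2 (el [b; a]) 1 b.
Proof. repeat split; auto. Qed.
Lemma vv_el3 (D : S -> Prop) a b c : D a -> D b -> D c ->
  vv D 3 (el [c; b; a]) 0 a /\ vv D 3 (el [c; b; a]) 1 b /\ vv D 3 (el [c; b; a]) 2 c.
Proof. repeat split; auto. Qed.
Lemma fb_ok (D : S -> Prop) (HD : closed D) n c : D n -> D c -> (dsat D (el [c; n]) fb <-> Bd D n c).
Proof. intros H1 H2. destruct (vv_el2 H1 H2). apply r_bounded; auto. Qed.

(** The given justification [W] may lie outside [z], but another one is built up along the code by
    induction, using only operations under which [z] is closed. Boundedness in [z] enters the
    induction as truth of [fb] in [z], which is Delta_0. *)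
Lemma Bd_cpt (z n c : S) : clset z -> Nat n -> Bd (fun _ => True) n c -> Bd (fun x => x ∈ z) n c.
Proof.
  intros Hz Hn (W & _ & H1 & H2).
  assert (A : forall c m c', pr m c' ∈ W -> c' = c -> Nat m -> c ∈ z /\ m ∈ z /\ dsat (fun x => x ∈ z) (el [c; m]) fb).
  { apply (@ind4 S (fun S e => forall m c', pr m c' ∈ e 1 -> c' = e 0 -> Nat m ->
      e 0 ∈ e 2 /\ m ∈ e 2 /\ dsat (fun x => x ∈ e 2) (el [e 0; m]) fb) [W; z]).
    - d0t.
    - simpl. intros x IH m c' H -> Hm.
      assert (IH' : forall m a, pr m a ∈ W -> Nat m -> deep a x -> Bd (fun x => x ∈ z) m a).
      { intros m' a Ha Hm' Hd. destruct (IH a Hd m' a Ha eq_refl Hm') as (A1 & A2 & A3). apply fb_ok in A3; auto. }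
      assert (B : Bd (fun x => x ∈ z) m x).
      { destruct (H2 _ _ H) as [(i & j & Hi & Hj & [->| ->])|[(a & -> & Ha)|[(a & b & -> & Ha & Hb)|(a & -> & Ha)]]].
        - apply Bd_mem; auto.
        - apply Bd_eq; auto.
        - apply Bd_neg; auto. apply IH'; auto. apply deep_Neg.
        - apply Bd_imp; auto; apply IH'; auto. apply deep_Imp1. apply deep_Imp2.
        - apply Bd_all; auto. apply IH'; auto using N_suc. apply deep_All. }
      pose proof (DBd Hz B). pose proof (DBd1 Hz B). repeat split; auto. apply fb_ok; auto. }
  destruct (A c n c H1 eq_refl Hn) as (A1 & A2 & A3). apply fb_ok in A3; auto.
Qed.
Lemma Fm_cpt (z c : S) : clset z -> Fm (fun _ => True) c -> Fm (fun x => x ∈ z) c.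
Proof. intros Hz (n & Hn & H). exists n; split; auto. apply Bd_cpt; auto. Qed.
Lemma Fm_sub (D D' : S -> Prop) c : (forall x, D x -> D' x) -> Fm D c -> Fm D' c.
Proof. intros H (n & Hn & H1); exists n; split; auto. eapply Bd_sub; eauto. Qed.

(** ** [Delta_0] codes *)
Definition JD (W c : S) :=
      (exists i j, Nat i /\ Nat j /\ (c = kMem i j \/ c = kEq i j))
   \/ (exists a, c = kNeg a /\ a ∈ W)
   \/ (exists a b, c = kImp a b /\ a ∈ W /\ b ∈ W)
   \/ (exists y a, Nat y /\ c = kAll (kImp (kMem (nm 0) (suc y)) a) /\ a ∈ W).
Lemma JD_mono (W W' c : S) : (forall x, x ∈ W -> x ∈ W') -> JD W c -> JD W' c.
Proof. intros H [H1|[(a & H1)|[(a & b & H1)|(y & a & H1)]]]; [left|right; left; exists a|right; right; left; exists a, b|right; right; right; exists y, a]; intuition auto. Qed.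
Lemma DW_add (W c : S) : DW W -> JD W c -> DW (un W (sing c)).
Proof.
  intros H H1 c' H2. apply (@JD_mono W); [intros; apply un_spec; auto|].
  apply un_spec in H2 as [H2|H2]; [apply H, H2|]. apply sing_spec in H2 as ->; auto.
Qed.
Lemma DW_un (W W' : S) : DW W -> DW W' -> DW (un W W').
Proof.
  intros H H' c H2. apply un_spec in H2 as [H2|H2]; [apply (@JD_mono W); [intros; apply un_spec; auto|apply H, H2]|].
  apply (@JD_mono W'); [intros; apply un_spec; auto|apply H', H2].
Qed.
Lemma DW_emp : DW (@emp S). Proof. intros c H; destruct (emp_spec H). Qed.

Section WithD1.
Variable D : S -> Prop.
Hypothesis HD : closed D.
Lemma D0c_intro W c : D W -> DW W -> JD W c -> D c -> D0c D c.
Proof.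
  intros HW H1 H2 Hc. exists (un W (sing c)). repeat split.
  - apply (cl_un HD); auto. apply (cl_sing HD); auto.
  - apply un_spec; right; apply sing_spec; auto.
  - apply DW_add; auto.
Qed.
Lemma D0c_mem i j : Nat i -> Nat j -> D0c D (kMem i j).
Proof.
  intros Hi Hj. apply (@D0c_intro emp); auto using DW_emp, (cl_emp HD).
  - left; eauto 6.
  - apply (D_kMem HD); apply (D_Nat HD); auto.
Qed.
Lemma D0c_eq i j : Nat i -> Nat j -> D0c D (kEq i j).
Proof.
  intros Hi Hj. apply (@D0c_intro emp); auto using DW_emp, (cl_emp HD).
  - left; eauto 6.
  - apply (D_kEq HD); apply (D_Nat HD); auto.
Qed.
Lemma D0c_neg a : D0c D a -> D0c D (kNeg a).
Proof.
  intros (W & H1 & H2 & H3). apply (@D0c_intro W); auto.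
  - right; left; eauto.
  - apply (D_kNeg HD), (D_in HD H1 H2).
Qed.
Lemma D0c_imp a b : D0c D a -> D0c D b -> D0c D (kImp a b).
Proof.
  intros (W & H1 & H2 & H3) (W' & H1' & H2' & H3'). apply (@D0c_intro (un W W')); auto using DW_un, (cl_un HD).
  - right; right; left. exists a, b; rewrite !un_spec; auto.
  - apply (D_kImp HD); [exact (D_in HD H1 H2)|exact (D_in HD H1' H2')].
Qed.
Lemma D0c_ball y a : Nat y -> D0c D a -> D0c D (kAll (kImp (kMem (nm 0) (suc y)) a)).
Proof.
  intros Hy (W & H1 & H2 & H3). apply (@D0c_intro W); auto.
  - right; right; right; eauto 6.
  - apply (D_kAll HD), (D_kImp HD); [|apply (D_in HD H1 H2)]. apply (D_kMem HD); [apply (D_nm HD)|apply (D_suc HD), (D_Nat HD), Hy].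
Qed.
Lemma D0c_inv c : D0c D c -> (exists i j, Nat i /\ Nat j /\ (c = kMem i j \/ c = kEq i j))
   \/ (exists a, c = kNeg a /\ D0c D a)
   \/ (exists a b, c = kImp a b /\ D0c D a /\ D0c D b)
   \/ (exists y a, Nat y /\ c = kAll (kImp (kMem (nm 0) (suc y)) a) /\ D0c D a).
Proof.
  intros (W & H1 & H2 & H3). destruct (H3 c H2) as [H|[(a & H & H4)|[(a & b & H & H4 & H5)|(y & a & Hy & H & H4)]]]; auto.
  - right; left. exists a; split; auto. exists W; auto.
  - right; right; left. exists a, b; repeat split; auto; exists W; auto.
  - right; right; right. exists y, a; split; [auto|split; [auto|exists W; auto]].
Qed.
End WithD1.
Lemma D0c_sub (D D' : S -> Prop) c : (forall x, D x -> D' x) -> D0c D c -> D0c D' c.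
Proof. intros H (W & HW & H1); exists W; auto. Qed.

Definition fd : form := is_Delta0 0 1.
Lemma fd_ok (D : S -> Prop) (HD : closed D) c : D c -> (dsat D (el [c]) fd <-> D0c D c).
Proof. intros H1. pose proof (vv_el1 H1). apply r_Delta0; auto. Qed.

Lemma D0_cpt (z c : S) : clset z -> D0c (fun _ => True) c -> D0c (fun x => x ∈ z) c.
Proof.
  intros Hz (W & _ & H1 & H2).
  (* A bounded universal quantifier skips a subformula of [c], so the induction also covers components of components. *)
  assert (A : forall c, (c ∈ W -> c ∈ z /\ dsat (fun x => x ∈ z) (el [c]) fd) /\
     forall a b, c = pr a b -> forall u v, b = pr u v -> v ∈ W -> v ∈ z /\ dsat (fun x => x ∈ z) (el [v]) fd).
  { apply (@ind4 S (fun S e => (e 0 ∈ e 1 -> e 0 ∈ e 2 /\ dsat (fun x => x ∈ e 2) (el [e 0]) fd) /\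
     forall a b, e 0 = pr a b -> forall u v, b = pr u v -> v ∈ e 1 -> v ∈ e 2 /\ dsat (fun x => x ∈ e 2) (el [v]) fd) [W; z]).
    - d0t.
    - simpl. intros x IH.
      assert (IH' : forall a, a ∈ W -> deep a x -> D0c (fun x => x ∈ z) a).
      { intros a Ha Hd. destruct (IH a Hd) as [A1 _]. destruct (A1 Ha) as (A2 & A3). apply fd_ok in A3; auto. }
      split.
      + intros Hx.
        assert (B : D0c (fun x => x ∈ z) x).
        { destruct (H2 _ Hx) as [(i & j & Hi & Hj & [->| ->])|[(a & -> & Ha)|[(a & b & -> & Ha & Hb)|(y & a & Hy & -> & Ha)]]].
          - apply D0c_mem; auto.
          - apply D0c_eq; auto.
          - apply D0c_neg; auto. apply IH'; auto. apply deep_Neg.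
          - apply D0c_imp; auto; apply IH'; auto. apply deep_Imp1. apply deep_Imp2.
          - apply D0c_ball; auto. destruct (IH _ (deep_All _)) as [_ A1].
            destruct (A1 _ _ eq_refl _ _ eq_refl Ha) as [A2 A3]. apply fd_ok in A3; auto. }
        pose proof (DD0 Hz B). repeat split; auto. apply fd_ok; auto.
      + intros a b -> u v -> Hv. assert (deep v (pr a (pr u v))).
        { right. exists (up2 a (pr u v)). split; [apply up2_spec; auto|]. right. exists (pr u v). split; [apply up2_spec; auto|].
          right. exists (up2 u v). split; apply up2_spec; auto. }
        pose proof (IH' v Hv H). pose proof (DD0 Hz H0). split; auto. apply fd_ok; auto. }
  destruct (A c) as [A1 _]. destruct (A1 H1) as [A2 A3]. apply fd_ok in A3; auto.
Qed.

(** ** Renaming *)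
Definition req (r r0 : S) := (forall n m, pr n m ∈ r -> pr n m ∈ r0) /\ (forall n m, pr n m ∈ r0 -> pr n m ∈ r).
Definition JR (W r c c' : S) :=
      (exists i j i' j', pr i i' ∈ r /\ pr j j' ∈ r /\
         (c = kMem i j /\ c' = kMem i' j' \/ c = kEq i j /\ c' = kEq i' j'))
   \/ (exists a a', c = kNeg a /\ c' = kNeg a' /\ pr r (pr a a') ∈ W)
   \/ (exists a b a' b', c = kImp a b /\ c' = kImp a' b' /\ pr r (pr a a') ∈ W /\ pr r (pr b b') ∈ W)
   \/ (exists a a' r', c = kAll a /\ c' = kAll a' /\ UpR r r' /\ pr r' (pr a a') ∈ W).
Lemma JR_mono (W W' r c c' : S) : (forall x, x ∈ W -> x ∈ W') -> JR W r c c' -> JR W' r c c'.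
Proof. intros H [H1|[(a & a' & H1)|[(a & b & a' & b' & H1)|(a & a' & r' & H1)]]]; [left|right; left; exists a, a'|right; right; left; exists a, b, a', b'|right; right; right; exists a, a', r']; intuition auto. Qed.
Lemma RW_add (W r c c' : S) : RW W -> JR W r c c' -> RW (un W (sing (pr r (pr c c')))).
Proof.
  intros H H1 r0 c0 c0' H2. apply (@JR_mono W); [intros; apply un_spec; auto|].
  apply un_spec in H2 as [H2|H2]; [apply H, H2|]. apply sing_spec, pr_inj in H2 as [-> H2]. apply pr_inj in H2 as [-> ->]; auto.
Qed.
Lemma RW_un (W W' : S) : RW W -> RW W' -> RW (un W W').
Proof.
  intros H H' r c c' H2. apply un_spec in H2 as [H2|H2]; [apply (@JR_mono W); [intros; apply un_spec; auto|apply H, H2]|].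
  apply (@JR_mono W'); [intros; apply un_spec; auto|apply H', H2].
Qed.
Lemma RW_emp : RW (@emp S). Proof. intros r c c' H; destruct (emp_spec H). Qed.
Lemma UpR_upr (r : S) : UpR r (upr r).
Proof.
  intros n m. rewrite upr_spec, pr_eq. split; [|].
  - intros [H|(n' & m' & H & H1)]; auto. apply pr_inj in H1 as [-> ->]. right; eauto 6.
  - intros [H|(n' & m' & -> & -> & H)]; auto. right; eauto 6.
Qed.
Lemma UpR_req (r r' r0 r0' : S) : req r r0 -> UpR r r' -> UpR r0 r0' -> req r' r0'.
Proof.
  intros [H1 H2] H3 H4. split; intros n m H; [apply H4; apply H3 in H|apply H3; apply H4 in H];
  (destruct H as [H|(n' & m' & A1 & A2 & A3)]; [auto|right; exists n', m'; auto]).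
Qed.
Section WithD2.
Variable D : S -> Prop.
Hypothesis HD : closed D.
Lemma Rn_intro W r c c' : D W -> RW W -> JR W r c c' -> D r -> D c -> D c' -> Rn D r c c'.
Proof.
  intros HW H1 H2 Hr Hc Hc'. exists (un W (sing (pr r (pr c c')))). repeat split.
  - apply (cl_un HD); auto. apply (cl_sing HD), (D_pr HD); auto. apply (D_pr HD); auto.
  - apply un_spec; right; apply sing_spec; auto.
  - apply RW_add; auto.
Qed.
Lemma Rn_mem r i j i' j' : D r -> pr i i' ∈ r -> pr j j' ∈ r -> Rn D r (kMem i j) (kMem i' j').
Proof.
  intros Hr Hi Hj. apply (@Rn_intro emp); auto using RW_emp, (cl_emp HD).
  - left; eauto 10.
  - apply (D_kMem HD); [exact (Dq1 HD Hr Hi)|exact (Dq1 HD Hr Hj)].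
  - apply (D_kMem HD); [exact (Dq2 HD Hr Hi)|exact (Dq2 HD Hr Hj)].
Qed.
Lemma Rn_eq r i j i' j' : D r -> pr i i' ∈ r -> pr j j' ∈ r -> Rn D r (kEq i j) (kEq i' j').
Proof.
  intros Hr Hi Hj. apply (@Rn_intro emp); auto using RW_emp, (cl_emp HD).
  - left; eauto 10.
  - apply (D_kEq HD); [exact (Dq1 HD Hr Hi)|exact (Dq1 HD Hr Hj)].
  - apply (D_kEq HD); [exact (Dq2 HD Hr Hi)|exact (Dq2 HD Hr Hj)].
Qed.
Lemma Rn_neg r a a' : Rn D r a a' -> Rn D r (kNeg a) (kNeg a').
Proof.
  intros H. pose proof (DRn1 HD H) as K1. pose proof (DRn2 HD H) as K2. destruct H as (W & H1 & H2 & H3). 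
  apply (@Rn_intro W); auto using (D_kNeg HD); [|exact (Dq1 HD H1 H2)].
  right; left; eauto 6.
Qed.
Lemma Rn_imp r a a' b b' : Rn D r a a' -> Rn D r b b' -> Rn D r (kImp a b) (kImp a' b').
Proof.
  intros H H'. pose proof (DRn1 HD H). pose proof (DRn2 HD H). pose proof (DRn1 HD H'). pose proof (DRn2 HD H').
  destruct H as (W & H4 & H5 & H6), H' as (W' & H4' & H5' & H6'). 
  apply (@Rn_intro (un W W')); auto using (D_kImp HD), (cl_un HD), RW_un; [|exact (Dq1 HD H4 H5)].
  right; right; left. exists a, b, a', b'. rewrite !un_spec; auto 6.
Qed.
Lemma Rn_all r r' a a' : D r -> UpR r r' -> Rn D r' a a' -> Rn D r (kAll a) (kAll a').
Proof.
  intros Hr Hu H. pose proof (DRn1 HD H) as K1. pose proof (DRn2 HD H) as K2. destruct H as (W & H1 & H2 & H3). 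
  apply (@Rn_intro W); auto using (D_kAll HD).
  right; right; right. exists a, a', r'; auto.
Qed.
Lemma Rn_inv r c c' : Rn D r c c' -> 
      (exists i j i' j', pr i i' ∈ r /\ pr j j' ∈ r /\
         (c = kMem i j /\ c' = kMem i' j' \/ c = kEq i j /\ c' = kEq i' j'))
   \/ (exists a a', c = kNeg a /\ c' = kNeg a' /\ Rn D r a a')
   \/ (exists a b a' b', c = kImp a b /\ c' = kImp a' b' /\ Rn D r a a' /\ Rn D r b b')
   \/ (exists a a' r', c = kAll a /\ c' = kAll a' /\ UpR r r' /\ Rn D r' a a').
Proof.
  intros (W & H1 & H2 & H3). destruct (H3 _ _ _ H2) as [H|[(a & a' & H & H4 & H5)|[(a & b & a' & b' & H & H4 & H5 & H6)|(a & a' & r' & H & H4 & H5 & H6)]]]; auto.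
  - right; left. exists a, a'; repeat split; auto. exists W; auto.
  - right; right; left. exists a, b, a', b'; repeat split; auto; exists W; auto.
  - right; right; right. exists a, a', r'; split; [auto|split; [auto|split; [auto|exists W; auto]]].
Qed.
End WithD2.
Lemma Rn_sub (D D' : S -> Prop) r c c' : (forall x, D x -> D' x) -> Rn D r c c' -> Rn D' r c c'.
Proof. intros H (W & HW & H1); exists W; auto. Qed.

Definition fr : form := is_ren 0 1 2 3.
Lemma fr_ok (D : S -> Prop) (HD : closed D) r c c' : D r -> D c -> D c' -> (dsat D (el [c'; c; r]) fr <-> Rn D r c c').
Proof. intros H1 H2 H3. destruct (vv_el3 H1 H2 H3) as (A1 & A2 & A3). apply r_ren; auto. Qed.

(** The conditions on renamings concern pairs only, so [r] may have further members and lie outside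
    [z]; hence the conclusion is about any [r0] in [z] with the same pairs. Below a quantifier the
    induction passes to [upr r0], which is again in [z]. *)
Lemma Rn_cpt (z r r0 c c' : S) : clset z -> r0 ∈ z -> req r r0 -> Rn (fun _ => True) r c c' -> Rn (fun x => x ∈ z) r0 c c'.
Proof.
  intros Hz Hr0 Hreq (W & _ & H1 & H2).
  assert (A : forall c, forall r q, pr r q ∈ W -> forall c0 c', q = pr c0 c' -> c0 = c -> forall r0, r0 ∈ z ->
     ((forall n m, pr n m ∈ r -> pr n m ∈ r0) /\ (forall n m, pr n m ∈ r0 -> pr n m ∈ r)) -> 
     c ∈ z /\ c' ∈ z /\ dsat (fun x => x ∈ z) (el [c'; c; r0]) fr).
  { apply (@ind4 S (fun S e => forall r q, pr r q ∈ e 1 -> forall c0 c', q = pr c0 c' -> c0 = e 0 -> forall r0, r0 ∈ e 2 ->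
     ((forall n m, pr n m ∈ r -> pr n m ∈ r0) /\ (forall n m, pr n m ∈ r0 -> pr n m ∈ r)) -> 
     e 0 ∈ e 2 /\ c' ∈ e 2 /\ dsat (fun x => x ∈ e 2) (el [c'; e 0; r0]) fr) [W; z]).
    - d0t.
    - simpl. intros x IH r1 q Hq c0 c1 -> -> r2 Hr2 [Hq1 Hq2].
      assert (IH' : forall r r0 a a', pr r (pr a a') ∈ W -> r0 ∈ z -> req r r0 -> deep a x -> Rn (fun x => x ∈ z) r0 a a').
      { intros r' r0' a a' Ha Hr' [B1 B2] Hd. destruct (IH a Hd r' _ Ha a a' eq_refl eq_refl r0' Hr' (conj B1 B2)) as (A1 & A2 & A3).
        apply fr_ok in A3; auto. }
      assert (B : Rn (fun x => x ∈ z) r2 x c1).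
      { destruct (H2 _ _ _ Hq) as [(i & j & i' & j' & Hi & Hj & [[-> ->]|[-> ->]])|[(a & a' & -> & -> & Ha)|[(a & b & a' & b' & -> & -> & Ha & Hb)|(a & a' & r' & -> & -> & Hu & Ha)]]].
        - apply Rn_mem; auto.
        - apply Rn_eq; auto.
        - apply Rn_neg; auto. apply (IH' r1); auto. split; auto. apply deep_Neg.
        - apply Rn_imp; auto; apply (IH' r1); auto. split; auto. apply deep_Imp1. split; auto. apply deep_Imp2.
        - apply (@Rn_all _ Hz) with (upr r2); auto. apply UpR_upr. apply (IH' r'); auto.
          + apply (cl_upr Hz); auto.
          + apply (@UpR_req r1 r' r2); auto. split; auto. apply UpR_upr.
          + apply deep_All. }
      pose proof (DRn1 Hz B). pose proof (DRn2 Hz B). repeat split; auto. apply fr_ok; auto. }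
  destruct (A c r _ H1 c c' eq_refl eq_refl r0 Hr0 Hreq) as (A1 & A2 & A3). apply fr_ok in A3; auto.
Qed.

(** ** Finite functions *)
Lemma fin_restr (z f n : S) : clset z -> isfun f -> Nat n -> (forall i, i ∈ n -> exists x, x ∈ z /\ pr i x ∈ f) ->
  exists f', f' ∈ z /\ (forall q, q ∈ f' <-> exists i x, q = pr i x /\ i ∈ n /\ pr i x ∈ f).
Proof.
  intros Hz Hf Hn H.
  assert (A : forall m, Nat m -> (m ∈ n \/ m = n) -> exists f', f' ∈ z /\ ((forall q, q ∈ f' -> exists i x, q = pr i x /\ i ∈ m /\ pr i x ∈ f) /\
     forall i x, pr i x ∈ f -> i ∈ m -> pr i x ∈ f')).
  { apply (@N_ind S (fun S e => (e 0 ∈ e 1 \/ e 0 = e 1) -> exists f', f' ∈ e 2 /\ ((forall q, q ∈ f' -> exists i x, q = pr i x /\ i ∈ e 0 /\ pr i x ∈ e 3) /\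
     forall i x, pr i x ∈ e 3 -> i ∈ e 0 -> pr i x ∈ f')) [n; z; f]).
    - d0t.
    - simpl. intros _. exists emp. split; [apply (cl_emp Hz)|]. split; [intros q Hq; destruct (emp_spec Hq)|intros i x _ Hi; destruct (emp_spec Hi)].
    - simpl. intros k Hk IH Hkn.
      assert (Hk' : k ∈ n). { destruct Hkn as [Hkn|<-]; [|apply in_suc]. apply (N_tr Hn Hkn), in_suc. }
      destruct (IH (or_introl Hk')) as (f' & Hf' & B1 & B2). destruct (H k Hk') as (x & Hx & Hkx).
      exists (un f' (sing (pr k x))). split; [|split].
      + apply (cl_un Hz); auto. apply (cl_sing Hz), (D_pr Hz); auto. apply (D_Nat Hz Hk).
      + intros q Hq. apply un_spec in Hq as [Hq|Hq].
        * destruct (B1 q Hq) as (i & y & -> & Hi & Hy). exists i, y; repeat split; auto. apply suc_spec; auto.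
        * apply sing_spec in Hq as ->. exists k, x; repeat split; auto. apply in_suc.
      + intros i y Hy Hi. apply un_spec. apply suc_spec in Hi as [Hi| ->]; auto. right. apply sing_spec.
        f_equal. apply (Hf k); auto. }
  destruct (A n Hn (or_intror eq_refl)) as (f' & H1 & H2 & H3). exists f'; split; auto.
  intros q; split; auto. intros (i & x & -> & Hi & Hx); auto.
Qed.

(** A finite function into [z] is assembled in [z] one pair at a time. Hence one closed set contains
    all assignments over [k], and satisfaction classes and sets of definable subsets are obtained
    without power sets. *)
Lemma Seq_in (z k n s : S) : clset z -> (forall x, x ∈ k -> x ∈ z) -> Nat n -> Seq k n s -> s ∈ z.
Proof.
  intros Hz Hk Hn (H1 & H2 & H3).
  destruct (@fin_restr z s n Hz H1 Hn) as (f' & Hf' & H).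
  - intros i Hi. destruct (H3 i Hi) as (x & Hx). exists x; split; auto. apply Hk.
    destruct (H2 _ Hx) as (j & y & _ & Hy & Hq). apply pr_inj in Hq as [_ ->]; auto.
  - replace s with f'; auto. apply ext; intros q. rewrite H. split.
    + intros (i & x & -> & _ & Hx); auto.
    + intros Hq. destruct (H2 q Hq) as (i & x & Hi & _ & ->). eauto.
Qed.

(** ** Provability *)
Lemma LA_sub (D D' : S -> Prop) c : (forall x, D x -> D' x) -> LA D c -> LA D' c.
Proof.
  intros H.
  assert (HF : forall p, Fm D p -> Fm D' p) by (intros; eapply Fm_sub; eauto).
  assert (HR : forall r p p', Rn D r p p' -> Rn D' r p p') by (intros; eapply Rn_sub; eauto).
  intros [(p & q & H1)|[(p & q & r & H1)|[(p & q & H1)|[(p & q & H1)|[(p & r & Hr & p' & H1)|[(p & t & r & Hr & p' & H1)|H1]]]]]].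
  - left. exists p, q; intuition auto.
  - right; left. exists p, q, r; intuition auto.
  - do 2 right; left. exists p, q; intuition auto.
  - do 3 right; left. exists p, q; intuition auto.
  - do 4 right; left. exists p, r; split; auto; exists p'; intuition auto.
  - do 5 right; left. exists p, t, r; split; auto; exists p'; intuition auto.
  - do 6 right. auto.
Qed.
Lemma ShfR_req (r : S) : ShfR r -> req r shf.
Proof.
  intros H. split; intros n m H1.
  - apply H in H1 as [H1 ->]. apply shf_spec; eauto.
  - apply shf_spec in H1 as (k & Hk & H1). apply pr_inj in H1 as [-> ->]. apply H; auto.
Qed.
Lemma ShfR_shf : ShfR (@shf S).
Proof.
  intros n m. rewrite shf_spec. split.
  - intros (k & Hk & H1). apply pr_inj in H1 as [-> ->]. auto.
  - intros [H ->]; eauto.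
Qed.
Lemma InsR_ins (t : S) : InsR t (ins t).
Proof.
  intros n m. rewrite ins_spec. split.
  - intros [H1|(k & Hk & H1)]; apply pr_inj in H1 as [-> ->]; split; auto using N_emp, N_suc.
  - intros [H [[-> ->]| ->]]; auto. right. exists m; split; auto. apply N_pred; auto.
Qed.
Lemma InsR_req (t r : S) : InsR t r -> req r (ins t).
Proof. intros H. split; intros n m H1; [apply InsR_ins, H, H1|apply H, InsR_ins, H1]. Qed.
Lemma LA_cpt (z c : S) : clset z -> LA (fun _ => True) c -> LA (fun x => x ∈ z) c.
Proof.
  intros Hz.
  assert (HF : forall p, Fm (fun _ => True) p -> Fm (fun x => x ∈ z) p) by (intros; apply Fm_cpt; auto).
  intros [(p & q & H1)|[(p & q & r & H1)|[(p & q & H1)|[(p & q & H1)|[(p & r & Hr & p' & H1)|[(p & t & r & Hr & p' & H1)|H1]]]]]].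
  - left. exists p, q; intuition auto.
  - right; left. exists p, q, r; intuition auto.
  - do 2 right; left. exists p, q; intuition auto.
  - do 3 right; left. exists p, q; intuition auto.
  - do 4 right; left. destruct H1 as (H1 & H2 & H3 & H4). exists p, shf; split; [apply (cl_shf Hz)|]; exists p'.
    split; [auto|split; [apply ShfR_shf|split; [|auto]]]. apply (@Rn_cpt z r); auto. apply (cl_shf Hz). apply ShfR_req; auto.
  - do 5 right; left. destruct H1 as (H1 & H2 & H3 & H4 & H5). exists p, t, (ins t). 
    assert (ins t ∈ z) by (apply (cl_ins Hz), (D_Nat Hz H2)). split; [auto|]; exists p'.
    split; [auto|split; [auto|split; [apply InsR_ins|split; [|auto]]]]. apply (@Rn_cpt z r); auto. apply InsR_req; auto.
  - do 6 right. auto.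
Qed.

Lemma kImp_in (z a b : S) : clset z -> kImp a b ∈ z -> a ∈ z /\ b ∈ z.
Proof. intros Hz H. split; [exact (Dk6 Hz H eq_refl)|exact (Dk7 Hz H eq_refl)]. Qed.


Lemma LA_in (D : S -> Prop) (HD : closed D) c : LA D c -> D c.
Proof.
  assert (I : forall p q, D p -> D q -> D (@imp S (k_syntax S) p q)) by (intros; apply (D_kImp HD); auto).
  assert (N : forall p, D p -> D (@neg S (k_syntax S) p)) by (intros; apply (D_kNeg HD); auto).
  assert (Al : forall p, D p -> D (@all S (k_syntax S) p)) by (intros; apply (D_kAll HD); auto).
  assert (M : forall i j, D (@mem S (k_syntax S) i j)) by (intros; apply (D_kMem HD); apply (D_nm HD)).
  assert (Q : forall i j, D (@eql S (k_syntax S) i j)) by (intros; apply (D_kEq HD); apply (D_nm HD)).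
  intros [(p & q & H1)|[(p & q & r & H1)|[(p & q & H1)|[(p & q & H1)|[(p & r & Hr & p' & H1)|[(p & t & r & Hr & p' & H1)|H1]]]]]];
  dbrk; subst;
  repeat match goal with H : Fm D _ |- _ => apply (DFm HD) in H 
    | H : Rn D _ _ _ |- _ => pose proof (DRn1 HD H); apply (DRn2 HD) in H end;
  unfold ax_K, ax_S, ax_N, ax_dist, ax_vac, ax_inst, eq_refl_ax, eq_eucl_ax, eq_mem_l_ax, eq_mem_r_ax; auto 20.
Qed.

Lemma PV_cpt (z c : S) (T : S -> Prop) : clset z -> PV (fun _ => True) T c -> PV (fun x => x ∈ z) T c.
Proof.
  intros Hz (n & P & _ & Hn & HP & (m & Hm & Hc) & H).
  assert (HzD : forall i, Nat i -> i ∈ z) by (intros; apply (D_Nat Hz); auto).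
  assert (Hin : forall i, Nat i -> i ∈ n -> exists x, x ∈ z /\ pr i x ∈ P).
  { intros i Hi Hin.
    assert (B : forall i, (i ∈ n -> exists x, pr i x ∈ P /\ x ∈ z)); [|destruct (B i Hin) as (x & ? & ?); eauto].
    clear i Hi Hin. apply (@ind0 S (fun S e => e 0 ∈ e 1 -> exists x, pr (e 0) x ∈ e 2 /\ x ∈ e 3) [n; P; z]); [d0t|].
    simpl. intros i IH Hi. destruct (H i Hi) as (x & Hx & Hj). exists x; split; auto.
    assert (IH' : forall j y, j ∈ i -> pr j y ∈ P -> y ∈ z).
    { intros j y Hj' Hy. assert (j ∈ n) by (exact (N_tr Hn Hi Hj')).
      destruct (IH j Hj' H0) as (y' & H1 & H2). rewrite (HP j y y'); auto. }
    destruct Hj as [Hj|[[Hj _]|[(j & k & y & w & Hj & Hk & Hy & Hw & ->)|(j & y & Hj & Hy & ->)]]].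
    - apply (LA_in Hz). apply LA_cpt; auto.
    - apply (DFm Hz). apply Fm_cpt; auto.
    - apply (@kImp_in z y x Hz). apply (IH' k); auto.
    - apply (D_kAll Hz). apply (IH' j); auto. }
  destruct (@fin_restr z P n Hz HP Hn) as (P' & HP' & Hs).
  { intros i Hi. apply Hin; auto. exact (N_mem Hn Hi). }
  assert (Hs' : forall i x, pr i x ∈ P' <-> i ∈ n /\ pr i x ∈ P).
  { intros i x. rewrite Hs. split; [intros (j & y & Hq & H1 & H2); apply pr_inj in Hq as [-> ->]; auto|intros [H1 H2]; eauto]. }
  exists n, P'. split; [auto|split; [auto|split; [|split]]].
  - intros i x y [H1 H2]. apply Hs' in H1 as [_ H1], H2 as [_ H2]. apply (HP i); auto.
  - exists m; split; auto. apply Hs'; split; auto. rewrite Hm. apply in_suc.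
  - intros i Hi. destruct (H i Hi) as (x & Hx & Hj). exists x; split; [apply Hs'; auto|].
    assert (Ht : forall j, j ∈ i -> j ∈ n) by (intros j Hj'; exact (N_tr Hn Hi Hj')).
    destruct Hj as [Hj|[[Hj HT]|[(j & k & y & w & Hj & Hk & Hy & Hw & ->)|(j & y & Hj & Hy & ->)]]].
    + left. apply LA_cpt; auto.
    + right; left. split; auto. apply Fm_cpt; auto.
    + do 2 right; left. exists j, k, y, (kImp y x). rewrite !Hs'. repeat split; auto.
    + do 3 right. exists j, y. rewrite !Hs'. repeat split; auto.
Qed.
Lemma PV_sub (D D' : S -> Prop) (T T' : S -> Prop) c : (forall x, D x -> D' x) -> (forall x, Fm D x -> T x -> T' x) ->
  PV D T c -> PV D' T' c.
Proof.
  intros HD HT (n & P & H1 & Hn & HP & H2 & H3). exists n, P. split; [auto|split; [auto|split; [auto|split; [auto|]]]].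
  intros i Hi. destruct (H3 i Hi) as (x & Hx & Hj). exists x; split; auto.
  destruct Hj as [Hj|[[Hj HT']|Hj]]; auto.
  - left; eapply LA_sub; eauto.
  - right; left; split; auto. eapply Fm_sub; eauto.
Qed.
End Codes.

Lemma d0_isfun n v : isv n v -> dfn n (fun S e => isfun (v S e)).
Proof.
  intros (i & Hi & Hv).
  apply (d0_ext (P := fun S e => forall a b, pr a b ∈ e i -> forall b', pr a b' ∈ e i -> b = b')); [d0t|].
  intros S e; rewrite Hv. unfold isfun. split; intros H; [intros a b b' [H1 H2]; exact (H _ _ H1 _ H2)|eauto].
Qed.
Lemma d0_Seq n u v w : isv n u -> isv n v -> isv n w -> dfn n (fun S e => Seq (u S e) (v S e) (w S e)).
Proof.
  intros (i & Hi & Hu) (j & Hj & Hv) (k & Hk & Hw).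
  apply (d0_ext (P := fun S e => isfun (e k) /\ (forall q, q ∈ e k -> exists a, a ∈ e j /\ exists x, x ∈ e i /\ q = pr a x) /\
    forall a, a ∈ e j -> exists x, pr a x ∈ e k /\ x = x)).
  - apply d0_and; [apply d0_isfun; isvt|d0t].
  - intros S e; rewrite Hu, Hv, Hw. unfold Seq. split; intros (H1 & H2 & H3); repeat split; auto.
    + intros q Hq. destruct (H2 q Hq) as (a & Ha & x & Hx & ->); eauto.
    + intros a Ha. destruct (H3 a Ha) as (x & Hx & _); eauto.
    + intros q Hq. destruct (H2 q Hq) as (a & x & Ha & Hx & ->); eauto 6.
    + intros a Ha. destruct (H3 a Ha) as (x & Hx); eauto.
Qed.
Lemma d0_Scn n u v w : isv n u -> isv n v -> isv n w -> dfn n (fun S e => Scn (u S e) (v S e) (w S e)).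
Proof.
  intros (i & Hi & Hu) (j & Hj & Hv) (k & Hk & Hw).
  apply (d0_ext (P := fun S e => (forall q, q ∈ e k -> q = pr emp (e i) \/ exists a x, pr a x ∈ e j /\ q = pr (suc a) x) /\
    pr emp (e i) ∈ e k /\ forall a x, pr a x ∈ e j -> pr (suc a) x ∈ e k)).
  - d0t.
  - intros S e; rewrite Hu, Hv, Hw. unfold Scn. split.
    + intros (H1 & H2 & H3) q. split; auto. intros [->|(a & x & H & ->)]; auto.
    + intros H; repeat split; [intros q Hq; apply H, Hq|apply H; auto|intros a x Hx; apply H; eauto].
Qed.
Ltac d0h2 := first [ simple apply d0_expr; [isvt|d0t] | simple apply d0_exval; [isvt|dtt|d0t]
  | simple apply d0_exmem; [isvt|d0t] | simple apply d0_allval; [isvt|dtt|d0t] | simple apply d0_allmem; [isvt|d0t]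
  | simple apply d0_allpr; [isvt|d0t] | simple apply d0_Nat; isvt | simple apply d0_clset; isvt
  | simple apply d0_isfun; isvt | simple apply d0_Seq; isvt | simple apply d0_Scn; isvt ].
Ltac d0h ::= d0h2.

Section Sat.
Variable S : kpm.

Ltac kno := exfalso; match goal with H : _ = _ |- _ =>
    revert H; unfold kMem, kEq, kNeg, kImp, kAll; apply tag_neq; lia end.
Ltac kcase H := destruct H as [(?i & ?j & ?x & ?y & ?Hi & ?Hj & [[?Hc ?Hw]|[?Hc ?Hw]])|[(?a & ?Hc & ?Ha & ?Hw)|[(?a & ?b & ?Hc & ?Ha & ?Hb & ?Hw)|(?a & ?Hc & ?Ha & ?Hw)]]].

Lemma SC_mem (k A W i j s : S) : SC k A W -> pr (kMem i j) s ∈ A ->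
  exists x y, pr i x ∈ s /\ pr j y ∈ s /\ (pr (kMem i j) s ∈ W <-> x ∈ y).
Proof. intros H H1. pose proof (H _ _ H1) as C. kcase C; try kno. apply kMem_inj in Hc as [-> ->]; eauto. Qed.
Lemma SC_eq (k A W i j s : S) : SC k A W -> pr (kEq i j) s ∈ A ->
  exists x y, pr i x ∈ s /\ pr j y ∈ s /\ (pr (kEq i j) s ∈ W <-> x = y).
Proof. intros H H1. pose proof (H _ _ H1) as C. kcase C; try kno. apply kEq_inj in Hc as [-> ->]; eauto. Qed.
Lemma SC_neg (k A W a s : S) : SC k A W -> pr (kNeg a) s ∈ A ->
  pr a s ∈ A /\ (pr (kNeg a) s ∈ W <-> ~ pr a s ∈ W).
Proof. intros H H1. pose proof (H _ _ H1) as C. kcase C; try kno. apply kNeg_inj in Hc as ->; eauto. Qed.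
Lemma SC_imp (k A W a b s : S) : SC k A W -> pr (kImp a b) s ∈ A ->
  pr a s ∈ A /\ pr b s ∈ A /\ (pr (kImp a b) s ∈ W <-> (pr a s ∈ W -> pr b s ∈ W)).
Proof. intros H H1. pose proof (H _ _ H1) as C. kcase C; try kno. apply kImp_inj in Hc as [-> ->]; eauto. Qed.
Lemma SC_all (k A W a s : S) : SC k A W -> pr (kAll a) s ∈ A ->
  (forall x, x ∈ k -> exists s', Scn x s s' /\ pr a s' ∈ A) /\
  (pr (kAll a) s ∈ W <-> forall x s', x ∈ k -> Scn x s s' -> pr a s' ∈ W).
Proof.
  intros H H1. pose proof (H _ _ H1) as C. kcase C; try kno. apply kAll_inj in Hc as ->. split; auto.
  rewrite Hw. split; intros G; [intros x s' H2 H3; apply (G x s'); auto|intros x s' [H2 H3]; apply (G x s'); auto].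
Qed.

Lemma Scn_in (x s s' i y : S) : Scn x s s' -> (pr i y ∈ s' <-> (i = emp /\ y = x) \/ exists j, i = suc j /\ pr j y ∈ s).
Proof.
  intros H. rewrite (H (pr i y)), pr_eq. split.
  - intros [H1|(j & y' & H1 & H2)]; auto. apply pr_inj in H2 as [-> ->]; eauto.
  - intros [H1|(j & -> & H1)]; eauto 6.
Qed.
Lemma Scn_isfun (x s s' : S) : isfun s -> Scn x s s' -> isfun s'.
Proof.
  intros H H1 i a b [Ha Hb]. apply (Scn_in _ _ H1) in Ha, Hb.
  destruct Ha as [[-> ->]|(j & -> & Ha)], Hb as [[Hi ->]|(j' & Hi & Hb)]; auto.
  - destruct (suc_emp (eq_sym Hi)).
  - destruct (suc_emp Hi).
  - apply suc_inj in Hi as ->. eauto.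
Qed.
Lemma Scn_ex (U : S -> Prop) (HU : isU U) x s : U x -> U s -> exists s', U s' /\ Scn x s s'.
Proof.
  intros Hx Hs.
  destruct (@U_coll S U HU (fun S e => forall i y, e 1 = pr i y -> e 0 = pr (suc i) y) [] s) as (b & Hb & H); auto.
  - d0t.
  - intros q Hq. destruct (classic (exists i y, q = pr i y)) as [(i & y & ->)|N].
    + exists (pr (suc i) y). split.
      * pose proof (U_closed HU) as HD. apply (D_pr HD); [apply (D_suc HD)|]; [exact (Dq1 HD Hs Hq)|exact (Dq2 HD Hs Hq)].
      * simpl. intros a c Hac. apply pr_inj in Hac as [-> ->]; auto.
    + exists emp; split; [apply (U_emp HU)|]. simpl. intros n m ->. exfalso; eauto.
  - destruct (@U_sep S U HU (fun S e => exists n m, pr n m ∈ e 1 /\ e 0 = pr (suc n) m) [s] b) as (Y & HY & H1); auto.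
    + d0t.
    + exists (un (sing (pr emp x)) Y). split; [apply (U_un HU); auto; apply (U_sing HU), (U_pr HU); auto; apply (U_emp HU)|].
      intros q. rewrite un_spec, sing_spec, H1. simpl. split; [intuition auto|].
      intros [Hq|(n & m & Hn & ->)]; auto. right. split; [|eauto].
      destruct (H _ Hn) as (y & Hy & H2). simpl in H2. rewrite <- (H2 n m eq_refl); auto.
Qed.
Lemma Scn_Seq (k m x s s' : S) : Nat m -> Seq k m s -> x ∈ k -> Scn x s s' -> Seq k (suc m) s'.
Proof.
  intros Hm (H1 & H2 & H3) Hx H. split; [apply (Scn_isfun H1 H)|split].
  - intros q Hq. apply H in Hq as [->|(i & y & Hy & ->)].
    + exists emp, x. split; [|auto]. destruct (emp_in_N (N_suc Hm)) as [E|E]; auto. destruct (suc_emp E).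
    + destruct (H2 _ Hy) as (i' & y' & Hi & Hy' & Hq). apply pr_inj in Hq as [-> ->].
      exists (suc i'), y'. split; auto. apply in_N_suc; auto.
  - intros i Hi. assert (Nat i) by (apply (N_mem (N_suc Hm) Hi)).
    destruct (N_case H0) as [->|(j & Hj & ->)].
    + exists x. apply (Scn_in _ _ H); auto.
    + destruct (H3 j) as (y & Hy); [apply suc_in_suc; auto|]. exists y. apply (Scn_in _ _ H); eauto.
Qed.
Lemma Seq_vals (k m s i x : S) : Seq k m s -> pr i x ∈ s -> i ∈ m /\ x ∈ k.
Proof. intros (_ & H & _) Hx. destruct (H _ Hx) as (j & y & Hj & Hy & Hq). apply pr_inj in Hq as [-> ->]; auto. Qed.
Lemma Seq_mono (k k' m s : S) : (forall x, x ∈ k -> x ∈ k') -> Seq k m s -> Seq k' m s.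
Proof. intros H (H1 & H2 & H3). repeat split; auto. intros q Hq. destruct (H2 q Hq) as (i & x & ? & ? & ?); eauto 6. Qed.
Lemma Seq_emp (k : S) : Seq k emp emp.
Proof. repeat split; [intros i x y [H _]|intros q H|intros q H]; destruct (emp_spec H). Qed.

(** ** Agreement of satisfaction classes *)
Definition isM {S : kpm} (c : S) := exists a b, c = pr a b /\ a = nm 0 /\ exists i j, b = pr i j /\ i = i.
Lemma isM_mem (i j : S) : isM (kMem i j).
Proof. do 2 eexists; split; [reflexivity|]. split; [reflexivity|]. do 2 eexists; split; reflexivity. Qed.
Lemma isM_inv (c : S) : isM c -> exists i j, c = kMem i j.
Proof. intros (a & b & -> & -> & i & j & -> & _). exists i, j; reflexivity. Qed.
(** The codes met by satisfaction as it descends into Delta_0 codes: besides members of [Wd] these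
    are the guard of a bounded quantifier and the implication that it heads, both skipped by [DW].
    The filler [i = i] in [isM] gives that existential the shape expected by [d0_expr]. *)
Definition okc {S : kpm} (Wd c : S) := c ∈ Wd \/ isM c \/ exists a b, c = pr a b /\ a = nm 3 /\ exists m d, b = pr m d /\ isM m /\ d ∈ Wd.
Lemma okc_imp_inv (Wd a b : S) : DW Wd -> okc Wd (kImp a b) -> okc Wd a /\ okc Wd b.
Proof.
  intros HW [H|[H|H]].
  - destruct (HW _ H) as [(i & j & _ & _ & [E|E])|[(c & E & _)|[(c & d & E & Hc & Hd)|(y & c & _ & E & _)]]]; try kno.
    apply kImp_inj in E as [-> ->]. split; left; auto.
  - apply isM_inv in H as (i & j & E). kno.
  - destruct H as (u & v & E & -> & m & d & -> & Hm & Hd).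
    change (pr (nm 3) (pr m d)) with (kImp m d) in E. apply kImp_inj in E as [-> ->]. split; [right; left; auto|left; auto].
Qed.
Lemma okc_neg_inv (Wd a : S) : DW Wd -> okc Wd (kNeg a) -> okc Wd a.
Proof.
  intros HW [H|[H|H]].
  - destruct (HW _ H) as [(i & j & _ & _ & [E|E])|[(c & E & Hc)|[(c & d & E & Hc & Hd)|(y & c & _ & E & _)]]]; try kno.
    apply kNeg_inj in E as ->. left; auto.
  - apply isM_inv in H as (i & j & E). kno.
  - destruct H as (u & v & E & -> & _). kno.
Qed.
Lemma okc_all_inv (Wd a : S) : DW Wd -> okc Wd (kAll a) -> exists y b, a = kImp (kMem (nm 0) (suc y)) b /\ okc Wd a.
Proof.
  intros HW [H|[H|H]].
  - destruct (HW _ H) as [(i & j & _ & _ & [E|E])|[(c & E & Hc)|[(c & d & E & Hc & Hd)|(y & c & _ & E & Hc)]]]; try kno.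
    apply kAll_inj in E as ->. exists y, c. split; auto. right; right. do 2 eexists; split; [reflexivity|].
    split; [reflexivity|]. do 2 eexists; split; [reflexivity|]. split; auto. apply isM_mem.
  - apply isM_inv in H as (i & j & E). kno.
  - destruct H as (u & v & E & -> & _). kno.
Qed.

(** One induction gives two results: for [k1 = k2] satisfaction in a structure is unique, and for a
    transitive [k1] inside [k2] Delta_0 formulas are absolute. In the second case a value outside
    [k1] falsifies the guard of a bounded quantifier, because the bounding set is an element of
    [k1]. *)
Lemma agree (k1 k2 A1 A2 W1 W2 Wd : S) : SC k1 A1 W1 -> SC k2 A2 W2 -> (forall x, x ∈ k1 -> x ∈ k2) ->
  (k1 = k2 \/ trans k1) -> DW Wd ->
  forall c, (k1 = k2 \/ okc Wd c) -> forall s, pr c s ∈ A1 -> pr c s ∈ A2 -> isfun s -> (forall i x, pr i x ∈ s -> x ∈ k1) ->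
    (pr c s ∈ W1 <-> pr c s ∈ W2).
Proof.
  intros S1 S2 Hk Ht HWd.
  apply (@ind4 S (fun S e => (e 1 = e 2 \/ okc (e 7) (e 0)) -> forall s, pr (e 0) s ∈ e 3 -> pr (e 0) s ∈ e 4 -> isfun s -> 
     (forall i x, pr i x ∈ s -> x ∈ e 1) -> (pr (e 0) s ∈ e 5 <-> pr (e 0) s ∈ e 6)) [k1; k2; A1; A2; W1; W2; Wd]).
  { unfold okc, isM. d0t. }
  simpl. intros c IH Hc s HA1 HA2 Hf Hv.
  pose proof (S1 _ _ HA1) as C. kcase C; subst c.
  - destruct (SC_mem S2 HA2) as (x' & y' & Hi' & Hj' & Hw'). rewrite Hw, Hw'.
    rewrite (Hf i x x'), (Hf j y y'); tauto.
  - destruct (SC_eq S2 HA2) as (x' & y' & Hi' & Hj' & Hw'). rewrite Hw, Hw'.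
    rewrite (Hf i x x'), (Hf j y y'); tauto.
  - destruct (SC_neg S2 HA2) as (Ha' & Hw'). rewrite Hw, Hw'. rewrite (IH a (deep_Neg a)); auto; try tauto.
    destruct Hc as [Hc|Hc]; auto. right; apply okc_neg_inv; auto.
  - destruct (SC_imp S2 HA2) as (Ha' & Hb' & Hw'). rewrite Hw, Hw'. 
    assert (k1 = k2 \/ (okc Wd a /\ okc Wd b)) as Hc' by (destruct Hc as [Hc|Hc]; auto; right; apply okc_imp_inv; auto).
    rewrite (IH a (deep_Imp1 a b)), (IH b (deep_Imp2 a b)); auto; tauto.
  - destruct (SC_all S2 HA2) as (Ha' & Hw'). rewrite Hw, Hw'.
    assert (Hvs : forall x s', x ∈ k1 -> Scn x s s' -> forall i y, pr i y ∈ s' -> y ∈ k1).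
    { intros x s' Hx Hs i y Hy. apply (Scn_in _ _ Hs) in Hy as [[_ ->]|(j & _ & Hy)]; eauto. }
    assert (Hok : k1 = k2 \/ okc Wd a) by (destruct Hc as [Hc|Hc]; auto; right; destruct (okc_all_inv HWd Hc) as (? & ? & ? & ?); auto).
    assert (Q : forall x s', x ∈ k1 -> Scn x s s' -> (pr a s' ∈ W1 <-> pr a s' ∈ W2)).
    { intros x s' Hx Hs. apply (IH a (deep_All a)); auto.
      - destruct (Ha x Hx) as (s'' & Hs'' & H). rewrite (Scn_fun Hs Hs''); auto.
      - destruct (Ha' x (Hk x Hx)) as (s'' & Hs'' & H). rewrite (Scn_fun Hs Hs''); auto.
      - eapply Scn_isfun; eauto.
      - eapply Hvs; eauto. }
    split; intros H.
    + intros x s' Hx Hs. destruct (classic (x ∈ k1)) as [Hx1|Hx1].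
      * apply (Q x s' Hx1 Hs), (H x s'); auto.
      * assert (Hne : k1 <> k2) by (intros E; apply Hx1; rewrite E; auto).
        destruct Hc as [Hc|Hc]; [tauto|]. destruct Ht as [Ht|Ht]; [tauto|].
        destruct (okc_all_inv HWd Hc) as (y & b & -> & _).
        destruct (Ha' x Hx) as (s'' & Hs'' & HA). rewrite <- (Scn_fun Hs Hs'') in HA.
        destruct (SC_imp S2 HA) as (Hm & _ & Hw2). apply Hw2. intros Hm2.
        destruct (SC_mem S2 Hm) as (x0 & y0 & Hx0 & Hy0 & Hw3). apply Hw3 in Hm2.
        exfalso. apply Hx1. 
        apply (Scn_in _ _ Hs) in Hx0 as [[_ ->]|(j & E & _)]; [|destruct (suc_emp (eq_sym E))].
        apply (Scn_in _ _ Hs) in Hy0 as [[E _]|(j & E & Hy0)]; [destruct (suc_emp E)|].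
        apply (Ht y0); auto. apply (Hv j); auto.
    + intros x s' [Hx Hs]. apply (Q x s' Hx Hs), (H x s'); auto.
Qed.

(** ** Existence of total satisfaction classes *)
Definition phi {S : kpm} (k z X c s : S) : Prop :=
  (exists a b, c = pr a b /\ (
     (a = nm 0 /\ exists i j, b = pr i j /\ exists x, pr i x ∈ s /\ exists y, pr j y ∈ s /\ x ∈ y) \/
     (a = nm 1 /\ exists i j, b = pr i j /\ exists x, pr i x ∈ s /\ exists y, pr j y ∈ s /\ x = y) \/
     (a = nm 2 /\ ~ pr b s ∈ X) \/
     (a = nm 3 /\ exists u v, b = pr u v /\ (pr u s ∈ X -> pr v s ∈ X)) \/
     (a = nm 4 /\ forall x, x ∈ k -> forall s', s' ∈ z -> Scn x s s' -> pr b s' ∈ X))).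

Ltac pinv := repeat match goal with
  | H : pr _ _ = pr _ _ |- _ => apply pr_inj in H; destruct H
  | H : exists _, _ |- _ => destruct H
  | H : _ /\ _ |- _ => destruct H
  | H : _ \/ _ |- _ => destruct H
  | H : nm ?i = nm ?j |- _ => apply nm_inj in H; discriminate H
  | H : ?x = _ |- _ => is_var x; subst x
  | H : _ = ?x |- _ => is_var x; subst x
  end; subst.
Lemma phi_mem (k z X i j s : S) : phi k z X (kMem i j) s <-> exists x, pr i x ∈ s /\ exists y, pr j y ∈ s /\ x ∈ y.
Proof.
  split.
  - intros H. unfold phi, kMem in H. pinv. eauto 6.
  - intros H. exists (nm 0), (pr i j). split; [reflexivity|]. left; eauto 6.
Qed.
Lemma phi_eq (k z X i j s : S) : phi k z X (kEq i j) s <-> exists x, pr i x ∈ s /\ exists y, pr j y ∈ s /\ x = y.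
Proof.
  split.
  - intros H. unfold phi, kEq in H. pinv. eauto 6.
  - intros H. exists (nm 1), (pr i j). split; [reflexivity|]. right; left; eauto 6.
Qed.
Lemma phi_neg (k z X a s : S) : phi k z X (kNeg a) s <-> ~ pr a s ∈ X.
Proof.
  split.
  - intros H. unfold phi, kNeg in H. pinv. auto.
  - intros H. exists (nm 2), a. split; [reflexivity|]. right; right; left; eauto 6.
Qed.
Lemma phi_imp (k z X a b s : S) : phi k z X (kImp a b) s <-> (pr a s ∈ X -> pr b s ∈ X).
Proof.
  split.
  - intros H. unfold phi, kImp in H. pinv. auto.
  - intros H. exists (nm 3), (pr a b). split; [reflexivity|]. do 3 right; left; eauto 6.
Qed.
Lemma phi_all (k z X a s : S) : phi k z X (kAll a) s <-> (forall x, x ∈ k -> forall s', s' ∈ z -> Scn x s s' -> pr a s' ∈ X).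
Proof.
  split.
  - intros H. unfold phi, kAll in H. pinv. auto.
  - intros H. exists (nm 4), a. split; [reflexivity|]. do 4 right; auto.
Qed.

Section Total.
Variables (U : S -> Prop) (HU : isU U) (k z : S).
Hypothesis Uz : U z.
Hypothesis Hz : clset z.
Hypothesis Hkz : k ∈ z.

Lemma kz x : x ∈ k -> x ∈ z. Proof. apply (cl_tr Hz Hkz). Qed.
Lemma Scn_z x s m : Nat m -> Seq k m s -> x ∈ k -> exists s', s' ∈ z /\ Scn x s s' /\ Seq k (suc m) s'.
Proof.
  intros Hm Hs Hx. destruct (@Scn_ex _ (isU_True S) x s I I) as (s' & _ & H).
  pose proof (Scn_Seq Hm Hs Hx H) as H1. exists s'; split; auto.
  apply (@Seq_in S z k (suc m)); auto using kz, N_suc.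
Qed.

(** The truth step [phi] is iterated from the empty set. Early stages may be wrong, as a negation
    can become true too soon, but the values at a code stop changing after a finite stage that
    depends on the code; [W] consists of the final values. Since the stages form a set [G], Delta_0
    induction on codes suffices to show that they settle. *)
Theorem total_sat : exists A W, U A /\ U W /\ SC k A W /\
  forall m c s, Nat m -> Bd (fun x => x ∈ z) m c -> Seq k m s -> pr c s ∈ A.
Proof.
  destruct (@U_sep S U HU (fun S e => exists c s, e 0 = pr c s /\ exists m, m ∈ e 2 /\ Nat m /\
      dsat (fun x => x ∈ e 2) (el [c; m]) fb /\ Seq (e 1) m s) [k; z] z) as (A & UA & HA); auto.
  { d0t. }
  { repeat constructor; auto. apply (U_tr HU Uz Hkz). }
  assert (HA' : forall c s, pr c s ∈ A <-> exists m, Nat m /\ Bd (fun x => x ∈ z) m c /\ Seq k m s).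
  { intros c s. rewrite HA. simpl. split.
    - intros (H & c' & s' & E & m & Hm & Nm & Hb & Hs). apply pr_inj in E as [<- <-]. exists m. split; [exact Nm|split; [|exact Hs]].
      apply (fb_ok Hz) in Hb; auto. exact (D_pr1 Hz H).
    - intros (m & Hm & Hb & Hs).
      pose proof (DBd Hz Hb) as Hc. pose proof (DBd1 Hz Hb) as Hm'.
      assert (s ∈ z) by (apply (@Seq_in S z k m); auto using kz).
      split; [apply (D_pr Hz); auto|]. exists c, s. split; auto. exists m. split; auto. split; auto. split; auto.
      apply fb_ok; auto. }
  clear HA.
  destruct (@iter S U HU (fun S e => (forall q, q ∈ e 0 -> q ∈ e 2 /\ exists c s, q = pr c s /\ phi (e 3) (e 4) (e 1) c s) /\
     forall q, q ∈ e 2 -> (exists c s, q = pr c s /\ phi (e 3) (e 4) (e 1) c s) -> q ∈ e 0) [A; k; z] emp) as (G & UG & G1 & G2 & G3 & G4).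
  { unfold phi. d0t. }
  { repeat constructor; auto. apply (U_tr HU Uz Hkz). }
  { apply (U_emp HU). }
  { intros Y UY. destruct (@U_sep S U HU (fun S e => exists c s, e 0 = pr c s /\ phi (e 3) (e 4) (e 1) c s) [Y; A; k; z] A) as (Y' & UY' & H); auto.
    - unfold phi; d0t.
    - repeat constructor; auto. apply (U_tr HU Uz Hkz).
    - exists Y'; split; auto. simpl. split; [intros q Hq; apply H, Hq|intros q H1 H2; apply H; auto]. }
  { intros Y Y1 Y2. simpl. intros [B1 B2] [B3 B4]. apply ext; intros q. split; intros Hq.
    - destruct (B1 q Hq); auto. - destruct (B3 q Hq); auto. }
  simpl in G4.
  assert (G5 : forall i Y, pr i Y ∈ G -> Nat i).
  { intros i Y H. destruct (G2 _ H) as (j & Z & Hq & Hj). apply pr_inj in Hq as [-> _]; auto. }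
  assert (G6 : forall i Y Y', pr i Y ∈ G -> pr (suc i) Y' ∈ G -> forall c s, pr c s ∈ A -> (pr c s ∈ Y' <-> phi k z Y c s)).
  { intros i Y Y' H H' c s Hcs. destruct (G4 i (G5 _ _ H)) as (Z & HZ & Z' & HZ' & B1 & B2).
    rewrite (G1 _ _ H _ HZ), (G1 _ _ H' _ HZ'). split.
    - intros Hq. destruct (B1 _ Hq) as (_ & c' & s' & E & Hp). apply pr_inj in E as [<- <-]; auto.
    - intros Hp. apply B2; eauto. }
  assert (Gex : forall i, Nat i -> exists Y, pr i Y ∈ G).
  { intros i Hi. destruct (G4 i Hi) as (Y & HY & _); eauto. }
  set (le := fun i j : S => i ∈ j \/ i = j).
  (* From stage [i] on, the values at [c] are constant for all assignments. The bounds [om] and [z]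
     keep this Delta_0. *)
  set (stab := fun (c i : S) => forall j, j ∈ om -> (i ∈ j \/ i = j) -> forall Y, pr j Y ∈ G -> forall Yi, pr i Yi ∈ G ->
      forall s, s ∈ z -> pr c s ∈ A -> (pr c s ∈ Y <-> pr c s ∈ Yi)).
  assert (lemax : forall i j, Nat i -> Nat j -> exists m, Nat m /\ le i m /\ le j m).
  { intros i j Hi Hj. destruct (N_tri Hi Hj) as [H|[H|H]]; [exists j|exists j|exists i]; unfold le; auto. }
  assert (letr : forall i j m, Nat m -> le i j -> le j m -> le i m).
  { intros i j m Hm [H|<-] [H'|<-]; unfold le; auto. left. apply (N_tr Hm H'); auto. }
  assert (stabm : forall c i i', Nat i -> Nat i' -> stab c i -> le i i' -> stab c i').
  { intros c i i' Hi Hi' H Hle j Hj Hij Y HY Yi HYi s Hs Hcs. apply om_spec in Hj. destruct (Gex i Hi) as (Y0 & HY0).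
    rewrite (H j) with (Yi := Y0); auto; [|apply om_spec; auto|apply (letr i i' j); auto].
    rewrite (H i') with (Y := Yi) (Yi := Y0); auto; [tauto|apply om_spec; auto]. }
  assert (HAz : forall c s, pr c s ∈ A -> s ∈ z).
  { intros c s H. apply HA' in H as (m & Hm & _ & Hs). apply (@Seq_in S z k m); auto using kz. }
  assert (Aneg : forall a s, pr (kNeg a) s ∈ A -> pr a s ∈ A).
  { intros a s H. apply HA' in H as (m & Hm & Hb & Hs). apply HA'. exists m; split; auto; split; auto.
    destruct (Bd_inv Hb) as [(i & j & _ & _ & [E|E])|[(c & E & Hc)|[(c & d & E & Hc & Hd)|(c & E & Hc)]]]; try kno.
    apply kNeg_inj in E as ->; auto. }
  assert (Aimp : forall a b s, pr (kImp a b) s ∈ A -> pr a s ∈ A /\ pr b s ∈ A).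
  { intros a b s H. apply HA' in H as (m & Hm & Hb & Hs). 
    destruct (Bd_inv Hb) as [(i & j & _ & _ & [E|E])|[(c & E & Hc)|[(c & d & E & Hc & Hd)|(c & E & Hc)]]]; try kno.
    apply kImp_inj in E as [-> ->]; split; apply HA'; exists m; auto. }
  assert (Aall : forall a s, pr (kAll a) s ∈ A -> forall x, x ∈ k -> exists s', s' ∈ z /\ Scn x s s' /\ pr a s' ∈ A).
  { intros a s H x Hx. apply HA' in H as (m & Hm & Hb & Hs). 
    destruct (Bd_inv Hb) as [(i & j & _ & _ & [E|E])|[(c & E & Hc)|[(c & d & E & Hc & Hd)|(c & E & Hc)]]]; try kno.
    apply kAll_inj in E as ->. destruct (Scn_z Hm Hs Hx) as (s' & H1 & H2 & H3). exists s'. split; auto. split; auto.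
    apply HA'. exists (suc m); auto using N_suc. }
  assert (Stab : forall c, exists i, i ∈ om /\ stab c i).
  { apply (@ind4 S (fun S e => exists i, i ∈ e 3 /\ forall j, j ∈ e 3 -> (i ∈ j \/ i = j) -> forall Y, pr j Y ∈ e 1 -> forall Yi, pr i Yi ∈ e 1 ->
      forall s, s ∈ e 4 -> pr (e 0) s ∈ e 2 -> (pr (e 0) s ∈ Y <-> pr (e 0) s ∈ Yi)) [G; A; om; z]).
    { d0t. }
    simpl. intros c IH. change (exists i, i ∈ om /\ stab c i).
    assert (IH' : forall y, deep y c -> exists i, Nat i /\ stab y i).
    { intros y Hy. destruct (IH y Hy) as (i & Hi & H). exists i; split; auto. apply om_spec; auto. }
    (* If the truth step gives the same values at [c] when applied to any stage from [i] on, then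
       the values at [c] are constant from stage [suc i] on. *)
    assert (Main : forall i, Nat i -> (forall j, Nat j -> le i j -> forall Y Yi s, pr j Y ∈ G -> pr i Yi ∈ G -> pr c s ∈ A -> (phi k z Y c s <-> phi k z Yi c s)) -> exists i, i ∈ om /\ stab c i).
    { intros i Hi H. exists (suc i). split; [apply om_spec, N_suc; auto|].
      assert (Q : forall j, Nat j -> le (suc i) j -> forall Y, pr j Y ∈ G -> forall Yi, pr i Yi ∈ G -> forall s, pr c s ∈ A -> (pr c s ∈ Y <-> phi k z Yi c s)).
      { intros j Hj Hij Y HY Yi HYi s Hcs. destruct (N_case Hj) as [->|(j' & Hj' & ->)].
        - destruct Hij as [H0|H0]; [destruct (emp_spec H0)|destruct (suc_emp H0)].
        - destruct (Gex j' Hj') as (Y0 & HY0). rewrite (G6 _ _ _ HY0 HY); auto. apply (H j'); auto.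
          destruct Hij as [H0|H0]; [left; apply suc_in_suc; auto|right; apply suc_inj; auto]. }
      intros j Hj Hij Y HY Yi HYi s Hs Hcs. apply om_spec in Hj. destruct (Gex i Hi) as (Y0 & HY0).
      rewrite (Q j Hj Hij Y HY Y0 HY0 s Hcs), (Q (suc i)) with (Y := Yi) (Yi := Y0); auto using N_suc; [tauto|right; auto]. }
    destruct (classic (exists s, pr c s ∈ A)) as [(s0 & Hs0)|N].
    2:{ apply (Main emp); [apply N_emp|]. intros j _ _ Y Yi s _ _ Hcs. exfalso; eauto. }
    pose proof Hs0 as Hs0'. apply HA' in Hs0 as (m & Hm & Hb & Hs).
    destruct (Bd_inv Hb) as [(i & j & _ & _ & [E|E])|[(a & E & _)|[(a & b & E & _ & _)|(a & E & _)]]]; subst c.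
    - apply (Main emp); [apply N_emp|]. intros. rewrite !phi_mem; tauto.
    - apply (Main emp); [apply N_emp|]. intros. rewrite !phi_eq; tauto.
    - destruct (IH' a (deep_Neg a)) as (i & Hi & Hst). apply (Main i); auto. intros j Hj Hij Y Yi s HY HYi Hcs.
      rewrite !phi_neg. rewrite (Hst j) with (Yi := Yi); auto; [tauto|apply om_spec; auto|exact (HAz _ _ Hcs)].
    - destruct (IH' a (deep_Imp1 a b)) as (i & Hi & Hst), (IH' b (deep_Imp2 a b)) as (i' & Hi' & Hst').
      destruct (lemax i i' Hi Hi') as (n & Hn & L1 & L2). pose proof (stabm _ _ _ Hi Hn Hst L1) as T1. pose proof (stabm _ _ _ Hi' Hn Hst' L2) as T2.
      apply (Main n); auto. intros j Hj Hij Y Yi s HY HYi Hcs. destruct (Aimp _ _ _ Hcs). pose proof (HAz _ _ Hcs).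
      assert (j ∈ om) by (apply om_spec; auto).
      rewrite !phi_imp. rewrite (T1 j) with (Yi := Yi), (T2 j) with (Yi := Yi); auto; tauto.
    - destruct (IH' a (deep_All a)) as (i & Hi & Hst). apply (Main i); auto. intros j Hj Hij Y Yi s HY HYi Hcs.
      rewrite !phi_all. assert (j ∈ om) by (apply om_spec; auto).
      assert (Q : forall x s', x ∈ k -> s' ∈ z -> Scn x s s' -> (pr a s' ∈ Y <-> pr a s' ∈ Yi)).
      { intros x s' Hx Hs' Hsc. apply (Hst j); auto. destruct (Aall _ _ Hcs x Hx) as (s'' & _ & H1 & H2).
        rewrite (Scn_fun Hsc H1); auto. }
      split; intros H1 x Hx s' Hs' Hsc; apply (Q x); eauto. }
  (* The final value: true at all stages from some point on. *)
  destruct (@U_sep S U HU (fun S e => exists i, i ∈ e 1 /\ forall j, j ∈ e 1 -> (i ∈ j \/ i = j) -> forall Y, pr j Y ∈ e 2 -> e 0 ∈ Y) [om; G] A) as (W & UW & HW); auto.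
  { d0t. }
  { repeat constructor; auto. apply (U_om HU). }
  assert (HW' : forall c i, Nat i -> stab c i -> forall s Yi, pr c s ∈ A -> pr i Yi ∈ G -> (pr c s ∈ W <-> pr c s ∈ Yi)).
  { intros c i Hi Hst s Yi Hcs HYi. rewrite HW. simpl. split.
    - intros (_ & i' & Hi' & H). apply om_spec in Hi'. destruct (lemax i i' Hi Hi') as (n & Hn & L1 & L2).
      destruct (Gex n Hn) as (Y & HY). rewrite <- (Hst n) with (Y := Y); auto; try (apply om_spec; auto).
      + apply (H n); auto. apply om_spec; auto.
      + exact (HAz _ _ Hcs).
    - intros Hq. split; auto. exists i. split; [apply om_spec; auto|]. intros j Hj Hij Y HY. apply (Hst j) with (Yi := Yi); auto.
      exact (HAz _ _ Hcs). }
  assert (St' : forall c, exists i, Nat i /\ stab c i).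
  { intros c. destruct (Stab c) as (i & Hi & H). exists i; split; auto. apply om_spec; auto. }
  exists A, W. split; auto. split; auto. split.
  2:{ intros m c s Hm Hb Hs. apply HA'; eauto. }
  assert (Q : forall c a, exists Y, (forall s, pr c s ∈ A -> (pr c s ∈ W <-> phi k z Y c s)) /\ (forall s, pr a s ∈ A -> (pr a s ∈ W <-> pr a s ∈ Y)) /\
     exists i, Nat i /\ pr i Y ∈ G).
  { intros c a. destruct (St' c) as (i & Hi & T1), (St' a) as (i' & Hi' & T2). destruct (lemax i i' Hi Hi') as (n & Hn & L1 & L2).
    destruct (G4 n Hn) as (Y & HY & Y' & HY' & _). exists Y. split; [|split; [|eauto]].
    - intros s Hcs. rewrite <- (G6 _ _ _ HY HY'); auto. apply (HW' c (suc n)); auto using N_suc.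
      apply (stabm c i); auto using N_suc. apply (letr i n); auto using N_suc. left; apply in_suc.
    - intros s Has. apply (HW' a n); auto. apply (stabm a i'); auto. }
  intros c s Hcs. pose proof Hcs as Hcs'. apply HA' in Hcs' as (m & Hm & Hb & Hs).
  assert (Hf : isfun s) by apply Hs.
  destruct (Bd_inv Hb) as [(i & j & Hi & Hj & [E|E])|[(a & E & _)|[(a & b & E & _ & _)|(a & E & _)]]]; subst c.
  - left. destruct Hs as (_ & _ & Hs). destruct (Hs i Hi) as (x & Hx), (Hs j Hj) as (y & Hy). exists i, j, x, y. split; auto. split; auto.
    left. split; auto. destruct (Q (kMem i j) emp) as (Y & H1 & _). rewrite H1, phi_mem; auto. split; eauto 6.
    intros (x' & Hx' & y' & Hy' & H). rewrite (Hf i x x'), (Hf j y y'); auto.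
  - left. destruct Hs as (_ & _ & Hs). destruct (Hs i Hi) as (x & Hx), (Hs j Hj) as (y & Hy). exists i, j, x, y. split; auto. split; auto.
    right. split; auto. destruct (Q (kEq i j) emp) as (Y & H1 & _). rewrite H1, phi_eq; auto. split; eauto 6.
    intros (x' & Hx' & y' & Hy' & H). rewrite (Hf i x x'), (Hf j y y'); auto.
  - right; left. exists a. split; auto. pose proof (Aneg _ _ Hcs). split; auto.
    destruct (Q (kNeg a) a) as (Y & H1 & H2 & _). rewrite H1, phi_neg, H2; auto. tauto.
  - right; right; left. exists a, b. destruct (Aimp _ _ _ Hcs) as [Ha' Hb']. split; auto. split; auto. split; auto.
    destruct (St' (kImp a b)) as (i0 & N0 & T0), (St' a) as (i1 & N1 & T1), (St' b) as (i2 & N2 & T2).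
    destruct (lemax i0 i1 N0 N1) as (n1 & Hn1 & L0 & L1). destruct (lemax n1 i2 Hn1 N2) as (n & Hn & L2 & L3).
    destruct (G4 n Hn) as (Y & HY & Y' & HY' & _).
    rewrite (HW' (kImp a b) (suc n)) with (Yi := Y'); auto using N_suc.
    + rewrite (G6 _ _ _ HY HY'), phi_imp; auto.
      rewrite (HW' a n) with (Yi := Y), (HW' b n) with (Yi := Y); auto; [tauto|apply (stabm b i2); auto|apply (stabm a i1); auto].
      apply (letr i1 n1); auto.
    + apply (stabm _ i0); auto using N_suc. apply (letr i0 n1); auto using N_suc. apply (letr n1 n); auto using N_suc. left; apply in_suc.
  - right; right; right. exists a. split; auto. split.
    + intros x Hx. destruct (Aall _ _ Hcs x Hx) as (s' & _ & H1 & H2). eauto.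
    + destruct (Q (kAll a) a) as (Y & H1 & H2 & _). rewrite H1, phi_all; auto.
      assert (K : forall x s', x ∈ k -> Scn x s s' -> s' ∈ z /\ pr a s' ∈ A).
      { intros x s' Hx Hsc. destruct (Aall _ _ Hcs x Hx) as (s'' & H3 & H4 & H5). rewrite (Scn_fun Hsc H4); auto. }
      split.
      * intros H x s' [Hx Hsc]. destruct (K x s' Hx Hsc) as [K1 K2]. apply H2; auto. apply (H x); auto.
      * intros H x Hx s' Hs' Hsc. destruct (K x s' Hx Hsc) as [K1 K2]. apply H2; auto. apply (H x s'); auto.
Qed.
End Total.
End Sat.

Definition fs : form := is_sat 0 1 2 3.
Definition Tr {S : kpm} (x : S) : Prop := True.
Notation inz z := (fun x => x ∈ z).

Section Sat.
Variable S : kpm.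

Lemma fs_ok (D : S -> Prop) (HD : closed D) k c s : D k -> D c -> D s -> (dsat D (el [s; c; k]) fs <-> St D k c s).
Proof. intros H1 H2 H3. destruct (vv_el3 H1 H2 H3) as (A1 & A2 & A3). apply r_sat; auto. Qed.
Lemma St_sub (D D' : S -> Prop) k c s : (forall x, D x -> D' x) -> St D k c s -> St D' k c s.
Proof. intros H (A & W & H1 & H2 & H3). exists A, W; auto. Qed.
Lemma DSt1 (D : S -> Prop) (HD : closed D) k c s : St D k c s -> D c /\ D s.
Proof. intros (A & W & H1 & _ & H3 & _). split; [exact (Dq1 HD H1 H3)|exact (Dq2 HD H1 H3)]. Qed.

Lemma St_agree (D D' : S -> Prop) (k1 k2 Wd c s : S) : (forall x, x ∈ k1 -> x ∈ k2) ->
  (k1 = k2 \/ trans k1) -> DW Wd -> (k1 = k2 \/ c ∈ Wd) -> isfun s -> (forall i x, pr i x ∈ s -> x ∈ k1) ->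
  St D k1 c s -> St D' k2 (kNeg c) s -> False.
Proof.
  intros H1 H2 H3 H4 H5 H6 (A1 & W1 & _ & _ & B1 & B2 & B3) (A2 & W2 & _ & _ & C1 & C2 & C3).
  destruct (SC_neg C3 C1) as (C4 & C5). apply C5 in C2. apply C2.
  apply (agree B3 C3 H1 H2 H3); auto. destruct H4; auto. right; left; auto.
Qed.
Lemma St_agree' (D D' : S -> Prop) (k1 k2 Wd c s : S) : (forall x, x ∈ k1 -> x ∈ k2) ->
  (k1 = k2 \/ trans k1) -> DW Wd -> (k1 = k2 \/ c ∈ Wd) -> isfun s -> (forall i x, pr i x ∈ s -> x ∈ k1) ->
  St D k1 (kNeg c) s -> St D' k2 c s -> False.
Proof.
  intros H1 H2 H3 H4 H5 H6 (A1 & W1 & _ & _ & B1 & B2 & B3) (A2 & W2 & _ & _ & C1 & C2 & C3).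
  destruct (SC_neg B3 B1) as (B4 & B5). apply B5 in B2. apply B2.
  apply (agree B3 C3 H1 H2 H3); auto. destruct H4; auto. right; left; auto.
Qed.
Lemma St_con (D D' : S -> Prop) (k c s m : S) : Seq k m s -> St D k c s -> St D' k (kNeg c) s -> False.
Proof.
  intros Hs. apply St_agree with (Wd := emp); auto using DW_emp. apply Hs.
  intros i x Hx. apply (Seq_vals Hs Hx).
Qed.
Lemma St_neg_of_not (D : S -> Prop) (k A W c s : S) : D A -> D W -> SC k A W -> pr (kNeg c) s ∈ A -> ~ St D k c s -> St D k (kNeg c) s.
Proof.
  intros HA HW H H1 H2. exists A, W. repeat split; auto. destruct (SC_neg H H1) as (H3 & H4). apply H4.
  intros H5. apply H2. exists A, W; auto.
Qed.

Section Tot.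
Variables (U : S -> Prop) (HU : isU U).
Lemma tot_ex k : U k -> exists z A W, U z /\ clset z /\ k ∈ z /\ U A /\ U W /\ SC k A W /\
  forall m c s, Nat m -> Bd Tr m c -> Seq k m s -> pr c s ∈ A.
Proof.
  intros Hk. destruct (closure HU Hk) as (z & Uz & Hz & Hkz).
  destruct (total_sat HU Uz Hz Hkz) as (A & W & UA & UW & H1 & H2).
  exists z, A, W. do 6 (split; auto). intros m c s Hm Hb Hs. apply (H2 m); auto. apply Bd_cpt; auto.
Qed.
Lemma St_dec k m c s : U k -> Nat m -> Bd Tr m c -> Seq k m s -> St U k c s \/ St U k (kNeg c) s.
Proof.
  intros Hk Hm Hb Hs. destruct (tot_ex Hk) as (z & A & W & Uz & Hz & Hkz & UA & UW & H1 & H2).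
  destruct (classic (St U k c s)) as [H|H]; auto. right. apply (@St_neg_of_not U k A W); auto.
  apply (H2 m); auto. apply Bd_neg; auto. apply (@closed_True S).
Qed.
End Tot.

(** ** Certificates for the set of definable subsets *)
Definition DefBy (z k n c s x : S) : Prop :=
  Nat n /\ Bd (inz z) (suc n) c /\ Seq k n s /\ (forall a, a ∈ x -> a ∈ k) /\
  forall a, a ∈ k -> (a ∈ x <-> exists s', s' ∈ z /\ (Scn a s s' /\ St (inz z) k c s')).
(** [d] is the set of definable subsets of [k]; the set [z] contains all formulas, all assignments and satisfaction classes for [k]. *)
Definition Dfn (k d z : S) : Prop := clset z /\ k ∈ z /\
  (forall m, m ∈ z -> forall c, c ∈ z -> forall s, s ∈ z -> Nat m -> Bd (inz z) m c -> Seq k m s -> St (inz z) k c s \/ St (inz z) k (kNeg c) s) /\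
  (forall n, n ∈ z -> forall c, c ∈ z -> forall s, s ∈ z -> Nat n -> Bd (inz z) (suc n) c -> Seq k n s -> exists x, x ∈ d /\ DefBy z k n c s x) /\
  (forall x, x ∈ d -> exists n, n ∈ z /\ exists c, c ∈ z /\ exists s, s ∈ z /\ DefBy z k n c s x).
End Sat.

Definition zB {S : kpm} (z m c : S) := m ∈ z /\ c ∈ z /\ dsat (inz z) (el [c; m]) fb.
Definition zS {S : kpm} (z k c s : S) := k ∈ z /\ c ∈ z /\ s ∈ z /\ dsat (inz z) (el [s; c; k]) fs.
Lemma zB_ok (S : kpm) (z m c : S) : clset z -> (zB z m c <-> Bd (inz z) m c).
Proof.
  intros Hz. unfold zB. split.
  - intros (H1 & H2 & H3). apply (fb_ok Hz) in H3; auto.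
  - intros H. pose proof (DBd Hz H). pose proof (DBd1 Hz H). split; auto. split; auto. apply (fb_ok Hz); auto.
Qed.
Lemma zS_ok (S : kpm) (z k c s : S) : clset z -> k ∈ z -> (zS z k c s <-> St (inz z) k c s).
Proof.
  intros Hz Hk. unfold zS. split.
  - intros (_ & H1 & H2 & H3). apply (fs_ok Hz) in H3; auto.
  - intros H. destruct (DSt1 Hz H). repeat split; auto. apply (fs_ok Hz); auto.
Qed.

Section DfnD0.
(** [Dfn] with satisfaction and boundedness expressed by formulas relativized to [z], which makes it [Delta_0]. *)
Definition DefBy' {S : kpm} (z k n c s x : S) : Prop :=
  Nat n /\ (exists m, m ∈ z /\ (m = suc n /\ zB z m c)) /\ Seq k n s /\ (forall a, a ∈ x -> a ∈ k) /\
  forall a, a ∈ k -> (a ∈ x <-> exists s', s' ∈ z /\ (Scn a s s' /\ zS z k c s')).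
Definition Dfn' {S : kpm} (k d z : S) : Prop := clset z /\ k ∈ z /\
  (forall m, m ∈ z -> forall c, c ∈ z -> forall s, s ∈ z -> Nat m -> zB z m c -> Seq k m s -> zS z k c s \/ exists c', c' ∈ z /\ (c' = pr (nm 2) c /\ zS z k c' s)) /\
  (forall n, n ∈ z -> forall c, c ∈ z -> forall s, s ∈ z -> Nat n -> (exists m, m ∈ z /\ (m = suc n /\ zB z m c)) -> Seq k n s -> exists x, x ∈ d /\ DefBy' z k n c s x) /\
  (forall x, x ∈ d -> exists n, n ∈ z /\ exists c, c ∈ z /\ exists s, s ∈ z /\ DefBy' z k n c s x).
Lemma DefBy'_ok (S : kpm) (z k n c s x : S) : clset z -> k ∈ z -> (DefBy' z k n c s x <-> DefBy z k n c s x).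
Proof.
  intros Hz Hk. unfold DefBy', DefBy.
  assert (E1 : (exists m, m ∈ z /\ (m = suc n /\ zB z m c)) <-> Bd (inz z) (suc n) c).
  { split; [intros (m & _ & -> & H); apply (zB_ok _ _ Hz), H|].
    intros H. exists (suc n). split; [exact (DBd1 Hz H)|]. split; auto. apply zB_ok; auto. }
  assert (E2 : forall a, (exists s', s' ∈ z /\ (Scn a s s' /\ zS z k c s')) <-> (exists s', s' ∈ z /\ (Scn a s s' /\ St (inz z) k c s'))).
  { intros a. split; intros (s' & H1 & H2 & H3); exists s'; (split; [auto|split; [auto|]]); apply (zS_ok _ _ Hz Hk); auto. }
  rewrite E1. split; intros (H1 & H2 & H3 & H4 & H5); (split; [auto|split; [auto|split; [auto|split; [auto|]]]]);
  intros a Ha; rewrite (H5 a Ha), E2; tauto.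
Qed.
Lemma Dfn'_ok (S : kpm) (k d z : S) : Dfn' k d z <-> Dfn k d z.
Proof.
  unfold Dfn', Dfn.
  assert (Q : forall P Q R R' : Prop, (P -> Q -> (R <-> R')) -> (P /\ Q /\ R <-> P /\ Q /\ R')) by (intros; tauto).
  apply Q. intros Hz Hk.
  assert (E1 : forall n c, (exists m, m ∈ z /\ (m = suc n /\ zB z m c)) <-> Bd (inz z) (suc n) c).
  { intros n c. split; [intros (m & _ & -> & H); apply (zB_ok _ _ Hz), H|].
    intros H. exists (suc n). split; [exact (DBd1 Hz H)|]. split; auto. apply zB_ok; auto. }
  assert (E2 : forall c s, (exists c', c' ∈ z /\ (c' = pr (nm 2) c /\ zS z k c' s)) <-> St (inz z) k (kNeg c) s).
  { intros c s. split; [intros (m & _ & -> & H); apply (zS_ok _ _ Hz Hk), H|].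
    intros H. exists (kNeg c). split; [apply (DSt1 Hz H)|]. split; [reflexivity|]. apply zS_ok; auto. }
  split; intros (H1 & H2 & H3); (split; [|split]).
  - intros m Hm c Hc s Hs Nm Hb Hq. destruct (H1 m Hm c Hc s Hs Nm) as [G|G]; auto. apply zB_ok; auto.
    left; apply (zS_ok _ _ Hz Hk); auto. right; apply E2; auto.
  - intros n Hn c Hc s Hs Nn Hb Hq. apply E1 in Hb. destruct (H2 n Hn c Hc s Hs Nn Hb Hq) as (x & Hx & G). exists x; split; auto. apply DefBy'_ok; auto.
  - intros x Hx. destruct (H3 x Hx) as (n & Hn & c & Hc & s & Hs & G). exists n; split; auto. exists c; split; auto. exists s; split; auto. apply DefBy'_ok; auto.
  - intros m Hm c Hc s Hs Nm Hb Hq. destruct (H1 m Hm c Hc s Hs Nm) as [G|G]; auto. apply zB_ok; auto.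
    left; apply (zS_ok _ _ Hz Hk); auto. right; apply E2; auto.
  - intros n Hn c Hc s Hs Nn Hb Hq. apply E1 in Hb. destruct (H2 n Hn c Hc s Hs Nn Hb Hq) as (x & Hx & G). exists x; split; auto. apply DefBy'_ok; auto.
  - intros x Hx. destruct (H3 x Hx) as (n & Hn & c & Hc & s & Hs & G). exists n; split; auto. exists c; split; auto. exists s; split; auto. apply DefBy'_ok; auto.
Qed.
Lemma Dfn_graph : dfn 3 (fun S e => Dfn (e 0) (e 1) (e 2)).
Proof.
  apply (d0_ext (P := fun S e => Dfn' (e 0) (e 1) (e 2))); [|intros; apply Dfn'_ok].
  unfold Dfn', DefBy', zB, zS. d0t.
Qed.
End DfnD0.
Lemma d0_Dfn n u v w : isv n u -> isv n v -> isv n w -> dfn n (fun S e => Dfn (u S e) (v S e) (w S e)).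
Proof.
  intros (i & Hi & Hu) (j & Hj & Hv) (k & Hk & Hw).
  apply (d0_ext (P := fun S e => Dfn (e i) (e j) (e k))); [|intros; rewrite Hu, Hv, Hw; tauto].
  apply (@d0_ren n 3 _ (fun x => match x with 0 => i | 1 => j | _ => k end) Dfn_graph). intros [|[|x]]; lia.
Qed.
Ltac d0h ::= first [ simple apply d0_Dfn; [isvt|isvt|isvt] | d0h2 ].

Section Levels.
Variable S : kpm.

(** Satisfaction witnessed in [z] agrees with satisfaction in the model: [z] decides every formula
    under every assignment, and if it verified the negation of something true, two satisfaction
    classes for [k] would disagree. *)
Lemma Dfn_spec (k d z x : S) : Dfn k d z -> (x ∈ d <-> InD Tr k x).
Proof.
  intros (Hz & Hk & HA & HB & HC).
  assert (Eq : forall m c s, Nat m -> Bd (inz z) m c -> Seq k m s -> s ∈ z -> (St (inz z) k c s <-> St Tr k c s)).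
  { intros m c s Hm Hb Hs Hsz. split; [apply St_sub; unfold Tr; auto|]. intros H.
    destruct (HA m (DBd1 Hz Hb) c (DBd Hz Hb) s Hsz Hm Hb Hs) as [H1|H1]; auto. destruct (St_con Hs H H1). }
  assert (Sz : forall n s, Nat n -> Seq k n s -> s ∈ z).
  { intros n s Hn Hs. apply (@Seq_in S z k n); auto. intros y; apply (cl_tr Hz Hk). }
  assert (Q : forall n c s x, DefBy z k n c s x -> forall a, a ∈ x <-> a ∈ k /\ exists s', Tr s' /\ Scn a s s' /\ St Tr k c s').
  { intros n c s y (H1 & H2 & H3 & H4 & H5) a. split.
    - intros Ha. split; auto. apply H5 in Ha as (s' & Hs' & Hsc & HSt); auto. exists s'. split; [exact I|]. split; auto.
      revert HSt. apply St_sub; unfold Tr; auto.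
    - intros (Ha & s' & _ & Hsc & HSt). apply H5; auto. pose proof (Scn_Seq H1 H3 Ha Hsc) as Hs'.
      exists s'. split; [apply (Sz (suc n)); auto using N_suc|]. split; auto. apply (Eq (suc n)); auto using N_suc.
      apply (Sz (suc n)); auto using N_suc. }
  split.
  - intros Hx. destruct (HC x Hx) as (n & Hn & c & Hc & s & Hs & HD). pose proof (Q _ _ _ _ HD) as HQ.
    destruct HD as (H1 & H2 & H3 & _). exists n, c, s. split; [exact I|]. split; auto. split.
    + exists (suc n); split; auto. revert H2; apply Bd_sub; unfold Tr; auto.
    + split; auto.
  - intros (n & c & s & _ & Hn & (n' & -> & Hb) & Hs & Hx).
    assert (Hb' : Bd (inz z) (suc n) c) by (apply Bd_cpt; auto using N_suc).
    destruct (HB n (D_Nat Hz Hn) c (DBd Hz Hb') s (Sz n s Hn Hs) Hn Hb' Hs) as (y & Hy & HD).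
    replace x with y; auto. apply ext; intros a. rewrite (Q _ _ _ _ HD a), (Hx a). tauto.
Qed.

(** The definable subsets are the image of the set [Z] of all triples of arity, formula and
    parameters under evaluation by one total satisfaction class. The certificate is a closed set
    around that class. *)
Lemma Dfn_ex (U : S -> Prop) (HU : isU U) k : U k -> exists d z, U d /\ U z /\ Dfn k d z.
Proof.
  intros Hk. destruct (tot_ex HU Hk) as (z0 & A & W & Uz0 & Hz0 & Hkz0 & UA & UW & HSC & HA).
  destruct (@U_sep S U HU (fun S e => exists n b, e 0 = pr n b /\ (Nat n /\ exists c s, b = pr c s /\ 
      ((exists m, m ∈ e 2 /\ (m = suc n /\ zB (e 2) m c)) /\ Seq (e 1) n s))) [k; z0] z0) as (Z & UZ & HZ); auto.
  { unfold zB; d0t. }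
  destruct (@U_img S U HU (fun S e => (forall a, a ∈ e 0 -> a ∈ e 2 /\ exists n b, e 1 = pr n b /\ exists c s, b = pr c s /\ exists s', s' ∈ e 3 /\ (Scn a s s' /\ pr c s' ∈ e 4)) /\
      (forall a, a ∈ e 2 -> (exists n b, e 1 = pr n b /\ exists c s, b = pr c s /\ exists s', s' ∈ e 3 /\ (Scn a s s' /\ pr c s' ∈ e 4)) -> a ∈ e 0)) [k; z0; W] Z) as (d & Ud & Hd); auto.
  { d0t. }
  { intros q Hq. destruct (@U_sep S U HU (fun S e => exists n b, e 1 = pr n b /\ exists c s, b = pr c s /\ exists s', s' ∈ e 3 /\ (Scn (e 0) s s' /\ pr c s' ∈ e 4)) [q; k; z0; W] k) as (y & Uy & Hy); auto.
    - d0t.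
    - repeat constructor; auto. apply (U_tr HU UZ Hq).
    - exists y; split; auto. simpl. split; [intros a Ha; apply Hy, Ha|intros a H1 H2; apply Hy; auto]. }
  { intros q y y'. simpl. intros [B1 B2] [B3 B4]. apply ext; intros a; split; intros Ha.
    - destruct (B1 a Ha); auto. - destruct (B3 a Ha); auto. }
  destruct (closure HU (X := up2 z0 (up2 A W))) as (z & Uz & Hz & Hin).
  { repeat apply (U_up2 HU); auto. }
  assert (z0 ∈ z) by (apply (cl_tr Hz Hin); apply up2_spec; auto).
  assert (up2 A W ∈ z) by (apply (cl_tr Hz Hin); apply up2_spec; auto).
  assert (HAz : A ∈ z) by (apply (cl_tr Hz H0); apply up2_spec; auto).
  assert (HWz : W ∈ z) by (apply (cl_tr Hz H0); apply up2_spec; auto).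
  assert (Hsub : forall x, x ∈ z0 -> x ∈ z) by (intros x Hx; apply (cl_tr Hz H Hx)).
  assert (ToT : forall m c, Bd (inz z) m c -> Bd Tr m c) by (intros m c; apply Bd_sub; unfold Tr; auto).
  assert (Sz0 : forall n s, Nat n -> Seq k n s -> s ∈ z0).
  { intros n s Hn Hs. apply (@Seq_in S z0 k n); auto. intros y; apply (cl_tr Hz0 Hkz0). }
  assert (StW : forall m c s, Nat m -> Bd Tr m c -> Seq k m s -> (St (inz z) k c s <-> pr c s ∈ W)).
  { intros m c s Hm Hb Hs. split.
    - intros HSt. apply NNPP; intros N. apply (St_con (m := m) (D := inz z) (D' := inz z) Hs HSt).
      exists A, W. repeat split; auto. 
      + apply (HA m); auto. apply Bd_neg; auto. apply (@closed_True S).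
      + apply (SC_neg HSC); auto. apply (HA m); auto. apply Bd_neg; auto. apply (@closed_True S).
    - intros HW. exists A, W. repeat split; auto. apply (HA m); auto. }
  assert (Main : forall n c s y, Nat n -> Bd Tr (suc n) c -> Seq k n s ->
     ((forall a, a ∈ y <-> a ∈ k /\ exists s', s' ∈ z0 /\ (Scn a s s' /\ pr c s' ∈ W)) -> DefBy z k n c s y)).
  { intros n c s y Hn Hb Hs Hy. split; [auto|split; [apply Bd_cpt; auto using N_suc|split; [auto|split]]].
    - intros a Ha. apply Hy, Ha.
    - intros a Ha. rewrite Hy. split.
      + intros (_ & s' & H1 & H2 & H3). exists s'. split; auto. split; auto. 
        apply (StW (suc n)); auto using N_suc. apply (Scn_Seq Hn Hs Ha H2).
      + intros (s' & H1 & H2 & H3). split; auto. exists s'. pose proof (Scn_Seq Hn Hs Ha H2) as Hs'.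
        split; [apply (Sz0 (suc n)); auto using N_suc|]. split; auto. apply (StW (suc n)); auto using N_suc. }
  exists d, z. split; auto. split; auto. split; [auto|split; [auto|split; [|split]]].
  - intros m Hm c Hc s Hs Nm Hb Hq. destruct (classic (St (inz z) k c s)) as [HSt|HSt]; auto. right.
    apply (@St_neg_of_not S (inz z) k A W); auto. apply (HA m); auto. apply Bd_neg; auto. apply (@closed_True S).
  - intros n Hn c Hc s Hs Nn Hb Hq.
    assert (HqZ : pr n (pr c s) ∈ Z).
    { apply HZ. assert (Hb0 : Bd (inz z0) (suc n) c) by (apply Bd_cpt; auto using N_suc).
      split; [apply (D_pr Hz0); [apply (D_Nat Hz0 Nn)|]; apply (D_pr Hz0); [exact (DBd Hz0 Hb0)|apply (Sz0 n); auto]|].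
      simpl. exists n, (pr c s). split; auto. split; auto. exists c, s. split; auto. split; auto.
      exists (suc n). split; [exact (DBd1 Hz0 Hb0)|]. split; auto. apply zB_ok; auto. }
    assert (exists x, x ∈ d /\ forall a, a ∈ x <-> a ∈ k /\ exists s', s' ∈ z0 /\ (Scn a s s' /\ pr c s' ∈ W)) as (x & Hx & Hx').
    { destruct (@U_sep S U HU (fun S e => exists s', s' ∈ e 1 /\ (Scn (e 0) (e 2) s' /\ pr (e 3) s' ∈ e 4)) [z0; s; c; W] k) as (x & Ux & Hx); auto.
      - d0t.
      - repeat constructor; auto; apply (U_tr HU Uz); auto.
      - exists x. split; [|exact Hx]. apply Hd. exists (pr n (pr c s)). split; auto. simpl. split.
        + intros a Ha. apply Hx in Ha as [Ha Hp]. split; auto. exists n, (pr c s). split; auto. exists c, s; split; auto.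
        + intros a Ha (n' & b & E & c' & s'' & E' & Hp). apply pr_inj in E as [<- <-]. apply pr_inj in E' as [<- <-]. apply Hx; auto. }
    exists x; split; auto.
  - intros x Hx. apply Hd in Hx as (q & Hq & Hx). apply HZ in Hq as (Hqz & n & b & E & Hn & c & s & E' & (m & Hm & Em & HB) & Hs).
    simpl in E, E', HB, Hs, Hm. subst q b m. apply (zB_ok _ _ Hz0) in HB.
    exists n. split; [apply (D_Nat Hz Hn)|]. exists c. split; [apply Hsub, (DBd Hz0 HB)|]. exists s. split; [apply Hsub, (Sz0 n); auto|].
    apply Main; auto. { revert HB; apply Bd_sub; unfold Tr; auto. }
    simpl in Hx. destruct Hx as [B1 B2]. intros a. split.
    + intros Ha. destruct (B1 a Ha) as (H1 & n' & b & E & c' & s'' & E' & Hp). apply pr_inj in E as [<- <-]. apply pr_inj in E' as [<- <-]. auto.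
    + intros [H1 H2]. apply B2; auto. exists n, (pr c s). split; auto. exists c, s; split; auto.
Qed.

(** ** Chains of levels *)
(** Every member of [C] is the union of the [Def k] for the [k] in [C] below it; so the members are levels of the hierarchy,
    without reference to ordinals. *)
Definition Ch (C : S) := forall m, m ∈ C -> trans m /\ forall x, x ∈ m <-> exists k, k ∈ C /\ k ∈ m /\ InD Tr k x.
End Levels.

(** The bounded form of [Ch]: [B] holds a certified set of definable subsets for each member of [C],
    and with these at hand [InD] is replaced by bounded statements. *)
Definition Ch0 {S : kpm} (C B : S) : Prop := (forall k, k ∈ C -> exists d, d ∈ B /\ exists z, z ∈ B /\ Dfn k d z) /\
  forall m, m ∈ C -> (forall x, x ∈ m -> forall y, y ∈ x -> y ∈ m) /\
    (forall x, x ∈ m -> exists k, k ∈ C /\ (k ∈ m /\ exists d, d ∈ B /\ exists z, z ∈ B /\ (Dfn k d z /\ x ∈ d))) /\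
    (forall k, k ∈ C -> k ∈ m -> forall d, d ∈ B -> forall z, z ∈ B -> Dfn k d z -> forall x, x ∈ d -> x ∈ m).
Lemma d0_Ch0 n u v : isv n u -> isv n v -> dfn n (fun S e => Ch0 (u S e) (v S e)).
Proof.
  intros (i & Hi & Hu) (j & Hj & Hv).
  apply (d0_ext (P := fun S e => Ch0 (e i) (e j))); [unfold Ch0; d0t|intros; rewrite Hu, Hv; tauto].
Qed.
Ltac d0h ::= first [ simple apply d0_Dfn; [isvt|isvt|isvt] | simple apply d0_Ch0; [isvt|isvt] | d0h2 ].

Section Levels2.
Variable S : kpm.
Lemma Ch0_Ch (C B : S) : Ch0 C B -> Ch C.
Proof.
  intros [H1 H2] m Hm. destruct (H2 m Hm) as (H3 & H4 & H5). split; [exact H3|]. intros x; split.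
  - intros Hx. destruct (H4 x Hx) as (k & Hk & Hkm & d & Hd & z & Hz & HD & Hxd). exists k. repeat split; auto. apply (Dfn_spec _ HD), Hxd.
  - intros (k & Hk & Hkm & Hx). destruct (H1 k Hk) as (d & Hd & z & Hz & HD). apply (H5 k Hk Hkm d Hd z Hz HD), (Dfn_spec _ HD), Hx.
Qed.
Lemma Ch_Ch0 (U : S -> Prop) (HU : isU U) C : U C -> Ch C -> exists B, U B /\ Ch0 C B.
Proof.
  intros UC HC.
  destruct (@U_coll S U HU (fun S e => exists d, d ∈ e 0 /\ exists z, z ∈ e 0 /\ Dfn (e 1) d z) [] C) as (b & Ub & Hb); auto.
  { d0t. }
  { intros k Hk. destruct (Dfn_ex HU (U_tr HU UC Hk)) as (d & z & Ud & Uz & HD). exists (up2 d z). split; [apply (U_up2 HU); auto|].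
    simpl. exists d. split; [apply up2_spec; auto|]. exists z; split; [apply up2_spec; auto|auto]. }
  exists (Un b). split; [apply (U_Un HU); auto|].
  assert (K : forall k, k ∈ C -> exists d, d ∈ Un b /\ exists z, z ∈ Un b /\ Dfn k d z).
  { intros k Hk. destruct (Hb k Hk) as (w & Hw & d & Hd & z & Hz & HD). exists d. split; [apply Un_spec; eauto|].
    exists z; split; [apply Un_spec; eauto|auto]. }
  split; auto. intros m Hm. destruct (HC m Hm) as [H1 H2]. split; [exact H1|]. split.
  - intros x Hx. apply H2 in Hx as (k & Hk & Hkm & Hx). destruct (K k Hk) as (d & Hd & z & Hz & HD).
    exists k; split; auto. split; auto. exists d; split; auto. exists z; split; auto. split; auto. apply (Dfn_spec _ HD), Hx.
  - intros k Hk Hkm d Hd z Hz HD x Hx. apply H2. exists k. repeat split; auto. apply (Dfn_spec _ HD), Hx.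
Qed.

(** The Delta_0 form of [belowT], equivalent to it when [B] contains a certificate for [k]. The
    condition on definable subsets is what makes a level precede another in the hierarchy, beyond
    being its element. *)
Definition below (B k m : S) := k ∈ m /\ forall d, d ∈ B -> forall z, z ∈ B -> Dfn k d z -> forall x, x ∈ d -> x ∈ m.
Definition belowT (k m : S) := k ∈ m /\ forall x, InD Tr k x -> x ∈ m.

(** Levels of different chains are compared without ordinals, by nested induction on the two
    members. If no predecessor of [m1] is equal to or above [m2], and conversely, then every
    predecessor on either side is below the other level; so its definable subsets belong to both,
    and [m1 = m2]. *)
Theorem Ch_tri (C1 C2 : S) : Ch C1 -> Ch C2 -> forall m1 m2, m1 ∈ C1 -> m2 ∈ C2 -> belowT m1 m2 \/ m1 = m2 \/ belowT m2 m1.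
Proof.
  intros H1 H2. destruct (Ch_Ch0 (isU_True S) (C := C1) I H1) as (B1 & _ & HB1), (Ch_Ch0 (isU_True S) (C := C2) I H2) as (B2 & _ & HB2).
  set (B := un B1 B2).
  assert (E : forall k m, (k ∈ C1 \/ k ∈ C2) -> (below B k m <-> belowT k m)).
  { intros k m Hk. unfold below, belowT. 
    assert (exists d, d ∈ B /\ exists z, z ∈ B /\ Dfn k d z) as (d & Hd & z & Hz & HD).
    { destruct Hk as [Hk|Hk]; [destruct HB1 as [HB1 _]; destruct (HB1 k Hk) as (d & Hd & z & Hz & HD)|destruct HB2 as [HB2 _]; destruct (HB2 k Hk) as (d & Hd & z & Hz & HD)];
      exists d; (split; [apply un_spec; auto|]); exists z; (split; [apply un_spec; auto|auto]). }
    split; intros [G1 G2]; split; auto.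
    - intros x Hx. apply (G2 d Hd z Hz HD), (Dfn_spec _ HD), Hx.
    - intros d' _ z' _ HD' x Hx. apply G2, (Dfn_spec _ HD'), Hx. }
  assert (T : forall m1, forall m2, m1 ∈ C1 -> m2 ∈ C2 -> below B m1 m2 \/ m1 = m2 \/ below B m2 m1).
  2:{ intros m1 m2 K1 K2. rewrite <- !E; auto. }
  assert (T : forall m1, m1 ∈ C1 -> forall m2, m2 ∈ C2 -> below B m1 m2 \/ m1 = m2 \/ below B m2 m1); [|auto].
  apply (@ind0 S (fun S e => e 0 ∈ e 1 -> forall m2, m2 ∈ e 2 -> 
    (e 0 ∈ m2 /\ forall d, d ∈ e 3 -> forall z, z ∈ e 3 -> Dfn (e 0) d z -> forall x, x ∈ d -> x ∈ m2) \/ e 0 = m2 \/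
    (m2 ∈ e 0 /\ forall d, d ∈ e 3 -> forall z, z ∈ e 3 -> Dfn m2 d z -> forall x, x ∈ d -> x ∈ e 0)) [C1; C2; B]).
  { d0t. }
  simpl. intros m1 IH1 K1.
  assert (IH1' : forall k, k ∈ m1 -> k ∈ C1 -> forall m2, m2 ∈ C2 -> belowT k m2 \/ k = m2 \/ belowT m2 k).
  { intros k Hk Hk1 m2 K2. rewrite <- !E; auto. exact (IH1 k Hk Hk1 m2 K2). }
  clear IH1.
  assert (T : forall m2, m2 ∈ C2 -> below B m1 m2 \/ m1 = m2 \/ below B m2 m1); [|exact T].
  apply (@ind0 S (fun S e => e 0 ∈ e 2 -> 
    (e 1 ∈ e 0 /\ forall d, d ∈ e 3 -> forall z, z ∈ e 3 -> Dfn (e 1) d z -> forall x, x ∈ d -> x ∈ e 0) \/ e 1 = e 0 \/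
    (e 0 ∈ e 1 /\ forall d, d ∈ e 3 -> forall z, z ∈ e 3 -> Dfn (e 0) d z -> forall x, x ∈ d -> x ∈ e 1)) [m1; C2; B]).
  { d0t. }
  simpl. intros m2 IH2 K2. change (below B m1 m2 \/ m1 = m2 \/ below B m2 m1).
  assert (IH2' : forall k, k ∈ m2 -> k ∈ C2 -> belowT m1 k \/ m1 = k \/ belowT k m1).
  { intros k Hk Hk2. rewrite <- !E; auto. exact (IH2 k Hk Hk2). }
  clear IH2. rewrite !E; auto.
  destruct (H1 m1 K1) as [Ht1 Hm1], (H2 m2 K2) as [Ht2 Hm2].
  destruct (classic (exists k, k ∈ C1 /\ k ∈ m1 /\ (k = m2 \/ belowT m2 k))) as [(k & Hk1 & Hkm & Hk)|N1].
  { right; right. split.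
    - destruct Hk as [<-|[Hk _]]; auto. apply (Ht1 k Hkm); auto.
    - intros x Hx. destruct Hk as [<-|[_ Hk]]; [apply Hm1; eauto|]. apply (Ht1 k Hkm); auto. }
  destruct (classic (exists k, k ∈ C2 /\ k ∈ m2 /\ (m1 = k \/ belowT m1 k))) as [(k & Hk1 & Hkm & Hk)|N2].
  { left. split.
    - destruct Hk as [->|[Hk _]]; auto. apply (Ht2 k Hkm); auto.
    - intros x Hx. destruct Hk as [->|[_ Hk]]; [apply Hm2; eauto|]. apply (Ht2 k Hkm); auto. }
  right; left. apply ext; intros x; split; intros Hx.
  - apply Hm1 in Hx as (k & Hk & Hkm & Hx). destruct (IH1' k Hkm Hk m2 K2) as [G|[G|G]]; [apply G, Hx| |]; exfalso; apply N1; exists k; auto.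
  - apply Hm2 in Hx as (k & Hk & Hkm & Hx). destruct (IH2' k Hkm Hk) as [G|[G|G]]; [| |apply G, Hx]; exfalso; apply N2; exists k; auto.
Qed.
End Levels2.

Lemma Delta0_abs (X : Type) (E : X -> X -> Prop) (D : X -> Prop) p : (forall x y, D y -> E x y -> D x) ->
  Delta0 p -> forall n e, bounded n p -> (forall i, i < n -> D (e i)) -> (tsat E D e p <-> tsat E (fun _ => True) e p).
Proof.
  intros HD. induction 1; simpl; intros n e B He; try tauto.
  - rewrite IHDelta0; eauto; tauto.
  - destruct B. rewrite (IHDelta0_1 n), (IHDelta0_2 n); auto; tauto.
  - destruct B as [[_ Hy] B].
    assert (Q : forall x, E x (e y) -> (tsat E D (sc x e) p <-> tsat E (fun _ => True) (sc x e) p)).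
    { intros x Hx. apply (IHDelta0 (S n)); auto. intros [|i] Hi; simpl; [|apply He; lia]. apply (HD x (e y)); auto. apply He; lia. }
    split; intros H1 x Hx Hxy; apply Q; auto. apply H1; auto. apply (HD x (e y)); auto. apply He; lia.
Qed.

(** * Codes of actual formulas *)
Section Std.
Variable S : kpm.
Notation Sn := Datatypes.S.

Ltac cdn := cbv [pairing union infinity separation collection Ex Iff And Or interp form_syntax mem eql neg imp all]; reflexivity.
Lemma cd_pairing : @cd S pairing = pairing.
Proof. rewrite <- (interp_cd S pairing). cdn. Qed.
Lemma cd_union : @cd S union = union.
Proof. rewrite <- (interp_cd S union). cdn. Qed.
Lemma cd_infinity : @cd S infinity = infinity.
Proof. rewrite <- (interp_cd S infinity). cdn. Qed.
Lemma cd_sep p : @cd S (separation p) = separation (cd p).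
Proof. rewrite <- (interp_cd S (separation p)), <- (interp_cd S p). cdn. Qed.
Lemma cd_coll p q : @cd S (collection p q) = collection (cd p) (cd q).
Proof. rewrite <- (interp_cd S (collection p q)), <- (interp_cd S p), <- (interp_cd S q). cdn. Qed.
Lemma cd_Ex p : @cd S (Ex p) = Ex (cd p).
Proof. rewrite <- (interp_cd S (Ex p)), <- (interp_cd S p). cdn. Qed.
Lemma cd_BAll y p : @cd S (BAll y p) = kAll (kImp (kMem (nm 0) (suc (nm y))) (cd p)). Proof. reflexivity. Qed.

Lemma nm_lt i n : i < n -> @nm S i ∈ nm n.
Proof.
  induction n; intros H; [lia|]. simpl. apply suc_spec. destruct (Nat.eq_dec i n) as [->|N]; auto. left; apply IHn; lia.
Qed.
Lemma in_nm n (x : S) : x ∈ nm n -> exists i, i < n /\ x = nm i.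
Proof.
  induction n; simpl; intros H; [destruct (emp_spec H)|]. apply suc_spec in H as [H| ->]; [|exists n; auto].
  destruct (IHn H) as (i & Hi & ->); exists i; auto.
Qed.

Section D.
Variable D : S -> Prop.
Hypothesis HD : closed D.
Lemma cd_Bd p : forall n, bounded n p -> Bd D (nm n) (cd p).
Proof.
  induction p; simpl; intros n B.
  - apply (Bd_mem HD); [apply nm_Nat|apply nm_lt, B|apply nm_lt, B].
  - apply (Bd_eq HD); [apply nm_Nat|apply nm_lt, B|apply nm_lt, B].
  - apply (Bd_neg HD); auto.
  - apply (Bd_imp HD); [apply IHp1|apply IHp2]; apply B.
  - apply (Bd_all HD). apply (IHp (Sn n)); auto.
Qed.
Lemma cd_Fm p : Fm D (cd p).
Proof. exists (nm (bnd p)); split; [apply nm_Nat|apply cd_Bd, bnd_ok]. Qed.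
Lemma cd_D p : D (cd p).
Proof. apply (DFm HD), cd_Fm. Qed.
Lemma cd_D0 p : Delta0 p -> D0c D (cd p).
Proof.
  induction 1; [| | | |rewrite cd_BAll]; cbn [cd].
  - apply (D0c_mem HD); apply nm_Nat.
  - apply (D0c_eq HD); apply nm_Nat.
  - apply (D0c_neg HD); auto.
  - apply (D0c_imp HD); auto.
  - apply (D0c_ball HD (y := nm y) (a := cd p)); auto. apply nm_Nat.
Qed.
Lemma cd_Rn p : forall r g, D r -> (forall i, pr (nm i) (nm (g i)) ∈ r) -> Rn D r (cd p) (cd (ren g p)).
Proof.
  induction p; simpl; intros r g Hr H.
  - apply (Rn_mem HD); auto.
  - apply (Rn_eq HD); auto.
  - apply (Rn_neg HD); auto.
  - apply (Rn_imp HD); auto.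
  - apply (Rn_all HD) with (upr r); auto using UpR_upr. apply IHp; [apply (cl_upr HD); auto|].
    intros [|i]; apply upr_spec; [left; reflexivity|]. right. exists (nm i), (nm (g i)). split; auto.
Qed.
End D.

Lemma seq_ex (k : S) n : forall e, (forall i, i < n -> e i ∈ k) ->
  exists s, Seq k (nm n) s /\ forall i, i < n -> pr (nm i) (e i) ∈ s.
Proof.
  induction n; intros e He.
  - exists emp. split; [apply Seq_emp|lia].
  - destruct (IHn (fun i => e (Sn i))) as (s & Hs & H); [intros; apply He; lia|].
    destruct (@Scn_ex _ _ (isU_True S) (e 0) s I I) as (s' & _ & Hs'). exists s'. split.
    + apply (@Scn_Seq S k (nm n) (e 0) s s'); auto. apply nm_Nat. apply He; lia.
    + intros [|i] Hi; apply (Scn_in _ _ Hs'); [left; split; reflexivity|].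
      right. exists (nm i). split; [reflexivity|]. apply H; lia.
Qed.

(** The code is that of an actual formula, so here the induction may run outside the model. *)
Lemma sat_std (k A W : S) : SC k A W -> forall p n e s, bounded n p -> isfun s ->
  (forall i, i < n -> pr (nm i) (e i) ∈ s) -> pr (cd p) s ∈ A -> (pr (cd p) s ∈ W <-> dsat (inz k) e p).
Proof.
  intros HSC. induction p; simpl; intros n e s B Hf Hs HA.
  - destruct (SC_mem HSC HA) as (x & y & Hx & Hy & H). rewrite (H : pr (pr (nm 0) (pr (nm i) (nm j))) s ∈ W <-> _).
    rewrite (Hf _ _ _ (conj Hx (Hs i (proj1 B)))), (Hf _ _ _ (conj Hy (Hs j (proj2 B)))). tauto.
  - destruct (SC_eq HSC HA) as (x & y & Hx & Hy & H). rewrite (H : pr (pr (nm 1) (pr (nm i) (nm j))) s ∈ W <-> _).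
    rewrite (Hf _ _ _ (conj Hx (Hs i (proj1 B)))), (Hf _ _ _ (conj Hy (Hs j (proj2 B)))). tauto.
  - destruct (SC_neg HSC HA) as (Ha & H). rewrite (H : pr (pr (nm 2) (cd p)) s ∈ W <-> _). rewrite (IHp n e s); auto; tauto.
  - destruct (SC_imp HSC HA) as (Ha & Hb & H). rewrite (H : pr (pr (nm 3) (pr (cd p1) (cd p2))) s ∈ W <-> _).
    destruct B. rewrite (IHp1 n e s), (IHp2 n e s); auto; tauto.
  - destruct (SC_all HSC HA) as (Ha & H). rewrite (H : pr (pr (nm 4) (cd p)) s ∈ W <-> _).
    assert (Q : forall x s', x ∈ k -> Scn x s s' -> (pr (cd p) s' ∈ W <-> dsat (inz k) (sc x e) p)).
    { intros x s' Hx Hsc. apply (IHp (Sn n)); auto.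
      - apply (Scn_isfun Hf Hsc).
      - intros [|i] Hi; apply (Scn_in _ _ Hsc); [left; split; reflexivity|]. right. exists (nm i). split; [reflexivity|]. apply Hs; lia.
      - destruct (Ha x Hx) as (s'' & H1 & H2). rewrite (Scn_fun Hsc H1); auto. }
    split; intros G.
    + intros x Hx. destruct (Ha x Hx) as (s' & Hsc & _). apply (Q x s' Hx Hsc), (G x s'); auto.
    + intros x s' Hx Hsc. apply (Q x s' Hx Hsc), G, Hx.
Qed.
End Std.

(** * Levels of the constructible hierarchy *)
Section Lev.
Variable S : kpm.
Notation Sn := Datatypes.S.
Variables (a l f : S).
Hypothesis Ha : isord a.
Hypothesis Hf : isfun f.
Hypothesis Hal : pr a l ∈ f.
Hypothesis Hd : forall g m, pr g m ∈ f -> forall h, h ∈ g -> exists k, pr h k ∈ f.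
Hypothesis Hx : forall g m, pr g m ∈ f -> forall x, x ∈ m <-> exists h k, h ∈ g /\ pr h k ∈ f /\ InD Tr k x.

Lemma InD_sub (D : S -> Prop) (k x y : S) : InD D k x -> y ∈ x -> y ∈ k.
Proof. intros (n & c & s & _ & _ & _ & _ & H) Hy. apply H, Hy. Qed.

Lemma lev_trans g m : trans g -> pr g m ∈ f -> trans m.
Proof.
  intros Hg Hm x Hxm y Hy. apply (Hx Hm) in Hxm as (h & k & Hh & Hk & HI).
  pose proof (InD_sub HI Hy) as Hyk. apply (Hx Hk) in Hyk as (h' & k' & Hh' & Hk' & HI').
  apply (Hx Hm). exists h', k'. split; auto. apply (Hg h); auto.
Qed.
Lemma l_trans : trans l. Proof. exact (lev_trans (proj1 Ha) Hal). Qed.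

Lemma InD_self (k : S) : InD Tr k k.
Proof.
  destruct (tot_ex (isU_True S) (k := k) I) as (z & A & W & _ & Hz & Hkz & _ & _ & HSC & HA).
  assert (HT : closed (@Tr S)) by (apply (@closed_True S)).
  (* The equation of variable 0 with itself, without parameters, defines all of [k]. *)
  exists emp, (kEq emp emp), emp. split; [exact I|]. split; [apply N_emp|]. split; [exists (suc emp); split; auto; apply (Bd_eq HT); auto using N_suc, N_emp, in_suc|].
  split; [apply Seq_emp|]. intros x. split; [|tauto]. intros Hxk. split; auto.
  destruct (@Scn_ex _ _ (isU_True S) x emp I I) as (s' & _ & Hs'). exists s'. split; [exact I|]. split; auto.
  pose proof (Scn_Seq (@N_emp S) (Seq_emp k) Hxk Hs') as Hq.
  exists A, W. split; [exact I|]. split; [exact I|].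
  assert (HA' : pr (kEq emp emp) s' ∈ A).
  { apply (HA (suc emp)); auto using N_suc, N_emp. apply (Bd_eq HT); auto using N_suc, N_emp, in_suc. }
  split; auto. split; auto. destruct (SC_eq HSC HA') as (u & v & Hu & Hv & Hw). apply Hw. apply (proj1 Hq emp); auto.
Qed.

Lemma lev_in h k g m : h ∈ g -> pr h k ∈ f -> pr g m ∈ f -> k ∈ m.
Proof. intros H1 H2 H3. apply (Hx H3). exists h, k. split; auto. split; auto. apply InD_self. Qed.

Lemma lev_uniq g f0 : isfun f0 -> (forall g m, pr g m ∈ f0 -> forall h, h ∈ g -> exists k, pr h k ∈ f0) ->
  (forall g m, pr g m ∈ f0 -> forall x, x ∈ m <-> exists h k, h ∈ g /\ pr h k ∈ f0 /\ InD Tr k x) ->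
  forall m, pr g m ∈ f -> forall m0, pr g m0 ∈ f0 -> m = m0.
Proof.
  intros Hf0 Hd0 Hx0. revert g.
  apply (@ind0 S (fun S e => forall m, pr (e 0) m ∈ e 1 -> forall m0, pr (e 0) m0 ∈ e 2 -> m = m0) [f; f0]); [d0t|].
  simpl. intros g IH m Hm m0 Hm0. apply ext; intros x. rewrite (Hx Hm), (Hx0 _ _ Hm0). split; intros (h & k & Hh & Hk & HI).
  - destruct (Hd0 _ _ Hm0 h Hh) as (k' & Hk'). pose proof (IH h Hh k Hk k' Hk') as E. subst k'. eauto.
  - destruct (Hd Hm Hh) as (k' & Hk'). pose proof (IH h Hh k' Hk' k Hk) as E. subst k'. eauto.
Qed.

(** ** [l] satisfies the axioms of KP *)
Hypothesis HKP : forall c, KPc Tr c -> MD Tr l c.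
Notation U := (inz l).

Lemma ax_true p : (forall c, c = cd p -> KPc (@Tr S) c) -> forall n e, bounded n p -> (forall i, i < n -> e i ∈ l) -> dsat U e p.
Proof.
  intros HK n e B He. destruct (@seq_ex S l n e He) as (s & Hs & Hse).
  assert (HT : closed (@Tr S)) by (apply (@closed_True S)).
  destruct (HKP (HK _ eq_refl)) with (n := @nm S n) (s := s) as (A & W & _ & _ & H1 & H2 & H3).
  - exact I.
  - split; [apply nm_Nat|]. split; auto. apply cd_Bd; auto.
  - apply (sat_std H3 (n := n) (e := e) (s := s)); auto. apply Hs.
Qed.

Lemma l_pair (x y : S) : x ∈ l -> y ∈ l -> up2 x y ∈ l.
Proof.
  intros H1 H2. assert (A : dsat U (el []) pairing).
  { apply (@ax_true pairing) with (n := 0); [intros c ->|apply bdb_ok; reflexivity|lia]. right; right; left. apply cd_pairing. }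
  unfold pairing in A. rewrite s_all in A. specialize (A x H1). rewrite s_all in A. specialize (A y H2).
  rewrite s_Ex in A. destruct A as (z & Hz & A). rewrite s_all in A.
  replace (up2 x y) with z; auto. apply ext. intros w. rewrite up2_spec.
  assert (Q : w ∈ l -> (w ∈ z <-> w = x \/ w = y)).
  { intros Hw. specialize (A w Hw). rewrite s_Iff, s_Or in A. exact A. }
  split; intros Hw; [apply Q; auto; apply (l_trans Hz); auto|apply Q; auto]. destruct Hw as [->| ->]; auto.
Qed.
Lemma l_Un (x : S) : x ∈ l -> Un x ∈ l.
Proof.
  intros H1. assert (A : dsat U (el []) union).
  { apply (@ax_true union) with (n := 0); [intros c ->|apply bdb_ok; reflexivity|lia]. right; left. apply cd_union. }
  unfold union in A. rewrite s_all in A. specialize (A x H1).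
  rewrite s_Ex in A. destruct A as (z & Hz & A). rewrite s_all in A.
  replace (Un x) with z; auto. apply ext. intros w. rewrite Un_spec.
  assert (Q : w ∈ l -> (w ∈ z <-> exists y, y ∈ l /\ (y ∈ x /\ w ∈ y))).
  { intros Hw. specialize (A w Hw). rewrite s_Iff, s_Ex in A. split.
    - intros Hwz. apply A in Hwz as (y & Hy & Hy'). rewrite s_And in Hy'. exists y; split; auto.
    - intros (y & Hy & Hy'). apply A. exists y; split; auto. rewrite s_And; exact Hy'. }
  split.
  - intros Hw. apply Q in Hw as (y & _ & Hy); [eauto|]. apply (l_trans Hz Hw).
  - intros (y & Hy & Hw). pose proof (l_trans H1 Hy). apply Q; [apply (l_trans H Hw)|eauto].
Qed.
(** The axiom in [l] yields the formula relativized to [l]; as [l] is transitive, absoluteness of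
    Delta_0 formulas turns it into truth in the whole model, which is what [isU] speaks about. *)
Lemma l_sep (P : pred) (L : list S) X : dfn (1 + length L) P -> Forall U L -> X ∈ l ->
    exists Y, Y ∈ l /\ forall x, x ∈ Y <-> x ∈ X /\ P S (el (x :: L)).
Proof.
  intros (p & HD & HB & Hp) HL HX.
  pose (r := fun i => match i with 0 => 0 | Sn i => Sn (Sn i) end).
  assert (HBr : bounded (2 + length L) (ren r p)).
  { apply (bounded_ren HB). intros [|i]; simpl; lia. }
  assert (A : dsat U (el L) (separation (ren (up Datatypes.S) (ren r p)))).
  { apply (@ax_true _) with (n := length L).
    - intros c ->. right; right; right; right; left. exists (cd (ren r p)), shf. split; [exact I|]. exists (upr shf). split; [exact I|].
      exists (cd (ren (up Datatypes.S) (ren r p))). split; [apply cd_Fm, (@closed_True S)|]. split; [apply cd_D0; [apply (@closed_True S)|apply Delta0_ren; auto]|].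
      split; [apply ShfR_shf|]. split; [apply UpR_upr|]. split; [|apply cd_sep]. apply (@cd_Rn S _ (@closed_True S) _ (upr shf)); [exact I|].
      intros [|i]; apply upr_spec; [left; reflexivity|]. right. exists (nm i), (nm (Sn i)). split; [apply shf_spec; exists (nm i); split; auto; apply nm_Nat|reflexivity].
    - unfold separation, Ex, And, Iff. simpl. 
      assert (bounded (3 + length L) (ren (up Datatypes.S) (ren r p))).
      { apply (bounded_ren HBr). intros [|i]; simpl; lia. } repeat split; auto; lia.
    - intros i Hi. rewrite Forall_forall in HL. apply HL. apply nth_In; auto. }
  unfold separation in A. rewrite s_all in A. specialize (A X HX). rewrite s_Ex in A. destruct A as (Y & HY & A).
  exists Y; split; auto. intros x. rewrite s_all in A.
  assert (Q : x ∈ l -> (x ∈ Y <-> x ∈ X /\ P S (el (x :: L)))).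
  { intros Hxl. specialize (A x Hxl). rewrite s_Iff, s_And in A. rewrite !tsat_ren in A. 
    rewrite (@Delta0_abs S E U p) with (n := 1 + length L) in A; auto.
    - assert (K : sat (fun n => sc x (sc Y (sc X (el L))) (up Datatypes.S (r n))) p <-> P S (el (x :: L))).
      { rewrite <- Hp. apply tsat_ext with (n := 1 + length L); auto. intros [|i] Hi; reflexivity. }
      rewrite K in A. exact A.
    - intros u v Hv Hu. apply (l_trans Hv Hu).
    - intros [|i] Hi; simpl; auto. rewrite Forall_forall in HL. apply HL, nth_In; lia. }
  split; intros H; apply Q; auto; [apply (l_trans HY H)|apply (l_trans HX (proj1 H))].
Qed.
Lemma l_coll (P : pred) (L : list S) X : dfn (2 + length L) P -> Forall U L -> X ∈ l ->
    (forall x, x ∈ X -> exists y, y ∈ l /\ P S (el (y :: x :: L))) ->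
    exists b, b ∈ l /\ forall x, x ∈ X -> exists y, y ∈ b /\ P S (el (y :: x :: L)).
Proof.
  intros (p & HD & HB & Hp) HL HX H.
  pose (r := fun i => match i with 0 => 1 | 1 => 2 | Sn (Sn i) => 4 + i end).
  pose (q := Ex (ren r p)).
  assert (HBr : bounded (4 + length L) (ren r p)).
  { apply (bounded_ren HB). intros [|[|i]]; simpl; lia. }
  assert (A : dsat U (el L) (collection q (ren (up (up Datatypes.S)) q))).
  { apply (@ax_true _) with (n := length L).
    - intros c ->. do 5 right; left. exists (cd q), shf. split; [exact I|]. exists (upr shf). split; [exact I|]. exists (upr (upr shf)). split; [exact I|].
      exists (cd (ren (up (up Datatypes.S)) q)). split; [apply cd_Fm, (@closed_True S)|].
      split; [exists (cd (ren r p)); split; [apply cd_D0; [apply (@closed_True S)|apply Delta0_ren; auto]|apply cd_Ex]|].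
      split; [apply ShfR_shf|]. split; [apply UpR_upr|]. split; [apply UpR_upr|]. split; [|apply cd_coll]. apply (@cd_Rn S _ (@closed_True S) _ (upr (upr shf))); [exact I|].
      intros [|[|i]]; apply upr_spec; [left; reflexivity| |]; right.
      + exists (nm 0), (nm 0). split; [|reflexivity]. apply upr_spec; left; reflexivity.
      + exists (nm (Sn i)), (nm (Sn (Sn i))). split; [|reflexivity]. apply upr_spec; right. exists (nm i), (nm (Sn i)). split; [|reflexivity].
        apply shf_spec; exists (nm i); split; auto; apply nm_Nat.
    - unfold collection, q, Ex, And, Iff. simpl.
      assert (bounded (5 + length L) (ren (up (up (up Datatypes.S))) (ren r p))).
      { apply (bounded_ren HBr). intros [|[|[|i]]]; simpl; lia. } repeat split; auto; lia.
    - intros i Hi. rewrite Forall_forall in HL. apply HL. apply nth_In; auto. }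
  assert (Lw : forall i, i < length L -> el L i ∈ l) by (intros i Hi; rewrite Forall_forall in HL; apply HL, nth_In; auto).
  assert (Tr1 : forall u v, v ∈ l -> u ∈ v -> u ∈ l) by (intros u v Hv Hu; apply (l_trans Hv Hu)).
  unfold collection in A. rewrite s_all in A. specialize (A X HX). rewrite s_imp in A.
  rewrite s_Ex in A. destruct A as (b & Hb & A).
  - rewrite s_all. intros x Hxl. rewrite s_imp. intros HxX. destruct (H x HxX) as (y & Hy & HP).
    rewrite s_Ex. exists y; split; auto. unfold q; rewrite s_Ex. exists y; split; auto. rewrite tsat_ren.
    rewrite (@Delta0_abs S E U p) with (n := 2 + length L); auto.
    + apply Hp in HP. revert HP. apply tsat_ext with (n := 2 + length L); auto. intros [|[|i]] Hi; reflexivity.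
    + intros [|[|i]] Hi; simpl; auto. apply Lw; lia.
  - exists b; split; auto. intros x HxX. rewrite s_all in A. specialize (A x (l_trans HX HxX)). rewrite s_imp in A. specialize (A HxX).
    rewrite s_Ex in A. destruct A as (y & Hy & A). rewrite s_And in A. destruct A as (A1 & A2). exists y; split; [exact A1|].
    unfold q in A2. rewrite tsat_ren, s_Ex in A2. destruct A2 as (w & Hw & A2). rewrite tsat_ren in A2.
    rewrite (@Delta0_abs S E U p) with (n := 2 + length L) in A2; auto.
    + apply Hp. revert A2. apply tsat_ext with (n := 2 + length L); auto. intros [|[|i]] Hi; reflexivity.
    + intros [|[|i]] Hi; simpl; auto. apply (l_trans HX HxX). apply Lw; lia.
Qed.
Lemma l_om : om ∈ l.
Proof.
  assert (A : dsat U (el []) infinity).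
  { apply (@ax_true infinity) with (n := 0); [intros c ->|apply bdb_ok; reflexivity|lia]. right; right; right; left. apply cd_infinity. }
  unfold infinity in A. rewrite s_Ex in A. destruct A as (i & Hi & A). rewrite s_And in A. destruct A as [A1 A2].
  rewrite s_Ex in A1. destruct A1 as (o & Ho & A1). rewrite s_And in A1. destruct A1 as [A0 A1].
  assert (Ho' : o = emp).
  { apply ext. intros z; split; intros Hz; [|destruct (emp_spec Hz)]. rewrite s_all in A1.
    specialize (A1 z (l_trans Ho Hz)). destruct (A1 Hz). }
  subst o. rewrite s_all in A2.
  assert (H : forall n, Nat n -> n ∈ i).
  { apply (@N_ind S (fun S e => e 0 ∈ e 1) [i]); [d0t|exact A0|].
    simpl. intros k _ Hk. specialize (A2 k (l_trans Hi Hk)). rewrite s_imp in A2. specialize (A2 Hk).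
    rewrite s_Ex in A2. destruct A2 as (y & Hy & A2). rewrite s_And in A2. destruct A2 as [A2 A3].
    replace (suc k) with y; auto. apply ext. intros z. rewrite suc_spec. rewrite s_all in A3.
    assert (Q : z ∈ l -> (z ∈ y <-> z ∈ k \/ z = k)).
    { intros Hz. specialize (A3 z Hz). rewrite s_Iff, s_Or in A3. exact A3. }
    pose proof (l_trans Hi Hk) as Hkl.
    split; intros Hz; apply Q; auto; [apply (l_trans Hy Hz)|destruct Hz as [Hz| ->]; auto; apply (l_trans Hkl Hz)]. }
  destruct (@l_sep (fun S e => Nat (e 0)) [] i) as (w & Hw & Hw'); auto.
  { d0t. }
  replace (@om S) with w; auto. apply ext; intros n. rewrite om_spec, Hw'. simpl. split; [tauto|auto].
Qed.
Lemma l_isU : isU U.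
Proof.
  constructor.
  - intros x y H1 H2. apply (l_trans H1 H2).
  - apply l_pair.
  - apply l_Un.
  - apply l_om.
  - apply l_sep.
  - apply l_coll.
  (* Witnesses are sought in the set [l], so Sigma_1 induction for this class is Delta_0 induction
     of the model. *)
  - intros P L HP H x.
    apply (@ind0 S (fun S e => exists w, w ∈ e 1 /\ P S (fun i => match i with 0 => w | 1 => e 0 | Sn (Sn i) => e (2 + i) end)) (l :: L)); auto.
    apply d0_bex; [isvt|]. cbv beta.
    apply (d0_perm (m := 2 + length L) (P := P) (r := fun i => match i with 0 => 0 | 1 => 1 | Sn (Sn i) => 3 + i end)); auto.
    + intros [|[|i]]; simpl; lia.
    + intros S' e. match goal with |- P S' ?a <-> P S' ?b => replace a with b; [tauto|] end.
      apply functional_extensionality; intros [|[|i]]; reflexivity.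
Qed.

(** ** Certified chains reaching every level below [a] *)
Lemma f_in_l h k : h ∈ a -> pr h k ∈ f -> k ∈ l.
Proof. intros H1 H2. apply (lev_in H1 H2 Hal). Qed.

(** The sequence [f] is no element of [l], so the levels below [a] must be certified inside [l] by
    other means. By induction on [h], collection in [l] gathers chains for the earlier levels; those
    of their members that belong to the level [m] at [h], together with [m], form a new chain. *)
Lemma chain_claim : forall h, h ∈ a -> exists C, C ∈ l /\ exists B, B ∈ l /\ (Ch0 C B /\ exists m, m ∈ C /\ pr h m ∈ f).
Proof.
  apply (@ind0 S (fun S e => e 0 ∈ e 1 -> exists C, C ∈ e 2 /\ exists B, B ∈ e 2 /\ (Ch0 C B /\ exists m, m ∈ C /\ pr (e 0) m ∈ e 3)) [a; l; f]).
  { d0t. }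
  simpl. intros h IH Hh.
  assert (Hth : trans h) by exact (proj2 Ha h Hh).
  destruct (Hd Hal Hh) as (m & Hm). pose proof (f_in_l Hh Hm) as Hml. pose proof (lev_trans Hth Hm) as Htm.
  assert (IH' : forall g, g ∈ h -> exists C B k, C ∈ l /\ B ∈ l /\ Ch0 C B /\ k ∈ C /\ pr g k ∈ f).
  { intros g Hg. assert (Hga : g ∈ a) by (apply (proj1 Ha h); auto). destruct (IH g Hg Hga) as (C & HC & B & HB & H1 & k & Hk & H2).
    exists C, B, k; auto. }
  clear IH.
  destruct (@U_coll S U l_isU (fun S e => exists C, C ∈ e 0 /\ exists B, B ∈ e 0 /\ (Ch0 C B /\ exists k, k ∈ C /\ (k ∈ e 2 /\ 
      exists d, d ∈ B /\ exists z, z ∈ B /\ (Dfn k d z /\ e 1 ∈ d)))) [m] m) as (b & Hb & Hcoll); auto.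
  { d0t. }
  { intros x Hxm. apply (Hx Hm) in Hxm as (g & k & Hg & Hk & HI). destruct (IH' g Hg) as (C & B & k' & HC & HB & HCB & HkC & Hk').
    assert (k' = k) by (apply (Hf (i := g)); auto). subst k'.
    exists (up2 C B). split; [apply l_pair; auto|]. simpl. exists C. split; [apply up2_spec; auto|]. exists B. split; [apply up2_spec; auto|].
    split; auto. exists k. split; auto. split; [apply (lev_in Hg Hk Hm)|]. destruct (proj1 HCB k HkC) as (d & Hd' & z & Hz & HD).
    exists d; split; auto. exists z; split; auto. split; auto. apply (Dfn_spec _ HD), HI. }
  destruct (@U_sep S U l_isU (fun S e => exists w, w ∈ e 1 /\ exists C, C ∈ w /\ exists B, B ∈ w /\ (Ch0 C B /\ e 0 ∈ C)) [b] m) as (C' & HC' & Hsep); auto.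
  { d0t. }
  simpl in Hcoll, Hsep.
  assert (Hchain : forall k, k ∈ C' -> k ∈ m /\ exists C, Ch C /\ k ∈ C).
  { intros k Hk. apply Hsep in Hk as (H1 & w & _ & C & _ & B & _ & H2 & H3). split; auto. exists C; split; auto. apply (Ch0_Ch H2). }
  (* [k] may come from another chain than the level [kg] over which it is definable; comparing the
     two leaves only [k] below or equal to [kg]. *)
  assert (Hdef : forall k, k ∈ C' -> forall x, InD Tr k x -> x ∈ m).
  { intros k Hk x HI. destruct (Hchain k Hk) as (Hkm & C & HC & HkC).
    apply (Hx Hm) in Hkm as (g & kg & Hg & Hkg & HIk). destruct (IH' g Hg) as (C2 & B2 & k2 & _ & _ & HCB2 & Hk2 & Hk2').
    assert (k2 = kg) by (apply (Hf (i := g)); auto). subst k2.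
    destruct (Ch_tri HC (Ch0_Ch HCB2) HkC Hk2) as [T|[T|T]].
    - destruct T as [_ T]. apply T in HI. apply (Htm kg); auto. apply (lev_in Hg Hkg Hm).
    - subst k. apply (Hx Hm). eauto.
    - destruct T as [T _]. destruct (irrefl (InD_sub HIk T)). }
  set (C'' := un C' (sing m)).
  assert (HCl : C'' ∈ l) by (apply (U_un l_isU); auto; apply (U_sing l_isU); auto).
  assert (HCh : Ch C'').
  { intros m1 Hm1. unfold C'' in Hm1. apply un_spec in Hm1 as [Hm1|Hm1].
    - pose proof Hm1 as Hm1'. apply Hsep in Hm1' as (Hm1m & w & Hw & C1 & HC1 & B1 & HB1 & HCB1 & Hm1C).
      destruct (Ch0_Ch HCB1 Hm1C) as [Ht1 Hx1]. split; auto. intros x. split.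
      + intros Hxm. apply Hx1 in Hxm as (k & Hk & Hkm & HI). exists k. split; auto. unfold C''. apply un_spec; left. apply Hsep.
        split; [apply (Htm m1); auto|]. exists w; split; auto. exists C1; split; auto. exists B1; auto.
      + intros (k & Hk & Hkm & HI). unfold C'' in Hk. apply un_spec in Hk as [Hk|Hk].
        * destruct (Hchain k Hk) as (_ & C2 & HC2 & HkC2).
          destruct (Ch_tri HC2 (Ch0_Ch HCB1) HkC2 Hm1C) as [T|[T|T]].
          -- apply T, HI.
          -- subst k. destruct (irrefl Hkm).
          -- destruct (asym Hkm (proj1 T)).
        * apply sing_spec in Hk as ->. destruct (asym Hkm Hm1m).
    - apply sing_spec in Hm1 as ->. split; auto. intros x. split.
      + intros Hxm. destruct (Hcoll x Hxm) as (w & Hw & C1 & HC1 & B1 & HB1 & HCB1 & k & Hk & Hkm & d & Hd' & z & Hz & HD & Hxd).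
        exists k. split; [|split; auto; apply (Dfn_spec _ HD), Hxd]. unfold C''. apply un_spec; left. apply Hsep. split; auto.
        exists w; split; auto. exists C1; split; auto. exists B1; auto.
      + intros (k & Hk & Hkm & HI). unfold C'' in Hk. apply un_spec in Hk as [Hk|Hk]; [eauto|].
        apply sing_spec in Hk as ->. destruct (irrefl Hkm). }
  destruct (Ch_Ch0 l_isU HCl HCh) as (B & HB & HCB). exists C''. split; auto. exists B. split; auto. split; auto.
  exists m. split; auto. unfold C''. apply un_spec; right; apply sing_spec; auto.
Qed.

(** [x] is definable over some level [kh], and a later level is needed. The singleton of [kh]
    belongs to [l], hence is definable over some [kg], so [kh] is an element of [kg]; by
    comparability the definable subsets of [kh], among them [x], are elements of [kg]. *)
Theorem level_cofinal x : x ∈ l -> exists k C B, C ∈ l /\ B ∈ l /\ Ch0 C B /\ k ∈ C /\ x ∈ k.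
Proof.
  intros Hxl. apply (Hx Hal) in Hxl as (h & kh & Hh & Hkh & HI).
  pose proof (f_in_l Hh Hkh) as Hkl. pose proof (U_sing l_isU Hkl) as Hs.
  apply (Hx Hal) in Hs as (g & kg & Hg & Hkg & HIg).
  assert (Hin : kh ∈ kg) by (apply (InD_sub HIg); apply sing_spec; auto).
  destruct (chain_claim Hh) as (C1 & HC1 & B1 & HB1 & HCB1 & k1 & Hk1 & Hk1f).
  destruct (chain_claim Hg) as (C2 & HC2 & B2 & HB2 & HCB2 & k2 & Hk2 & Hk2f).
  assert (k1 = kh) by (apply (Hf (i := h)); auto). assert (k2 = kg) by (apply (Hf (i := g)); auto). subst k1 k2.
  exists kg, C2, B2. split; [auto|split; [auto|split; [auto|split; [auto|]]]].
  destruct (Ch_tri (Ch0_Ch HCB1) (Ch0_Ch HCB2) Hk1 Hk2) as [T|[T|T]].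
  - apply T, HI.
  - rewrite T in Hin. destruct (irrefl Hin).
  - destruct (asym Hin (proj1 T)).
Qed.
End Lev.

Definition kEx {S : kpm} (p : S) : S := kNeg (kAll (kNeg p)).

(** [T] restricted to [z] is [t], as certified by [b]. *)
Definition Gt (s0 q0 : form) {S : kpm} (z t b : S) : Prop := forall x, x ∈ z ->
  (x ∈ t /\ exists y, y ∈ b /\ sat (el [y; x]) s0) \/ (~ x ∈ t /\ exists y, y ∈ b /\ ~ sat (el [y; x]) q0).

(** [e] and [s] merely name the code of [∃x p] and the empty assignment, because satisfaction in a
    set was shown definable with variables as arguments. *)
Definition Truth {S : kpm} (zk k p : S) : Prop :=
  exists e, e ∈ zk /\ (e = pr (nm 2) (pr (nm 4) (pr (nm 2) p)) /\ exists s, s ∈ zk /\ (s = emp /\ zS zk k e s)).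

(** Levels 0, 1 and 2 are the set [t] of axioms, the code [p] and the relativized code. The axioms
    are defined by [Mem 0 1]: [papp] sends index 1, which is beyond the end of its list, to the
    default level 0, that is to [t]. *)
Definition PVf : form := pand (is_Delta0 1) (pand (pex (fun n => pand (dnum 1 n) (is_bounded n 1))) (is_provable (Mem 0 1) 2)) 3.

Definition rlx (R : form) {S : kpm} (p : S) : S :=
  kAll (kImp (cd R) (kAll (kImp (cd L_form) (kNeg (kAll (kImp (kMem (nm 0) (nm 1)) (kNeg p))))))).

(** Every [∃x p(x)] with [p] in [z] whose relativization follows from [t] within [z] is true in [k], according to [zk]. *)
Definition AllT (R : form) {S : kpm} (z t k zk : S) : Prop :=
  forall p, p ∈ z -> (exists c, c ∈ z /\ (c = rlx R p /\ dsat (inz z) (el [c; p; t]) PVf)) -> Truth zk k p.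

Lemma d0_Gt s0 q0 n (u v w : term) : Delta0 s0 -> Delta0 q0 -> bounded 2 s0 -> bounded 2 q0 ->
  isv n u -> isv n v -> isv n w -> dfn n (fun S e => Gt s0 q0 (u S e) (v S e) (w S e)).
Proof.
  intros D1 D2 B1 B2 (i & Hi & Hu) (j & Hj & Hv) (k & Hk & Hw).
  apply (d0_ext (P := fun S e => Gt s0 q0 (e i) (e j) (e k))); [unfold Gt; d0t|intros; rewrite Hu, Hv, Hw; tauto].
Qed.
Lemma d0_AllT R n (u v w x : term) : isv n u -> isv n v -> isv n w -> isv n x ->
  dfn n (fun S e => AllT R (u S e) (v S e) (w S e) (x S e)).
Proof.
  intros (i & Hi & Hu) (j & Hj & Hv) (k & Hk & Hw) (m & Hm & Hx).
  apply (d0_ext (P := fun S e => AllT R (e i) (e j) (e k) (e m))); [|intros; rewrite Hu, Hv, Hw, Hx; tauto].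
  assert (HB : bounded 3 PVf) by (apply bdb_ok; vm_compute; reflexivity). revert HB. unfold AllT, rlx. generalize PVf L_form. intros f g HB.
  unfold Truth, zS, kAll, kImp, kNeg, kMem. d0t.
Qed.

Section M.
Variable S : kpm.

Definition Tru (k p : S) := St Tr k (kEx p) emp.

Lemma Tru_iff (k p : S) : Bd Tr (nm 1) p -> (Tru k p <-> exists x s, x ∈ k /\ Scn x emp s /\ St Tr k p s).
Proof.
  intros Hb. assert (HT : closed (@Tr S)) by (apply (@closed_True S)).
  assert (Hb' : Bd Tr emp (kEx p)) by (apply (Bd_neg HT), (Bd_all HT), (Bd_neg HT), Hb).
  unfold Tru. split.
  - intros (A & W & _ & _ & H1 & H2 & H3). destruct (SC_neg H3 H1) as (H4 & H5). apply H5 in H2.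
    destruct (SC_all H3 H4) as (H6 & H7). apply NNPP; intros N. apply H2, H7. intros x s Hx Hs.
    destruct (H6 x Hx) as (s' & Hs' & H8). rewrite <- (Scn_fun Hs Hs') in H8. destruct (SC_neg H3 H8) as (H9 & H10). apply H10.
    intros H11. apply N. exists x, s. split; auto. split; auto. exists A, W; repeat split; auto.
  - intros (x & s & Hx & Hs & H). destruct (tot_ex (isU_True S) (k := k) I) as (z & A & W & _ & _ & _ & _ & _ & HSC & HA).
    pose proof (HA emp _ _ (@N_emp S) Hb' (Seq_emp k)) as H1. exists A, W. split; [exact I|split; [exact I|split; [auto|split; [|auto]]]].
    destruct (SC_neg HSC H1) as (H4 & H5). apply H5. intros H6. destruct (SC_all HSC H4) as (H7 & H8).
    pose proof (proj1 H8 H6 x s Hx Hs) as H9. destruct (H7 x Hx) as (s' & Hs' & H10). rewrite <- (Scn_fun Hs Hs') in H10.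
    apply (SC_neg HSC H10) in H9. apply H9.
    pose proof (Scn_Seq (@N_emp S) (Seq_emp k) Hx Hs) as Hq.
    apply NNPP; intros N. apply (St_con (D := Tr) (D' := Tr) Hq H). exists A, W. repeat split; auto. apply (SC_neg HSC H10); auto.
Qed.

Lemma St_up (k k' Wd p x s : S) : (forall y, y ∈ k -> y ∈ k') -> trans k -> D0c Tr p -> Bd Tr (nm 1) p -> x ∈ k -> Scn x emp s ->
  (St Tr k p s <-> St Tr k' p s).
Proof.
  intros Hk Ht (W & _ & Hp & HW) Hb Hx Hs.
  pose proof (Scn_Seq (@N_emp S) (Seq_emp k) Hx Hs) as Hq. pose proof (Seq_mono Hk Hq) as Hq'.
  assert (Hv : forall i y, pr i y ∈ s -> y ∈ k) by (intros i y Hy; apply (Seq_vals Hq Hy)).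
  assert (N1 : Nat (suc (@emp S))) by (apply N_suc, N_emp).
  split; intros H.
  - destruct (St_dec (isU_True S) (k := k') I N1 Hb Hq') as [H1|H1]; auto. exfalso.
    apply (@St_agree S Tr (fun _ => True) k k' W p s); auto. apply Hq.
  - destruct (St_dec (isU_True S) (k := k) I N1 Hb Hq) as [H1|H1]; auto. exfalso.
    apply (@St_agree' S (fun _ => True) Tr k k' W p s); auto. apply Hq.
Qed.
Lemma Tru_mono (k k' p : S) : (forall y, y ∈ k -> y ∈ k') -> trans k -> D0c Tr p -> Bd Tr (nm 1) p -> Tru k p -> Tru k' p.
Proof.
  intros Hk Ht HD Hb. rewrite !Tru_iff; auto. intros (x & s & Hx & Hs & H). exists x, s. split; auto. split; auto.
  apply (@St_up k k' emp p x s); auto.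
Qed.

Lemma Truth_ok (k d zk p : S) : Dfn k d zk -> Bd Tr (nm 1) p -> (Truth zk k p <-> Tru k p).
Proof.
  intros (Hz & Hk & HA & _) Hb. assert (HT : closed (@Tr S)) by (apply (@closed_True S)).
  assert (Hb' : Bd Tr emp (kEx p)) by (apply (Bd_neg HT), (Bd_all HT), (Bd_neg HT), Hb).
  assert (Hb'' : Bd (inz zk) emp (kEx p)) by (apply Bd_cpt; auto using N_emp).
  pose proof (DBd Hz Hb'') as He. pose proof (cl_emp Hz) as Hemp.
  unfold Truth. transitivity (zS zk k (kEx p) emp).
  - split.
    + intros (e & _ & -> & s & _ & -> & H). exact H.
    + intros H. exists (kEx p). split; auto. split; [reflexivity|]. exists emp; auto.
  - rewrite zS_ok; auto. unfold Tru. split; [apply St_sub; unfold Tr; auto|]. intros H.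
    destruct (HA emp Hemp _ He emp Hemp (@N_emp S) Hb'' (Seq_emp k)) as [H1|H1]; auto. destruct (St_con (Seq_emp k) H H1).
Qed.

(** ** Provability of [∃x p(x)] relativized to [L_α] *)
Variable R : form.
Definition Prv (T : S -> Prop) (p : S) := D0c Tr p /\ Bd Tr (nm 1) p /\ PV Tr T (rlx R p).

Lemma rlx_in (z p : S) : clset z -> p ∈ z -> rlx R p ∈ z.
Proof.
  intros Hz Hp. pose proof (D_nm Hz) as Hn. unfold rlx.
  apply (D_kAll Hz), (D_kImp Hz); [apply (cd_D Hz)|]. apply (D_kAll Hz), (D_kImp Hz); [apply (cd_D Hz)|].
  apply (D_kNeg Hz), (D_kAll Hz), (D_kImp Hz); [apply (D_kMem Hz); [exact (Hn 0)|exact (Hn 1)]|apply (D_kNeg Hz), Hp].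
Qed.
Lemma PVf_ok (z p t : S) : clset z -> p ∈ z -> t ∈ z ->
  ((exists c, c ∈ z /\ (c = rlx R p /\ dsat (inz z) (el [c; p; t]) PVf)) <->
   D0c (inz z) p /\ Bd (inz z) (nm 1) p /\ PV (inz z) (fun x => x ∈ t) (rlx R p)).
Proof.
  intros Hz Hp Ht. pose proof (rlx_in Hz Hp) as Hc. revert Hc. generalize (rlx R p). intros c Hc.
  transitivity (dsat (inz z) (el [c; p; t]) PVf).
  { split; [intros (rc & _ & -> & H); auto|intros H; exists c; auto]. }
  unfold PVf. assert (V : vv (inz z) 3 (el [c; p; t]) 0 t /\ vv (inz z) 3 (el [c; p; t]) 1 p /\ vv (inz z) 3 (el [c; p; t]) 2 c) by (repeat split; auto).
  destruct V as (V1 & V2 & V3).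
  apply r_and; [apply (r_Delta0 Hz); auto|apply r_and].
  - transitivity (exists n, n = nm 1 /\ Bd (inz z) n p).
    + apply r_exB; [intros n [-> _]; apply (D_nm Hz 1)|]. intros a Ha. apply r_and.
      * apply r_term; [apply (den_num Hz _ _ 1)|apply vv_new; auto].
      * apply (r_bounded Hz); [apply vv_new; auto|apply vv_old; auto].
    + split; [intros (n & -> & H); auto|intros H; exists (nm 1); auto].
  - apply (r_provable Hz); [|auto]. intros d' e' y u He Hu.
    unfold papp. cbn [ren nth]. change (lv d' e' y ∈ lv d' e' 0 <-> u ∈ t).
    pose proof (vv_ext He V1) as (_ & E0 & _). destruct Hu as (_ & <- & _). rewrite E0. tauto.
Qed.

Section Theory.
Variables (T : S -> Prop) (s0 q0 : form) (l : S).
Hypothesis Htl : trans l.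
Hypothesis HT1 : forall x, x ∈ l -> (T x <-> exists y, y ∈ l /\ sat (el [y; x]) s0).
Hypothesis HT2 : forall x, x ∈ l -> (T x <-> forall y, y ∈ l -> sat (el [y; x]) q0).

Lemma Gt_spec (z t b : S) : z ∈ l -> b ∈ l -> Gt s0 q0 z t b -> forall x, x ∈ z -> (x ∈ t <-> T x).
Proof.
  intros Hz Hb H x Hx. pose proof (Htl Hz Hx) as Hxl. destruct (H x Hx) as [(H1 & y & Hy & H2)|(H1 & y & Hy & H2)].
  - split; auto. intros _. apply HT1; auto. exists y; split; auto. apply (Htl Hb Hy).
  - split; [tauto|]. intros H3. exfalso. apply H2. apply (proj1 (HT2 Hxl) H3). apply (Htl Hb Hy).
Qed.

(** A proof asks about [T] only at codes of formulas, and these all lie in [z0], where [t] agrees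
    with [T]. For the rest of the proof predicate the closed set [z] gives the same answer as the
    whole model. *)
Lemma Prv_ok (z0 z t b p : S) : clset z0 -> clset z -> z0 ∈ l -> t ∈ z -> b ∈ l -> Gt s0 q0 z0 t b -> p ∈ z ->
  ((exists c, c ∈ z /\ (c = rlx R p /\ dsat (inz z) (el [c; p; t]) PVf)) <-> Prv T p).
Proof.
  intros Hz0 Hz Hzl Ht Hb HG Hp.
  assert (HGt : forall x, Fm Tr x -> (x ∈ t <-> T x)).
  { intros x Hx. apply (Gt_spec Hzl Hb HG), (DFm Hz0), Fm_cpt; auto. }
  rewrite PVf_ok; auto. unfold Prv. split; intros (H1 & H2 & H3); (split; [|split]).
  - revert H1; apply D0c_sub; unfold Tr; auto.
  - revert H2; apply Bd_sub; unfold Tr; auto.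
  - revert H3; apply PV_sub; [unfold Tr; auto|]. intros x Hx. apply HGt. revert Hx; apply Fm_sub; unfold Tr; auto.
  - apply D0_cpt; auto.
  - apply Bd_cpt; auto using nm_Nat.
  - apply (PV_cpt Hz) in H3. revert H3. apply PV_sub; auto. intros x Hx. apply HGt. revert Hx; apply Fm_sub; unfold Tr; auto.
Qed.
Lemma AllT_ok (z0 z t b k d zk : S) : clset z0 -> clset z -> z0 ∈ l -> t ∈ z -> b ∈ l -> Gt s0 q0 z0 t b -> Dfn k d zk ->
  (AllT R z t k zk <-> forall p, Prv T p -> Tru k p).
Proof.
  intros Hz0 Hz Hzl Ht Hb HG HD. pose proof (fun p => @Prv_ok z0 z t b p Hz0 Hz Hzl Ht Hb HG) as Q. split.
  - intros H p Hp. assert (p ∈ z) by (apply (DD0 Hz), D0_cpt; auto; apply Hp).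
    apply (Truth_ok HD); [apply Hp|]. apply H; auto. apply Q; auto.
  - intros H p Hp Hq. apply Q in Hq; auto. apply (Truth_ok HD); [apply Hq|auto].
Qed.
End Theory.

(** ** Levels *)
Definition goodl (l : S) := isU (inz l) /\ trans l /\
  forall x, x ∈ l -> exists k C B, C ∈ l /\ B ∈ l /\ Ch0 C B /\ k ∈ C /\ x ∈ k.

Section Good.
Variable l : S.
Hypothesis Hl : goodl l.
Let HU := proj1 Hl.
Let Htl := proj1 (proj2 Hl).

(** Delta_1 comprehension in [l]: each [x] in [z] has a witness for the Sigma_1 definition or a
    counterexample to the Pi_1 definition, collection gathers these in [b], and relative to [b]
    membership in [t] is Delta_0. *)
Lemma Gt_ex (P : S -> Prop) s q (z : S) : Delta0 s -> Delta0 q -> bounded 2 s -> bounded 2 q -> z ∈ l ->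
  (forall x, x ∈ l -> (P x <-> exists y, y ∈ l /\ sat (el [y; x]) s)) ->
  (forall x, x ∈ l -> (P x <-> forall y, y ∈ l -> sat (el [y; x]) q)) ->
  exists t b, t ∈ l /\ b ∈ l /\ Gt s q z t b.
Proof.
  intros Ds Dq Bs Bq Hz H1 H2.
  destruct (@U_coll S (inz l) HU (fun S e => sat (el [e 0; e 1]) s \/ ~ sat (el [e 0; e 1]) q) [] z) as (b & Hb & H); auto.
  { d0t. }
  { intros x Hx. pose proof (Htl Hz Hx) as Hxl. simpl. destruct (classic (P x)) as [HP|HP].
    - apply H1 in HP as (y & Hy & HP); eauto.
    - rewrite H2 in HP; auto. apply not_all_ex_not in HP as (y & HP). apply imply_to_and in HP as (Hy & HP). eauto. }
  destruct (@U_sep S (inz l) HU (fun S e => exists y, y ∈ e 1 /\ sat (el [y; e 0]) s) [b] z) as (t & Ht & H3); auto.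
  { d0t. }
  exists t, b. split; auto. split; auto. intros x Hx. simpl in H, H3.
  destruct (classic (x ∈ t)) as [Hxt|Hxt].
  - left. split; auto. apply H3 in Hxt as [_ Hxt]; auto.
  - right. split; auto. destruct (H x Hx) as (y & Hy & [G|G]); [|eauto]. exfalso. apply Hxt, H3. split; auto. exists y; auto.
Qed.

Lemma Gt_mono s q (z t b b' : S) : (forall x, x ∈ b -> x ∈ b') -> Gt s q z t b -> Gt s q z t b'.
Proof.
  intros H H1 x Hx. destruct (H1 x Hx) as [(H2 & y & Hy & H3)|(H2 & y & Hy & H3)]; [left|right]; split; auto; exists y; auto.
Qed.
End Good.
End M.

(** Certifies, inside an admissible level, what [AllT] is applied to: [t] and [u] are the two sets of axioms restricted to
    [z0], which already contains all formulas (so [t] and [u] may be elements of the larger [z] in which proofs are evaluated), and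
    [k], with its definable subsets [d], is a level because it belongs to the chain [C]. *)
Definition GD (s0 q0 s0' q0' : form) {S : kpm} (z0 z t u b C B k d zk : S) : Prop :=
  clset z0 /\ clset z /\ t ∈ z /\ u ∈ z /\ Gt s0 q0 z0 t b /\ Gt s0' q0' z0 u b /\ Ch0 C B /\ k ∈ C /\ d ∈ B /\ zk ∈ B /\ Dfn k d zk.

Section Good.
Variable S : kpm.
Variables (R : form) (T T' : S -> Prop) (s0 q0 s0' q0' : form) (l : S).
Hypothesis (D1 : Delta0 s0) (D2 : Delta0 q0) (D3 : Delta0 s0') (D4 : Delta0 q0').
Hypothesis (B1 : bounded 2 s0) (B2 : bounded 2 q0) (B3 : bounded 2 s0') (B4 : bounded 2 q0').
Hypothesis Hl : goodl l.
Hypothesis HT1 : forall x, x ∈ l -> (T x <-> exists y, y ∈ l /\ sat (el [y; x]) s0).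
Hypothesis HT2 : forall x, x ∈ l -> (T x <-> forall y, y ∈ l -> sat (el [y; x]) q0).
Hypothesis HT1' : forall x, x ∈ l -> (T' x <-> exists y, y ∈ l /\ sat (el [y; x]) s0').
Hypothesis HT2' : forall x, x ∈ l -> (T' x <-> forall y, y ∈ l -> sat (el [y; x]) q0').
Let HU := proj1 Hl.
Let Htl := proj1 (proj2 Hl).
Notation GD := (GD s0 q0 s0' q0').

Lemma GD_ex x : x ∈ l -> exists z0 z t u b C B k d zk, GD z0 z t u b C B k d zk /\ x ∈ k /\
  z0 ∈ l /\ z ∈ l /\ t ∈ l /\ u ∈ l /\ b ∈ l /\ C ∈ l /\ B ∈ l.
Proof.
  intros Hx. destruct (closure HU (U_emp HU)) as (z0 & Hz0 & Cz0 & _).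
  destruct (Gt_ex Hl D1 D2 B1 B2 Hz0 HT1 HT2) as (t & b & Ht & Hb & HG).
  destruct (Gt_ex Hl D3 D4 B3 B4 Hz0 HT1' HT2') as (u & c & Hu & Hc & HH).
  destruct (closure HU (U_up2 HU Ht Hu)) as (z & Hz & Cz & Htu).
  destruct (proj2 (proj2 Hl) x Hx) as (k & C & B & HC & HB & HCB & Hk & Hxk).
  destruct (proj1 HCB k Hk) as (d & Hd & zk & Hzk & HD).
  exists z0, z, t, u, (un b c), C, B, k, d, zk. split; [|repeat (split; [assumption|]); split; [apply (U_un HU Hb Hc)|auto]].
  split; [exact Cz0|split; [exact Cz|]]. split; [apply (cl_tr Cz Htu), up2_spec; auto|]. split; [apply (cl_tr Cz Htu), up2_spec; auto|].
  split; [revert HG; apply Gt_mono; intros; apply un_spec; auto|]. split; [revert HH; apply Gt_mono; intros; apply un_spec; auto|].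
  exact (conj HCB (conj Hk (conj Hd (conj Hzk HD)))).
Qed.

Lemma AllT_t z0 z t u b C B k d zk : GD z0 z t u b C B k d zk -> z0 ∈ l -> b ∈ l ->
  (AllT R z t k zk <-> forall p, Prv R T p -> Tru k p).
Proof. intros (H1 & H2 & H3 & _ & H4 & _ & _ & _ & _ & _ & H5) Hz Hb. exact (AllT_ok R Htl HT1 HT2 H1 H2 Hz H3 Hb H4 H5). Qed.
Lemma AllT_u z0 z t u b C B k d zk : GD z0 z t u b C B k d zk -> z0 ∈ l -> b ∈ l ->
  (AllT R z u k zk <-> forall p, Prv R T' p -> Tru k p).
Proof. intros (H1 & H2 & _ & H3 & _ & H4 & _ & _ & _ & _ & H5) Hz Hb. exact (AllT_ok R Htl HT1' HT2' H1 H2 Hz H3 Hb H4 H5). Qed.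

Lemma GD_k z0 z t u b C B k d zk : GD z0 z t u b C B k d zk -> C ∈ l -> trans k /\ forall x, x ∈ k -> x ∈ l.
Proof.
  intros (_ & _ & _ & _ & _ & _ & H & Hk & _) HC. split; [exact (proj1 (Ch0_Ch H Hk))|]. intros x Hx. apply (Htl (Htl HC Hk) Hx).
Qed.

Lemma AllT_level z0 z t u b C B k d zk : GD z0 z t u b C B k d zk -> z0 ∈ l -> b ∈ l -> C ∈ l ->
  AllT R z u k zk -> forall p, Prv R T' p -> Tru l p.
Proof.
  intros HG Hz Hb HC HA p Hp. destruct (GD_k HG HC) as [Ht Hk]. apply (Tru_mono Hk Ht); [apply Hp|apply Hp|].
  apply (proj1 (AllT_u HG Hz Hb) HA p Hp).
Qed.

(** By collection, the witnesses of all consequences of [T] appear in a single level. *)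
Lemma level_AllT : (forall p, Prv R T p -> Tru l p) -> exists z0 z t u b C B k d zk, GD z0 z t u b C B k d zk /\ AllT R z t k zk /\
  z0 ∈ l /\ z ∈ l /\ t ∈ l /\ u ∈ l /\ b ∈ l /\ C ∈ l /\ B ∈ l.
Proof.
  intros H. destruct (GD_ex (U_emp HU)) as (z0 & z & t & u & b & C & B & k & d & zk & HG & _ & Hz0 & Hz & Ht & Hu & Hb & _).
  assert (HB3 : bounded 3 PVf) by (apply bdb_ok; vm_compute; reflexivity).
  destruct (@U_sep S (inz l) HU (fun S e => exists c, c ∈ e 1 /\ (c = rlx R (e 0) /\ dsat (inz (e 1)) (el [c; e 0; e 2]) PVf)) [z; t] z) as (X & HX & HXs); auto.
  { revert HB3. unfold rlx. generalize PVf L_form. intros f g HB3. unfold kAll, kImp, kNeg, kMem. d0t. }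
  cbn [el nth] in HXs.
  (* The provable sentences thus form a set in [l], over which collection can run. *)
  assert (HXp : forall p, p ∈ X <-> Prv R T p).
  { intros p. destruct HG as (G1 & G2 & G3 & _ & G4 & _). rewrite HXs. split.
    - intros [Hp Hc]. apply (Prv_ok R Htl HT1 HT2 G1 G2 Hz0 G3 Hb G4 Hp); exact Hc.
    - intros Hp. assert (Hpz : p ∈ z) by (apply (DD0 G2), D0_cpt; auto; apply Hp). split; auto.
      apply (Prv_ok R Htl HT1 HT2 G1 G2 Hz0 G3 Hb G4 Hpz); exact Hp. }
  destruct (@U_coll S (inz l) HU (fun S e => exists C, C ∈ e 0 /\ exists B, B ∈ e 0 /\ (Ch0 C B /\ exists k, k ∈ C /\ exists d, d ∈ B /\ exists zk, zk ∈ B /\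
     (Dfn k d zk /\ Truth zk k (e 1)))) [] X) as (w & Hw & Hcoll); auto.
  { unfold Truth, zS. d0t. }
  { intros p Hp. apply HXp in Hp. pose proof (H p Hp) as Hpl. apply Tru_iff in Hpl; [|apply Hp]. destruct Hpl as (x & s & Hx & Hs & HSt).
    destruct (proj2 (proj2 Hl) x Hx) as (k' & C' & B' & HC' & HB' & HCB & Hk & Hxk).
    destruct (proj1 HCB k' Hk) as (d' & Hd & zk' & Hzk & HD).
    exists (up2 C' B'). split; [apply (U_up2 HU); auto|]. simpl. exists C'. split; [apply up2_spec; auto|]. exists B'. split; [apply up2_spec; auto|].
    split; [exact HCB|]. exists k'. split; auto. exists d'; split; auto. exists zk'; split; auto. split; auto.
    apply (Truth_ok HD); [apply Hp|]. apply Tru_iff; [apply Hp|]. exists x, s. split; auto. split; auto.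
    apply (@St_up S k' l emp p x s); auto.
    - intros y Hy. apply (Htl (Htl HC' Hk) Hy).
    - exact (proj1 (Ch0_Ch HCB Hk)).
    - apply Hp.
    - apply Hp. }
  simpl in Hcoll.
  (* A level that has [w] as an element contains, being transitive, all levels collected in [w]. *)
  destruct (GD_ex Hw) as (y0 & y & t' & u' & b' & C' & B' & k' & d' & zk' & HG' & Hwk & Hy0 & Hy & Ht' & Hu' & Hb' & HC' & HB').
  exists y0, y, t', u', b', C', B', k', d', zk'. split; [exact HG'|]. split; [|repeat (split; [assumption|]); assumption].
  apply (AllT_t HG' Hy0 Hb'). intros p Hp. destruct (GD_k HG' HC') as [Htk _].
  destruct (Hcoll p (proj2 (HXp p) Hp)) as (v & Hv & C2 & HC2 & B2' & HB2 & HCB2 & k2 & Hk2 & d2 & Hd2 & zk2 & Hzk2 & HD2 & HTk).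
  apply (Truth_ok HD2) in HTk; [|apply Hp].
  assert (Hk2k : k2 ∈ k') by (apply (Htk C2); auto; apply (Htk v); auto; apply (Htk w); auto).
  apply (Tru_mono (k := k2)); auto.
  - intros x Hx. apply (Htk k2); auto.
  - exact (proj1 (Ch0_Ch HCB2 Hk2)).
  - apply Hp.
  - apply Hp.
Qed.
End Good.

(** * Relativization to [L_α] *)
Lemma rel_Delta0 q : Delta0 q -> forall z, rel z q = q.
Proof.
  induction 1; intros z; cbn [rel]; rewrite ?IHDelta0, ?IHDelta0_1, ?IHDelta0_2; auto.
  unfold BAll. cbn. rewrite IHDelta0. reflexivity.
Qed.
(** [rel] recognizes bounded quantifiers by their shape. A universal quantifier whose matrix happens
    to be an implication from [Mem 0 (S y)] is therefore not restricted to [z], and this case has to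
    be treated apart; [Ex], with a negation under its quantifier, never has that shape. *)
Lemma rel_All z p : (exists y q, p = Imp (Mem 0 (S y)) q /\ rel z (All p) = BAll y (rel (S z) q)) \/
  ((forall y q, p <> Imp (Mem 0 (S y)) q) /\ rel z (All p) = BAll z (rel (S z) p)).
Proof.
  destruct p as [i j|i j|p|[[|i] [|j]|i j|p|p p'|p] q|p]; try (right; split; [intros ? ?; congruence|reflexivity]).
  left. exists j, q. split; reflexivity.
Qed.
Lemma rel_Ex z q : Delta0 q -> rel z (Ex q) = BEx z q.
Proof.
  intros Hq. unfold Ex, BEx, BAll. cbn [rel neg all form_syntax mem imp]. rewrite rel_Delta0 by auto. reflexivity.
Qed.

Section Rel.
Variable S : kpm.
Notation Sn := Datatypes.S.
Lemma sat_rel_all q (e : nat -> S) : Delta0 q ->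
  (forall y p, q = Imp (Mem 0 (Sn y)) p -> forall x, x ∈ e y -> x ∈ e 0) ->
  (sat e (rel 0 (All q)) <-> forall y, y ∈ e 0 -> sat (sc y e) q).
Proof.
  intros Hq He. destruct (rel_All 0 q) as [(y & p & -> & ->)|[_ ->]].
  - assert (Hp : Delta0 p) by (inversion Hq; auto). rewrite rel_Delta0 by auto. rewrite s_BAll.
    split; intros H x; [intros _ Hx; exact (H x I Hx)|intros _ Hx; apply H; auto; apply (He y p); auto].
  - rewrite rel_Delta0 by auto. rewrite s_BAll. split; intros H x; auto.
Qed.

Definition rr (i : nat) : nat := 2 + i.
(** The matrix of a relativized formula in the context [l; a; x, ...]. *)
Lemma sat_rel_L_ex q (l a : S) (e : nat -> S) : Delta0 q ->
  (sat (sc l (sc a e)) (rel 0 (ren rr (Ex q))) <-> exists y, y ∈ l /\ sat (sc y e) q).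
Proof.
  intros Hq. change (ren rr (Ex q)) with (Ex (ren (up rr) q)). rewrite rel_Ex by (apply Delta0_ren; auto). rewrite s_BEx.
  assert (A : forall y, sat (sc y (sc l (sc a e))) (ren (up rr) q) <-> sat (sc y e) q).
  { intros y. rewrite tsat_ren. apply tsat_ext with (n := bnd q); [apply bnd_ok|]. intros [|i] Hi; reflexivity. }
  split; [intros (y & _ & H1 & H2); exists y; split; [exact H1|apply A, H2]|intros (y & H1 & H2); exists y; split; [auto|split; [exact H1|apply A, H2]]].
Qed.
Lemma sat_rel_L_all q n (l a : S) (e : nat -> S) : Delta0 q -> bounded (1 + n) q -> (forall i, i < n -> forall y, y ∈ e i -> y ∈ l) ->
  (sat (sc l (sc a e)) (rel 0 (ren rr (All q))) <-> forall y, y ∈ l -> sat (sc y e) q).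
Proof.
  intros Hq HB HL.
  assert (A : forall y, sat (sc y (sc l (sc a e))) (ren (up rr) q) <-> sat (sc y e) q).
  { intros y. rewrite tsat_ren. apply tsat_ext with (n := bnd q); [apply bnd_ok|]. intros [|i] Hi; reflexivity. }
  change (ren rr (All q)) with (All (ren (up rr) q)). rewrite sat_rel_all.
  - split; intros H y Hy; apply A, H, Hy.
  - apply Delta0_ren; auto.
  - intros y p Hp x Hx. destruct q as [| | |[[|i] [|j]| | | |] q|]; try discriminate.
    injection Hp as <- <-. destruct HB as [[_ HB] _]. apply (HL j); [lia|exact Hx].
Qed.
End Rel.

(** * Models of [KP1] with the representation of [α] *)
Section Repr.
Variable R : form.
Hypothesis hR : representation R.
Hypothesis hadm : provably_admissible R.
Let HRb : bounded 1 R := proj1 (proj2 hR).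

Section Model.
Variable S : kpm.
Notation Sn := Datatypes.S.
Definition Rp (a : S) := sat (el [a]) R.
Let HT := @closed_True S.

Lemma kp_sound p (e : nat -> S) : prov KP1 p -> sat e p.
Proof. intros H. apply (soundness (T := KP1)); auto. intros q e' Hq. apply (kp_ax Hq). Qed.

Lemma Rp_uniq a b : Rp a -> Rp b -> a = b.
Proof.
  intros Ha Hb. pose proof (kp_sound (el []) (proj2 (proj2 hR))) as H.
  specialize (H a I b I). unfold pimp, pand, peq, papp in H. rewrite s_imp, s_And, !tsat_ren in H. apply H. split.
  - revert Ha. apply tsat_ext with (n := 1); auto. intros [|i] Hi; [reflexivity|lia].
  - revert Hb. apply tsat_ext with (n := 1); auto. intros [|i] Hi; [reflexivity|lia].
Qed.
Lemma Rp_adm a : Rp a -> Adm Tr a.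
Proof.
  intros Ha. pose proof (kp_sound (el []) hadm) as H. specialize (H a I). unfold pimp, papp in H. rewrite s_imp, tsat_ren in H.
  assert (V : vv (@Tr S) 1 (sc a (el [])) 0 a) by (repeat split; auto).
  apply (r_adm HT V), H. revert Ha. apply tsat_ext with (n := 1); auto. intros [|i] Hi; [reflexivity|lia].
Qed.

Lemma IsL_uniq (a l l' : S) : IsL Tr a l -> IsL Tr a l' -> l = l'.
Proof.
  intros (f & _ & H1 & H2 & H3) (f' & _ & H1' & H2' & H3').
  apply (@lev_uniq S f) with (g := a) (f0 := f'); auto.
  - intros g m H; apply (proj1 (H3 g m H)).
  - intros g m H x; apply (proj2 (H3 g m H)); exact I.
  - intros g m H; apply (proj1 (H3' g m H)).
  - intros g m H x; apply (proj2 (H3' g m H)); exact I.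
Qed.
Lemma Rp_L a : Rp a -> exists l, IsL Tr a l.
Proof. intros H. destruct (Rp_adm H) as (_ & l & _ & Hl & _). eauto. Qed.
Lemma Rp_good a l : Rp a -> IsL Tr a l -> goodl l.
Proof.
  intros Ha Hl. destruct (Rp_adm Ha) as (Ho & l' & _ & Hl' & HKP). rewrite (IsL_uniq Hl Hl') in *. clear l Hl. rename l' into l.
  destruct Hl' as (f & _ & Hf & Hal & H).
  assert (Hd : forall g m, pr g m ∈ f -> forall h, h ∈ g -> exists k, pr h k ∈ f) by (intros g m Hg; apply (proj1 (H g m Hg))).
  assert (Hx : forall g m, pr g m ∈ f -> forall x, x ∈ m <-> exists h k, h ∈ g /\ pr h k ∈ f /\ InD Tr k x).
  { intros g m Hg x; apply (proj2 (H g m Hg)); exact I. }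
  assert (HK : forall c, KPc Tr c -> MD Tr l c) by (intros c; apply HKP; exact I).
  split; [|split].
  - eapply l_isU; eauto.
  - eapply l_trans; eauto.
  - eapply level_cofinal; eauto.
Qed.

Lemma sat_Lform (a l : S) e : sat (sc l (sc a e)) L_form <-> IsL Tr a l.
Proof.
  transitivity (sat (el [l; a]) L_form).
  - apply tsat_ext with (n := 2); [apply bdb_ok; vm_compute; reflexivity|]. intros [|[|i]] Hi; try reflexivity; lia.
  - apply (@r_L S Tr HT 2); repeat split; auto.
Qed.

Lemma sat_rel_L p (e : nat -> S) : sat e (rel_L R p) <->
  forall a l, Rp a -> IsL Tr a l -> sat (sc l (sc a e)) (rel 0 (ren rr p)).
Proof.
  assert (A : forall a, sat (sc a e) R <-> Rp a).
  { intros a. apply tsat_ext with (n := 1); auto. intros [|i] Hi; [reflexivity|lia]. }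
  unfold rel_L. split.
  - intros H a l Ha Hl. refine (H a I (proj2 (A a) Ha) l I _). apply (sat_Lform a l e); auto.
  - intros H a _ Ha l _ Hl. apply H; [apply A, Ha|]. apply (sat_Lform a l e), Hl.
Qed.

(** ** Definitions of the axioms *)
Definition Tp (tau : form) (x : S) := sat (el [x]) tau.
Lemma def_sat tau s : (forall e : nat -> S, sat e (Exists R)) -> prov (KP1_Exists R) (All (Iff tau (rel_L R s))) ->
  forall x a l, Rp a -> IsL Tr a l -> (Tp tau x <-> sat (el [l; a; x]) (rel 0 (ren rr s))).
Proof.
  intros He Hp x a l Ha Hl.
  assert (H : sat (el ([] : list S)) (All (Iff tau (rel_L R s)))).
  { apply (soundness (T := KP1_Exists R)); auto. intros q e [H| ->]; [exact (kp_ax H e)|apply He]. }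
  specialize (H x I). rewrite s_Iff in H. etransitivity; [exact H|]. rewrite (sat_rel_L s (el [x])).
  split; [intros G; apply G; auto|]. intros G a' l' Ha' Hl'. rewrite (Rp_uniq Ha' Ha) in *. rewrite (IsL_uniq Hl' Hl). exact G.
Qed.
Lemma def_ex tau q a l : (forall e : nat -> S, sat e (Exists R)) -> Delta0 q -> bounded 2 q ->
  prov (KP1_Exists R) (All (Iff tau (rel_L R (Ex q)))) -> Rp a -> IsL Tr a l ->
  forall x, Tp tau x <-> exists y, y ∈ l /\ sat (el [y; x]) q.
Proof. intros He H1 H2 H3 H4 H5 x. rewrite (def_sat He H3 x H4 H5). apply (@sat_rel_L_ex S q l a (el [x])); auto. Qed.
(** Membership of [x] in [l] provides for a matrix that has the shape of a bounded quantifier over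
    [x]: [rel] leaves it unrestricted, but the members of [x] lie in the transitive [l] anyway. *)
Lemma def_all tau q a l : (forall e : nat -> S, sat e (Exists R)) -> Delta0 q -> bounded 2 q ->
  prov (KP1_Exists R) (All (Iff tau (rel_L R (All q)))) -> Rp a -> IsL Tr a l ->
  forall x, x ∈ l -> (Tp tau x <-> forall y, y ∈ l -> sat (el [y; x]) q).
Proof.
  intros He H1 H2 H3 H4 H5 x Hx. rewrite (def_sat He H3 x H4 H5). apply (@sat_rel_L_all S q 1 l a (el [x])); auto.
  intros [|i] Hi y Hy; [|lia]. exact (proj1 (proj2 (Rp_good H4 H5)) x Hx y Hy).
Qed.

Lemma rlx_code p : @rel_L_ex S (k_syntax S) (interp (k_syntax S) R) p = rlx R p.
Proof. unfold rel_L_ex, rlx, BEx, BAll. rewrite !interp_cd. reflexivity. Qed.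

Lemma sat_RFN tau (e : nat -> S) : bounded 1 tau ->
  (sat e (RFN R tau) <-> forall p, Prv R (Tp tau) p -> forall a l, Rp a -> IsL Tr a l -> Tru l p).
Proof.
  intros Hb. transitivity (forall p, Tr p -> D0c Tr p /\ (exists n, n = nm 1 /\ Bd Tr n p) ->
    forall c, Tr c -> c = @rel_L_ex S (k_syntax S) (interp (k_syntax S) R) p /\ PV Tr (Tp tau) c ->
    forall a, Tr a -> forall l, Tr l -> forall e, Tr e -> Rp a /\ IsL Tr a l /\ e = @Ex S (k_syntax S) p -> TS Tr l e).
  - unfold RFN. apply r_all. intros p Hp. assert (V0 : vv Tr 1 (sc p e) 0 p) by (repeat split; auto).
    apply r_imp.
    + apply r_and; [apply (r_Delta0 HT V0)|]. apply r_exB; [intros; exact I|]. intros n Hn. apply r_and.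
      * apply r_term; [apply (den_num HT _ _ 1)|apply vv_new; auto].
      * apply (r_bounded HT); [apply vv_new; auto|apply vv_old; auto].
    + apply r_all. intros c Hc. apply r_imp.
      * apply r_and.
        -- apply r_term; [|apply vv_new; auto]. apply (den_rel_L_ex HT); [apply (den_interp HT)|]. apply den_var, vv_old; auto.
        -- apply (r_provable HT); [|apply vv_new; auto]. intros d' e' y u _ (_ & <- & _). unfold papp, Tp. rewrite tsat_ren.
           apply tsat_ext with (n := 1); auto. intros [|i] Hi; [reflexivity|lia].
      * apply r_all. intros a Ha. apply r_all. intros l Hl. apply r_all. intros c' Hc'. apply r_imp; [apply r_and; [|apply r_and]|].
        -- unfold papp, Rp. rewrite tsat_ren. apply tsat_ext with (n := 1); auto. intros [|i] Hi; [reflexivity|lia].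
        -- apply (r_L HT); auto using vv_new, vv_old.
        -- apply r_term; [|apply vv_new; auto]. apply (den_Ex HT). apply den_var; auto using vv_old.
        -- apply (r_true HT); auto using vv_new, vv_old.
  - split.
    + intros H p (H1 & H2 & H3) a l Ha Hl.
      destruct (H p I) with (c := rlx R p) (a := a) (l := l) (e := kEx p) as (p' & s & _ & _ & _ & -> & G); try exact I.
      * split; eauto.
      * split; [symmetry; apply rlx_code|exact H3].
      * split; [exact Ha|split; [exact Hl|reflexivity]].
      * exact G.
    + intros H p _ (H1 & n & -> & H2) c _ (-> & H3) a _ l _ c' _ (Ha & Hl & ->). exists p, emp. split; auto. split; [eauto|].
      split; [reflexivity|split; [reflexivity|]]. rewrite rlx_code in H3. exact (H p (conj H1 (conj H2 H3)) a l Ha Hl).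
Qed.
End Model.
End Repr.

Ltac d0h ::= first [ simple apply d0_Dfn; [isvt|isvt|isvt] | simple apply d0_Ch0; [isvt|isvt] | d0h2 ].

(** * The matrices of psi, chi and the negation of rho, and their effect in a model *)

Lemma d0_GD s0 q0 s0' q0' n (u0 u1 u2 u3 u4 u5 u6 u7 u8 u9 : term) : 
  Delta0 s0 -> Delta0 q0 -> Delta0 s0' -> Delta0 q0' -> bounded 2 s0 -> bounded 2 q0 -> bounded 2 s0' -> bounded 2 q0' ->
  isv n u0 -> isv n u1 -> isv n u2 -> isv n u3 -> isv n u4 -> isv n u5 -> isv n u6 -> isv n u7 -> isv n u8 -> isv n u9 ->
  dfn n (fun S e => GD s0 q0 s0' q0' (u0 S e) (u1 S e) (u2 S e) (u3 S e) (u4 S e) (u5 S e) (u6 S e) (u7 S e) (u8 S e) (u9 S e)).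
Proof.
  intros. unfold GD. apply d0_and; [apply d0_clset; auto|]. apply d0_and; [apply d0_clset; auto|].
  do 2 (apply d0_and; [apply d0_mem; auto|]). do 2 (apply d0_and; [apply d0_Gt; auto|]).
  apply d0_and; [apply d0_Ch0; auto|]. do 3 (apply d0_and; [apply d0_mem; auto|]). apply d0_Dfn; auto.
Qed.

(** The unbounded quantifiers over certificates become one quantifier over a set [Z] containing
    them, which leaves a Pi_1 sentence with Delta_0 matrix; [k], [d] and [zk] are reached as members
    of [C] and [B]. *)
Definition allGD (s0 q0 s0' q0' : form) {S : kpm} (Z : S) (Q : S -> S -> S -> S -> S -> Prop) : Prop :=
  forall z0, z0 ∈ Z -> forall z, z ∈ Z -> forall t, t ∈ Z -> forall u, u ∈ Z -> forall b, b ∈ Z -> forall C, C ∈ Z -> forall B, B ∈ Z ->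
  forall k, k ∈ C -> forall d, d ∈ B -> forall zk, zk ∈ B -> GD s0 q0 s0' q0' z0 z t u b C B k d zk -> Q z t u k zk.

(** [psiP], with [T] and [U] exchanged, is the oracle for the direction from left to right; [chiP] and the negation of [nrhoP]
    are the formulas chi and rho of the other direction. *)
Definition psiP R s0 q0 s0' q0' {S : kpm} (Z : S) :=
  allGD s0 q0 s0' q0' Z (fun z t u k zk => AllT R z t k zk -> AllT R z u k zk).
Definition chiP R f s0 q0 s0' q0' {S : kpm} (Z : S) :=
  allGD s0 q0 s0' q0' Z (fun z t u k zk => (exists x, x ∈ k /\ sat (el [x]) f) -> AllT R z u k zk).
Definition nrhoP R s0 q0 s0' q0' {S : kpm} (Z : S) :=
  allGD s0 q0 s0' q0' Z (fun z t u k zk => ~ AllT R z t k zk).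

Ltac d0g := first [simple apply d0_ball; [isvt|d0g] | simple apply d0_imp; [simple apply d0_GD; first [assumption|isvt]|] ].
Ltac d0h ::= first [ simple apply d0_AllT; isvt | d0h2 ].
Section D0.
Variables (R f s0 q0 s0' q0' : form).
Hypothesis (D1 : Delta0 s0) (D2 : Delta0 q0) (D3 : Delta0 s0') (D4 : Delta0 q0') (D5 : Delta0 f).
Hypothesis (B1 : bounded 2 s0) (B2 : bounded 2 q0) (B3 : bounded 2 s0') (B4 : bounded 2 q0') (B5 : bounded 1 f).
Lemma d0_psi : dfn 1 (fun S e => psiP R s0 q0 s0' q0' (e 0)).
Proof. unfold psiP, allGD. d0g. d0t. Qed.
Lemma d0_chi : dfn 1 (fun S e => chiP R f s0 q0 s0' q0' (e 0)).
Proof. unfold chiP, allGD. d0g. d0t. Qed.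
Lemma d0_nrho : dfn 1 (fun S e => nrhoP R s0 q0 s0' q0' (e 0)).
Proof. unfold nrhoP, allGD. d0g. d0t. Qed.

Section Use.
Variables (S : kpm) (T T' : S -> Prop) (l : S).
Hypothesis Hl : goodl l.
Hypothesis HT1 : forall x, x ∈ l -> (T x <-> exists y, y ∈ l /\ sat (el [y; x]) s0).
Hypothesis HT2 : forall x, x ∈ l -> (T x <-> forall y, y ∈ l -> sat (el [y; x]) q0).
Hypothesis HT1' : forall x, x ∈ l -> (T' x <-> exists y, y ∈ l /\ sat (el [y; x]) s0').
Hypothesis HT2' : forall x, x ∈ l -> (T' x <-> forall y, y ∈ l -> sat (el [y; x]) q0').
Let HU := proj1 Hl.

Lemma fin_set (L : list S) : Forall (inz l) L -> exists Z, Z ∈ l /\ forall x, In x L -> x ∈ Z.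
Proof.
  induction 1 as [|x L Hx HL (Z & HZ & IH)]; [exists emp; split; [apply (U_emp HU)|intros x []]|].
  exists (un (sing x) Z). split; [apply (U_un HU); auto; apply (U_sing HU); auto|]. intros y [<-|Hy]; apply un_spec; auto.
  left; apply sing_spec; auto.
Qed.
Lemma allGD_use Q : (forall Z, Z ∈ l -> allGD s0 q0 s0' q0' Z Q) -> forall z0 z t u b C B k d zk, GD s0 q0 s0' q0' z0 z t u b C B k d zk ->
  z0 ∈ l -> z ∈ l -> t ∈ l -> u ∈ l -> b ∈ l -> C ∈ l -> B ∈ l -> Q z t u k zk.
Proof.
  intros H z0 z t u b C B k d zk HG H0 H1 H2 H3 H4 H5 H6.
  destruct (@fin_set [z0; z; t; u; b; C; B]) as (Z & HZ & HZ'); [repeat (constructor; auto)|].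
  destruct HG as (G1 & G2 & G3 & G4 & G5 & G6 & G7 & G8 & G9 & G10 & G11).
  apply (H Z HZ z0) with (b := b) (C := C) (B := B) (d := d); auto; try (apply HZ'; simpl; tauto).
  exact (conj G1 (conj G2 (conj G3 (conj G4 (conj G5 (conj G6 (conj G7 (conj G8 (conj G9 (conj G10 G11)))))))))).
Qed.
(** Collection provides one level that satisfies all consequences of [T]; psi makes it satisfy those
    of [T'], and Sigma_1 truth persists from the level to [l]. *)
Lemma psi_use : (forall Z, Z ∈ l -> psiP R s0 q0 s0' q0' Z) ->
  (forall p, Prv R T p -> Tru l p) -> forall p, Prv R T' p -> Tru l p.
Proof.
  intros H H1. destruct (level_AllT D1 D2 D3 D4 B1 B2 B3 B4 Hl HT1 HT2 HT1' HT2' H1)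
    as (z0 & z & t & u & b & C & B & k & d & zk & HG & HA & H2 & H3 & H4 & H5 & H6 & H7 & H8).
  apply (AllT_level Hl HT1' HT2' HG H2 H6 H7). apply (allGD_use H HG); auto.
Qed.
Lemma chi_use : (forall Z, Z ∈ l -> chiP R f s0 q0 s0' q0' Z) ->
  (exists x, x ∈ l /\ sat (el [x]) f) -> forall p, Prv R T' p -> Tru l p.
Proof.
  intros H (x & Hx & Hf). destruct (GD_ex D1 D2 D3 D4 B1 B2 B3 B4 Hl HT1 HT2 HT1' HT2' Hx)
    as (z0 & z & t & u & b & C & B & k & d & zk & HG & HA & H2 & H3 & H4 & H5 & H6 & H7 & H8).
  apply (AllT_level Hl HT1' HT2' HG H2 H6 H7). apply (allGD_use H HG); eauto.
Qed.
Lemma nrho_use : (forall p, Prv R T p -> Tru l p) -> ~ forall Z, Z ∈ l -> nrhoP R s0 q0 s0' q0' Z.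
Proof.
  intros H1 H. destruct (level_AllT D1 D2 D3 D4 B1 B2 B3 B4 Hl HT1 HT2 HT1' HT2' H1)
    as (z0 & z & t & u & b & C & B & k & d & zk & HG & HA & H2 & H3 & H4 & H5 & H6 & H7 & H8).
  apply (allGD_use H HG); auto.
Qed.
End Use.
End D0.

(** * The two provability arguments *)

Record defs (R : form) (tau s q : form) : Prop := {
  df_b : bounded 1 tau;
  df_s : Delta0 s; df_q : Delta0 q; df_bs : bounded 2 s; df_bq : bounded 2 q;
  df_ps : prov (KP1_Exists R) (All (Iff tau (rel_L R (Ex s))));
  df_pq : prov (KP1_Exists R) (All (Iff tau (rel_L R (All q)))) }.

Lemma defs_ex R T tau : Delta1_definition R T tau -> exists s q, defs R tau s q.
Proof.
  intros (H1 & _ & (s & (s' & H2 & ->) & H3 & H4) & (q & (q' & H5 & ->) & H6 & H7)). exists s', q'. constructor; auto.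
Qed.

Section Repr.
Variable R : form.
Hypothesis hR : representation R.
Hypothesis hadm : provably_admissible R.

Section Mod.
Variable S : kpm.
Hypothesis Hex : forall e : nat -> S, sat e (Exists R).
Lemma Rp_ex : exists a : S, Rp R a.
Proof.
  pose proof (@Hex (el [])) as H. unfold Exists in H. rewrite s_Ex in H. destruct H as (a & _ & H). exists a. exact H.
Qed.
Lemma sat_rel_L_unique p (a l : S) (e : nat -> S) : Rp R a -> IsL Tr a l ->
  (sat e (rel_L R p) <-> sat (sc l (sc a e)) (rel 0 (ren rr p))).
Proof.
  intros Ha Hl. rewrite (sat_rel_L hR). split; [intros G; apply G; auto|]. intros G a' l' Ha' Hl'.
  rewrite (Rp_uniq hR Ha' Ha) in *. rewrite (IsL_uniq Hl' Hl). exact G.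
Qed.
Lemma sat_L_Ex q (a l : S) (e : nat -> S) : Rp R a -> IsL Tr a l -> Delta0 q -> bounded 1 q ->
  (sat e (rel_L R (Ex q)) <-> exists y, y ∈ l /\ sat (el [y]) q).
Proof.
  intros Ha Hl H1 H2. rewrite (sat_rel_L_unique (Ex q) e Ha Hl), sat_rel_L_ex; auto.
  split; intros (y & Hy & H); exists y; (split; [exact Hy|]); revert H; apply tsat_ext with (n := 1); auto; intros [|i] Hi; (reflexivity || lia).
Qed.
Lemma sat_L_All q (a l : S) (e : nat -> S) : Rp R a -> IsL Tr a l -> Delta0 q -> bounded 1 q ->
  (sat e (rel_L R (All q)) <-> forall y, y ∈ l -> sat (el [y]) q).
Proof.
  intros Ha Hl H1 H2. rewrite (sat_rel_L_unique (All q) e Ha Hl), (@sat_rel_L_all S q 0); auto; [|lia].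
  split; intros H y Hy; generalize (H y Hy); apply tsat_ext with (n := 1); auto; intros [|i] Hi; (reflexivity || lia).
Qed.
End Mod.

Variables tau upsilon s0 q0 s0' q0' : form.
Hypothesis Ht : defs R tau s0 q0.
Hypothesis Hu : defs R upsilon s0' q0'.

Lemma RFN_of_psi (ps : form) : Delta0 ps -> bounded 1 ps -> (forall (S : kpm) (e : nat -> S), sat e ps <-> psiP R s0' q0' s0 q0 (e 0)) ->
  true_V (rel_L R (All ps)) -> RFN_le R tau upsilon.
Proof.
  intros D B H HV. exists (All ps). split; [exists ps; auto|]. split; [exact B|]. split; [exact HV|].
  apply completeness. intros X E0 x0 HX e.
  pose (S := {| car := X; E := E0; dft := x0; kp_ax := fun p Hp e => HX p e (or_introl (or_introl Hp)) |}).
  assert (Hex : forall e : nat -> S, sat e (Exists R)) by (intros e'; exact (HX _ e' (or_introl (or_intror eq_refl)))).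
  assert (Hps : sat (el ([] : list S)) (rel_L R (All ps))) by exact (HX _ (el ([] : list S)) (or_intror eq_refl)).
  change (tsat (@E S) (fun _ => True) e (RFN R upsilon) -> tsat (@E S) (fun _ => True) e (RFN R tau)).
  rewrite (@sat_RFN R hR S _ e (df_b Ht)), (@sat_RFN R hR S _ e (df_b Hu)).
  intros H1 p Hp a l Ha Hl. pose proof (Rp_good hR hadm Ha Hl) as Hg.
  refine (psi_use (df_s Hu) (df_q Hu) (df_s Ht) (df_q Ht) (df_bs Hu) (df_bq Hu) (df_bs Ht) (df_bq Ht) Hg _ _ _ _ _ _ Hp).
  - intros x _. exact (def_ex hR Hex (df_s Hu) (df_bs Hu) (df_ps Hu) Ha Hl x).
  - intros x Hx. exact (def_all hR hadm Hex (df_q Hu) (df_bq Hu) (df_pq Hu) Ha Hl Hx).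
  - intros x _. exact (def_ex hR Hex (df_s Ht) (df_bs Ht) (df_ps Ht) Ha Hl x).
  - intros x Hx. exact (def_all hR hadm Hex (df_q Ht) (df_bq Ht) (df_pq Ht) Ha Hl Hx).
  - intros Z HZ. apply (@H S (el [Z])). apply (@sat_L_All S _ _ _ (el []) Ha Hl D B); auto.
  - intros p' Hp'. apply (H1 p' Hp' a l Ha Hl).
Qed.

(** Argued in a model of [T]: if the matrices [ch], [q] and [nr] held throughout L_alpha, then chi
    and phi would give RFN(U), the oracle would give RFN(T), and this provides a saturated level,
    against [nr]. Asking for one [Z] at which the conjunction fails makes the conclusion a single
    Sigma_1 sentence. *)
Lemma T_proves (T : theory) (f ch nr q : form) : extends T (KP1_Exists R) ->
  Delta0 f -> bounded 1 f -> prov T (rel_L R (Ex f)) ->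
  Delta0 ch -> bounded 1 ch -> (forall (S : kpm) (e : nat -> S), sat e ch <-> chiP R f s0 q0 s0' q0' (e 0)) ->
  Delta0 nr -> bounded 1 nr -> (forall (S : kpm) (e : nat -> S), sat e nr <-> nrhoP R s0 q0 s0' q0' (e 0)) ->
  Delta0 q -> bounded 1 q -> prov (add (KP1_Exists R) (rel_L R (All q))) (Imp (RFN R upsilon) (RFN R tau)) ->
  prov T (rel_L R (Ex (Neg (And ch (And q nr))))).
Proof.
  intros HT D1 B1 HP D2 B2 H2 D3 B3 H3 D4 B4 H4. apply completeness. intros X E0 x0 HX e.
  assert (HK : forall p, prov T p -> forall e, tsat E0 (fun _ => True) e p) by (intros p; apply soundness; auto).
  pose (S := {| car := X; E := E0; dft := x0; kp_ax := fun p Hp => HK p (HT p (prov_ax (or_introl Hp))) |}).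
  assert (Hex : forall e : nat -> S, sat e (Exists R)) by (intros e'; refine (HK _ (HT _ (prov_ax (or_intror eq_refl))) e')).
  assert (D : Delta0 (Neg (And ch (And q nr)))) by (unfold And; repeat (simpl; constructor; auto)).
  assert (B : bounded 1 (Neg (And ch (And q nr)))) by (unfold And; simpl; tauto).
  destruct (Rp_ex Hex) as (a & Ha). destruct (Rp_L hR hadm Ha) as (l & Hl). pose proof (Rp_good hR hadm Ha Hl) as Hg.
  apply (@sat_L_Ex S _ _ _ e Ha Hl D B). apply NNPP. intros N.
  assert (HN : forall Z, Z ∈ l -> chiP R f s0 q0 s0' q0' Z /\ (sat (el [Z]) q /\ nrhoP R s0 q0 s0' q0' Z)).
  { intros Z HZ. apply NNPP; intros N'. apply N. exists Z. split; auto. rewrite s_neg, !s_And, (@H2 S (el [Z])), (@H3 S (el [Z])). exact N'. }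
  assert (G1 : forall x, x ∈ l -> (Tp tau x <-> exists y, y ∈ l /\ sat (el [y; x]) s0)).
  { intros x _. exact (def_ex hR Hex (df_s Ht) (df_bs Ht) (df_ps Ht) Ha Hl x). }
  assert (G2 : forall x, x ∈ l -> (Tp tau x <-> forall y, y ∈ l -> sat (el [y; x]) q0)).
  { intros x Hx. exact (def_all hR hadm Hex (df_q Ht) (df_bq Ht) (df_pq Ht) Ha Hl Hx). }
  assert (G3 : forall x, x ∈ l -> (Tp upsilon x <-> exists y, y ∈ l /\ sat (el [y; x]) s0')).
  { intros x _. exact (def_ex hR Hex (df_s Hu) (df_bs Hu) (df_ps Hu) Ha Hl x). }
  assert (G4 : forall x, x ∈ l -> (Tp upsilon x <-> forall y, y ∈ l -> sat (el [y; x]) q0')).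
  { intros x Hx. exact (def_all hR hadm Hex (df_q Hu) (df_bq Hu) (df_pq Hu) Ha Hl Hx). }
  refine (nrho_use (df_s Ht) (df_q Ht) (df_s Hu) (df_q Hu) (df_bs Ht) (df_bq Ht) (df_bs Hu) (df_bq Hu) Hg G1 G2 G3 G4 _ (fun Z HZ => proj2 (proj2 (HN Z HZ)))).
  assert (HO : tsat (@E S) (fun _ => True) (el []) (Imp (RFN R upsilon) (RFN R tau))).
  { apply (soundness (T := add (KP1_Exists R) (rel_L R (All q)))); auto. intros r e' [Hr| ->].
    - destruct Hr as [Hr| ->]; [exact (@kp_ax S r Hr e')|apply Hex].
    - apply (@sat_L_All S _ _ _ e' Ha Hl D4 B4); intros Z HZ; apply HN, HZ. }
  change (tsat (@E S) (fun _ => True) (el []) (RFN R upsilon) -> tsat (@E S) (fun _ => True) (el []) (RFN R tau)) in HO.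
  rewrite (@sat_RFN R hR S _ _ (df_b Ht)), (@sat_RFN R hR S _ _ (df_b Hu)) in HO.
  intros p Hp. refine (HO _ p Hp a l Ha Hl). clear p Hp. intros p Hp a' l' Ha' Hl'.
  rewrite (Rp_uniq hR Ha' Ha) in *. rewrite (IsL_uniq Hl' Hl) in *. revert p Hp. 
  apply (chi_use (f := f) (df_s Ht) (df_q Ht) (df_s Hu) (df_q Hu) (df_bs Ht) (df_bq Ht) (df_bs Hu) (df_bq Hu) Hg G1 G2 G3 G4 (fun Z HZ => proj1 (HN Z HZ))).
  apply (@sat_L_Ex S _ _ _ e Ha Hl D1 B1). exact (HK _ HP e).
Qed.
End Repr.

(** * The universe of sets as a model of [KP1] *)
Lemma eqv_refl x : eqv x x.
Proof. induction x as [A f IH]; simpl; split; intros a; exists a; auto. Qed.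
Lemma eqv_sym x : forall y, eqv x y -> eqv y x.
Proof.
  induction x as [A f IH]; intros [B g] [H1 H2]; simpl; split.
  - intros b. destruct (H2 b) as (a & H). exists a; auto.
  - intros a. destruct (H1 a) as (b & H). exists b; auto.
Qed.
Lemma eqv_trans x : forall y z, eqv x y -> eqv y z -> eqv x z.
Proof.
  induction x as [A f IH]; intros [B g] [C h] [H1 H2] [H3 H4]; simpl; split.
  - intros a. destruct (H1 a) as (b & Hb), (H3 b) as (c & Hc). exists c. eapply IH; eauto.
  - intros c. destruct (H4 c) as (b & Hb), (H2 b) as (a & Ha). exists a. eapply IH; eauto.
Qed.

(** Sets up to [eqv], so that equality is Leibniz equality. *)
Definition V : Type := { P : Ens -> Prop | exists x, P = eqv x }.
Definition mk (x : Ens) : V := exist _ (eqv x) (ex_intro _ x eq_refl).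
Definition rp (X : V) : Ens := epsilon (inhabits empty) (fun x => proj1_sig X = eqv x).
Lemma V_eq (X Y : V) : proj1_sig X = proj1_sig Y -> X = Y.
Proof. destruct X as [P p], Y as [Q q]. simpl. intros <-. f_equal. apply proof_irrelevance. Qed.
Lemma mk_rp X : mk (rp X) = X.
Proof. apply V_eq. symmetry. unfold rp. apply epsilon_spec. apply (proj2_sig X). Qed.
Lemma mk_eq x y : mk x = mk y <-> eqv x y.
Proof.
  split.
  - intros H. apply (f_equal (@proj1_sig _ _)) in H. simpl in H. rewrite H. apply eqv_refl.
  - intros H. apply V_eq. simpl. apply functional_extensionality. intros z. apply propositional_extensionality.
    split; intros G; [apply (eqv_trans (eqv_sym H) G)|apply (eqv_trans H G)].
Qed.
Definition VE (X Y : V) : Prop := isin (rp X) (rp Y).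
Lemma isin_eqv x x' y y' : eqv x x' -> eqv y y' -> isin x y -> isin x' y'.
Proof.
  destruct y as [B g], y' as [C h]. intros Hx [H _] (b & Hb). destruct (H b) as (c & Hc). exists c.
  apply (eqv_trans (eqv_sym Hx)), (eqv_trans Hb), Hc.
Qed.
Lemma rp_mk x : eqv (rp (mk x)) x. Proof. apply mk_eq, mk_rp. Qed.
Lemma VE_mk x y : VE (mk x) (mk y) <-> isin x y.
Proof. unfold VE. split; apply isin_eqv; auto using rp_mk, eqv_sym. Qed.
Lemma V_surj X : exists x, X = mk x. Proof. exists (rp X). symmetry; apply mk_rp. Qed.
Lemma in_sup A (f : A -> Ens) X : VE X (mk (sup f)) <-> exists a, X = mk (f a).
Proof.
  destruct (V_surj X) as (x & ->). rewrite VE_mk. split; intros (a & H); exists a; [apply mk_eq, H|apply mk_eq in H; exact H].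
Qed.

Lemma V_ext X Y : (forall Z, VE Z X <-> VE Z Y) -> X = Y.
Proof.
  destruct (V_surj X) as ([A f] & ->), (V_surj Y) as ([B g] & ->). intros H. apply mk_eq. split.
  - intros a. assert (G : VE (mk (f a)) (mk (sup f))) by (apply in_sup; eauto).
    apply H, in_sup in G as (b & G). exists b. apply mk_eq, G.
  - intros b. assert (G : VE (mk (g b)) (mk (sup g))) by (apply in_sup; eauto).
    apply H, in_sup in G as (a & G). exists a. apply eqv_sym, mk_eq. symmetry. auto.
Qed.
Lemma V_sep (P : V -> Prop) X : exists Y, forall Z, VE Z Y <-> VE Z X /\ P Z.
Proof.
  destruct (V_surj X) as ([A f] & ->). exists (mk (sup (fun a : { a | P (mk (f a)) } => f (proj1_sig a)))).
  intros Z. rewrite !in_sup. split.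
  - intros ([a Ha] & ->). split; [exists a; reflexivity|exact Ha].
  - intros [(a & ->) H]. exists (exist _ a H). reflexivity.
Qed.
(** Epsilon chooses one value for each index of [X]; the values are indexed by the same type and so
    form a set. *)
Lemma V_coll (P : V -> V -> Prop) X : (forall Z, VE Z X -> exists Y, P Z Y) -> exists B, forall Z, VE Z X -> exists Y, VE Y B /\ P Z Y.
Proof.
  destruct (V_surj X) as ([A f] & ->). intros H.
  exists (mk (sup (fun a => rp (epsilon (inhabits (mk empty)) (P (mk (f a))))))). intros Z HZ. apply in_sup in HZ as (a & ->).
  exists (epsilon (inhabits (mk empty)) (P (mk (f a)))). split.
  - apply in_sup. exists a. symmetry; apply mk_rp.
  - apply epsilon_spec, H, in_sup. eauto.
Qed.
Lemma V_union X : exists Y, forall Z, VE Z Y <-> exists W, VE W X /\ VE Z W.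
Proof.
  destruct (V_surj X) as ([A f] & ->). exists (mk (sup (fun a : { a & idx (f a) } => elt (projT2 a)))).
  intros Z. rewrite in_sup. split.
  - intros ([a b] & ->). exists (mk (f a)). split; [apply in_sup; eauto|]. simpl. apply VE_mk. exists b. apply eqv_refl.
  - intros (W & HW & HZ). apply in_sup in HW as (a & ->). destruct (V_surj Z) as (z & ->). rewrite VE_mk in HZ. destruct HZ as (b & Hb).
    exists (existT _ a b). apply mk_eq, Hb.
Qed.
Lemma in_upair x y Z : VE Z (mk (upair x y)) <-> Z = mk x \/ Z = mk y.
Proof.
  unfold upair. rewrite in_sup. split.
  - intros ([|] & ->); auto.
  - intros [-> | ->]; [exists true|exists false]; auto.
Qed.
Lemma in_succ x Z : VE Z (mk (succ x)) <-> VE Z (mk x) \/ Z = mk x.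
Proof.
  unfold succ. rewrite in_sup. destruct (V_surj Z) as (z & ->). rewrite VE_mk. split.
  - intros ([a|] & H); [left; exists a; apply mk_eq, H|auto].
  - intros [(a & H)|H]; [exists (Some a); apply mk_eq, H|exists None; auto].
Qed.
Lemma in_empty Z : ~ VE Z (mk empty).
Proof. unfold empty. rewrite in_sup. intros ([] & _). Qed.
Lemma V_ind (P : V -> Prop) : (forall X, (forall Y, VE Y X -> P Y) -> P X) -> forall X, P X.
Proof.
  intros H X. destruct (V_surj X) as (x & ->). induction x as [A f IH]. apply H. intros Y HY. apply in_sup in HY as (a & ->). auto.
Qed.

Lemma V_kp p : KP1 p -> forall e, tsat VE (fun _ => True) e p.
Proof.
  destruct 1; intros e.
  - intros x _ y _. rewrite s_imp, s_all. intros H. apply V_ext. intros Z. specialize (H Z I). rewrite s_Iff in H. exact H.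
  - intros x _. rewrite s_Ex. destruct (V_union x) as (y & Hy). exists y. split; auto. intros z _. rewrite s_Iff, s_Ex.
    etransitivity; [apply Hy|]. split; [intros (w & H1 & H2); exists w|intros (w & _ & H); exists w]; [split; auto; rewrite s_And; auto|].
    rewrite s_And in H. exact H.
  - intros x _ y _. destruct (V_surj x) as (x' & ->), (V_surj y) as (y' & ->). rewrite s_Ex. exists (mk (upair x' y')). split; auto. intros z _.
    rewrite s_Iff, s_Or. apply in_upair.
  - assert (Hn : forall n X, X = mk (num n) -> VE X (mk (sup num))) by (intros n X ->; apply in_sup; eauto).
    unfold infinity. rewrite s_Ex. exists (mk (sup num)). split; auto. rewrite s_And. split.
    + rewrite s_Ex. exists (mk empty). split; auto. rewrite s_And. split; [apply (Hn 0); reflexivity|]. intros z _. apply in_empty.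
    + intros x _. rewrite s_imp. intros Hx. apply in_sup in Hx as (n & Hx). change (x = mk (num n)) in Hx. subst x. rewrite s_Ex. exists (mk (num (S n))). split; auto.
      rewrite s_And. split; [apply (Hn (S n)); reflexivity|]. intros z _. rewrite s_Iff, s_Or. apply in_succ.
  - intros a _. rewrite s_Ex. destruct (V_sep (fun x => tsat VE (fun _ => True) (sc x (sc a e)) p) a) as (b & Hb). exists b. split; auto.
    intros x _. rewrite s_Iff, s_And, tsat_ren. etransitivity; [apply Hb|]. rewrite sc_up. tauto.
  - intros a _. rewrite s_imp, s_Ex. intros H1.
    destruct (@V_coll (fun x y => tsat VE (fun _ => True) (sc y (sc x (sc a e))) p) a) as (b & Hb).
    + intros x Hx. specialize (H1 x I). rewrite s_imp, s_Ex in H1. destruct (H1 Hx) as (y & _ & Hy); eauto.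
    + exists b. split; auto. intros x _. rewrite s_imp, s_Ex. intros Hx. destruct (Hb x Hx) as (y & H2 & H3). exists y. split; auto.
      rewrite s_And, tsat_ren. split; [exact H2|]. rewrite !sc_up. exact H3.
  - unfold induction. rewrite s_imp. intros H1. intros X _. revert X. apply V_ind. intros X IH. specialize (H1 X I). rewrite s_imp in H1. apply H1.
    intros Y _. rewrite s_imp. intros HY. rewrite tsat_ren. rewrite sc_up. apply IH, HY.
Qed.
Definition Vk : kpm := {| car := V; E := VE; dft := mk empty; kp_ax := V_kp |}.

(** * Well-founded models decode codes correctly *)
Section WF.
Variable S : kpm.
Notation Sn := Datatypes.S.
Hypothesis wf : forall P : S -> Prop, (forall x, (forall y, y ∈ x -> P y) -> P x) -> forall x, P x.
Let HT := @closed_True S.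

Lemma wf_deep (P : S -> Prop) : (forall x, (forall y, deep y x -> P y) -> P x) -> forall x, P x.
Proof.
  intros H x. apply H. revert x. apply (wf (P := fun x => forall y, deep y x -> P y)). intros x IH y [Hy|(a & Ha & Hy)].
  - exact (H y (IH y Hy)).
  - apply (IH a Ha). destruct Hy as [Hy|(b & Hb & Hy)]; [left; exact Hy|]. right. exists b. split; [exact Hb|]. destruct Hy as [Hy|(c & Hc & Hy)]; [left; exact Hy|].
    right. exists c. auto.
Qed.
Lemma wf_Nat : forall n : S, Nat n -> exists j, n = nm j.
Proof.
  apply (wf (P := fun n => Nat n -> _)). intros n IH Hn. destruct (N_case Hn) as [->|(k & Hk & ->)]; [exists 0; reflexivity|].
  destruct (IH k (in_suc k) Hk) as (j & ->). exists (Sn j); reflexivity.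
Qed.

Lemma cd_inj p : forall q, @cd S p = cd q -> p = q.
Proof.
  induction p; intros [] H; cbn [cd] in H; try (exfalso; revert H; apply tag_neq; discriminate).
  - apply kMem_inj in H as [H1 H2]. apply nm_inj in H1, H2. congruence.
  - apply kEq_inj in H as [H1 H2]. apply nm_inj in H1, H2. congruence.
  - apply kNeg_inj in H. f_equal; auto.
  - apply kImp_inj in H as [H1 H2]. f_equal; auto.
  - apply kAll_inj in H. f_equal; auto.
Qed.

Lemma wf_Bd : forall c n, Bd Tr (nm n) c -> exists p, c = @cd S p /\ bounded n p.
Proof.
  apply (wf_deep (P := fun c => forall n, Bd Tr (nm n) c -> exists p, c = @cd S p /\ bounded n p)). intros c IH n Hc.
  destruct (Bd_inv Hc) as [(i & j & Hi & Hj & H)|[(a & -> & H)|[(a & b & -> & Ha & Hb)|(a & -> & H)]]].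
  - apply in_nm in Hi as (i' & Hi & ->). apply in_nm in Hj as (j' & Hj & ->).
    destruct H as [->| ->]; [exists (Mem i' j')|exists (Eq i' j')]; simpl; auto.
  - destruct (IH a (deep_Neg a) n H) as (p & -> & Hp). exists (Neg p); simpl; auto.
  - destruct (IH a (deep_Imp1 a b) n Ha) as (p & -> & Hp), (IH b (deep_Imp2 _ b) n Hb) as (q & -> & Hq). exists (Imp p q); simpl; auto.
  - destruct (IH a (deep_All a) (Sn n) H) as (p & -> & Hp). exists (All p); simpl; auto.
Qed.
Lemma wf_Fm (c : S) : Fm Tr c -> exists p, c = cd p.
Proof. intros (n & Hn & H). destruct (wf_Nat Hn) as (j & ->). destruct (wf_Bd H) as (p & -> & _); eauto. Qed.

Lemma D0_Delta0 p : D0c Tr (@cd S p) -> Delta0 p.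
Proof.
  (* A bounded quantifier refers to the consequent of the implication below it, two constructors
     down; the second conjunct supplies the induction hypothesis there. *)
  enough (A : (D0c Tr (@cd S p) -> Delta0 p) /\ forall a b, p = Imp a b -> D0c Tr (@cd S b) -> Delta0 b) by apply A.
  induction p as [i j|i j|p IH|p IHp q IHq|p IH]; (split; [|try discriminate]); intros H.
  - constructor.
  - constructor.
  - destruct (D0c_inv H) as [(i & j & _ & _ & [E|E])|[(a & E & Ha)|[(a & b & E & Ha & Hb)|(y & a & _ & E & Ha)]]]; cbn [cd] in E;
      try (exfalso; revert E; apply tag_neq; discriminate).
    apply kNeg_inj in E as <-. constructor. apply IH, Ha.
  - destruct (D0c_inv H) as [(i & j & _ & _ & [E|E])|[(a & E & Ha)|[(a & b & E & Ha & Hb)|(y & a & _ & E & Ha)]]]; cbn [cd] in E;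
      try (exfalso; revert E; apply tag_neq; discriminate).
    apply kImp_inj in E as [<- <-]. constructor; [apply IHp, Ha|apply IHq, Hb].
  - intros b E. injection E as <- <-. apply IHq.
  - destruct (D0c_inv H) as [(i & j & _ & _ & [E|E])|[(a & E & Ha)|[(a & b & E & Ha & Hb)|(y & a & Hy & E & Ha)]]]; cbn [cd] in E;
      try (exfalso; revert E; apply tag_neq; discriminate).
    apply kAll_inj in E. destruct p as [| | |p q|]; cbn [cd] in E; try (exfalso; revert E; apply tag_neq; discriminate).
    apply kImp_inj in E as [E <-]. destruct p as [i j| | | |]; cbn [cd] in E; try (exfalso; revert E; apply tag_neq; discriminate).
    apply kMem_inj in E as [E1 E2]. apply (@nm_inj _ i 0) in E1 as ->.
    destruct j as [|j]; [exfalso; apply (@suc_emp S y); symmetry; exact E2|]. apply D0_ball. apply (proj2 IH _ _ eq_refl Ha).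
Qed.

Lemma wf_Rn p : forall (r c : S) g, (forall i m, pr (nm i) m ∈ r -> m = nm (g i)) -> Rn Tr r (cd p) c -> c = cd (ren g p).
Proof.
  induction p as [i j|i j|p IH|p IHp q IHq|p IH]; intros r c g Hr H;
  destruct (Rn_inv H) as [(a & b & a' & b' & Ha & Hb & [[E ->]|[E ->]])|[(a & a' & E & -> & Ha)|[(a & b & a' & b' & E & -> & Ha & Hb)|(a & a' & r' & E & -> & Hu & Ha)]]];
  cbn [cd] in E; try (exfalso; revert E; apply tag_neq; discriminate).
  - apply kMem_inj in E as [<- <-]. rewrite (Hr _ _ Ha), (Hr _ _ Hb). reflexivity.
  - apply kEq_inj in E as [<- <-]. rewrite (Hr _ _ Ha), (Hr _ _ Hb). reflexivity.
  - apply kNeg_inj in E as <-. rewrite (IH _ _ g Hr Ha). reflexivity.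
  - apply kImp_inj in E as [<- <-]. rewrite (IHp _ _ g Hr Ha), (IHq _ _ g Hr Hb). reflexivity.
  - apply kAll_inj in E as <-. rewrite (IH r' a' (up g)); [reflexivity| |exact Ha].
    intros i m Hm. apply Hu in Hm as [[E ->]|(n' & m' & E & -> & Hm)].
    + apply (@nm_inj _ i 0) in E as ->. reflexivity.
    + destruct i as [|i]; [exfalso; apply (@suc_emp S n'); symmetry; exact E|]. apply (@suc_inj S (nm i)) in E as <-. rewrite (Hr _ _ Hm). reflexivity.
Qed.
Lemma ShfR_g (r : S) : ShfR r -> forall i m, pr (nm i) m ∈ r -> m = nm (Sn i).
Proof. intros H i m Hm. apply H in Hm as [_ ->]. reflexivity. Qed.
Lemma InsR_g t (r : S) : InsR (nm t) r -> forall i m, pr (nm i) m ∈ r -> m = nm (inst t i).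
Proof.
  intros H i m Hm. apply H in Hm as [_ [[E ->]|E]].
  - apply (@nm_inj _ i 0) in E as ->. reflexivity.
  - destruct i as [|i]; [exfalso; apply (@suc_emp S m); symmetry; exact E|]. apply (@suc_inj S (nm i)) in E as <-. reflexivity.
Qed.

Ltac cdn := rewrite <- !interp_cd; cbv [ax_K ax_S ax_N ax_dist ax_vac ax_inst eq_refl_ax eq_eucl_ax eq_mem_l_ax eq_mem_r_ax interp form_syntax mem eql neg imp all]; reflexivity.
Lemma cd_K p q : @cd S (ax_K p q) = ax_K (cd p) (cd q). Proof. cdn. Qed.
Lemma cd_S p q r : @cd S (ax_S p q r) = ax_S (cd p) (cd q) (cd r). Proof. cdn. Qed.
Lemma cd_N p q : @cd S (ax_N p q) = ax_N (cd p) (cd q). Proof. cdn. Qed.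
Lemma cd_dist p q : @cd S (ax_dist p q) = ax_dist (cd p) (cd q). Proof. cdn. Qed.
Lemma cd_vac p q : @cd S (ax_vac p q) = ax_vac (cd p) (cd q). Proof. cdn. Qed.
Lemma cd_inst p q : @cd S (ax_inst p q) = ax_inst (cd p) (cd q). Proof. cdn. Qed.
Lemma cd_refl : @cd S eq_refl_ax = eq_refl_ax. Proof. cdn. Qed.
Lemma cd_eucl : @cd S eq_eucl_ax = eq_eucl_ax. Proof. cdn. Qed.
Lemma cd_mem_l : @cd S eq_mem_l_ax = eq_mem_l_ax. Proof. cdn. Qed.
Lemma cd_mem_r : @cd S eq_mem_r_ax = eq_mem_r_ax. Proof. cdn. Qed.

Lemma LA_decode c : LA (@Tr S) c -> exists p, c = cd p /\ logical_axiom p.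
Proof.
  intros [(p & q & Hp & Hq & ->)|[(p & q & r & Hp & Hq & Hr & ->)|[(p & q & Hp & Hq & ->)|[(p & q & Hp & Hq & ->)|[(p & r & _ & p' & Hp & Hr & Hn & ->)|
    [(p & t & r & _ & p' & Hp & Ht & Hr & Hn & ->)|[->|[->|[->| ->]]]]]]]]].
  - destruct (wf_Fm Hp) as (p' & ->), (wf_Fm Hq) as (q' & ->). rewrite <- cd_K. eexists; split; [reflexivity|constructor].
  - destruct (wf_Fm Hp) as (p' & ->), (wf_Fm Hq) as (q' & ->), (wf_Fm Hr) as (r' & ->). rewrite <- cd_S. eexists; split; [reflexivity|constructor].
  - destruct (wf_Fm Hp) as (p' & ->), (wf_Fm Hq) as (q' & ->). rewrite <- cd_N. eexists; split; [reflexivity|constructor].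
  - destruct (wf_Fm Hp) as (p' & ->), (wf_Fm Hq) as (q' & ->). rewrite <- cd_dist. eexists; split; [reflexivity|constructor].
  - destruct (wf_Fm Hp) as (q & ->). rewrite (wf_Rn (ShfR_g Hr) Hn), <- cd_vac. eexists; split; [reflexivity|constructor].
  - destruct (wf_Fm Hp) as (q & ->), (wf_Nat Ht) as (j & ->). rewrite (wf_Rn (InsR_g Hr) Hn), <- cd_inst. eexists; split; [reflexivity|constructor].
  - rewrite <- cd_refl. eexists; split; [reflexivity|constructor].
  - rewrite <- cd_eucl. eexists; split; [reflexivity|constructor].
  - rewrite <- cd_mem_l. eexists; split; [reflexivity|constructor].
  - rewrite <- cd_mem_r. eexists; split; [reflexivity|constructor].
Qed.
Lemma LA_code p : logical_axiom p -> LA (@Tr S) (cd p).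
Proof.
  pose proof (cd_Fm HT) as F.
  destruct 1; [left|right; left|do 2 right; left|do 3 right; left|do 4 right; left|do 5 right; left|do 6 right; left|do 7 right; left|do 8 right; left|do 9 right].
  - exists (cd p), (cd q). rewrite cd_K; auto.
  - exists (cd p), (cd q), (cd r). rewrite cd_S; auto.
  - exists (cd p), (cd q). rewrite cd_N; auto.
  - exists (cd p), (cd q). rewrite cd_dist; auto.
  - exists (cd p), shf. split; [exact I|]. exists (cd (ren Sn p)). split; [auto|]. split; [apply ShfR_shf|]. split; [|apply cd_vac].
    apply (cd_Rn HT); [exact I|]. intros i. apply ShfR_shf. split; [apply nm_Nat|reflexivity].
  - exists (cd p), (nm t), (ins (nm t)). split; [exact I|]. exists (cd (ren (inst t) p)). split; [auto|]. split; [apply nm_Nat|]. split; [apply InsR_ins|]. split; [|apply cd_inst].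
    apply (cd_Rn HT); [exact I|]. intros i. apply InsR_ins. split; [apply nm_Nat|]. destruct i; [left|right]; auto.
  - apply cd_refl.
  - apply cd_eucl.
  - apply cd_mem_l.
  - apply cd_mem_r.
Qed.

(** ** Provability *)
Variables (T : theory) (T' : S -> Prop).
Hypothesis HTT : forall x, T' x <-> exists p, T p /\ x = cd p.

Lemma PV_prov c : PV Tr T' c -> exists p, c = cd p /\ prov T p.
Proof.
  intros (n & P & _ & Hn & HP & (m & -> & Hm) & H).
  assert (A : forall i, nm i ∈ suc m -> forall x, pr (nm i) x ∈ P -> exists p, x = cd p /\ prov T p).
  { induction i as [i IH] using lt_wf_ind. intros Hi x Hx.
    assert (IH' : forall j x, j ∈ nm i -> pr j x ∈ P -> exists p, x = cd p /\ prov T p).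
    { intros j x' Hj Hx'. destruct (in_nm Hj) as (j' & Hj' & ->). apply (IH j' Hj'); auto. apply (N_tr Hn Hi Hj). }
    destruct (H _ Hi) as (x' & Hx' & HJ). rewrite <- (HP _ _ _ (conj Hx Hx')) in HJ. clear x' Hx'.
    destruct HJ as [HJ|[[_ HJ]|[(j & k & y & z & Hj & Hk & Hy & Hz & ->)|(j & y & Hj & Hy & ->)]]].
    - destruct (LA_decode HJ) as (p & -> & Hp). exists p; split; auto. apply prov_log, Hp.
    - apply HTT in HJ as (p & Hp & ->). exists p; split; auto. apply prov_ax, Hp.
    - destruct (IH' _ _ Hj Hy) as (p & -> & Hp), (IH' _ _ Hk Hz) as (r & E & Hr).
      destruct r as [| | |p' q|]; cbn [cd] in E; try (exfalso; revert E; apply tag_neq; discriminate).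
      apply kImp_inj in E as [E ->]. apply cd_inj in E as ->. exists q; split; auto. exact (prov_mp Hp Hr).
    - destruct (IH' _ _ Hj Hy) as (p & -> & Hp). exists (All p). split; [reflexivity|]. apply prov_gen, Hp. }
  destruct (wf_Nat (N_pred Hn)) as (j & ->). apply (A j); auto. apply in_suc.
Qed.

Definition just (l : list form) (p : form) := logical_axiom p \/ T p \/ (exists q, In q l /\ In (Imp q p) l) \/ exists q, In q l /\ p = All q.
(** Derivation trees are flattened to lists because [is_provable] speaks of a sequence whose entries
    refer to earlier positions. *)
Inductive pf : list form -> Prop :=
| pf_nil : pf []
| pf_snoc l p : pf l -> just l p -> pf (l ++ [p]).
Lemma just_mono l l' p : List.incl l l' -> just l p -> just l' p.
Proof.
  intros Hl [H|[H|[(q & H1 & H2)|(q & H1 & H2)]]]; [left|right; left|right; right; left; exists q|right; right; right; exists q]; auto.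
Qed.
Lemma pf_app l l' : pf l -> pf l' -> pf (l ++ l').
Proof.
  intros H. induction 1 as [|l' p H1 IH H2]; [rewrite app_nil_r; auto|]. rewrite app_assoc. constructor; auto.
  revert H2. apply just_mono, incl_appr, incl_refl.
Qed.
Lemma prov_pf p : prov T p -> exists l, pf (l ++ [p]).
Proof.
  induction 1 as [p H|p H|p q H1 (l & IH1) H2 (l' & IH2)|p H1 (l & IH1)].
  - exists []. apply (@pf_snoc [] p pf_nil). left; auto.
  - exists []. apply (@pf_snoc [] p pf_nil). right; left; auto.
  - exists ((l ++ [p]) ++ (l' ++ [Imp p q])). constructor; [apply pf_app; auto|]. right; right; left. exists p.
    split; rewrite !in_app_iff; simpl; auto.
  - exists (l ++ [p]). constructor; auto. right; right; right. exists p. split; auto. rewrite in_app_iff; simpl; auto.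
Qed.
Lemma pf_nth l : pf l -> forall i, i < length l -> exists l1 l2, l = l1 ++ l2 /\ length l1 = i /\ just l1 (nth i l (Mem 0 0)).
Proof.
  induction 1 as [|l p H1 IH H2]; intros i Hi; [simpl in Hi; lia|]. rewrite length_app in Hi. simpl in Hi.
  destruct (Nat.eq_dec i (length l)) as [->|N].
  - exists l, [p]. rewrite app_nth2, Nat.sub_diag; auto.
  - destruct (IH i) as (l1 & l2 & E & Hl & HJ); [lia|]. exists l1, (l2 ++ [p]). rewrite app_nth1 by lia. rewrite app_assoc, <- E. auto.
Qed.
Lemma prov_PV p : prov T p -> PV Tr T' (cd p).
Proof.
  intros H. destruct (prov_pf H) as (l0 & Hl). set (l := l0 ++ [p]) in *.
  destruct (closure (isU_True S) (X := emp) I) as (z & _ & Hz & _).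
  destruct (@seq_ex S z (length l) (fun i => cd (nth i l (Mem 0 0)))) as (s & Hs & Hsi); [intros; apply (cd_D Hz)|].
  exists (nm (length l)), s. split; [exact I|]. split; [apply nm_Nat|]. split; [apply Hs|]. split.
  - exists (nm (length l0)). unfold l in *. rewrite length_app, Nat.add_1_r in *. split; [reflexivity|].
    specialize (Hsi (length l0)). rewrite app_nth2, Nat.sub_diag in Hsi; auto.
  - intros x Hx. destruct (in_nm Hx) as (i & Hi & ->). exists (cd (nth i l (Mem 0 0))). split; [apply Hsi, Hi|].
    destruct (pf_nth Hl Hi) as (l1 & l2 & E & <- & HJ).
    assert (K : forall q, In q l1 -> exists j, j ∈ nm (length l1) /\ pr j (cd q) ∈ s).
    { intros q Hq. destruct (In_nth l1 q (Mem 0 0) Hq) as (j & Hj & <-). exists (nm j). split; [apply nm_lt, Hj|].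
      rewrite <- (app_nth1 l1 l2) by auto. rewrite <- E. apply Hsi. lia. }
    destruct HJ as [HJ|[HJ|[(q & H1 & H2)|(q & H1 & ->)]]].
    + left. apply LA_code, HJ.
    + right; left. split; [apply (cd_Fm HT)|apply HTT; eauto].
    + right; right; left. destruct (K _ H1) as (j & Hj & Hj'), (K _ H2) as (k & Hk & Hk'). exists j, k, (cd q), (cd (Imp q (nth (length l1) l (Mem 0 0)))).
      split; [exact Hj|]. split; [exact Hk|]. split; [exact Hj'|]. split; [exact Hk'|reflexivity].
    + right; right; right. destruct (K _ H1) as (j & Hj & Hj'). exists j, (cd q). split; [exact Hj|]. split; [exact Hj'|reflexivity].
Qed.

Lemma Prv_prov R p : bounded 1 R -> bounded 1 p -> Delta0 p -> (Prv R T' (cd p) <-> prov T (rel_L R (Ex p))).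
Proof.
  intros HR Hb HD.
  (* The renaming inside [rel_L] is the identity on [p], whose only free variable is bound by the
     existential quantifier. *)
  assert (E : rlx R (@cd S p) = cd (rel_L R (Ex p))).
  { unfold rel_L. change (ren (fun i => 2 + i) (Ex p)) with (Ex (ren (up rr) p)). rewrite rel_Ex by (apply Delta0_ren; auto).
    rewrite (@ren_id p 1) by first [exact Hb|intros [|i] Hi; [reflexivity|lia]]. unfold rlx, BEx, BAll. cbn [cd neg imp all mem form_syntax]. reflexivity. }
  unfold Prv. rewrite E. split.
  - intros (_ & _ & H). destruct (PV_prov H) as (q & Eq & Hq). apply cd_inj in Eq as ->. exact Hq.
  - intros H. split; [apply (cd_D0 HT HD)|]. split; [exact (cd_Bd HT Hb)|]. apply prov_PV, H.
Qed.
Lemma Prv_decode R (x : S) : Prv R T' x -> exists p, x = cd p /\ Delta0 p /\ bounded 1 p.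
Proof.
  intros (H1 & H2 & _). destruct (wf_Bd (n := 1) H2) as (p & -> & Hp). exists p. split; auto. split; auto. apply D0_Delta0, H1.
Qed.
End WF.

(** * Satisfaction classes at actual formulas *)

Section Gen.
Variable S : kpm.
Notation Sn := Datatypes.S.
Lemma St_sat (k s : S) n e p : Seq k (nm n) s -> (forall i, i < n -> pr (nm i) (e i) ∈ s) -> bounded n p ->
  (St Tr k (cd p) s <-> dsat (inz k) e p).
Proof.
  intros Hs He Hb. assert (HT := @closed_True S). split.
  - intros (A & W & _ & _ & H1 & H2 & H3). apply (sat_std H3 Hb (proj1 Hs) He H1), H2.
  - intros H. destruct (St_dec (isU_True S) (k := k) I (nm_Nat S n) (cd_Bd HT Hb) Hs) as [G|(A & W & _ & _ & H1 & H2 & H3)]; auto.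
    exfalso. apply (SC_neg H3 H1) in H2. apply H2. apply (sat_std H3 Hb (proj1 Hs) He); auto. apply (SC_neg H3 H1).
Qed.
Lemma St_Scn_sat (k s a : S) n e p : Seq k (nm n) s -> (forall i, i < n -> pr (nm i) (e i) ∈ s) -> bounded (Sn n) p -> a ∈ k ->
  ((exists s', Tr s' /\ Scn a s s' /\ St Tr k (cd p) s') <-> dsat (inz k) (sc a e) p).
Proof.
  intros Hs He Hb Ha.
  assert (Q : forall s', Scn a s s' -> (St Tr k (cd p) s' <-> dsat (inz k) (sc a e) p)).
  { intros s' Hs'. apply (St_sat (n := Sn n)); auto; [apply (Scn_Seq (nm_Nat S n) Hs Ha Hs')|].
    intros [|i] Hi; apply (Scn_in _ _ Hs'); [left; split; reflexivity|right]. exists (nm i). split; [reflexivity|]. apply He; lia. }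
  split.
  - intros (s' & _ & Hs' & H). apply (Q s' Hs'), H.
  - intros H. destruct (@Scn_ex _ _ (isU_True S) a s I I) as (s' & _ & Hs'). exists s'. split; [exact I|]. split; auto. apply (Q s' Hs'), H.
Qed.
Lemma Tru_dsat (k : S) e f : bounded 1 f -> (Tru k (cd f) <-> dsat (inz k) e (Ex f)).
Proof.
  intros Hb. unfold Tru. change (kEx (cd f)) with (@cd S (Neg (All (Neg f)))).
  apply (@St_sat k emp 0 e (Neg (All (Neg f)))); [apply Seq_emp|lia|exact Hb].
Qed.
Lemma Tru_sat (k : S) f : trans k -> Delta0 f -> bounded 1 f -> (Tru k (cd f) <-> exists x, x ∈ k /\ sat (el [x]) f).
Proof.
  intros Hk HD Hb. transitivity (dsat (inz k) (el ([] : list S)) (Ex f)).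
  - apply Tru_dsat, Hb.
  - rewrite s_Ex. split; intros (x & Hx & H); exists x; (split; [exact Hx|]); revert H;
    apply (Delta0_abs (E := E) (D := inz k) (p := f)) with (n := 1); auto; try (intros u v Hu Hv; apply (Hk _ Hu _ Hv)); intros [|i] Hi; auto; lia.
Qed.
End Gen.

(** * Sets and the constructible hierarchy *)
Notation "x ∈v y" := (@E Vk x y) (at level 70).
Lemma Vwf : forall P : Vk -> Prop, (forall x, (forall y, y ∈ x -> P y) -> P x) -> forall x, P x.
Proof. exact V_ind. Qed.

Lemma mk_up2 x y : mk (upair x y) = up2 (mk x : Vk) (mk y).
Proof. apply (@ext Vk). intros z. rewrite up2_spec. apply in_upair. Qed.
Lemma mk_pr x y : mk (opair x y) = pr (mk x : Vk) (mk y).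
Proof. unfold opair. rewrite !mk_up2. reflexivity. Qed.
Lemma mk_num n : mk (num n) = @nm Vk n.
Proof.
  induction n; apply (@ext Vk); intros z.
  - split; intros H; [destruct (in_empty H)|destruct (emp_spec H)].
  - cbn [nm num]. rewrite suc_spec, <- IHn. apply in_succ.
Qed.
Lemma mk_code p : mk (code p) = @cd Vk p.
Proof. induction p; cbn [code cd]; rewrite !mk_pr, ?IHp, ?IHp1, ?IHp2, !mk_num; reflexivity. Qed.

Lemma vsat (D : Ens -> Prop) (D' : Vk -> Prop) p : (forall x, D x <-> D' (mk x)) -> forall e,
  Defs.sat D e p <-> dsat D' (fun i => mk (e i) : Vk) p.
Proof.
  intros HD. induction p; intros e; cbn [Defs.sat tsat].
  - symmetry; apply VE_mk.
  - symmetry; apply mk_eq.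
  - rewrite IHp; tauto.
  - rewrite IHp1, IHp2; tauto.
  - assert (Q : forall x, Defs.sat D (scons x e) p <-> dsat D' (sc (mk x : Vk) (fun i => mk (e i))) p).
    { intros x. rewrite IHp. apply tsat_ext with (n := bnd p); [apply bnd_ok|]. intros [|i] _; reflexivity. }
    split; intros H x Hx.
    + destruct (V_surj x) as (y & ->). apply Q, H, HD, Hx.
    + apply Q, H, HD, Hx.
Qed.

Lemma in_elt (A : Ens) (X : Vk) : X ∈v mk A <-> exists a : idx A, X = mk (elt a).
Proof. destruct A as [A f]. exact (in_sup f X). Qed.
Lemma list_choice {A : Type} (Q : nat -> A -> Prop) n : (forall i, i < n -> exists a, Q i a) ->
  exists l, length l = n /\ forall i d, i < n -> Q i (nth i l d).
Proof.
  intros H. induction n as [|n IH]; [exists []; split; [auto|lia]|]. destruct IH as (l & <- & Hl); [intros; apply H; lia|].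
  destruct (H (length l)) as (a & Ha); [lia|]. exists (l ++ [a]). rewrite length_app. simpl. split; [lia|]. intros i d Hi.
  destruct (Nat.eq_dec i (length l)) as [->|N]; [rewrite app_nth2, Nat.sub_diag by lia; exact Ha|]. rewrite app_nth1 by lia. apply Hl; lia.
Qed.

(** Natural numbers and codes of the universe are standard, so an internal definition comes from an
    actual formula and its parameters from an actual list. *)
Lemma in_Def_iff (A : Ens) (X : Vk) : X ∈v mk (Def A) <-> InD Tr (mk A : Vk) X.
Proof.
  set (k := mk A : Vk).
  assert (Q : forall (l : list (idx A)) p (a : idx A), bounded (S (length l)) p ->
    (Defs.sat (fun x => isin x A) (env (elt a :: map (@elt A) l)) p <-> dsat (inz k) (sc (mk (elt a)) (fun i => mk (nth i (map (@elt A) l) empty))) p)).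
  { intros l p a Hb. rewrite (@vsat _ (inz k)) by (intros x; symmetry; apply VE_mk).
    apply tsat_ext with (n := S (length l)); auto. intros [|i] _; reflexivity. }
  assert (R : forall (l : list (idx A)) p, bounded (S (length l)) p -> forall Y : Vk, 
     (Y ∈ mk (sup (fun a : { a : idx A | Defs.sat (fun x => isin x A) (env (elt a :: map (@elt A) l)) p } => elt (proj1_sig a))) <->
      Y ∈ k /\ dsat (inz k) (sc Y (fun i => mk (nth i (map (@elt A) l) empty))) p)).
  { intros l p Hb Y. change (VE Y (mk (sup (fun a : { a : idx A | Defs.sat (fun x => isin x A) (env (elt a :: map (@elt A) l)) p } => elt (proj1_sig a)))) <->
      Y ∈ k /\ dsat (inz k) (sc Y (fun i => mk (nth i (map (@elt A) l) empty))) p). rewrite in_sup. split.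
    - intros ([a Ha] & ->). split; [apply in_elt; eexists; reflexivity|]. apply (Q l p a Hb), Ha.
    - intros [HY H]. apply in_elt in HY as (a & ->). apply (Q l p a Hb) in H. exists (exist _ a H). reflexivity. }
  unfold Def. change (VE X (mk (Def A)) <-> InD Tr k X). unfold Def. rewrite in_sup. split.
  - intros ([[p l] Hb] & ->). cbn [proj1_sig fst snd] in Hb |- *.
    destruct (@seq_ex Vk k (length l) (fun i => mk (nth i (map (@elt A) l) empty))) as (s & Hs & Hse).
    { intros i Hi. apply in_elt. destruct (nth_error l i) as [a|] eqn:E; [|apply nth_error_None in E; lia]. exists a.
      f_equal. apply nth_error_nth. rewrite nth_error_map, E. reflexivity. }
    exists (nm (length l)), (cd p), s. split; [exact I|]. split; [apply nm_Nat|].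
    split; [exists (nm (S (length l))); split; [reflexivity|apply (cd_Bd (@closed_True Vk)), Hb]|]. split; [exact Hs|].
    intros Y. rewrite (R l p Hb Y). split; intros [HY H]; (split; [exact HY|]); revert H; apply (St_Scn_sat Hs Hse Hb HY).
  - intros (n & c & s & _ & Hn & (k' & -> & Hc) & Hs & HX).
    destruct (wf_Nat Vwf Hn) as (j & ->). destruct (wf_Bd Vwf (n := S j) Hc) as (p & -> & Hp).
    destruct (@list_choice (idx A) (fun i a => pr (nm i) (mk (elt a) : Vk) ∈ s) j) as (l & <- & Hl).
    { intros i Hi. destruct (proj2 (proj2 Hs) (nm i) (nm_lt Vk Hi)) as (x & Hx). destruct (Seq_vals Hs Hx) as (_ & Hxk).
      apply in_elt in Hxk as (a & ->). exists a; exact Hx. }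
    exists (exist _ (p, l) Hp). apply (@ext Vk). intros Y. cbn [proj1_sig fst snd]. rewrite (R l p Hp Y), (HX Y).
    assert (Hse : forall i, i < length l -> pr (nm i) (mk (nth i (map (@elt A) l) empty) : Vk) ∈ s).
    { intros i Hi. destruct l as [|a0 l]; [simpl in Hi; lia|]. rewrite (nth_indep _ empty (elt a0)) by (rewrite length_map; exact Hi).
      rewrite map_nth. apply Hl, Hi. }
    split; intros [HY H]; (split; [exact HY|]); revert H; apply (St_Scn_sat Hs Hse Hp HY).
Qed.

Lemma def_true R T tau : Delta1_definition R T tau -> forall x : Vk, Tp tau x <-> exists p, T p /\ x = cd p.
Proof.
  intros (Hb & H & _) X. destruct (V_surj X) as (x & ->). specialize (H x). rewrite (@vsat _ Tr) in H by (intros; split; intros _; exact I).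
  assert (E : Tp tau (mk x : Vk) <-> sat (fun i => mk (env [x] i) : Vk) tau).
  { apply tsat_ext with (n := 1); auto. intros [|i] Hi; [reflexivity|lia]. }
  rewrite E, H. split; intros (p & Hp & Hx); exists p; (split; [exact Hp|]).
  - rewrite <- mk_code. apply mk_eq, Hx.
  - apply mk_eq. rewrite mk_code. exact Hx.
Qed.

(** * The hierarchy L in the universe of sets *)

Definition LV (X : Vk) : Vk := mk (L (rp X)).
Lemma in_L_sup A (f : A -> Ens) (X : Vk) : X ∈v mk (L (sup f)) <-> exists a, InD Tr (mk (L (f a)) : Vk) X.
Proof.
  transitivity (exists a, X ∈v mk (Def (L (f a)))).
  - change (VE X (mk (sup (fun c : { a & idx (Def (L (f a))) } => elt (projT2 c)))) <-> exists a, X ∈v mk (Def (L (f a)))).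
    rewrite in_sup. split.
    + intros ([a c] & ->). exists a. apply in_elt. exists c. reflexivity.
    + intros (a & H). apply in_elt in H as (c & ->). exists (existT _ a c). reflexivity.
  - split; intros (a & H); exists a; apply in_Def_iff, H.
Qed.
(** [L] is defined by recursion on the tree that presents a set; that equivalent presentations give
    the same level needs an induction on trees. *)
Lemma L_cong : forall x y, eqv x y -> mk (L x) = mk (L y).
Proof.
  induction x as [A f IH]; intros [B g] [H1 H2]. apply (@ext Vk). intros X.
  transitivity (exists a, InD Tr (mk (L (f a)) : Vk) X); [apply in_L_sup|]. symmetry. transitivity (exists b, InD Tr (mk (L (g b)) : Vk) X); [apply in_L_sup|].
  split; intros (a & Ha).
  - destruct (H2 a) as (b & Hb). exists b. rewrite (IH b (g a) Hb). exact Ha.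
  - destruct (H1 a) as (b & Hb). exists b. rewrite <- (IH a (g b) Hb). exact Ha.
Qed.
Lemma LV_mk x : LV (mk x) = mk (L x).
Proof. apply L_cong, rp_mk. Qed.
Lemma LV_spec (a X : Vk) : X ∈ LV a <-> exists h, h ∈ a /\ InD Tr (LV h) X.
Proof.
  destruct (V_surj a) as ([A f] & ->). rewrite LV_mk. etransitivity; [apply in_L_sup|]. split.
  - intros (b & H). exists (mk (f b)). rewrite LV_mk. split; [apply in_sup; eauto|exact H].
  - intros (h & Hh & H). apply in_sup in Hh as (b & ->). rewrite LV_mk in H. exists b; exact H.
Qed.

Lemma LV_IsL (a l : Vk) : IsL Tr a l -> l = LV a.
Proof.
  intros (f & _ & Hf & Hal & H). revert a l Hal.
  apply (Vwf (P := fun a => forall l, pr a l ∈ f -> l = LV a)). intros a IH l Hl. apply ext. intros x. rewrite LV_spec.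
  destruct (H a l Hl) as [H1 H2]. rewrite (H2 x I). split.
  - intros (h & k & Hh & Hk & HI). exists h. split; auto. rewrite <- (IH h Hh k Hk). exact HI.
  - intros (h & Hh & HI). destruct (H1 h Hh) as (k & Hk). exists h, k. split; auto. split; auto. rewrite (IH h Hh k Hk). exact HI.
Qed.

Lemma LV_mono (a b : Vk) : (forall x, x ∈ a -> x ∈ b) -> forall x, x ∈ LV a -> x ∈ LV b.
Proof. intros H x Hx. apply LV_spec in Hx as (h & Hh & Hx). apply LV_spec. eauto. Qed.
Lemma LV_trans (a : Vk) : trans a -> trans (LV a).
Proof.
  intros Ha y Hy x Hx. apply LV_spec in Hy as (h & Hh & Hy). apply (InD_sub Hy) in Hx. apply LV_spec in Hx as (g & Hg & Hx).
  apply LV_spec. exists g. split; [exact (Ha h Hh g Hg)|exact Hx].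
Qed.

(** ** Ordinals *)
Lemma ord_in (a b : Vk) : isord a -> b ∈ a -> isord b.
Proof.
  intros [H1 H2] Hb. split; [exact (H2 b Hb)|]. intros y Hy. exact (H2 y (H1 b Hb y Hy)).
Qed.
Lemma ord_tri : forall a b : Vk, isord a -> isord b -> a ∈ b \/ a = b \/ b ∈ a.
Proof.
  apply (Vwf (P := fun a => forall b : Vk, isord a -> isord b -> a ∈ b \/ a = b \/ b ∈ a)). intros a IHa.
  apply (Vwf (P := fun b => isord a -> isord b -> a ∈ b \/ a = b \/ b ∈ a)). intros b IHb Ha Hb.
  destruct (classic (exists c, c ∈ a /\ (c = b \/ b ∈ c))) as [(c & Hc & [->|H])|N1]; auto.
  { right; right. exact (proj1 Ha c Hc b H). }
  destruct (classic (exists c, c ∈ b /\ (c = a \/ a ∈ c))) as [(c & Hc & [->|H])|N2]; auto.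
  { left. exact (proj1 Hb c Hc a H). }
  right; left. apply ext. intros c. split; intros Hc.
  - destruct (IHa c Hc b (ord_in Ha Hc) Hb) as [G|[G|G]]; auto; exfalso; apply N1; eauto.
  - destruct (IHb c Hc Ha (ord_in Hb Hc)) as [G|[G|G]]; auto; exfalso; apply N2; eauto.
Qed.
Lemma ord_sub (a b : Vk) : isord a -> isord b -> (forall x, x ∈ a -> x ∈ b) \/ b ∈ a.
Proof.
  intros Ha Hb. destruct (ord_tri Ha Hb) as [H|[->|H]]; auto. left. exact (proj1 Hb a H).
Qed.
Lemma ord_least (Q : Vk -> Prop) a : isord a -> Q a ->
  exists b, isord b /\ Q b /\ forall c, isord c -> Q c -> forall x, x ∈ b -> x ∈ c.
Proof.
  revert a. apply (Vwf (P := fun a => isord a -> Q a -> _)). intros a IH Ha HQ.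
  destruct (classic (exists c, c ∈ a /\ Q c)) as [(c & Hc & HQc)|N].
  - apply (IH c Hc); auto. apply (ord_in Ha Hc).
  - exists a. split; auto. split; auto. intros c Hc HQc. destruct (ord_sub Ha Hc) as [H|H]; auto. exfalso; apply N; eauto.
Qed.

(** This ties chains to the hierarchy, by induction on membership: the earlier levels of [C] inside
    [k] already have indices, and the index of [k] lies just above all of these. Ordinals strictly
    between them contribute nothing new, since [k] is transitive. *)
Lemma Ch_LV (C : Vk) : Ch C -> forall k, k ∈ C -> exists d, isord d /\ k = LV d.
Proof.
  intros HC. apply (Vwf (P := fun k => k ∈ C -> exists d, isord d /\ k = LV d)). intros k IH Hk. destruct (HC k Hk) as [Ht Hx].
  destruct (@V_coll (fun k' d' : Vk => k' ∈ C -> isord d' /\ k' = LV d') k) as (b0 & Hb0).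
  (* Collection asks for a value at every member of [k]; those outside [C] get themselves as a
     dummy. *)
  { intros k' Hk'. destruct (classic (@E Vk k' C)) as [HC'|HC']; [destruct (IH k' Hk' HC') as (d & Hd); exists d; auto|]. exists k'; tauto. }
  destruct (V_sep (fun d : Vk => isord d /\ @E Vk (LV d) C /\ @E Vk (LV d) k) b0) as (b & Hb).
  (* The least ordinal greater than all members of [b]. *)
  set (d := @un Vk (@Un Vk b) b).
  assert (Hb' : forall h, h ∈v b -> isord h /\ LV h ∈v C /\ LV h ∈v k) by (intros h Hh; apply Hb, Hh).
  assert (Hd : forall h, h ∈ d -> h ∈v b \/ exists d', d' ∈v b /\ h ∈ d').
  { intros h Hh. apply un_spec in Hh as [Hh|Hh]; [|auto]. apply Un_spec in Hh as (d' & H1 & H2). eauto. }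
  exists d. split; [split|].
  - intros y Hy x Hx'. apply un_spec; left. apply Un_spec. destruct (Hd y Hy) as [Hy'|(d' & Hd' & Hy')]; [eauto|].
    exists d'. split; [exact Hd'|]. exact (proj1 (proj1 (Hb' d' Hd')) y Hy' x Hx').
  - intros y Hy. destruct (Hd y Hy) as [Hy'|(d' & Hd' & Hy')]; [exact (proj1 (proj1 (Hb' y Hy')))|].
    exact (proj2 (proj1 (Hb' d' Hd')) y Hy').
  - apply ext. intros x. rewrite LV_spec. split.
    + intros Hxk. apply Hx in Hxk as (k' & H1 & H2 & H3). destruct (Hb0 k' H2) as (d' & Hd' & H4). destruct (H4 H1) as [H5 H6].
      exists d'. rewrite <- H6. split; [|exact H3]. apply un_spec; right. apply Hb. rewrite <- H6. auto.
    + intros (h & Hh & H1). destruct (Hd h Hh) as [Hh'|(d' & Hd' & Hh')].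
      * apply Hx. exists (LV h). destruct (Hb' h Hh') as (_ & H2 & H3). auto.
      * destruct (Hb' d' Hd') as (_ & _ & H3). apply (Ht (LV d') H3). apply LV_spec. eauto.
Qed.

Lemma mk_incl a b : incl a b <-> forall x : Vk, x ∈v mk a -> x ∈v mk b.
Proof.
  split; intros H x Hx.
  - destruct (V_surj x) as (y & ->). apply VE_mk, H, VE_mk, Hx.
  - apply VE_mk, H, VE_mk, Hx.
Qed.
Lemma mk_trans x : transitive x <-> trans (mk x : Vk).
Proof.
  split.
  - intros H y Hy. destruct (V_surj y) as (z & ->). apply mk_incl, H, VE_mk, Hy.
  - intros H y Hy. apply mk_incl. apply (H (mk y)), VE_mk, Hy.
Qed.
Lemma mk_ord x : ordinal x <-> isord (mk x : Vk).
Proof.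
  split; intros [H1 H2]; (split; [apply mk_trans, H1|]); intros y Hy.
  - destruct (V_surj y) as (z & ->). apply mk_trans, H2, VE_mk, Hy.
  - apply mk_trans, H2, VE_mk, Hy.
Qed.

(** * The norm, and soundness of a theory for a level *)

Section Norm.
Variable R : form.
Definition SV (T : theory) (X : Vk) := forall f, Delta0 f -> bounded 1 f -> prov T (rel_L R (Ex f)) -> Tru (LV X) (cd f).
Lemma sound_SV T b : Sigma1_sound R b T <-> SV T (mk b).
Proof.
  assert (Q : forall f, bounded 1 f -> (models (L b) (Ex f) <-> Tru (LV (mk b)) (cd f))).
  { intros f Hf. rewrite LV_mk. unfold models. rewrite (@vsat _ (inz (mk (L b) : Vk))) by (intros x; symmetry; apply VE_mk).
    rewrite (Tru_dsat _ (el [])) by exact Hf. apply tsat_ext with (n := 0); [exact Hf|lia]. }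
  split.
  - intros H f HD Hf HP. apply Q; auto. apply H; auto. exists f; auto.
  - intros H p (f & HD & ->) Hf HP. apply Q; auto.
Qed.
(** Soundness of [T] at [a] provides a candidate, so a least one exists and the epsilon term in
    [least_ordinal] denotes it. *)
Lemma norm_spec T a : ordinal a -> Sigma1_sound R a T ->
  isord (mk (Sigma1_norm R T) : Vk) /\ SV T (mk (Sigma1_norm R T)) /\
  forall c : Vk, isord c -> SV T c -> forall x : Vk, x ∈v mk (Sigma1_norm R T) -> x ∈ c.
Proof.
  intros Ha HS. apply mk_ord in Ha. apply sound_SV in HS. destruct (ord_least (Q := SV T) Ha HS) as (b & Hb & HSb & Hmin).
  assert (E : exists b, ordinal b /\ Sigma1_sound R b T /\ forall c, ordinal c -> Sigma1_sound R c T -> incl b c).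
  { destruct (V_surj b) as (b' & ->). exists b'. split; [apply mk_ord, Hb|]. split; [apply sound_SV, HSb|].
    intros c Hc HSc. apply mk_incl, Hmin; [apply mk_ord, Hc|apply sound_SV, HSc]. }
  pose proof (epsilon_spec (inhabits empty) _ E) as H. fold (least_ordinal (fun b => Sigma1_sound R b T)) in H. fold (Sigma1_norm R T) in H.
  destruct H as (H1 & H2 & H3). split; [apply mk_ord, H1|]. split; [apply sound_SV, H2|].
  intros c Hc HSc. destruct (V_surj c) as (c' & ->). apply mk_incl, H3; [apply mk_ord, Hc|apply sound_SV, HSc].
Qed.
Lemma SV_mono T (a b : Vk) : isord a -> (forall x, x ∈ a -> x ∈ b) -> SV T a -> SV T b.
Proof.
  intros Ha Hab H f HD Hf HP. pose proof (@closed_True Vk) as HT.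
  apply (Tru_mono (k := LV a)); [apply (LV_mono Hab)|exact (LV_trans (proj1 Ha))|apply (cd_D0 HT HD)|exact (cd_Bd HT Hf)|exact (H f HD Hf HP)].
Qed.
(** In the well-founded universe internal proofs are actual proofs of actual formulas, so saturation
    of a level, which is stated internally, is soundness of [T] for it. *)
Lemma SV_Prv T T' (X : Vk) : bounded 1 R -> (forall x, T' x <-> exists p, T p /\ x = cd p) ->
  (SV T X <-> forall p, Prv R T' p -> Tru (LV X) p).
Proof.
  intros HR HT. split.
  - intros H p Hp. destruct (Prv_decode Vwf Hp) as (f & -> & HD & Hf). apply H; auto. apply (Prv_prov Vwf HT); auto.
  - intros H f HD Hf HP. apply H. apply (Prv_prov Vwf HT); auto.
Qed.
End Norm.

Unset Implicit Arguments.

Theorem theorem6p9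
  (R : form) (alpha : Ens)
  (hR : representation R) (hadm : provably_admissible R)
  (hVL : V_equals_L) (hex : true_V (Exists R)) (halpha : represents R alpha)
  (T U : theory) (tau upsilon : form)
  (hT : Delta1_definition R T tau) (hU : Delta1_definition R U upsilon)
  (hTs : Sigma1_sound R alpha T) (hUs : Sigma1_sound R alpha U)
  (hTe : extends T (KP1_Exists R)) (hUe : extends U (KP1_Exists R)) :
  incl (Sigma1_norm R T) (Sigma1_norm R U) <-> RFN_le R tau upsilon.
Proof.
  assert (HRb : bounded 1 R) by apply hR.
  set (al := mk alpha : Vk).
  assert (Hal : Rp R al).
  { pose proof (proj2 (proj2 halpha alpha (hVL alpha)) (eqv_refl alpha)) as H.
    apply (@vsat _ Tr) in H; [|intros x; split; [intros _; exact I|intros _; apply hVL]].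
    revert H. apply tsat_ext with (n := 1); auto. intros [|i] Hi; [reflexivity|lia]. }
  assert (Hex : forall e : nat -> Vk, sat e (Exists R)).
  { intros e. unfold Exists. rewrite s_Ex. exists al. split; [exact I|]. revert Hal. apply tsat_ext with (n := 1); auto. intros [|i] Hi; [reflexivity|lia]. }
  destruct (Rp_L hR hadm Hal) as (l & Hl). pose proof (Rp_good hR hadm Hal Hl) as Hg. pose proof (LV_IsL Hl) as El.
  assert (Hor : isord al) by (apply mk_ord, halpha).
  assert (HTT : forall x : Vk, Tp tau x <-> exists p, T p /\ x = cd p) by exact (def_true hT).
  assert (HUU : forall x : Vk, Tp upsilon x <-> exists p, U p /\ x = cd p) by exact (def_true hU).
  destruct (defs_ex hT) as (s & q & DT), (defs_ex hU) as (s' & q' & DU).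
  pose proof (norm_spec (proj1 halpha) hTs) as (HnT & HST & HmT). pose proof (norm_spec (proj1 halpha) hUs) as (HnU & HSU & HmU).
  set (nT := mk (Sigma1_norm R T) : Vk) in *. set (nU := mk (Sigma1_norm R U) : Vk) in *.
  assert (T1 : forall x, x ∈ l -> (Tp tau x <-> exists y, y ∈ l /\ sat (el [y; x]) s)).
  { intros x _. exact (def_ex hR Hex (df_s DT) (df_bs DT) (df_ps DT) Hal Hl x). }
  assert (T2 : forall x, x ∈ l -> (Tp tau x <-> forall y, y ∈ l -> sat (el [y; x]) q)).
  { intros x Hx. exact (def_all hR hadm Hex (df_q DT) (df_bq DT) (df_pq DT) Hal Hl Hx). }
  assert (U1 : forall x, x ∈ l -> (Tp upsilon x <-> exists y, y ∈ l /\ sat (el [y; x]) s')).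
  { intros x _. exact (def_ex hR Hex (df_s DU) (df_bs DU) (df_ps DU) Hal Hl x). }
  assert (U2 : forall x, x ∈ l -> (Tp upsilon x <-> forall y, y ∈ l -> sat (el [y; x]) q')).
  { intros x Hx. exact (def_all hR hadm Hex (df_q DU) (df_bq DU) (df_pq DU) Hal Hl Hx). }
  destruct Hg as (Hg0 & Htl & Hg1).
  assert (true_L : forall f, Delta0 f -> bounded 1 f -> (true_V (rel_L R (All f)) <-> forall y, y ∈ l -> sat (el [y]) f)).
  { intros f HD Hf. unfold true_V. rewrite (@vsat _ Tr) by (intros x; split; intros _; exact I).
    apply (sat_L_All hR _ Hal Hl HD Hf). }
  rewrite mk_incl. fold nT nU. split.
  - intros Hincl. destruct (d0_psi R (df_s DU) (df_q DU) (df_s DT) (df_q DT) (df_bs DU) (df_bq DU) (df_bs DT) (df_bq DT)) as (ps & HD & Hb & Hps).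
    apply (RFN_of_psi hR hadm DT DU HD Hb Hps). apply true_L; auto. intros Z HZ. apply (Hps Vk (el [Z])).
    intros z0 Hz0 z Hz t Ht u Hu b Hb' C HC B HB k Hk d Hd zk Hzk HG HA. cbn [el nth] in *.
    assert (Il : forall x, x ∈ Z -> x ∈ l) by exact (Htl Z HZ).
    pose proof (proj1 (AllT_t R (T := Tp upsilon) (conj Hg0 (conj Htl Hg1)) U1 U2 HG (Il _ Hz0) (Il _ Hb')) HA) as HA'. clear HA; rename HA' into HA.
    apply (AllT_u R (T' := Tp tau) (conj Hg0 (conj Htl Hg1)) T1 T2 HG (Il _ Hz0) (Il _ Hb')).
    assert (HC' : Ch C) by (apply Ch0_Ch with B, HG).
    destruct (Ch_LV HC' Hk) as (del & Hdel & ->). apply (SV_Prv del HRb HTT). apply (SV_Prv del HRb HUU) in HA.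
    (* A level saturated for U has an index at least |U|, hence at least |T|, and soundness for T is
       inherited from L_|T|. *)
    refine (SV_mono HnT (fun x Hx => HmU del Hdel HA x (Hincl x Hx)) HST).
  - intros (q0' & (q0 & HDq & ->) & Hbq & Hq & Hpq). apply NNPP. intros N.
    assert (Hbq1 : bounded 1 q0) by exact Hbq.
    assert (NS : ~ SV R T nU) by (intros HS; apply N; exact (HmT nU HnU HS)).
    (* [f] is the matrix of the sentence phi, which separates the two norms. *)
    apply not_all_ex_not in NS as (f & NS). apply imply_to_and in NS as (HDf & NS). apply imply_to_and in NS as (Hbf & NS). apply imply_to_and in NS as (HPf & NS).
    destruct (d0_chi R (df_s DT) (df_q DT) (df_s DU) (df_q DU) HDf (df_bs DT) (df_bq DT) (df_bs DU) (df_bq DU) Hbf) as (ch & HDc & Hbc & Hch).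
    destruct (d0_nrho R (df_s DT) (df_q DT) (df_s DU) (df_q DU) (df_bs DT) (df_bq DT) (df_bs DU) (df_bq DU)) as (nr & HDn & Hbn & Hnr).
    pose proof (T_proves hR hadm DT DU hTe HDf Hbf HPf HDc Hbc Hch HDn Hbn Hnr HDq Hbq1 Hpq) as HT.
    assert (Dw : Delta0 (Neg (And ch (And q0 nr)))) by (unfold And; repeat (simpl; constructor; auto)).
    assert (Bw : bounded 1 (Neg (And ch (And q0 nr)))) by (unfold And; simpl; tauto).
    (* The Sigma_1 sentence that T proves holds in L_|T|, so there is a [Z] in L_|T| at which one of
       the three matrices fails; it remains to verify all three at [Z]. *)
    apply (HST _ Dw Bw) in HT. apply Tru_sat in HT; auto; [|exact (LV_trans (proj1 HnT))].
    destruct HT as (Z & HZ & HT). rewrite s_neg, !s_And in HT. apply HT. clear HT.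
    (* |T| is at most alpha since T is sound at alpha, so [Z] belongs to L_alpha, where the
       certificates are interpreted. *)
    assert (HZl : Z ∈ l).
    { rewrite El. revert HZ. apply LV_mono, HmT; auto. apply sound_SV, hTs. }
    assert (Il : forall x, x ∈ Z -> x ∈ l) by exact (Htl Z HZl).
    split; [|split].
    + apply (Hch Vk (el [Z])).
      intros z0 Hz0 z Hz t Ht u Hu b Hb' C HC B HB k Hk d Hd zk Hzk HG Hf. cbn [el nth] in *.
      apply (AllT_u R (T' := Tp upsilon) (conj Hg0 (conj Htl Hg1)) U1 U2 HG (Il _ Hz0) (Il _ Hb')).
      assert (HC' : Ch C) by (apply Ch0_Ch with B, HG).
      destruct (Ch_LV HC' Hk) as (del & Hdel & ->). apply (SV_Prv del HRb HUU).
      apply (Tru_sat (LV_trans (proj1 Hdel)) HDf Hbf) in Hf.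
      (* Either |U| is at most [del], and U is sound for L_del, or [del] is below |U|, and phi would
         persist from L_del to L_|U|. *)
      destruct (ord_sub HnU Hdel) as [H|H]; [apply (SV_mono HnU H HSU)|]. exfalso. apply NS.
      pose proof (@closed_True Vk) as HTr.
      apply (Tru_mono (k := LV del)); [apply LV_mono, (proj1 HnU), H|exact (LV_trans (proj1 Hdel))|apply (cd_D0 HTr HDf)|exact (cd_Bd HTr Hbf)|exact Hf].
    + exact (proj1 (true_L q0 HDq Hbq1) Hq Z HZl).
    + apply (Hnr Vk (el [Z])).
      intros z0 Hz0 z Hz t Ht u Hu b Hb' C HC B HB k Hk d Hd zk Hzk HG HA. cbn [el nth] in *.
      pose proof (proj1 (AllT_t R (T := Tp tau) (conj Hg0 (conj Htl Hg1)) T1 T2 HG (Il _ Hz0) (Il _ Hb')) HA) as HA'. clear HA; rename HA' into HA.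
      assert (HC' : Ch C) by (apply Ch0_Ch with B, HG).
      destruct (Ch_LV HC' Hk) as (del & Hdel & ->). apply (SV_Prv del HRb HTT) in HA.
      pose proof (LV_trans (proj1 HnT)) as Htn.
      (* Saturation gives that |T| is at most [del], so L_|T| is included in L_del. But L_del lies
         in [C], [C] in [Z] and [Z] in the transitive L_|T|, so L_del would be an element of
         itself. *)
      apply (@irrefl Vk (LV del)). apply (LV_mono (HmT del Hdel HA)). exact (Htn C (Htn Z HZ C HC) _ Hk).
Qed.
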